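(* Let $S=\{(0,0,0,0),\pm(1,2,3,4)\}$. Let $x,y,z$ be positive integers and $P=\{0,x,x+y,2x+y+z\}$. Then $\mathcal{I}(P)\setminus S$ equals: - $\{\pm(1,-3,1,0),\pm(1,0,-3,1),\pm(3,-3,-1,1)\}$ if $(x,y,z)\in\mathbb{N}\cdot(1,1,1)$; - $\{\pm(0,3,2,3)\}$ if $(x,y,z)\in\mathbb{N}\cdot(1,3,2)$; - $\{\pm(3,0,-1,3)\}$ if $(x,y,z)\in\mathbb{N}\cdot(1,4,4)$; - $\{\pm(4,0,1,4)\}$ if $(x,y,z)\in\mathbb{N}\cdot(2,1,1)$; - $\{\pm(1,2,1,4),\pm(3,2,1,4),\pm(3,2,3,4)\}$ if $2x^2+xz-yz=0$; - $\{\pm(3,-3,-1,1)\}$ if $x^2-yz=0$ and $(x,y,z)\notin\mathbb{N}\cdot(1,1,1)$; - $\{\pm(2,3,-2,-3)\}$ if $x^2+xz-y^2=0$; - $\{\pm(2,1,-2,-1)\}$ if $2x^3+4x^2y+x^2z+2xy^2-y^2z-yz^2=0$; - $\{\pm(3,-1,1,-3)\}$ if $4x^3+4x^2y+4x^2z+2xyz+xz^2-y^2z=0$; - $\emptyset$ otherwise. Furthermore, if $2x^2+xz-yz=0$, then $p_3^{I}(x,y,z)=0$ for each $I\in\{\pm(1,2,1,4),\pm(3,2,1,4),\pm(3,2,3,4)\}$.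
   Context: $\mathbb{N}\cdot(a,b,c)=\{(na,nb,nc):n\in\mathbb{N}\}$ with $\mathbb{N}$ the positive integers. Over the polynomial ring $\mathbb{Z}[X,Y,Z]$ set $k_1=X$, $k_2=X+Y$, $k_3=2X+Y+Z$, $a_1=-Y(X+Z)(X+Y+Z)$, $a_2=(X+Y)(X+Z)(2X+Y+Z)$, $a_3=-X(2X+Y+Z)(X+Y+Z)$, $a_4=XY(X+Y)$, $a_0=0$ and $a_{-j}=-a_j$ for $j=1,2,3,4$. A signature is a tuple $I=(i_1,i_2,i_3,i_4)$ of integers with $-4\le i_1,i_2,i_3,i_4\le4$; $\pm I$ denotes the two signatures $I$ and $-I$. For a signature $I$ define polynomials $p_1^I,p_2^I,p_3^I\in\mathbb{Z}[X,Y,Z]$ by the identity in new indeterminates $T,D$: $a_{i_1}T^2+a_{i_2}(T+k_1D)^2+a_{i_3}(T+k_2D)^2+a_{i_4}(T+k_3D)^2=p_1^IT^2+p_2^ITD+p_3^ID^2$. A signature $I$ is degenerate at the pattern $P=\{0,x,x+y,2x+y+z\}$ (with $x,y,z$ positive integers) if $p_1^I(x,y,z)=p_2^I(x,y,z)=0$; $\mathcal{I}(P)$ denotes the set of signatures degenerate at $P$. *)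

(* Defs.v *)
From HB Require Import structures.
From mathcomp Require Import all_boot all_order all_algebra ring.
From mathcomp.multinomials Require Import mpoly.

Set Implicit Arguments.
Unset Strict Implicit.
Unset Printing Implicit Defensive.

Import Order.TTheory GRing.Theory Num.Theory.
Local Open Scope ring_scope.

Notation ZXYZ := {mpoly int[3]}.

Definition pX : ZXYZ := 'X_(@Ordinal 3 0 isT).
Definition pY : ZXYZ := 'X_(@Ordinal 3 1 isT).
Definition pZ : ZXYZ := 'X_(@Ordinal 3 2 isT).

Definition k1 : ZXYZ := pX.
Definition k2 : ZXYZ := pX + pY.
Definition k3 : ZXYZ := 2 * pX + pY + pZ.

(* Only the indices 0, ..., 4 are meaningful; the value 0 elsewhere is junk. *)
Definition a_nat (j : nat) : ZXYZ :=
  match j with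
  | 1%N => - pY * (pX + pZ) * (pX + pY + pZ)
  | 2%N => (pX + pY) * (pX + pZ) * (2 * pX + pY + pZ)
  | 3%N => - pX * (2 * pX + pY + pZ) * (pX + pY + pZ)
  | 4%N => pX * pY * (pX + pY)
  | _ => 0
  end.

(* [Negz j] is the integer [- j.+1]. *)
Definition a_ (i : int) : ZXYZ :=
  match i with
  | Posz j => a_nat j
  | Negz j => - a_nat j.+1
  end.

(* The opposite [- I] is that of the product group. The bounds on the entries
   are imposed by [is_signature]. *)
Notation signature := (int * int * int * int)%type.

Definition is_signature (I : signature) : bool :=
  let: (i1, i2, i3, i4) := I in
  [&& -4 <= i1 <= 4, -4 <= i2 <= 4, -4 <= i3 <= 4 & -4 <= i4 <= 4].

Notation ZXYZ_TD := {mpoly ZXYZ[2]}.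

Definition vT : ZXYZ_TD := 'X_(@Ordinal 2 0 isT).
Definition vD : ZXYZ_TD := 'X_(@Ordinal 2 1 isT).

Definition sig_form (I : signature) : ZXYZ_TD :=
  let: (i1, i2, i3, i4) := I in
  (a_ i1)%:MP * vT ^+ 2
  + (a_ i2)%:MP * (vT + k1%:MP * vD) ^+ 2
  + (a_ i3)%:MP * (vT + k2%:MP * vD) ^+ 2
  + (a_ i4)%:MP * (vT + k3%:MP * vD) ^+ 2.

Definition mTT : 'X_{1..2} := (U_(@Ordinal 2 0 isT) *+ 2)%MM.
Definition mTD : 'X_{1..2} := (U_(@Ordinal 2 0 isT) + U_(@Ordinal 2 1 isT))%MM.
Definition mDD : 'X_{1..2} := (U_(@Ordinal 2 1 isT) *+ 2)%MM.

(* The defining identity is [sig_formE] below, and [sig_form_uniq] shows that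
   it determines the three polynomials. *)
Definition p1 (I : signature) : ZXYZ := (sig_form I)@_mTT.
Definition p2 (I : signature) : ZXYZ := (sig_form I)@_mTD.
Definition p3 (I : signature) : ZXYZ := (sig_form I)@_mDD.

Lemma sig_form_uniq (I : signature) (q1 q2 q3 : ZXYZ) :
  sig_form I = q1%:MP * vT ^+ 2 + q2%:MP * (vT * vD) + q3%:MP * vD ^+ 2 ->
  [/\ q1 = p1 I, q2 = p2 I & q3 = p3 I].
Proof.
have ne1 : (mTT == mTD) = false.
  by apply/negP => /eqP/mnmP/(_ (@Ordinal 2 1 isT)); rewrite mulmnE mnmDE !mnm1E.
have ne2 : (mTT == mDD) = false.
  by apply/negP => /eqP/mnmP/(_ (@Ordinal 2 1 isT)); rewrite !mulmnE !mnm1E.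
have ne3 : (mTD == mDD) = false.
  by apply/negP => /eqP/mnmP/(_ (@Ordinal 2 0 isT)); rewrite mulmnE mnmDE !mnm1E.
have eTT : vT ^+ 2 = 'X_[mTT] by rewrite /vT -mpolyXn.
have eTD : vT * vD = 'X_[mTD] by rewrite /vT /vD -mpolyXD.
have eDD : vD ^+ 2 = 'X_[mDD] by rewrite /vD -mpolyXn.
rewrite /p1 /p2 /p3 => ->; rewrite eTT eTD eDD !mcoeffD !mcoeffCM !mcoeffX.
rewrite !eqxx (eq_sym mTD) (eq_sym mDD) (eq_sym mDD mTD) ne1 ne2 ne3.
by rewrite !mulr1 !mulr0 !addr0 !add0r.
Qed.

Lemma sig_formE (I : signature) :
  sig_form I = (p1 I)%:MP * vT ^+ 2 + (p2 I)%:MP * (vT * vD) + (p3 I)%:MP * vD ^+ 2.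
Proof.
suff [q1 [q2 [q3 e]]] : exists q1 q2 q3 : ZXYZ,
    sig_form I = q1%:MP * vT ^+ 2 + q2%:MP * (vT * vD) + q3%:MP * vD ^+ 2.
  by rewrite [LHS]e; have [-> -> ->] := sig_form_uniq e.
case: I => [[[i1 i2] i3] i4].
exists (a_ i1 + a_ i2 + a_ i3 + a_ i4).
exists ((a_ i2 * k1 + a_ i3 * k2 + a_ i4 * k3) *+ 2).
exists (a_ i2 * k1 ^+ 2 + a_ i3 * k2 ^+ 2 + a_ i4 * k3 ^+ 2).
rewrite /sig_form !(mpolyCD, mpolyCMn, mpolyCM, rmorphXn) /=; ring.
Qed.

Definition evalZ (p : ZXYZ) (x y z : int) : int := p.@[tnth [tuple x; y; z]].

(* [degenerate x y z] is the set of signatures degenerate at the pattern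
   {0, x, x + y, 2x + y + z}. For positive x, y, z the pattern, listed in
   increasing order, determines (x, y, z). *)
Definition degenerate (x y z : int) : pred signature :=
  [pred J | [&& is_signature J,
               evalZ (p1 J) x y z == 0 & evalZ (p2 J) x y z == 0]].

Definition pm (s : seq signature) : seq signature := s ++ [seq - J | J <- s].

Definition trivial_signatures : seq signature := (0, 0, 0, 0) :: pm [:: (1, 2, 3, 4)].

Definition in_ray (a b c x y z : int) : Prop :=
  exists2 n : nat, (0 < n)%N & [/\ x = n%:Z * a, y = n%:Z * b & z = n%:Z * c].

(* Main.v *)
(** Write the gaps of the pattern as u = x, v = y, w = x + z. Both p1 and p2 / 2
    are signed sums of explicit forms in x, y, z, and for all but 79 signatures
    (up to sign) one of p1, p2 / 2 + l p1 (l a small linear form) has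
    coefficients of one sign, hence no zero at positive x, y, z. For most of the
    remaining ones p1 and p2 are independent; eliminating a variable leaves a
    binary form, which either has coefficients of one sign or has no zero modulo
    a small prime, up to the finitely many rays of the statement. The
    signatures with p1 = 0 identically are curves. Since the a_i are the
    coefficients of a third divided difference, p2 = 0 says that a permutation of
    the four points is interpolated by a quadratic polynomial: 3-cycles
    and 4-cycles lead to the modular curves X_1(18) and X_1(16), and
    the products of differences "star = triangle" to X_1(14). All rational points
    of these are cusps: for X_1(14) by a 2-isogeny descent, for
    X_1(16) by Fermat's quartics, and for X_1(18) by a 3-descent on the cubic
    t^3 + 2 U^3 - V^3 = 3 t U V over the real cubic subfield of Q(zeta_9), whose
    integers, and those of Q(zeta_9), are norm-Euclidean. *)

Require Import Defs.
From HB Require Import structures.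
From mathcomp Require Import all_boot all_order all_algebra all_field ring lra zify.

Set Implicit Arguments.
Unset Strict Implicit.
Unset Printing Implicit Defensive.

Import Order.TTheory GRing.Theory Num.Theory.
Local Open Scope ring_scope.

(** * Integer arithmetic *)

(** Congruences alone cannot exclude the modular curves, because their cusps are rational points:
    they correspond to patterns with coinciding points. Each descent therefore ends by recognizing
    the cusps, which positivity of the gaps then rules out. For 3-cycles the two factors of [8 n^3]
    turn a rational point of a genus 2 curve into a point [(t : U : V)] of a plane cubic, with [t]
    in the cubic field; a symmetry of order 3 and a translation bring it close, at the prime [pi3]
    above 3, to the line [U = 0]. From there a single number governs the descent, the valuation of
    [U] at [pi3], which falls by 3 in each round. Of the unit group only the classes modulo cubes
    matter, and Hilbert 90 applied twice provides them, since [(1 - tau)^2] is the relative norm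
    minus [3 tau] in the group ring. The factorizations need roots of unity and take place in
    Z[zeta], while the points must return to the real ring; hence the repeated passage between the
    two rings. *)

Lemma coprime_pow_nat (k a b c : nat) : (0 < k)%N -> coprime a b -> (a * b = c ^ k)%N -> a = (gcdn a c ^ k)%N.
Proof.
move=> k0 co e.
have [c0|cp] := posnP c.
  move: e; rewrite c0 gcdn0 exp0n //; move/eqP; rewrite muln_eq0 => /orP[]/eqP h.
    by rewrite h exp0n.
  by move: co; rewrite h /coprime gcdn0 => /eqP ->; rewrite exp1n.
have : (0 < a * b)%N by rewrite e expn_gt0 cp.
rewrite muln_gt0 => /andP[a0 b0].
apply: eqn_from_log => //; first by rewrite expn_gt0 gcdn_gt0 a0.
move=> p; rewrite lognX logn_gcd //.
have el : (logn p a + logn p b = k * logn p c)%N by rewrite -lognM // e lognX.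
have [pp|np] := boolP (prime p); last by rewrite /logn (negbTE np) muln0.
have [pa|npa] := boolP (p %| a)%N; last first.
  by rewrite (logn_coprime (m := a)) ?prime_coprime // min0n muln0.
have lb : logn p b = 0%N.
  rewrite logn_coprime // prime_coprime //; apply/negP => pb.
  have : (p %| gcdn a b)%N by rewrite dvdn_gcd pa.
  by rewrite (eqP co) dvdn1 => /eqP h; rewrite h in pp.
by move: el; rewrite lb addn0; nia.
Qed.

Lemma PoszX (m k : nat) : (m ^ k)%N = m%:Z ^+ k :> int.
Proof. by elim: k => // k IH; rewrite expnS PoszM IH exprS. Qed.

Lemma coprime_powz (k : nat) (a b n : int) : (0 < k)%N -> 0 <= a -> 0 <= b -> coprimez a b -> a * b = n ^+ k ->
  exists x y : int, [/\ 0 <= x, 0 <= y, a = x ^+ k & b = y ^+ k] /\ `|n| = x * y /\ coprimez x y.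
Proof.
move=> k0 a0 b0 co e; rewrite coprimezE in co.
have en : (`|a| * `|b| = `|n| ^ k)%N by rewrite -abszM e abszX.
have ea := coprime_pow_nat k0 co en.
have eb : `|b|%N = (gcdn `|b| `|n| ^ k)%N by apply: (@coprime_pow_nat k _ `|a|%N); rewrite 1?coprime_sym 1?mulnC.
exists (gcdn `|a| `|n| : int), (gcdn `|b| `|n| : int); split; first split=> //.
- by rewrite -[LHS]gez0_abs // {1}ea PoszX.
- by rewrite -[LHS]gez0_abs // {1}eb PoszX.
split.
  rewrite -PoszM; congr Posz; apply/eqP; rewrite -(eqn_exp2r _ _ k0) expnMn -ea -eb en; exact/eqP.
by rewrite coprimezE /=; apply: coprime_dvdl (dvdn_gcdl _ _) _; apply: coprime_dvdr (dvdn_gcdl _ _) _.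
Qed.

Lemma prime_cop (a b : int) :
  (forall p : nat, prime p -> (p %| a)%Z -> (p %| b)%Z -> False) -> coprimez a b.
Proof.
move=> h; rewrite coprimezE; apply/negP => /negP nc.
have gd q : (q %| gcdn `|a| `|b|)%N -> (q %| a)%Z /\ (q %| b)%Z by rewrite dvdn_gcd => /andP.
have [g1|g1] := ltnP 1 (gcdn `|a| `|b|).
  by have [] := gd _ (pdiv_dvd _); exact: h (pdiv_prime g1).
have g0 : gcdn `|a| `|b| = 0%N.
  by move: nc; rewrite /coprime; case: gcdn g1 => [|[|]].
(* Both numbers vanish: every prime divides them, and 2 serves. *)
by have [] := gd 2%N; [rewrite g0 | exact: h].
Qed.

Lemma cop_prime (a b : int) (p : nat) : coprimez a b -> prime p -> (p %| a)%Z -> (p %| b)%Z -> False.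
Proof.
rewrite coprimezE => co pp pa pb.
have : (p %| gcdn `|a| `|b|)%N by rewrite dvdn_gcd; apply/andP.
by rewrite (eqP co) dvdn1 => /eqP h; rewrite h in pp.
Qed.

Lemma prime_mulz (a b : int) (p : nat) : prime p -> (p %| a * b)%Z -> (p %| a)%Z \/ (p %| b)%Z.
Proof. by move=> pp; rewrite !dvdzE abszM Euclid_dvdM // => /orP. Qed.

Lemma prime_expz (a : int) (p k : nat) : prime p -> (p %| a ^+ k)%Z -> (p %| a)%Z.
Proof. by move=> pp; rewrite !dvdzE abszX Euclid_dvdX // => /andP[]. Qed.

Lemma prime_dvd_eq (p q : nat) : prime p -> prime q -> (p %| q%:Z)%Z -> p = q.
Proof. by move=> pp pq; rewrite dvdzE /= dvdn_prime2 // => /eqP. Qed.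

Lemma dvd_sqz (g w : int) : (g ^+ 2 %| w ^+ 2)%Z -> (g %| w)%Z.
Proof. by rewrite !dvdzE !abszX dvdn_pexp2r. Qed.

Lemma coprime_scale (a b : int) : (a != 0) || (b != 0) -> exists g a' b' : int,
  [/\ g != 0, a = g * a', b = g * b' & coprimez a' b'].
Proof.
move=> ab; have [u [v e]] := Bezoutz a b.
have g0 : gcdz a b != 0 by rewrite gcdz_eq0 negb_and.
have /dvdzP [a' ea] := dvdz_gcdl a b; have /dvdzP [b' eb] := dvdz_gcdr a b.
exists (gcdz a b), a', b'; split=> //; [by rewrite mulrC | by rewrite mulrC |].
apply/coprimezP; exists (u, v) => /=; apply: (mulIf g0).
by rewrite mul1r mulrDl -!mulrA -ea -eb.
Qed.

Lemma dvd_comb (p a b x y c : int) : (p %| a)%Z -> (p %| b)%Z -> c = x * a + y * b -> (p %| c)%Z.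
Proof. by move=> ha hb ->; apply: rpredD; apply: dvdz_mull. Qed.

Lemma prime_2 (p : nat) : prime p -> (p %| 2)%Z -> p = 2%N.
Proof. by move=> pp; exact: (@prime_dvd_eq p 2). Qed.

Lemma parity (n : int) : exists k, n = 2 * k \/ n = 2 * k + 1.
Proof.
by exists (n %/ 2)%Z; have := divz_eq n 2; have := modz_ge0 n (isT : (2 : int) != 0);
  have := ltz_pmod n (isT : (0 : int) < 2); lia.
Qed.

Lemma odd_ndvd (k : int) : (2 %| 2 * k + 1)%Z -> False.
Proof. by case/dvdzP => q; lia. Qed.

Lemma coprime_two (a b : int) : coprimez (2 * a) (2 * b) -> False.
Proof. by move=> co; apply: (cop_prime co (isT : prime 2)); apply: dvdz_mulr. Qed.

Lemma coprime_absz (a b : int) : coprimez `|a| `|b| = coprimez a b.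
Proof. by have h (x : int) : absz `|x| = absz x by [lia]; rewrite !coprimezE !h. Qed.

Lemma pos_factors (a b : int) : 0 < a * b -> 0 <= a + b -> 0 < a /\ 0 < b.
Proof. by move=> h s; split; nia. Qed.

(** Bounds a factor of an explicit constant, so that [lia] can list its possible values. *)
Lemma factor_bound (a b k : int) : a * b = k -> k != 0 -> - `|k| <= a <= `|k|.
Proof.
move=> e k0; have : (`|a| <= `|k|)%N by apply: dvdn_leq; [rewrite absz_gt0 | rewrite -e abszM dvdn_mulr].
lia.
Qed.

(* [lia] after discarding the hypotheses that mention powers. *)
Ltac lin := repeat match goal with H : context [@GRing.exp] |- _ => clear H end; lia.

(** * Star-triangle quadruples *)

(** Squares modulo 8 in a shape that [lia] can use: the square of an odd number is rewritten as
    [8 * M + 1] with [M] an atom. *)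
Lemma odd_square (m : int) : exists k, m = 2 * k \/ exists M, m = 2 * k + 1 /\ m ^+ 2 = 8 * M + 1.
Proof.
have [k [e|e]] := parity m; exists k; [by left | right].
by have [j [ej|ej]] := parity k; [exists (2 * j ^+ 2 + j) | exists (2 * j ^+ 2 + 3 * j + 1)]; rewrite e ej; split=> //; ring.
Qed.

Lemma normsq (x : int) : `|x| ^+ 2 = x ^+ 2.
Proof. by rewrite real_normK // num_real. Qed.

(** Descent along a 2-isogeny. Two successive factorizations into coprime parts return to the same
    quartic, with [b] replaced by one of its divisors; [B] bounds [|b|] and carries the
    induction. *)
Lemma quart_odd (B : nat) (a b c : int) : (`|b| < B)%N -> coprimez a b -> (exists j, b = 2 * j + 1) ->
  4 * a ^+ 4 - 11 * a ^+ 2 * b ^+ 2 + 8 * b ^+ 4 = c ^+ 2 -> a ^+ 2 = 1 /\ b ^+ 2 = 1.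
Proof.
elim: B a b c => // B IH a b c lt co [j ej] e.
wlog c0 : c e / 0 <= c by move=> h; apply: (h `|c|) => //; rewrite normsq.
have b0 : b != 0 by rewrite ej; lia.
have b4 : 0 < b ^+ 4 by rewrite exprn_even_gt0.
(* Completing the square in 16 times the equation gives [(4 c)^2 - x8^2 = 7 b^4]. *)
pose x8 := 8 * a ^+ 2 - 11 * b ^+ 2; pose al := 4 * c + x8; pose be := 4 * c - x8.
have ab : al * be = 7 * b ^+ 4.
  by transitivity (16 * c ^+ 2 - x8 ^+ 2); [rewrite /al /be; ring | rewrite -e /x8; ring].
have [al0 be0] : 0 < al /\ 0 < be.
  apply: pos_factors; first by rewrite ab; move: b4; clear; lia.
  by have -> : al + be = 8 * c by [rewrite /al /be; ring]; move: c0; clear; lia.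
have coab : coprimez al be.
  apply: prime_cop => p pp pa pb.
  have p7 : (p %| 7 * b ^+ 4)%Z by rewrite -ab; exact: dvdz_mulr.
  have px2 : (p %| 2 * x8)%Z by apply: (dvd_comb pa pb (x := 1) (y := -1)); rewrite /al /be; ring.
  have nb : (p %| b)%Z -> False.
    move=> hb; have n2 : p <> 2%N by move=> p2; move: hb; rewrite p2 ej; exact: odd_ndvd.
    have px : (p %| x8)%Z by case/(prime_mulz pp): px2 => // /(prime_2 pp).
    have : (p %| 2 ^+ 3 * a ^+ 2)%Z by apply: (dvd_comb px hb (x := 1) (y := 11 * b)); rewrite /x8; ring.
    case/(prime_mulz pp) => /(prime_expz pp); first by move/(prime_2 pp).
    by move=> ha; exact: (cop_prime co pp).
  case/(prime_mulz pp): p7 => [|/(prime_expz pp)] //.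
  move/(@prime_dvd_eq p 7 pp isT) => e7; apply: nb; apply: (prime_expz (k := 4) pp).
  case/dvdzP: pa => u eu; case/dvdzP: pb => v ev; apply/dvdzP; exists (u * v).
  by apply: (mulfI (x := 7)) => //; rewrite -ab eu ev e7; ring.
(* The case [al = m^4], [be = 7 n^4], read through [al - be = 16 a^2 - 22 b^2]. The opposite
   distribution of the 7 is excluded at the end by a congruence. *)
have fin : forall m n : int, 0 <= m -> 0 <= n -> `|b| = m * n -> coprimez m n ->
    16 * a ^+ 2 = m ^+ 4 + 22 * (m ^+ 2 * n ^+ 2) - 7 * n ^+ 4 -> a ^+ 2 = 1 /\ b ^+ 2 = 1.
  move=> m n m0 n0 emn comn ea.
  have bsq : b ^+ 2 = m ^+ 2 * n ^+ 2 by rewrite -normsq emn; ring.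
  have [m1 [em|[M [em eM]]]] := odd_square m; first by move: bsq; rewrite em ej; clear; lia.
  have [n1 [en|[N [en eN]]]] := odd_square n; first by move: bsq; rewrite en ej; clear; lia.
  (* As [m] and [n] are odd, [m^2 + 11 n^2] is 4 times an odd number [k]; completing the square once
     more gives [k^2 - a^2 = 8 n^4]. *)
  pose k1 := M + 11 * N + 1; pose k := 2 * k1 + 1.
  have k4 : 4 * k = m ^+ 2 + 11 * n ^+ 2 by rewrite eM eN /k /k1; ring.
  have ek : a ^+ 2 = k ^+ 2 - 8 * n ^+ 4.
    apply: (mulfI (x := 16)) => //; transitivity ((4 * k) ^+ 2 - 128 * n ^+ 4); last by ring.
    by rewrite k4 ea; ring.
  have asq := normsq a; have a0 : 0 <= `|a| by [].
  have [a1 ea1] : exists a1, `|a| = 2 * a1 + 1.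
    by have [a1 [h|h]] := parity `|a|; exists a1 => //; exfalso; move: asq; rewrite h ek /k; clear; lia.
  pose g := k1 - a1; pose d := k1 + a1 + 1.
  have gd : g * d = 2 * n ^+ 4.
    by apply: (mulfI (x := 4)) => //; transitivity (k ^+ 2 - `|a| ^+ 2); [rewrite ea1 /k /g /d | rewrite asq ek]; ring.
  have gpd : g + d = k by rewrite /g /d /k; ring.
  have npos : 0 < n by lin.
  have n4 : 0 < n ^+ 4 by rewrite exprn_gt0.
  have kp : 0 < k by have h1 : 0 <= m ^+ 2 by [rewrite exprn_even_ge0]; have h2 : 0 < n ^+ 2 by [rewrite exprn_gt0]; move: k4 h1 h2; clear; lia.
  have [g0 d0] : 0 < g /\ 0 < d by apply: pos_factors; [rewrite gd; move: n4; clear; lia | rewrite gpd; exact: ltW].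
  have cogd : coprimez g d.
    apply: prime_cop => p pp pg pd.
    have pk : (p %| k)%Z by rewrite -gpd; apply: (dvd_comb pg pd (x := 1) (y := 1)); ring.
    have : (p %| 2 * n ^+ 4)%Z by rewrite -gd; exact: dvdz_mulr.
    case/(prime_mulz pp) => [/(prime_2 pp) p2|/(prime_expz pp) pn].
      by move: pk; rewrite p2 /k; exact: odd_ndvd.
    apply: (cop_prime comn pp) => //; apply: (prime_expz (k := 2) pp).
    by apply: (dvd_comb pk pn (x := 4) (y := - 11 * n)); rewrite k4; ring.
  (* Back to the start: [m^2 = 4 k - 11 n^2] with [k = 2 x^4 + y^4] and [n = x y] is the original
     quartic at [(y, x)]. *)
  have last : forall x y : int, 0 <= x -> 0 <= y -> coprimez x y -> n = x * y -> k = 2 * x ^+ 4 + y ^+ 4 -> a ^+ 2 = 1 /\ b ^+ 2 = 1.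
    move=> x y x0 y0 coxy exy kxy.
    have em2 : 4 * y ^+ 4 - 11 * y ^+ 2 * x ^+ 2 + 8 * x ^+ 4 = m ^+ 2.
      have -> : m ^+ 2 = 4 * k - 11 * n ^+ 2 by rewrite k4; ring.
      by rewrite kxy exy; ring.
    have [x1 [ex|ex]] := parity x; first by move: en; rewrite exy ex; clear; lia.
    have mpos : 0 < m by lin.
    have xpos : 0 < x by lin. have ypos : 0 < y by move: npos; rewrite exy pmulr_rgt0.
    have [lx|lx] := ltnP `|x| B.
      have [y1 x1'] : y ^+ 2 = 1 /\ x ^+ 2 = 1 by apply: (IH y x m) => //; [rewrite coprimez_sym | exists x1].
      have nn : n ^+ 2 = 1 by rewrite exy exprMn y1 x1'.
      have mm : m ^+ 2 = 1 by rewrite -em2 -[y ^+ 4]/(y ^+ (2 * 2)) -[x ^+ 4]/(x ^+ (2 * 2)) !exprM y1 x1'.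
      have mm4 : m ^+ 4 = 1 by rewrite -[m ^+ 4]/(m ^+ (2 * 2)) exprM mm.
      have nn4 : n ^+ 4 = 1 by rewrite -[n ^+ 4]/(n ^+ (2 * 2)) exprM nn.
      by rewrite bsq nn mm; split=> //; move: ea; rewrite mm nn mm4 nn4; clear; lia.
    (* Here [x >= B >= |b| = m x y], so there was no descent; then [m = y = 1] and the equation is
       solved directly. *)
    have hb : m * (x * y) <= x by rewrite -exy -emn; lin.
    have my : m * y <= 1.
      have : x * (m * y) <= x * 1 by rewrite mulr1 mulrCA.
      by rewrite ler_pM2l.
    have [m1' y1'] : m = 1 /\ y = 1 by clear -my mpos ypos; split; nia.
    have h0 : (8 * x ^+ 2 - 3) * (x ^+ 2 - 1) = 0 by move: em2; rewrite m1' y1'; clear; lia.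
    have xx : x ^+ 2 = 1 by move/eqP: h0; rewrite mulf_eq0 => /orP[]/eqP; clear; lia.
    have nn : n ^+ 2 = 1 by rewrite exy y1' mulr1.
    have nn4 : n ^+ 4 = 1 by rewrite -[n ^+ 4]/(n ^+ (2 * 2)) exprM nn.
    by rewrite bsq nn m1'; split=> //; move: ea; rewrite m1' nn nn4; clear; lia.
  have nabs : `|n| = n by rewrite ger0_norm.
  have : (2 %| g * d)%Z by rewrite gd dvdz_mulr.
  case/(@prime_mulz _ _ 2 isT) => /dvdzP [h eh].
    have hd : h * d = n ^+ 4 by apply: (mulfI (x := 2)) => //; rewrite -gd eh; ring.
    have h0 : 0 <= h by lin.
    have cohd : coprimez h d by apply: prime_cop => p pp ph pd; apply: (cop_prime cogd pp) => //; rewrite eh; exact: dvdz_mulr.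
    have [x' [y [[x0 y0 ex ey] [exy coxy]]]] := coprime_powz (isT : (0 < 4)%N) h0 (ltW d0) cohd hd.
    apply: (last x' y) => //; first by rewrite -exy nabs.
    by rewrite -gpd eh -ex -ey; ring.
  have hd : h * g = n ^+ 4 by apply: (mulfI (x := 2)) => //; rewrite -gd eh; ring.
  have h0 : 0 <= h by lin.
  have cohd : coprimez h g by apply: prime_cop => p pp ph pd; apply: (cop_prime cogd pp) => //; rewrite eh; exact: dvdz_mulr.
  have [x' [y [[x0 y0 ex ey] [exy coxy]]]] := coprime_powz (isT : (0 < 4)%N) h0 (ltW g0) cohd hd.
  apply: (last x' y) => //; first by rewrite -exy nabs.
  by rewrite -gpd eh -ex -ey; ring.
have : (7 %| al * be)%Z by rewrite ab dvdz_mulr.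
case/(@prime_mulz _ _ 7 isT) => /dvdzP [h eh].
  have hd : h * be = b ^+ 4 by apply: (mulfI (x := 7)) => //; rewrite -ab eh; ring.
  have h0 : 0 <= h by lin.
  have cohd : coprimez h be by apply: prime_cop => p pp ph pd; apply: (cop_prime coab pp) => //; rewrite eh; exact: dvdz_mulr.
  have [n [m [[n0 m0 en em] [emn _]]]] := coprime_powz (isT : (0 < 4)%N) h0 (ltW be0) cohd hd.
  exfalso.
  have bsq : b ^+ 2 = m ^+ 2 * n ^+ 2 by rewrite -normsq emn; ring.
  have ea : 16 * a ^+ 2 = 22 * (m ^+ 2 * n ^+ 2) + 7 * n ^+ 4 - m ^+ 4.
    rewrite -em -en -bsq [7 * h]mulrC -eh /al /be /x8; ring.
  have [m1 [em'|[M [em' eM]]]] := odd_square m; first by move: bsq; rewrite em' ej; clear; lia.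
  have [n1 [en'|[N [en' eN]]]] := odd_square n; first by move: bsq; rewrite en' ej; clear; lia.
  (* The right side is 12 modulo 16. *)
  move: ea; rewrite -[m ^+ 4]/(m ^+ (2 * 2)) -[n ^+ 4]/(n ^+ (2 * 2)) !exprM eM eN; clear; lia.
have hd : al * h = b ^+ 4 by apply: (mulfI (x := 7)) => //; rewrite -ab eh; ring.
have h0 : 0 <= h by lin.
have cohd : coprimez al h by apply: prime_cop => p pp ph pd; apply: (cop_prime coab pp) => //; rewrite eh; exact: dvdz_mulr.
have [m [n [[m0 n0 em en] [emn comn]]]] := coprime_powz (isT : (0 < 4)%N) (ltW al0) h0 cohd hd.
apply: (fin m n) => //.
have bsq : b ^+ 2 = m ^+ 2 * n ^+ 2 by rewrite -normsq emn; ring.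
rewrite -em -en -bsq [7 * h]mulrC -eh /al /be /x8; ring.
Qed.

(** This is the previous quartic with [2 b] for [b] and [2 c] for [c]. The same two factorizations
    now return a second variable of at most half the size, so the only survivor is [b = 0]. *)
Lemma quart_even (B : nat) (a b c : int) : (`|b| < B)%N -> coprimez a b -> (exists j, a = 2 * j + 1) ->
  a ^+ 4 - 11 * a ^+ 2 * b ^+ 2 + 32 * b ^+ 4 = c ^+ 2 -> b = 0.
Proof.
elim: B a b c => // B IH a b c lt co [j ej] e.
have [//|b0] := eqVneq b 0; exfalso.
wlog c0 : c e / 0 <= c by move=> h; apply: (h `|c|) => //; rewrite normsq.
have [kk [h|[A [_ eA]]]] := odd_square a; first by lin.
have a4 : a ^+ 4 = (8 * A + 1) ^+ 2 by rewrite -eA; ring.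
(* An odd [b] would make the left side 6 modulo 8, which is not a square. *)
have [b2 [eb|[N [eb eN]]]] := odd_square b; last first.
  have b4 : b ^+ 4 = (8 * N + 1) ^+ 2 by rewrite -eN; ring.
  have [c1 [ec|[C [ec eC]]]] := odd_square c; move: e; rewrite a4 b4 eA eN ?eC.
    have [c2 [ec2|ec2]] := parity c1; rewrite ec ec2; clear; lia.
  clear; lia.
have b20 : b2 != 0 by apply: contra_neq b0 => h; rewrite eb h mulr0.
have b24 : 0 < b2 ^+ 4 by rewrite exprn_even_gt0.
have [c1 ec] : exists c1, c = 2 * c1 + 1.
  by have [c1 [h|h]] := parity c; exists c1 => //; exfalso; move: e; rewrite a4 eA eb h; clear; lia.
pose s := 4 * A; pose al := c1 - s + 11 * b2 ^+ 2; pose be := c1 + s + 1 - 11 * b2 ^+ 2.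
have ab : al * be = 7 * b2 ^+ 4.
  apply: (mulfI (x := 4)) => //; transitivity (c ^+ 2 - (a ^+ 2 - 22 * b2 ^+ 2) ^+ 2).
    by rewrite ec eA /al /be /s; ring.
  by rewrite -e eb; ring.
have apb : al + be = c by rewrite /al /be ec; ring.
have bma : be - al = a ^+ 2 - 22 * b2 ^+ 2 by rewrite /al /be eA /s; ring.
have [al0 be0] : 0 < al /\ 0 < be by apply: pos_factors; [rewrite ab; move: b24; clear; lia | rewrite apb].
have coab : coprimez al be.
  apply: prime_cop => p pp pa pb.
  have p7 : (p %| 7 * b2 ^+ 4)%Z by rewrite -ab; exact: dvdz_mulr.
  have nb : (p %| b2)%Z -> False.
    move=> hb; apply: (cop_prime co pp); last by rewrite eb; exact: dvdz_mull.
    apply: (prime_expz (k := 2) pp).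
    have px : (p %| a ^+ 2 - 22 * b2 ^+ 2)%Z by rewrite -bma; apply: (dvd_comb pa pb (x := -1) (y := 1)); ring.
    by apply: (dvd_comb px hb (x := 1) (y := 22 * b2)); ring.
  case/(prime_mulz pp): p7 => [|/(prime_expz pp)] //.
  move/(@prime_dvd_eq p 7 pp isT) => e7; apply: nb; apply: (prime_expz (k := 4) pp).
  case/dvdzP: pa => u eu; case/dvdzP: pb => v ev; apply/dvdzP; exists (u * v).
  by apply: (mulfI (x := 7)) => //; rewrite -ab eu ev e7; ring.
have asq := normsq a.
have [a1 ea1] : exists a1, `|a| = 2 * a1 + 1.
  by have [a1 [h|h]] := parity `|a|; exists a1 => //; exfalso; move: asq; rewrite h eA; clear; lia.
have fin : forall m n : int, 0 <= m -> 0 <= n -> `|b2| = m * n -> coprimez m n ->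
    a ^+ 2 = m ^+ 4 + 22 * (m ^+ 2 * n ^+ 2) - 7 * n ^+ 4 -> False.
  move=> m n m0 n0 emn comn ea.
  have npos : 0 < n.
    have : n != 0 by apply: contra_neq b20 => h; apply/eqP; rewrite -normr_eq0 emn h mulr0.
    lin.
  have mpos : 0 < m.
    have : m != 0 by apply: contra_neq b20 => h; apply/eqP; rewrite -normr_eq0 emn h mul0r.
    lin.
  pose h := m ^+ 2 + 11 * n ^+ 2.
  have eh : a ^+ 2 = h ^+ 2 - 128 * n ^+ 4 by rewrite ea /h; ring.
  have [h1 eh1] : exists h1, h = 2 * h1 + 1.
    by have [h1 [k|k]] := parity h; exists h1 => //; exfalso; move: eh; rewrite eA k; clear; lia.
  pose g := h1 - a1; pose d := h1 + a1 + 1.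
  have gd : g * d = 32 * n ^+ 4.
    by apply: (mulfI (x := 4)) => //; transitivity (h ^+ 2 - `|a| ^+ 2); [rewrite ea1 eh1 /g /d | rewrite asq eh]; ring.
  have gpd : g + d = h by rewrite /g /d eh1; ring.
  have n4 : 0 < n ^+ 4 by rewrite exprn_gt0.
  have hp : 0 < h by have : 0 < m ^+ 2 by [rewrite exprn_gt0]; have : 0 < n ^+ 2 by [rewrite exprn_gt0]; rewrite /h; clear; lia.
  have [g0 d0] : 0 < g /\ 0 < d by apply: pos_factors; [rewrite gd; move: n4; clear; lia | rewrite gpd; exact: ltW].
  have cogd : coprimez g d.
    apply: prime_cop => p pp pg pd.
    have pk : (p %| h)%Z by rewrite -gpd; apply: (dvd_comb pg pd (x := 1) (y := 1)); ring.
    have : (p %| 2 ^+ 5 * n ^+ 4)%Z by rewrite -[2 ^+ 5]/(32 : int) -gd; exact: dvdz_mulr.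
    case/(prime_mulz pp) => /(prime_expz pp) => [/(prime_2 pp) p2|pn].
      by move: pk; rewrite p2 eh1; exact: odd_ndvd.
    apply: (cop_prime comn pp) => //; apply: (prime_expz (k := 2) pp).
    by apply: (dvd_comb pk pn (x := 1) (y := - 11 * n)); rewrite /h; ring.
  (* Now [m^2 = h - 11 n^2] with [h = 32 x^4 + y^4] and [n = x y] restores the quartic at
     [(y, x)]. *)
  have last : forall x y : int, 0 <= x -> 0 <= y -> coprimez x y -> n = x * y -> h = 32 * x ^+ 4 + y ^+ 4 -> False.
    move=> x y x0 y0 coxy exy hxy.
    have em2 : y ^+ 4 - 11 * y ^+ 2 * x ^+ 2 + 32 * x ^+ 4 = m ^+ 2.
      have -> : m ^+ 2 = h - 11 * n ^+ 2 by rewrite /h; ring.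
      by rewrite hxy exy; ring.
    have [y1 [ey|ey]] := parity y.
      by move: eh1; rewrite hxy ey; clear; lia.
    have yp : 1 <= y by lin.
    suff x00 : x = 0 by move: npos; rewrite exy x00; clear; lia.
    apply: (IH y x m) => //; [|by rewrite coprimez_sym|by exists y1].
    have h1' : x <= n by rewrite exy ler_peMr.
    have h2' : n <= `|b2| by rewrite emn ler_peMl.
    have h3' : `|b| = 2 * `|b2| by rewrite eb normrM.
    by move: lt; lin.
  have nabs : `|n| = n by rewrite ger0_norm.
  have c32 : forall g d : int, coprimez g d -> (2 %| g)%Z -> g * d = 32 * n ^+ 4 -> exists k, g = 32 * k.
    move=> g' d' co' h2 e'.
    have : coprimez 2 d' by apply: prime_cop => p pp /(prime_2 pp) -> hd; exact: (cop_prime co' (isT : prime 2)).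
    move/(coprimezXl 5) => co5; have : (2 ^+ 5 %| g' * d')%Z by rewrite e' -[2 ^+ 5]/(32 : int) dvdz_mulr.
    by rewrite Gauss_dvdzl // => /dvdzP [k ->]; exists k; rewrite -[2 ^+ 5]/(32 : int) mulrC.
  have : (2 %| g * d)%Z by rewrite gd; apply/dvdzP; exists (16 * n ^+ 4); ring.
  case/(@prime_mulz _ _ 2 isT) => hh.
    have [k ek] := c32 _ _ cogd hh gd.
    have hd : k * d = n ^+ 4 by apply: (mulfI (x := 32)) => //; rewrite -gd ek; ring.
    have k0 : 0 <= k by lin.
    have cohd : coprimez k d by apply: prime_cop => p pp ph pd; apply: (cop_prime cogd pp) => //; rewrite ek; exact: dvdz_mull.
    have [x' [y [[x0 y0 ex ey] [exy coxy]]]] := coprime_powz (isT : (0 < 4)%N) k0 (ltW d0) cohd hd.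
    apply: (last x' y) => //; first by rewrite -exy nabs.
    by rewrite -gpd ek -ex -ey; ring.
  have cogd' : coprimez d g by rewrite coprimez_sym.
  have [k ek] := c32 _ _ cogd' hh (etrans (mulrC _ _) gd).
  have hd : k * g = n ^+ 4 by apply: (mulfI (x := 32)) => //; rewrite -gd ek; ring.
  have k0 : 0 <= k by lin.
  have cohd : coprimez k g by apply: prime_cop => p pp ph pd; apply: (cop_prime cogd pp) => //; rewrite ek; exact: dvdz_mull.
  have [x' [y [[x0 y0 ex ey] [exy coxy]]]] := coprime_powz (isT : (0 < 4)%N) k0 (ltW g0) cohd hd.
  apply: (last x' y) => //; first by rewrite -exy nabs.
  by rewrite -gpd ek -ex -ey; ring.
have : (7 %| al * be)%Z by rewrite ab dvdz_mulr.
case/(@prime_mulz _ _ 7 isT) => /dvdzP [h eh].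
  have hd : h * be = b2 ^+ 4 by apply: (mulfI (x := 7)) => //; rewrite -ab eh; ring.
  have h0 : 0 <= h by lin.
  have cohd : coprimez h be by apply: prime_cop => p pp ph pd; apply: (cop_prime coab pp) => //; rewrite eh; exact: dvdz_mulr.
  have [n [m [[n0 m0 en em] [emn conm]]]] := coprime_powz (isT : (0 < 4)%N) h0 (ltW be0) cohd hd.
  apply: (fin m n) => //; [by rewrite emn mulrC | by rewrite coprimez_sym |].
  have bsq : b2 ^+ 2 = m ^+ 2 * n ^+ 2 by rewrite -normsq emn; ring.
  by rewrite -em -en -bsq; move: bma; rewrite eh; clear; lia.
have hd : al * h = b2 ^+ 4 by apply: (mulfI (x := 7)) => //; rewrite -ab eh; ring.
have h0 : 0 <= h by lin.
have cohd : coprimez al h by apply: prime_cop => p pp ph pd; apply: (cop_prime coab pp) => //; rewrite eh; exact: dvdz_mulr.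
have [m [n [[m0 n0 em en] [emn comn]]]] := coprime_powz (isT : (0 < 4)%N) (ltW al0) h0 cohd hd.
have bsq : b2 ^+ 2 = m ^+ 2 * n ^+ 2 by rewrite -normsq emn; ring.
have ea : a ^+ 2 = 7 * n ^+ 4 - m ^+ 4 + 22 * (m ^+ 2 * n ^+ 2) by rewrite -em -en -bsq; move: bma; rewrite eh; clear; lia.
(* In none of the four parity cases is the right side 1 modulo 8. *)
have [m1 [em'|[M [em' eM]]]] := odd_square m; have [n1 [en'|[N [en' eN]]]] := odd_square n.
- by move: ea; rewrite eA em' en'; clear; lia.
- by move: ea; rewrite eA -[n ^+ 4]/(n ^+ (2 * 2)) !exprM eN em'; clear; lia.
- by move: ea; rewrite eA -[m ^+ 4]/(m ^+ (2 * 2)) !exprM eM en'; clear; lia.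
- by move: ea; rewrite eA -[n ^+ 4]/(n ^+ (2 * 2)) -[m ^+ 4]/(m ^+ (2 * 2)) !exprM eM eN; clear; lia.
Qed.

Lemma quartic14 (a b c : int) : coprimez a b -> b != 0 ->
  4 * a ^+ 4 - 11 * a ^+ 2 * b ^+ 2 + 8 * b ^+ 4 = c ^+ 2 -> a ^+ 2 = 1 /\ b ^+ 2 = 1.
Proof.
move=> co b0 e; have [j [ej|ej]] := parity b; last by apply: (@quart_odd `|b|.+1 a b c) => //; exists j.
exfalso; have [i [ei|ei]] := parity a; first by move: co; rewrite ei ej; exact: coprime_two.
have [k [ek|ek]] := parity c; last by move: e; rewrite ej ek; clear; lia.
have j0 : j = 0.
  apply: (@quart_even `|j|.+1 a j k) => //; last 2 first.
  - by exists i.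
  - by apply: (mulfI (x := 4)) => //; move: e; rewrite ej ek; clear; lia.
  by apply: prime_cop => p pp pa pj; apply: (cop_prime co pp) => //; rewrite ej; exact: dvdz_mull.
by move: b0; rewrite ej j0 mulr0 eqxx.
Qed.

(** A common factor 2 is stripped from [S] and [T] until they are coprime; each round exchanges the
    two alternatives. *)
Lemma two_squares (B : nat) (S T Y : int) : (`|S| < B)%N -> 0 < S -> 0 < T -> S * T = Y ^+ 2 ->
  (forall p : nat, prime p -> (p %| S)%Z -> (p %| T)%Z -> p = 2%N) ->
  exists a c, (S = a ^+ 2 /\ T = c ^+ 2) \/ (S = 2 * a ^+ 2 /\ T = 2 * c ^+ 2).
Proof.
elim: B S T Y => // B IH S T Y lt S0 T0 e h.
have [co|nco] := boolP (coprimez S T).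
  have [x [y [[_ _ ex ey] _]]] := coprime_powz (isT : (0 < 2)%N) (ltW S0) (ltW T0) co e.
  by exists x, y; left.
have [/dvdzP [S' eS]|nS] := boolP (2 %| S)%Z; last first.
  case/negP: nco; apply: prime_cop => p pp pS pT; have p2 := h p pp pS pT.
  by move: nS; rewrite p2 in pS; rewrite pS.
have [/dvdzP [T' eT]|nT] := boolP (2 %| T)%Z; last first.
  case/negP: nco; apply: prime_cop => p pp pS pT; have p2 := h p pp pS pT.
  by move: nT; rewrite p2 in pT; rewrite pT.
have [Y' eY] : exists Y', Y = Y' * 2.
  by apply/dvdzP; apply: (@prime_expz _ 2 2 isT); rewrite -e eS; apply/dvdzP; exists (S' * T); ring.
have [|||||a [c [[ea ec]|[ea ec]]]] := IH S' T' Y'.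
- by lin. - by lin. - by lin.
- by apply: (mulfI (x := 4)) => //; move: e; rewrite eS eT eY; clear; lia.
- by move=> p pp pS pT; apply: h => //; rewrite ?eS ?eT; exact: dvdz_mulr.
- by exists a, c; right; rewrite eS eT ea ec; split; ring.
- by exists (2 * a), (2 * c); left; rewrite eS eT ea ec; split; ring.
Qed.

(** As a quadratic in [q1] the equation has discriminant [(g + 2 h) (4 g^2 + 5 g h + 2 h^2)] with
    [g = q2 r2] and [h = r1^2]. The two factors share only powers of 2, so both are squares or both
    are twice squares, and either way a point of the quartic of [quartic14] appears. Its few points
    contradict the side conditions. *)
Lemma core14 (q1 q2 r1 r2 : int) : q1 != 0 -> q2 != 0 -> r1 != 0 -> r2 != 0 ->
  coprimez (q1 * q2) (r1 * r2) -> coprimez (q2 * r2) r1 -> q1 * q2 != r1 * r2 ->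
  2 * q1 * r1 ^+ 3 + q2 * r2 ^+ 3 = (q1 * q2) ^+ 2 - 3 * (q1 * q2) * (r1 * r2) - (r1 * r2) ^+ 2 -> False.
Proof.
move=> q10 q20 r10 r20 coqr cog ne e.
pose g := q2 * r2; pose h := r1 ^+ 2; pose Y := 2 * q2 ^+ 2 * q1 - (3 * q2 * r1 * r2 + 2 * r1 ^+ 3).
pose S := g + 2 * h; pose T := 4 * g ^+ 2 + 5 * g * h + 2 * h ^+ 2.
have ST : S * T = Y ^+ 2.
  have e0 : 2 * q1 * r1 ^+ 3 + q2 * r2 ^+ 3 - ((q1 * q2) ^+ 2 - 3 * (q1 * q2) * (r1 * r2) - (r1 * r2) ^+ 2) = 0.
    by rewrite e subrr.
  transitivity (Y ^+ 2 + 4 * q2 ^+ 2 * (2 * q1 * r1 ^+ 3 + q2 * r2 ^+ 3 - ((q1 * q2) ^+ 2 - 3 * (q1 * q2) * (r1 * r2) - (r1 * r2) ^+ 2))).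
    by rewrite /S /T /Y /g /h; ring.
  by rewrite e0 mulr0 addr0.
have h0 : 0 < h by rewrite /h exprn_even_gt0.
have T0 : 0 < T.
  have : 16 * T = (8 * g + 5 * h) ^+ 2 + 7 * h ^+ 2 by rewrite /T; ring.
  have : 0 <= (8 * g + 5 * h) ^+ 2 by rewrite exprn_even_ge0.
  have : 0 < h ^+ 2 by rewrite exprn_gt0.
  clear; lia.
have nr1 : forall p : nat, prime p -> (p %| g)%Z -> (p %| r1)%Z -> False by move=> p pp pg pr; exact: (cop_prime cog pp).
have [S0|S0|S0] := ltgtP S 0.
- by have : 0 <= Y ^+ 2 by [rewrite exprn_even_ge0]; rewrite -ST leNgt nmulr_rlt0 // T0.
- have common : forall p : nat, prime p -> (p %| S)%Z -> (p %| T)%Z -> p = 2%N.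
    move=> p pp pS pT.
    have : (p %| 2 ^+ 3 * h ^+ 2)%Z by apply: (dvd_comb pS pT (x := - (4 * g - 3 * h)) (y := 1)); rewrite /S /T; ring.
    case/(prime_mulz pp) => /(prime_expz pp); first by move/(prime_2 pp).
    move/(prime_expz pp) => pr; case: (nr1 p pp) => //.
    by apply: (dvd_comb pS pr (x := 1) (y := - 2 * r1)); rewrite /S /h; ring.
  have [a [c [[eS eT]|[eS eT]]]] := @two_squares `|S|.+1 S T Y (ltnSn _) S0 T0 ST common.
    have eg : g = a ^+ 2 - 2 * r1 ^+ 2 by rewrite -eS /S /h; ring.
    have coa : coprimez a r1.
      apply: prime_cop => p pp pa pr; apply: (nr1 p pp _ pr); rewrite eg.
      by apply: (dvd_comb pa pr (x := a) (y := - 2 * r1)); ring.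
    have [|a1 r11] := @quartic14 a r1 c coa r10; first by rewrite -eT /T eg /h; ring.
    have g1 : q2 * r2 = -1 by rewrite -/g eg a1 r11.
    have [[eq2 er2]|[eq2 er2]] : (q2 = 1 /\ r2 = -1) \/ (q2 = -1 /\ r2 = 1).
      have hb := factor_bound g1 isT.
      have [eq2|eq2] : q2 = 1 \/ q2 = -1 by lin.
        by left; move: g1; rewrite eq2; clear; lia.
      by right; move: g1; rewrite eq2; clear; lia.
      have r3 : r1 ^+ 3 = r1 by rewrite exprS r11 mulr1.
      have : q1 * (q1 + r1) = 0 by move: e r11; rewrite eq2 er2 r3; clear; lia.
      move/eqP; rewrite mulf_eq0 (negbTE q10) /= => /eqP h1.
      by case/eqP: ne; rewrite eq2 er2; lin.
    have r3 : r1 ^+ 3 = r1 by rewrite exprS r11 mulr1.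
    have : q1 * (q1 + r1) = 0 by move: e r11; rewrite eq2 er2 r3; clear; lia.
    move/eqP; rewrite mulf_eq0 (negbTE q10) /= => /eqP h1.
    by case/eqP: ne; rewrite eq2 er2; lin.
  have a0 : a != 0 by apply/eqP => a0; move: S0; rewrite eS a0; clear; lia.
  have eg : g = 2 * a ^+ 2 - 2 * r1 ^+ 2 by rewrite -eS /S /h; ring.
  have coa : coprimez r1 a.
    apply: prime_cop => p pp pr pa; apply: (nr1 p pp _ pr); rewrite eg.
    by apply: (dvd_comb pa pr (x := 2 * a) (y := - 2 * r1)); ring.
  have [|r11 a1] := @quartic14 r1 a c coa a0.
    by apply: (mulfI (x := 2)) => //; rewrite -eT /T eg /h; ring.
  have g1 : q2 * r2 = 0 by rewrite -/g eg a1 r11.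
  by move/eqP: g1; rewrite mulf_eq0 (negbTE q20) (negbTE r20).
(* The case [S = 0]: coprimality of [g] and [r1] leaves [r1^2 = 1] and [q2 r2 = -2], a finite
   check. *)
- have eg : g = - 2 * h by rewrite -[g]subr0 -S0 /S; ring.
  have r11 : r1 ^+ 2 = 1.
    have : coprimez 1 r1 by rewrite coprimezE /= coprime1n.
    have cr : coprimez r1 r1.
      by apply: prime_cop => p pp pr _; apply: (nr1 p pp _ pr); rewrite eg /h; apply: (dvd_comb pr pr (x := - 2 * r1) (y := 0)); ring.
    move: cr; rewrite coprimezE /coprime gcdnn => /eqP h1 _.
    by rewrite -normsq -abszE h1.
  have g2 : q2 * r2 = - 2 by rewrite -/g eg /h r11.
  have Y0 : Y = 0 by move/eqP: ST; rewrite S0 mul0r eq_sym expf_eq0 /= => /eqP.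
  have r3 : r1 ^+ 3 = r1 by rewrite exprS r11 mulr1.
  have eq1 : q2 ^+ 2 * q1 = - 2 * r1.
    have : Y = 2 * q2 ^+ 2 * q1 - (3 * r1 * (q2 * r2) + 2 * r1 ^+ 3) by rewrite /Y; ring.
    by rewrite Y0 g2 r3; clear; lia.
  have [eq2|[eq2|[eq2|eq2]]] : q2 = 1 \/ q2 = -1 \/ q2 = 2 \/ q2 = -2.
    by have hb := factor_bound g2 isT; clear -hb q20; lia.
  + apply: (cop_prime coqr (isT : prime 2)); apply/dvdzP; [exists (- r1) | exists (- r1)].
      by rewrite eq2; move: eq1; rewrite eq2; clear; lia.
    by have : r2 = - 2 * q2 by [move: g2; rewrite eq2; clear; lia]; move=> ->; rewrite eq2; ring.
  + apply: (cop_prime coqr (isT : prime 2)); apply/dvdzP; [exists r1 | exists r1].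
      by rewrite eq2; move: eq1; rewrite eq2; clear; lia.
    by have : r2 = - 2 * q2 by [move: g2; rewrite eq2; clear; lia]; move=> ->; rewrite eq2; ring.
  + by move: eq1 r11; rewrite eq2 => h1; have [h2|h2] : r1 = 2 * q1 \/ r1 = - 2 * q1 by [move: h1; clear; lia]; rewrite h2; clear; lia.
  + by move: eq1 r11; rewrite eq2 => h1; have [h2|h2] : r1 = 2 * q1 \/ r1 = - 2 * q1 by [move: h1; clear; lia]; rewrite h2; clear; lia.
Qed.

(** For [p], [q], [r] the differences from one pattern point to the other three, the right side is
    the product over the star at that point and the left side the product over the opposite
    triangle. The equation is quadratic in [p]; for coprime [q], [r] its discriminant is
    [A^2 - 8 q r^3], so that [(A - Z) (A + Z) = 8 q r^3], and distributing the cube over the coprime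
    halves leads to [core14]. *)
Theorem star_triangle (p q r : int) : p != 0 -> q != 0 -> r != 0 ->
  (p - q) * (q - r) * (r - p) = p * q * r -> False.
Proof.
move=> p0 q0 r0 e.
have pqr : p * q * r != 0 by rewrite !mulf_neq0.
have qr : q != r by apply/eqP => h; move: pqr; rewrite -e h subrr mulr0 mul0r eqxx.
have [g [q' [r' [g0 eq er co]]]] : exists g a' b' : int, [/\ g != 0, q = g * a', r = g * b' & coprimez a' b'].
  by apply: coprime_scale; rewrite q0.
have q'0 : q' != 0 by apply: contra_neq q0 => h; rewrite eq h mulr0.
have r'0 : r' != 0 by apply: contra_neq r0 => h; rewrite er h mulr0.
have qr' : q' != r' by apply: contra_neq qr => h; rewrite eq er h.
pose Y := 2 * (q - r) * p - (q ^+ 2 - r ^+ 2 - q * r).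
pose A := q' ^+ 2 - 3 * (q' * r') - r' ^+ 2.
have eY : Y ^+ 2 = (A ^+ 2 - 8 * q' * r' ^+ 3) * (g ^+ 2) ^+ 2.
  have e0 : (p - q) * (q - r) * (r - p) - p * q * r = 0 by rewrite e subrr.
  transitivity ((q ^+ 2 - r ^+ 2 - q * r) ^+ 2 - 4 * q * r * (q - r) ^+ 2
      - 4 * (q - r) * ((p - q) * (q - r) * (r - p) - p * q * r)); first by rewrite /Y; ring.
  by rewrite e0 mulr0 subr0 eq er /A; ring.
have [Z eZ] : exists Z, Y = Z * g ^+ 2 by apply/dvdzP; apply: dvd_sqz; rewrite eY dvdz_mull.
have ZA : Z ^+ 2 = A ^+ 2 - 8 * q' * r' ^+ 3.
  by apply: (mulIf (expf_neq0 2 (expf_neq0 2 g0))); rewrite -eY eZ; ring.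
have [al [be [eal ebe]]] : exists al be, A - Z = 2 * al /\ A + Z = 2 * be.
  have [a [ea|ea]] := parity A; have [z [ez|ez]] := parity Z.
  - by exists (a - z), (a + z); split; rewrite ea ez; ring.
  - by exfalso; move: ZA; rewrite ea ez; clear; lia.
  - by exfalso; move: ZA; rewrite ea ez; clear; lia.
  - by exists (a - z), (a + z + 1); split; rewrite ea ez; ring.
have ab : al * be = 2 * q' * r' ^+ 3.
  by apply: (mulfI (x := 4)) => //; transitivity (A ^+ 2 - Z ^+ 2); [transitivity ((2 * al) * (2 * be)); [ring | rewrite -eal -ebe; ring] | rewrite ZA; ring].
have apb : al + be = A by move: eal ebe; clear; lia.
have ab0 : al * be != 0 by rewrite ab !mulf_neq0 ?expf_neq0.
have [al0 be0] : al != 0 /\ be != 0 by apply/andP; rewrite -negb_or -mulf_eq0.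
have coab : coprimez al be.
  apply: prime_cop => l pl la lb.
  have lA : (l %| A)%Z by rewrite -apb; apply: (dvd_comb la lb (x := 1) (y := 1)); ring.
  have : (l %| q' * r' ^+ 3)%Z.
    case/dvdzP: (la) => u eu; case/dvdzP: (lb) => v ev.
    have : (l %| 2 * (q' * r' ^+ 3))%Z by rewrite mulrA -ab; exact: dvdz_mulr.
    case/(prime_mulz pl) => // /(prime_2 pl) l2; apply/dvdzP; exists (u * v).
    by apply: (mulfI (x := 2)) => //; rewrite mulrA -ab eu ev l2; ring.
  case/(prime_mulz pl) => [lq|/(prime_expz pl) lr]; apply: (cop_prime co pl) => //; apply: (prime_expz (k := 2) pl).
    by apply: (dvd_comb lA lq (x := -1) (y := q' - 3 * r')); rewrite /A; ring.
  by apply: (dvd_comb lA lr (x := 1) (y := 3 * q' + r')); rewrite /A; ring.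
(* [r1] is the common part of [al] and [r']. Since [al] and [be] are coprime, the cube of [r1]
   divides [al] and that of [r2] divides [be]. *)
have [r1 [a0 [r2 [r10 ea0 er2 coar]]]] : exists g a' b' : int, [/\ g != 0, al = g * a', r' = g * b' & coprimez a' b'].
  by apply: coprime_scale; rewrite al0.
have r20 : r2 != 0 by apply: contra_neq r'0 => h; rewrite er2 h mulr0.
have cor1 : coprimez r1 be by apply: prime_cop => l pl h1 h2; apply: (cop_prime coab pl) => //; rewrite ea0; exact: dvdz_mulr.
have [al' eal'] : exists al', al = al' * r1 ^+ 3.
  apply/dvdzP; rewrite -(Gauss_dvdzl _ (coprimezXl 3 cor1)) ab er2.
  by apply/dvdzP; exists (2 * q' * r2 ^+ 3); ring.
have cor2 : coprimez r2 al.
  apply: prime_cop => l pl h1 h2.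
  have na0 : (l %| a0)%Z -> False by move=> h; exact: (cop_prime coar pl).
  move: h2; rewrite ea0 => /(prime_mulz pl) [h2|//]; apply: na0.
  have -> : a0 = al' * r1 * r1 by apply: (mulfI r10); rewrite -ea0 eal'; ring.
  exact: dvdz_mull.
have [be' ebe'] : exists be', be = be' * r2 ^+ 3.
  apply/dvdzP; rewrite -(Gauss_dvdzr _ (coprimezXl 3 cor2)) ab er2.
  by apply/dvdzP; exists (2 * q' * r1 ^+ 3); ring.
have ab' : al' * be' = 2 * q'.
  by apply: (mulIf (expf_neq0 3 r'0)); rewrite -ab eal' ebe' er2; ring.
have cor12 : coprimez r1 r2.
  by apply: prime_cop => l pl h1 h2; apply: (cop_prime cor2 pl) => //; rewrite ea0; exact: dvdz_mulr.
(* The factor 2 of [2 q'] sits in one of the two cofactors; the cases differ by exchanging [r1] and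
   [r2]. *)
have : (2 %| al' * be')%Z by rewrite ab' dvdz_mulr.
case/(@prime_mulz _ _ 2 isT) => /dvdzP [s es].
  have eq' : q' = s * be' by apply: (mulfI (x := 2)) => //; rewrite -ab' es; ring.
  have [s0 b0] : s != 0 /\ be' != 0 by apply/andP; rewrite -negb_or -mulf_eq0 -eq'.
  apply: (@core14 s be' r1 r2) => //; rewrite -?eq' -?er2 //.
    rewrite coprimezMl [coprimez r2 _]coprimez_sym cor12 andbT.
    by apply: prime_cop => l pl h1 h2; apply: (cop_prime co pl); [rewrite eq'; exact: dvdz_mull | rewrite er2; exact: dvdz_mulr].
  have -> : q' ^+ 2 - 3 * q' * r' - r' ^+ 2 = A by rewrite /A; ring.
  by rewrite -apb eal' ebe' es; ring.
have eq' : q' = s * al' by apply: (mulfI (x := 2)) => //; rewrite -ab' es; ring.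
have [s0 b0] : s != 0 /\ al' != 0 by apply/andP; rewrite -negb_or -mulf_eq0 -eq'.
have er2' : r' = r2 * r1 by rewrite er2 mulrC.
apply: (@core14 s al' r2 r1) => //; rewrite -?eq' -?er2' //.
  rewrite coprimezMl cor12 andbT.
  by apply: prime_cop => l pl h1 h2; apply: (cop_prime co pl); [rewrite eq'; exact: dvdz_mull | rewrite er2'; exact: dvdz_mulr].
have -> : q' ^+ 2 - 3 * q' * r' - r' ^+ 2 = A by rewrite /A; ring.
by rewrite -apb eal' ebe' es; ring.
Qed.

(** * Rational 4-cycles of quadratic polynomials *)

(** Infinite descent on [|a b|]. With [x] the odd one of the two, the difference [c^2 - x^4] factors
    twice and yields [p^2 = x1^4 + y1^4] with [x1 y1] a proper divisor of the even one. *)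
Lemma fermat_quartic (B : nat) (a b c : int) : (`|(a * b)%R| < B)%N -> coprimez a b ->
  a ^+ 4 + b ^+ 4 = c ^+ 2 -> a * b = 0.
Proof.
elim: B a b c => // B IH a b c lt co e.
have [//|ab0] := eqVneq (a * b) 0.
have core : forall (a b' c : int), 0 <= c -> coprimez (2 * a + 1) (2 * b') ->
    (2 * a + 1) ^+ 4 + (2 * b') ^+ 4 = c ^+ 2 -> (`|((2 * a + 1) * (2 * b'))%R| < B.+1)%N -> (2 * a + 1) * (2 * b') != 0 -> False.
  move=> {}a b' {}c c0 {}co {}e {}lt {}ab0.
  pose x := 2 * a + 1; have ex : x = 2 * a + 1 by [].
  have b0 : b' != 0 by apply: contra_neq ab0 => ->; rewrite !mulr0.
  have [k ek] : exists k, c = 2 * k + 1.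
    by have [k [ek|ek]] := parity c; exists k => //; exfalso; move: e; rewrite ek; clear; lia.
  have xsq : x ^+ 2 = 2 * (2 * a ^+ 2 + 2 * a) + 1 by rewrite ex; ring.
  pose s := 2 * a ^+ 2 + 2 * a.
  pose g := k - s; pose d := k + s + 1.
  have egd : g * d = 4 * b' ^+ 4.
    apply: (mulfI (x := 4)) => //; transitivity (c ^+ 2 - x ^+ 4); last by rewrite -e ex; ring.
    by rewrite ek /g /d /s ex; ring.
  have dg : d - g = x ^+ 2 by rewrite xsq /d /g /s; ring.
  have b4 : 0 < b' ^+ 4 by rewrite exprn_even_gt0.
  have [g0' d0] : 0 < g /\ 0 < d.
    apply: pos_factors; first by rewrite egd; move: b4; clear; lia.
    by have -> : g + d = c by [rewrite /g /d ek; ring].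
  have g0 := ltW g0'.
  have cogd : coprimez g d.
    apply: prime_cop => p pp pg pd.
    have px : (p %| x)%Z by apply: (prime_expz (k := 2) pp); rewrite -dg; apply: (dvd_comb pd pg (x := 1) (y := -1)); ring.
    have : (p %| 4 * b' ^+ 4)%Z by rewrite -egd; exact: dvdz_mulr.
    case/(prime_mulz pp).
      rewrite -[4]/((2 : int) * 2) => /(prime_mulz pp) h; have p2 : p = 2%N by apply: prime_2 => //; case: h.
      by move: px; rewrite p2 ex; exact: odd_ndvd.
    move/(prime_expz pp) => pb; apply: (cop_prime co pp px); exact: dvdz_mull.
  have : (2 %| g * d)%Z by rewrite egd; apply/dvdzP; exists (2 * b' ^+ 4); ring.
  case/(@prime_mulz _ _ 2 isT) => h2.
    have cod : coprimez 4 d.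
      have : coprimez 2 d by apply: prime_cop => p pp /(prime_2 pp) -> hd; exact: (cop_prime cogd (isT : prime 2)).
      by move/(coprimezXl 2).
    have : (4 %| g * d)%Z by rewrite egd dvdz_mulr.
    rewrite Gauss_dvdzl // => /dvdzP [g2 eg2].
    have egd2 : g2 * d = b' ^+ 4 by apply: (mulfI (x := 4)) => //; rewrite -egd eg2; ring.
    have co2 : coprimez g2 d.
      apply: prime_cop => p pp pg pd; apply: (cop_prime cogd pp) => //; rewrite eg2; exact: dvdz_mulr.
    have g20 : 0 <= g2 by lin.
    have [q [p [[q0 p0 eq ep] [ebq coqp]]]] := coprime_powz (isT : (0 < 4)%N) g20 (ltW d0) co2 egd2.
    (* Second factorization: half the sum and half the difference of [p^2] and [|x|] are coprime
       with product [q^4]. *)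
    have eqa : p ^+ 4 - 4 * q ^+ 4 = x ^+ 2 by rewrite -dg -ep eg2 -eq; ring.
    pose y := `|x|; have y0 : 0 <= y by rewrite /y.
    have ysq : y ^+ 2 = x ^+ 2 by rewrite /y real_normK // num_real.
    have [l el] : exists l, y = 2 * l + 1.
      by have [l [el|el]] := parity y; exists l => //; exfalso; move: ysq; rewrite xsq el; clear; lia.
    have [l' el'] : exists l', p = 2 * l' + 1.
      by have [l' [el'|el']] := parity p; exists l' => //; exfalso; move: eqa; rewrite xsq el'; clear; lia.
    pose X := 2 * l' ^+ 2 + 2 * l' - l; pose Y := 2 * l' ^+ 2 + 2 * l' + l + 1.
    have XpY : Y + X = p ^+ 2 by rewrite /X /Y el'; ring.
    have YmX : Y - X = y by rewrite /X /Y el; ring.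
    have XY : X * Y = q ^+ 4.
      apply: (mulfI (x := 4)) => //; transitivity ((Y + X) ^+ 2 - (Y - X) ^+ 2); first by ring.
      by rewrite XpY YmX ysq -eqa; ring.
    have l0 : 0 <= l by lin. have l'0 : 0 <= l' by lin.
    have Yp : 0 < Y by have := exprn_even_ge0 l' (isT : ~~ odd 2); move: l0 l'0; rewrite /Y; clear; lia.
    have X0 : 0 <= X.
      by rewrite -(pmulr_lge0 _ Yp) XY exprn_even_ge0.
    have coXY : coprimez X Y.
      apply: prime_cop => r pr rX rY.
      have rp : (r %| p)%Z by apply: (prime_expz (k := 2) pr); rewrite -XpY; apply: (dvd_comb rX rY (x := 1) (y := 1)); ring.
      have rq : (r %| q)%Z by apply: (prime_expz (k := 4) pr); rewrite -XY; exact: dvdz_mulr.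
      exact: (cop_prime coqp pr).
    have [x1 [y1 [[x10 y10 ex1 ey1] [exy coxy]]]] := coprime_powz (isT : (0 < 4)%N) X0 (ltW Yp) coXY XY.
    have eqq : q = x1 * y1 by rewrite -exy ger0_norm.
    have q00 : x1 * y1 = 0.
      apply: (IH x1 y1 p) => //; last by rewrite -ex1 -ey1 -XpY; ring.
      have hb : `|b'| = q * p by [].
      have p1 : 1 <= p by lin.
      have hq : q <= `|b'| by rewrite hb ler_peMr.
      have hx : `|(2 * a + 1) * (2 * b')| = `|x| * (2 * `|b'|) by rewrite normrM normrM -/x.
      have xp : 1 <= `|x| by lin.
      have bp : 1 <= `|b'| by lin.
      have hx2 : 2 * `|b'| <= `|x| * (2 * `|b'|) by rewrite ler_peMl // mulr_ge0.
      move: lt hx hx2 hq bp q0; rewrite -eqq; move: (`|x| * _) ((2 * a + 1) * _) => u v; clear; lia.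
    move: b0; rewrite -normr_eq0 ebq eqq q00 mul0r eqxx //.
  (* The other place for the factor 4 leads to [4 p^4 - q^4 = x^2] with [q] and [x] odd, impossible
     modulo 4. *)
  have [d1 ed1] : exists d1, d = 4 * d1.
    have cod : coprimez 4 g.
      have : coprimez 2 g by apply: prime_cop => p pp /(prime_2 pp) -> hd; exact: (cop_prime cogd (isT : prime 2)).
      by move/(coprimezXl 2).
    have : (4 %| g * d)%Z by rewrite egd dvdz_mulr.
    by rewrite Gauss_dvdzr // => /dvdzP [d1 ed1]; exists d1; rewrite ed1 mulrC.
  have egd2 : g * d1 = b' ^+ 4 by apply: (mulfI (x := 4)) => //; rewrite -egd ed1; ring.
  have co2 : coprimez g d1.
    by apply: prime_cop => p pp pg pd; apply: (cop_prime cogd pp) => //; rewrite ed1; exact: dvdz_mull.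
  have d10 : 0 <= d1 by lin.
  have [q [p [[q0 p0 eq ep] _]]] := coprime_powz (isT : (0 < 4)%N) g0 d10 co2 egd2.
  have [l [el|el]] := parity q.
    apply: (cop_prime cogd (isT : prime 2)) => //; rewrite eq el; apply/dvdzP; exists (8 * l ^+ 4); ring.
  by move: dg; rewrite eq el xsq ed1; clear; lia.
have cc : `|c| ^+ 2 = c ^+ 2 by rewrite real_normK // num_real.
exfalso; have [i [ei|ei]] := parity a; have [j [ej|ej]] := parity b.
- by move: co; rewrite ei ej; exact: coprime_two.
- apply: (core j i `|c|) => //; rewrite -ei -ej ?cc -?e; first by rewrite coprimez_sym.
  + by rewrite addrC. + by rewrite mulrC. + by rewrite mulrC.
- by apply: (core i j `|c|) => //; rewrite -ei -ej ?cc.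
- have [k [ek|ek]] := parity c; move: e; rewrite ei ej ek; clear; lia.
Qed.

(** Fermat's theorem that 1 is not a congruent number. Half the sum and half the difference of [c]
    and [d] are the legs of a right triangle with hypotenuse [|m|] and area [(n / 2)^2]; two
    factorizations produce [p], [q] with [p^2 + q^2] and [p^2 - q^2] squares and [q] smaller than
    [|n|]. *)
Lemma congruent_one (B : nat) (m n c d : int) : (`|n| < B)%N -> coprimez m n ->
  m ^+ 2 + n ^+ 2 = c ^+ 2 -> m ^+ 2 - n ^+ 2 = d ^+ 2 -> n = 0.
Proof.
elim: B m n c d => // B IH m n c d lt co ec ed.
have [//|n0] := eqVneq n 0; exfalso.
wlog [c0 d0] : c d ec ed / 0 <= c /\ 0 <= d.
  by move=> h; apply: (h `|c| `|d|); rewrite ?real_normK ?num_real.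
have [m1 em] : exists k, m = 2 * k + 1.
  have [k [ek|ek]] := parity m; exists k => //; exfalso.
  have [j [ej|ej]] := parity n; first by move: co; rewrite ek ej; exact: coprime_two.
  by have [l [el|el]] := parity d; move: ed; rewrite ek ej el; clear; lia.
have [n1 en] : exists k, n = 2 * k.
  have [k [ek|ek]] := parity n; exists k => //; exfalso.
  by have [l [el|el]] := parity c; move: ec; rewrite em ek el; clear; lia.
have [i ei] : exists k, c = 2 * k + 1.
  by have [k [ek|ek]] := parity c; exists k => //; exfalso; move: ec; rewrite em en ek; clear; lia.
have [j ej] : exists k, d = 2 * k + 1.
  by have [k [ek|ek]] := parity d; exists k => //; exfalso; move: ed; rewrite em en ek; clear; lia.
pose P := i + j + 1; pose Q := i - j.
have PQ2 : P ^+ 2 + Q ^+ 2 = m ^+ 2 by rewrite /P /Q; move: ec ed; rewrite ei ej; clear; lia.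
have PQ : P * Q = 2 * n1 ^+ 2 by rewrite /P /Q; move: ec ed; rewrite ei ej en; clear; lia.
have n1sq : 0 < n1 ^+ 2 by rewrite exprn_even_gt0 //=; apply: contra_neq n0 => h; rewrite en h mulr0.
have [P0' Q0'] : 0 < P /\ 0 < Q.
  apply: pos_factors; first by rewrite PQ; move: n1sq; clear; lia.
  by have -> : P + Q = c by [rewrite /P /Q ei; ring].
have P0 := ltW P0'; have Q0 := ltW Q0'.
have coPQ : coprimez P Q.
  apply: prime_cop => p pp pP pQ.
  have pm : (p %| m)%Z by apply: (prime_expz (k := 2) pp); rewrite -PQ2; apply: (dvd_comb pP pQ (x := P) (y := Q)); ring.
  have : (p %| 2 * n1 ^+ 2)%Z by rewrite -PQ; exact: dvdz_mulr.
  case/(prime_mulz pp) => [/(prime_2 pp) p2|]; first by move: pm; rewrite p2 em; exact: odd_ndvd.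
  by move/(prime_expz pp) => pn; apply: (cop_prime co pp) => //; rewrite en; exact: dvdz_mull.
have main : forall S T : int, 0 <= S -> 0 <= T -> coprimez (2 * S) T -> (2 * S) * T = 2 * n1 ^+ 2 ->
    (2 * S) ^+ 2 + T ^+ 2 = m ^+ 2 -> False.
  move=> S T S0 T0 coST ST eST.
  have ST' : S * T = n1 ^+ 2 by move: ST; clear; lia.
  have coST' : coprimez S T.
    by apply: prime_cop => p pp pS pT; apply: (cop_prime coST pp) => //; exact: dvdz_mull.
  have [y [x [[y0 x0 ey ex] [exy coyx]]]] := coprime_powz (isT : (0 < 2)%N) S0 T0 coST' ST'.
  have eq4 : 4 * y ^+ 4 + x ^+ 4 = m ^+ 2 by rewrite -eST ey ex; ring.
  have [x1 ex1] : exists k, x = 2 * k + 1.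
    have [k [ek|ek]] := parity x; exists k => //; exfalso.
    by move: eq4; rewrite em ek; clear; lia.
  pose z := `|m|; have zsq : z ^+ 2 = m ^+ 2 by rewrite /z real_normK // num_real.
  have [z1 ez1] : exists k, z = 2 * k + 1.
    by have [k [ek|ek]] := parity z; exists k => //; exfalso; move: zsq; rewrite em ek; clear; lia.
  pose s := 2 * x1 ^+ 2 + 2 * x1.
  have xsq : x ^+ 2 = 2 * s + 1 by rewrite ex1 /s; ring.
  pose g := z1 - s; pose h := z1 + s + 1.
  have gh : g * h = y ^+ 4.
    apply: (mulfI (x := 4)) => //; transitivity (z ^+ 2 - (x ^+ 2) ^+ 2); first by rewrite xsq ez1 /g /h; ring.
    by rewrite zsq -eq4; ring.
  have hg : h - g = x ^+ 2 by rewrite xsq /h /g; ring.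
  have y00 : y != 0 by apply/eqP => y00; move: n1sq; rewrite -ST' ey y00; clear; lia.
  have y4 : 0 < y ^+ 4 by rewrite exprn_even_gt0.
  have [g0' h0] : 0 < g /\ 0 < h.
    apply: pos_factors; first by rewrite gh.
    by have -> : g + h = z by [rewrite /g /h ez1; ring]; rewrite /z.
  have g0 := ltW g0'.
  have cogh : coprimez g h.
    apply: prime_cop => p pp pg ph.
    have px : (p %| x)%Z by apply: (prime_expz (k := 2) pp); rewrite -hg; apply: (dvd_comb pg ph (x := -1) (y := 1)); ring.
    have py : (p %| y)%Z by apply: (prime_expz (k := 4) pp); rewrite -gh; exact: dvdz_mulr.
    exact: (cop_prime coyx pp).
  have [q [p [[q0 p0 eq ep] [eyq coqp]]]] := coprime_powz (isT : (0 < 4)%N) g0 (ltW h0) cogh gh.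
  have epq : (p ^+ 2 - q ^+ 2) * (p ^+ 2 + q ^+ 2) = x ^+ 2 by rewrite -hg eq ep; ring.
  have xp : 0 < x ^+ 2 by rewrite exprn_even_gt0 //= ex1; lin.
  have pq2 : 0 <= p ^+ 2 + q ^+ 2 by rewrite addr_ge0 // exprn_even_ge0.
  have pq1 : 0 <= p ^+ 2 - q ^+ 2.
    have [|//|h1 _] := @pos_factors (p ^+ 2 - q ^+ 2) (p ^+ 2 + q ^+ 2); [by rewrite epq | | exact: ltW].
    by have -> : p ^+ 2 - q ^+ 2 + (p ^+ 2 + q ^+ 2) = 2 * p ^+ 2 by [ring]; rewrite mulr_ge0 // exprn_even_ge0.
  have copq : coprimez (p ^+ 2 - q ^+ 2) (p ^+ 2 + q ^+ 2).
    apply: prime_cop => r pr r1 r2.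
    have rx : (r %| x)%Z by apply: (prime_expz (k := 2) pr); rewrite -epq; exact: dvdz_mulr.
    have n2 : r <> 2%N by move=> r2'; move: rx; rewrite r2' ex1; exact: odd_ndvd.
    have rp : (r %| p)%Z.
      have : (r %| 2 * p ^+ 2)%Z by apply: (dvd_comb r1 r2 (x := 1) (y := 1)); ring.
      by case/(prime_mulz pr) => [/(prime_2 pr)|/(prime_expz pr)].
    have rq : (r %| q)%Z.
      have : (r %| 2 * q ^+ 2)%Z by apply: (dvd_comb r1 r2 (x := -1) (y := 1)); ring.
      by case/(prime_mulz pr) => [/(prime_2 pr)|/(prime_expz pr)].
    exact: (cop_prime coqp pr).
  have [d' [c' [[d'0 c'0 ed' ec'] _]]] := coprime_powz (isT : (0 < 2)%N) pq1 pq2 copq epq.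
  have eyq' : y = q * p by rewrite -eyq ger0_norm.
  have q00 : q = 0.
    apply: (IH p q c' d') => //; last by rewrite coprimez_sym.
    have p1 : 1 <= p by have : p != 0 by [apply: contra_neq y00 => p00; rewrite eyq' p00 mulr0]; lin.
    have xx : 1 <= x by lin.
    have h1 : q <= y by rewrite eyq' ler_peMr.
    have h2 : y <= `|n1| by rewrite exy ler_peMr.
    have h3 : `|n| = 2 * `|n1| by rewrite en normrM.
    have h4 : 0 < y by lin.
    by move: lt; lin.
  by move: y00; rewrite eyq' q00 mul0r eqxx.
have : (2 %| P * Q)%Z by rewrite PQ dvdz_mulr.
case/(@prime_mulz _ _ 2 isT) => /dvdzP [S eS].
- apply: (main S Q) => //; [by lin| | |]; rewrite -[2 * S]mulrC -eS //.
- apply: (main S P) => //; [by lin| | |]; rewrite -[2 * S]mulrC -eS; first by rewrite coprimez_sym.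
    by rewrite mulrC.
  by rewrite addrC.
Qed.

(** [D1] and [D2] are the differences within the two opposite pairs of a 4-cycle, and [E] is the
    difference of their sums. In lowest terms the product of [m^2 - n^2], [m^2 + n^2] and [W] is a
    square. If [m + n] is odd the three are pairwise coprime and [congruent_one] applies; if [m] and
    [n] are odd, the substitution [m = a + N], [n = a - N] makes [|a|], [|N|] and [a^2 + N^2]
    squares, which is Fermat's quartic. *)
Lemma four_cycle (D1 D2 E : int) : D1 != 0 -> D2 != 0 ->
  D2 ^+ 4 - D1 ^+ 4 = E ^+ 2 * (D2 ^+ 2 + 2 * D1 * D2 - D1 ^+ 2) -> D1 ^+ 2 = D2 ^+ 2.
Proof.
move=> D10 D20 e.
have [g [n [m [g0 en em co]]]] : exists g a' b' : int, [/\ g != 0, D1 = g * a', D2 = g * b' & coprimez a' b'].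
  by apply: coprime_scale; rewrite D10.
have n0 : n != 0 by apply: contra_neq D10 => h; rewrite en h mulr0.
have m0 : m != 0 by apply: contra_neq D20 => h; rewrite em h mulr0.
pose W := m ^+ 2 + 2 * n * m - n ^+ 2.
have eW : (m ^+ 4 - n ^+ 4) * W * g ^+ 2 = (E * W) ^+ 2.
  apply: (mulfI (expf_neq0 2 g0)); transitivity ((D2 ^+ 4 - D1 ^+ 4) * W); first by rewrite en em; ring.
  by rewrite e en em /W; ring.
have [k ek] : exists k, E * W = k * g.
  by apply/dvdzP; apply: dvd_sqz; rewrite -eW dvdz_mull.
have {}eW : (m ^+ 2 - n ^+ 2) * (m ^+ 2 + n ^+ 2) * W = k ^+ 2.
  by apply: (mulIf (expf_neq0 2 g0)); rewrite -exprMn -ek -eW; ring.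
suff mn : n ^+ 2 = m ^+ 2 by rewrite en em !exprMn mn.
have absq : forall x : int, `|x| ^+ 2 = x ^+ 2 by move=> x; rewrite real_normK // num_real.
have opp : (exists a, m + n = 2 * a + 1) -> n ^+ 2 = m ^+ 2.
  move=> [a ea]; exfalso.
  have cop2 : forall p : nat, prime p -> (p %| m ^+ 2 + n ^+ 2)%Z \/ (p %| m ^+ 2 - n ^+ 2)%Z -> p <> 2%N.
    move=> p pp h p2; rewrite {}p2 in h.
    have : (2 %| (2 * a + 1) ^+ 2)%Z.
      rewrite -ea; case: h => /dvdzP [q eq]; apply/dvdzP; [exists (q + m * n) | exists (q + n ^+ 2 + m * n)]; move: eq; clear; lia.
    by move/(@prime_expz _ 2 _ isT); exact: odd_ndvd.
  have both : forall p : nat, prime p -> (p %| m)%Z -> (p %| n)%Z -> False.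
    by move=> p pp pm pn; exact: (cop_prime co pp).
  have c12 : coprimez (m ^+ 2 + n ^+ 2) (m ^+ 2 - n ^+ 2).
    apply: prime_cop => p pp h1 h2; have p2 := cop2 _ pp (or_introl h1).
    apply: (both p pp).
      have : (p %| 2 * m ^+ 2)%Z by apply: (dvd_comb h1 h2 (x := 1) (y := 1)); ring.
      by case/(prime_mulz pp) => [/(prime_2 pp)|/(prime_expz pp)].
    have : (p %| 2 * n ^+ 2)%Z by apply: (dvd_comb h1 h2 (x := 1) (y := -1)); ring.
    by case/(prime_mulz pp) => [/(prime_2 pp)|/(prime_expz pp)].
  have sqm : forall p : nat, prime p -> (p %| m ^+ 2 + n ^+ 2)%Z \/ (p %| m ^+ 2 - n ^+ 2)%Z -> (p %| m)%Z \/ (p %| n)%Z -> False.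
    move=> p pp h [pm|pn]; apply: (both p pp) => //; apply: (prime_expz (k := 2) pp).
      by case: h => h; [apply: (dvd_comb h pm (x := 1) (y := - m)) | apply: (dvd_comb h pm (x := -1) (y := m))]; ring.
    by case: h => h; [apply: (dvd_comb h pn (x := 1) (y := - n)) | apply: (dvd_comb h pn (x := 1) (y := n))]; ring.
  have c2W : coprimez (m ^+ 2 + n ^+ 2) W.
    apply: prime_cop => p pp h1 h2; have p2 := cop2 _ pp (or_introl h1).
    have : (p %| 2 * (n * (m - n)))%Z by apply: (dvd_comb h1 h2 (x := -1) (y := 1)); rewrite /W; ring.
    case/(prime_mulz pp) => [/(prime_2 pp) //|/(prime_mulz pp) [pn|pmn]].
      by apply: (sqm p pp); [left | right].
    have : (p %| 2 * (m * n))%Z by apply: (dvd_comb h1 pmn (x := 1) (y := - (m - n))); ring.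
    case/(prime_mulz pp) => [/(prime_2 pp) //|/(prime_mulz pp) h].
    by apply: (sqm p pp) => //; left.
  have c1W : coprimez (m ^+ 2 - n ^+ 2) W.
    apply: prime_cop => p pp h1 h2; have p2 := cop2 _ pp (or_intror h1).
    have : (p %| 2 * (m * n))%Z by apply: (dvd_comb h1 h2 (x := -1) (y := 1)); rewrite /W; ring.
    case/(prime_mulz pp) => [/(prime_2 pp) //|/(prime_mulz pp) h].
    by apply: (sqm p pp) => //; right.
  have T2 : 0 < m ^+ 2 + n ^+ 2 by rewrite ltr_pwDl ?exprn_even_ge0 ?exprn_even_gt0.
  have c2 : coprimez (m ^+ 2 + n ^+ 2) ((m ^+ 2 - n ^+ 2) * W) by rewrite coprimezMr c12 c2W.
  have e2 : (m ^+ 2 + n ^+ 2) * ((m ^+ 2 - n ^+ 2) * W) = k ^+ 2 by rewrite -eW; ring.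
  have TW : 0 <= (m ^+ 2 - n ^+ 2) * W by rewrite -(pmulr_rge0 _ T2) e2 exprn_even_ge0.
  have [x [y [[x0 y0 ex ey] _]]] := coprime_powz (isT : (0 < 2)%N) (ltW T2) TW c2 e2.
  have c1 : coprimez `|m ^+ 2 - n ^+ 2| `|W| by rewrite coprime_absz.
  have e1 : `|m ^+ 2 - n ^+ 2| * `|W| = y ^+ 2 by rewrite -normrM ger0_norm.
  have [d [d' [[d0 _ ed _] _]]] := coprime_powz (isT : (0 < 2)%N) (normr_ge0 _) (normr_ge0 _) c1 e1.
  have [s|s] := leP 0 (m ^+ 2 - n ^+ 2).
    rewrite ger0_norm // in ed; move: n0; rewrite (@congruent_one `|n|.+1 m n x d) ?eqxx //.
    by rewrite coprimez_sym.
  rewrite ltr0_norm // opprB in ed; move: m0; rewrite (@congruent_one `|m|.+1 n m x d) ?eqxx //.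
  by rewrite addrC.
have [a [ea|ea]] := parity (m + n); last by apply: opp; exists a.
have [//|mn] := eqVneq (n ^+ 2) (m ^+ 2); exfalso.
pose N := m - a; have em' : m = a + N by rewrite /N; lin. have en' : n = a - N by rewrite /N; lin.
have [i ei] : exists i, m = 2 * i + 1.
  have [i [ei|ei]] := parity m; exists i => //; exfalso.
  by move: co; have -> : n = 2 * (a - i) by [lin]; rewrite ei; exact: coprime_two.
have W' : W = 2 * (a ^+ 2 + 2 * a * N - N ^+ 2) by rewrite /W em' en'; ring.
have ek16 : 16 * (a * N * (a ^+ 2 + N ^+ 2) * (a ^+ 2 + 2 * a * N - N ^+ 2)) = k ^+ 2.
  by rewrite -eW W' em' en'; ring.
have [k' ek'] : exists k', k = k' * 4.
  by apply/dvdzP; apply: dvd_sqz; rewrite -ek16 -[4 ^+ 2]/(16 : int) dvdz_mulr.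
pose w := a ^+ 2 + 2 * a * N - N ^+ 2.
have eN : a * (N * (a ^+ 2 + N ^+ 2) * w) = k' ^+ 2.
  by apply: (mulfI (x := 16)) => //; transitivity (k ^+ 2); [rewrite -ek16 /w | rewrite ek']; ring.
have coaN : forall p : nat, prime p -> (p %| a)%Z -> (p %| N)%Z -> False.
  by move=> p pp pa pN; apply: (cop_prime co pp); [rewrite en'; apply: (dvd_comb pa pN (x := 1) (y := -1)) | rewrite em'; apply: (dvd_comb pa pN (x := 1) (y := 1))]; ring.
have odd2 : forall p : nat, prime p -> (p %| a ^+ 2 + N ^+ 2)%Z -> p <> 2%N.
  move=> p pp h p2; rewrite {}p2 in h; have : (2 %| (2 * i + 1) ^+ 2)%Z.
    by rewrite -ei em'; case/dvdzP: h => q eq; apply/dvdzP; exists (q + a * N); move: eq; clear; lia.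
  by move/(@prime_expz _ 2 _ isT); exact: odd_ndvd.
have cN : coprimez a N by apply: prime_cop => p pp; exact: coaN.
have caS : coprimez a (a ^+ 2 + N ^+ 2).
  apply: prime_cop => p pp pa h; apply: (coaN p pp pa); apply: (prime_expz (k := 2) pp).
  by apply: (dvd_comb h pa (x := 1) (y := - a)); ring.
have cNS : coprimez N (a ^+ 2 + N ^+ 2).
  apply: prime_cop => p pp pa h; apply: (coaN p pp _ pa); apply: (prime_expz (k := 2) pp).
  by apply: (dvd_comb h pa (x := 1) (y := - N)); ring.
have caw : coprimez a w.
  apply: prime_cop => p pp pa h; apply: (coaN p pp pa); apply: (prime_expz (k := 2) pp).
  by apply: (dvd_comb h pa (x := -1) (y := a + 2 * N)); rewrite /w; ring.
have cNw : coprimez N w.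
  apply: prime_cop => p pp pa h; apply: (coaN p pp _ pa); apply: (prime_expz (k := 2) pp).
  by apply: (dvd_comb h pa (x := 1) (y := N - 2 * a)); rewrite /w; ring.
have cSw : coprimez (a ^+ 2 + N ^+ 2) w.
  apply: prime_cop => p pp h1 h2; have p2 := odd2 _ pp h1.
  have sq : (p %| a)%Z \/ (p %| N)%Z -> False.
    case=> pa; [apply: (cop_prime caS pp pa h1) | exact: (cop_prime cNS pp pa h1)].
  have : (p %| 2 * (N * (a - N)))%Z by apply: (dvd_comb h1 h2 (x := -1) (y := 1)); rewrite /w; ring.
  case/(prime_mulz pp) => [/(prime_2 pp) //|/(prime_mulz pp) [pn|pmn]]; first by apply: sq; right.
  have : (p %| 2 * (a * N))%Z by apply: (dvd_comb h1 pmn (x := 1) (y := - (a - N))); ring.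
  by case/(prime_mulz pp) => [/(prime_2 pp) //|/(prime_mulz pp) h]; exact: sq.
have get : forall x y : int, coprimez x y -> x * y = k' ^+ 2 -> exists2 z, 0 <= z & `|x| = z ^+ 2.
  move=> x y cxy exy; have c1 : coprimez `|x| `|y| by rewrite coprime_absz.
  have e1 : `|x| * `|y| = k' ^+ 2 by rewrite -normrM exy ger0_norm // exprn_even_ge0.
  by have [d [d' [[d0 _ ed _] _]]] := coprime_powz (isT : (0 < 2)%N) (normr_ge0 _) (normr_ge0 _) c1 e1; exists d.
have [x x0 ex] : exists2 z, 0 <= z & `|a| = z ^+ 2.
  by apply: (get _ _ _ eN); rewrite !coprimezMr cN caS caw.
have [y y0 ey] : exists2 z, 0 <= z & `|N| = z ^+ 2.
  apply: (get _ (a * (a ^+ 2 + N ^+ 2) * w)); last by rewrite -eN; ring.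
  by rewrite !coprimezMr coprimez_sym cN cNS cNw.
have [z z0 ez] : exists2 z, 0 <= z & `|a ^+ 2 + N ^+ 2| = z ^+ 2.
  apply: (get _ (a * N * w)); last by rewrite -eN; ring.
  by rewrite !coprimezMr coprimez_sym caS coprimez_sym cNS cSw.
have coxy : coprimez x y.
  by rewrite -(coprimez_pexpl _ _ (isT : (0 < 2)%N)) -(coprimez_pexpr _ _ (isT : (0 < 2)%N)) -ex -ey coprime_absz.
have exy : x ^+ 4 + y ^+ 4 = z ^+ 2.
  have -> : x ^+ 4 + y ^+ 4 = (x ^+ 2) ^+ 2 + (y ^+ 2) ^+ 2 by ring.
  by rewrite -ex -ey -ez !absq ger0_norm // addr_ge0 // exprn_even_ge0.
have := @fermat_quartic `|(x * y)%R|.+1 x y z (ltnSn _) coxy exy.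
move/eqP; rewrite mulf_eq0 => /orP[]/eqP h.
  by move: ex; rewrite h => /eqP; rewrite expr0n normr_eq0 => /eqP a0; move: mn; rewrite em' en' a0 !add0r sqrrN eqxx.
by move: ey; rewrite h => /eqP; rewrite expr0n normr_eq0 => /eqP N0; move: mn; rewrite em' en' N0 ?subr0 ?addr0 eqxx.
Qed.

(** * Divisibility in subrings of a field *)

(** Subrings are predicates with values in [Prop], since membership below asserts the existence of
    coordinates. The same lemmas then serve Z[omega], Z[zeta] and the real cubic ring inside
    [algC]. *)
Definition subring_pred (F : fieldType) (P : F -> Prop) : Prop :=
  [/\ P 1, forall x y, P x -> P y -> P (x - y) & forall x y, P x -> P y -> P (x * y)].

Definition dvdP (F : fieldType) (P : F -> Prop) (d a : F) : Prop :=
  exists2 c, P c & a = c * d.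

Definition coprimeP (F : fieldType) (P : F -> Prop) (a b : F) : Prop :=
  exists u v, [/\ P u, P v & u * a + v * b = 1].

Definition unitP (F : fieldType) (P : F -> Prop) (e : F) : Prop :=
  exists2 f, P f & P e /\ f * e = 1.

Definition bezoutP (F : fieldType) (P : F -> Prop) : Prop :=
  forall a b, P a -> P b ->
  exists d u v, [/\ P u, P v, d = u * a + v * b, dvdP P d a & dvdP P d b].

Section SubringPred.

Variables (F : fieldType) (P : F -> Prop).
Hypothesis ringP : subring_pred P.

Lemma P1 : P 1. Proof. by case: ringP. Qed.
Lemma PB x y : P x -> P y -> P (x - y). Proof. by case: ringP => _ + _; exact. Qed.
Lemma PM x y : P x -> P y -> P (x * y). Proof. by case: ringP => _ _; exact. Qed.
Lemma P0 : P 0. Proof. by rewrite -(subrr 1); apply: PB; exact: P1. Qed.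
Lemma PN x : P x -> P (- x). Proof. by rewrite -sub0r => ?; apply: PB => //; exact: P0. Qed.
Lemma PD x y : P x -> P y -> P (x + y).
Proof. by move=> Px Py; rewrite -[y]opprK; apply: PB => //; exact: PN. Qed.
Lemma PX x n : P x -> P (x ^+ n).
Proof. by move=> Px; elim: n => [|n IH]; rewrite ?expr0 ?exprS; [exact: P1 | exact: PM]. Qed.
Lemma Pnat n : P n%:R.
Proof. by elim: n => [|n IH]; [exact: P0 | rewrite -natr1; apply: PD => //; exact: P1]. Qed.
Lemma Pint (n : int) : P n%:~R.
Proof. by case: n => n; rewrite ?NegzE ?mulrNz; [|apply: PN]; exact: Pnat. Qed.

Lemma dvdP_trans b a c : dvdP P a b -> dvdP P b c -> dvdP P a c.
Proof. by move=> [u Pu ->] [v Pv ->]; exists (v * u); [exact: PM | rewrite mulrA]. Qed.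
Lemma dvdP_mull d a c : P c -> dvdP P d a -> dvdP P d (c * a).
Proof. by move=> Pc [u Pu ->]; exists (c * u); [exact: PM | rewrite mulrA]. Qed.
Lemma dvdP_mulr d a c : P c -> dvdP P d a -> dvdP P d (a * c).
Proof. by rewrite mulrC; exact: dvdP_mull. Qed.
Lemma dvdPD d a b : dvdP P d a -> dvdP P d b -> dvdP P d (a + b).
Proof. by move=> [u Pu ->] [v Pv ->]; exists (u + v); [exact: PD | rewrite mulrDl]. Qed.
Lemma dvdPN d a : dvdP P d a -> dvdP P d (- a).
Proof. by move=> [u Pu ->]; exists (- u); [exact: PN | rewrite mulNr]. Qed.
Lemma dvdPB d a b : dvdP P d a -> dvdP P d b -> dvdP P d (a - b).
Proof. by move=> da db; apply: dvdPD => //; exact: dvdPN. Qed.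
Lemma dvdPP d : dvdP P d d.
Proof. by exists 1; [exact: P1 | rewrite mul1r]. Qed.
Lemma dvdP0 d : dvdP P d 0.
Proof. by exists 0; [exact: P0 | rewrite mul0r]. Qed.
Lemma dvdPX d a n : dvdP P d a -> dvdP P (d ^+ n) (a ^+ n).
Proof. by move=> [u Pu ->]; exists (u ^+ n); [exact: PX | rewrite exprMn]. Qed.

Lemma coprimePC a b : coprimeP P a b -> coprimeP P b a.
Proof. by move=> [u [v [Pu Pv e]]]; exists v, u; rewrite addrC. Qed.

Lemma coprimePM a b c : P a -> P b -> P c ->
  coprimeP P a b -> coprimeP P a c -> coprimeP P a (b * c).
Proof.
move=> Pa Pb Pc [u [v [Pu Pv e]]] [u' [v' [Pu' Pv' e']]].
exists (u * u' * a + u * v' * c + v * b * u'), (v * v').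
by split; [repeat (apply: PD || apply: PM => //)| exact: PM | rewrite -[RHS]mulr1 -{1}e -e'; ring].
Qed.

Lemma coprimePX a b n : P a -> P b -> coprimeP P a b -> coprimeP P a (b ^+ n).
Proof.
move=> Pa Pb co; elim: n => [|n IH].
  by exists 0, 1; split; [exact: P0 | exact: P1 | rewrite mul0r add0r mul1r].
by rewrite exprS; apply: coprimePM => //; exact: PX.
Qed.

Lemma gaussP a b c : P b -> P c -> coprimeP P a b -> dvdP P a (b * c) -> dvdP P a c.
Proof.
move=> Pb Pc [u [v [Pu Pv e]]] [w Pw ew].
exists (u * c + v * w); first by apply: PD; exact: PM.
by rewrite -[LHS]mul1r -e mulrDl [v * b * c]mulrAC -!mulrA [c * b]mulrC ew; ring.
Qed.

Lemma coprime_dvdl a a' b : dvdP P a' a -> coprimeP P a b -> coprimeP P a' b.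
Proof.
move=> [c Pc ->] [u [v [Pu Pv e]]]; exists (u * c), v.
by split=> //; [exact: PM | rewrite -mulrA].
Qed.

Lemma coprime_dvdr a b b' : dvdP P b' b -> coprimeP P a b -> coprimeP P a b'.
Proof. by move=> d /coprimePC co; apply: coprimePC; exact: coprime_dvdl co. Qed.

Lemma unit_coprime a b : P a -> P b -> coprimeP P a b -> dvdP P a b -> unitP P a.
Proof.
move=> Pa Pb [u [v [Pu Pv e]]] [c Pc eb]; exists (u + v * c).
  by apply: PD => //; exact: PM.
by split=> //; rewrite -e eb; ring.
Qed.

Lemma unitP_neq0 e : unitP P e -> e != 0.
Proof. by move=> [f _ [_ h]]; apply/eqP => z; move/eqP: h; rewrite z mulr0 eq_sym oner_eq0. Qed.
Lemma unitP_inv e : unitP P e -> P e^-1.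
Proof.
move=> u; have nz := unitP_neq0 u; case: u => f Pf [_ h].
by rewrite -[e^-1]mul1r -h mulfK.
Qed.
Lemma unitPM e f : unitP P e -> unitP P f -> unitP P (e * f).
Proof.
move=> ue uf; exists (e^-1 * f^-1); first by apply: PM; exact: unitP_inv.
split; first by case: ue uf => ? _ [? _] [? _ [? _]]; exact: PM.
by rewrite mulrACA !mulVf ?unitP_neq0 // mulr1.
Qed.
Lemma unitPV e : unitP P e -> unitP P e^-1.
Proof.
move=> ue; exists e; first by case: ue => ? _ [].
by split; [exact: unitP_inv | rewrite mulfV // unitP_neq0].
Qed.
Lemma unitP_P e : unitP P e -> P e. Proof. by case=> ? _ []. Qed.

Section Bezout.
Hypothesis bez : bezoutP P.

Lemma gcdP_coprime a b : P a -> P b ->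
  (forall d, P d -> dvdP P d a -> dvdP P d b -> unitP P d) -> coprimeP P a b.
Proof.
move=> Pa Pb h; have [d [u [v [Pu Pv e da db]]]] := bez Pa Pb.
have Pd : P d by rewrite e; apply: PD; exact: PM.
have ud := h _ Pd da db.
exists (d^-1 * u), (d^-1 * v); split; try by apply: PM => //; exact: unitP_inv.
by rewrite -!mulrA -mulrDr -e mulVf // unitP_neq0.
Qed.

(** [a] is associate to the cube of [d = gcd(a, c)]. In the expansion of [(u a + v c)^3] every term
    is a multiple of [a], the last one through [c^3 = a b]; conversely [a^2] and [b] are coprime, so
    [a] is a combination of [a^3] and [c^3], both multiples of [d^3]. *)
Lemma coprime_cube a b c : P a -> P b -> P c ->
  coprimeP P a b -> a * b = c ^+ 3 -> exists e d, [/\ unitP P e, P d & a = e * d ^+ 3].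
Proof.
move=> Pa Pb Pc co eab.
have [d [u [v [Pu Pv e da dc]]]] := bez Pa Pc.
have Pd : P d by rewrite e; apply: PD; exact: PM.
have ad : dvdP P a (d ^+ 3).
  exists (u ^+ 3 * a ^+ 2 + 3 * u ^+ 2 * a * v * c + 3 * u * v ^+ 2 * c ^+ 2 + v ^+ 3 * b).
    by repeat first [assumption | exact: Pnat | apply: PX | apply: PM | apply: PD].
  transitivity ((u * a + v * c) ^+ 3); first by rewrite e.
  transitivity (u ^+ 3 * a ^+ 3 + 3 * u ^+ 2 * a ^+ 2 * v * c + 3 * u * a * v ^+ 2 * c ^+ 2 + v ^+ 3 * c ^+ 3); first by ring.
  by rewrite -eab; ring.
have da3 : dvdP P (d ^+ 3) a.
  have [r [s [Pr Ps ers]]] : coprimeP P (a ^+ 2) b.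
    by apply: coprimePC; apply: coprimePX => //; exact: coprimePC.
  have -> : a = r * a ^+ 3 + s * c ^+ 3 by rewrite -eab -[LHS]mul1r -ers; ring.
  by apply: dvdPD; apply: dvdP_mull => //; apply: dvdPX.
have [a0|a0] := eqVneq a 0.
  have d0 : d = 0.
    case: ad => w _; rewrite a0 mulr0 => /eqP; rewrite expf_eq0 /=.
    by move/eqP.
  exists 1, 0; split; [|exact: P0|by rewrite a0 expr0n mulr0].
  by exists 1; [exact: P1 | split; [exact: P1 | rewrite mulr1]].
case: da3 => w Pw ew; case: ad => w' Pw' ew'.
exists w, d; split=> //; exists w' => //; split=> //.
apply: (mulfI a0); rewrite mulr1.
by rewrite [a * _]mulrC -mulrA [w * a]mulrC mulrA -ew' mulrC -ew.
Qed.

(** In lowest terms the cube of the denominator divides the cube of the numerator and is coprime to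
    it, hence is a unit. *)
Lemma cube_closed p q : P p -> P q -> q != 0 -> P ((p / q) ^+ 3) -> P (p / q).
Proof.
move=> Pp Pq q0 h.
have [d [u [v [Pu Pv e [p' Pp' ep] [q' Pq' eq]]]]] := bez Pp Pq.
have d0 : d != 0 by apply: contra_neq q0 => d0; rewrite eq d0 mulr0.
have q'0 : q' != 0 by apply: contra_neq q0 => d1; rewrite eq d1 mul0r.
have co : coprimeP P p' q'.
  exists u, v; split=> //; apply: (mulIf d0).
  by rewrite mul1r mulrDl -!mulrA -ep -eq -e.
have epq : p / q = p' / q' by rewrite ep eq; field; rewrite q'0.
rewrite epq in h *.
have dv : dvdP P (q' ^+ 3) (p' ^+ 3).
  by exists ((p' / q') ^+ 3) => //; rewrite expr_div_n divfK // expf_neq0.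
have co3 : coprimeP P (q' ^+ 3) (p' ^+ 3).
  apply: coprimePX => //; first exact: PX.
  by apply: coprimePC; apply: coprimePX.
have u3 : unitP P (q' ^+ 3) by apply: unit_coprime co3 dv; exact: PX.
have -> : p' / q' = p' * q' ^+ 2 * (q' ^+ 3)^-1 by field.
by apply: PM; [apply: PM => //; exact: PX | exact: unitP_inv].
Qed.

End Bezout.
End SubringPred.

(** The norm has values in [algC]; that they are natural numbers on [P] is what makes Euclid's
    algorithm terminate. *)
Lemma euclid_bezout (P : algC -> Prop) (nrm : algC -> algC) :
  subring_pred P -> (forall x, P x -> exists n : nat, nrm x = n%:R) ->
  (forall a b, P a -> P b -> b != 0 -> exists2 q, P q & nrm (a - q * b) < nrm b) ->
  bezoutP P.
Proof.
move=> rP nP eP a b Pa Pb; have [n en] := nP b Pb.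
elim/ltn_ind: n a b Pa Pb en => n IH a b Pa Pb en.
have [->|b0] := eqVneq b 0.
  exists a, 1, 0; split; [exact: P1|exact: P0|by rewrite mul1r mul0r addr0|exact: dvdPP|exact: dvdP0].
have [q Pq lt] := eP a b Pa Pb b0.
have Pr : P (a - q * b) by apply: PB => //; exact: PM.
have [m em] := nP _ Pr.
have ltmn : (m < n)%N by rewrite -(ltr_nat algC) -em -en.
have [d [u [v [Pu Pv e db dr]]]] := IH m ltmn b (a - q * b) Pb Pr em.
exists d, v, (u - v * q); split=> //.
- by apply: PB => //; exact: PM.
- by rewrite e; ring.
- have -> : a = (a - q * b) + q * b by ring.
  by apply: dvdPD => //; apply: dvdP_mull.
Qed.

(** * The ring of integers of the ninth cyclotomic field *)

Definition zeta : algC := sval (@C_prim_root_exists 9 isT).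
(** Locked, so that [omega] stays an atom beside [zeta]; [omegaZ] restores the link where it is
    wanted. *)
Definition omega : algC := locked (zeta ^+ 3).
(** On Q(zeta) this has order 3; as 4 is 1 modulo 3 it fixes [omega], so it generates the Galois
    group over Q(omega). *)
Definition tau : {rmorphism algC -> algC} := sval (@Qn_aut_exists 4 9 isT).

Lemma zeta_prim : 9.-primitive_root zeta.
Proof. exact: (svalP (@C_prim_root_exists 9 isT)). Qed.

Lemma zeta9 : zeta ^+ 9 = 1.
Proof. exact: prim_expr_order zeta_prim. Qed.

Lemma omegaZ : omega = zeta ^+ 3. Proof. by rewrite /omega -lock. Qed.
Lemma zeta3 : zeta ^+ 3 = omega. Proof. by rewrite omegaZ. Qed.

Lemma omega_neq1 : omega != 1.
Proof. by rewrite omegaZ -(prim_order_dvd zeta_prim). Qed.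

Lemma omega3 : omega ^+ 3 = 1.
Proof. by rewrite omegaZ -exprM zeta9. Qed.

Lemma omegaE : omega ^+ 2 = - 1 - omega.
Proof.
have h : (omega - 1) * (omega ^+ 2 + omega + 1) = 0.
  by transitivity (omega ^+ 3 - 1); [ring | rewrite omega3 subrr].
move/eqP: h; rewrite mulf_eq0 subr_eq0 (negbTE omega_neq1) /= => /eqP h.
by rewrite -[LHS]subr0 -h; ring.
Qed.

(** Turns an identity modulo [omega^2 + omega + 1] into one for [ring]: [c] is the cofactor of that
    polynomial in the difference of the two sides. The long polynomials passed to this lemma, to
    [zeta_red] and to [theta_red] are such cofactors. *)
Lemma omega_red a b c : a - b = (omega ^+ 2 + omega + 1) * c -> a = b.
Proof.
by move=> h; apply/eqP; rewrite -subr_eq0 h omegaE; apply/eqP; ring.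
Qed.

Lemma zeta_red a b c : a - b = (zeta ^+ 6 + zeta ^+ 3 + 1) * c -> a = b.
Proof. by move=> h; apply: (@omega_red _ _ c); rewrite h omegaZ; ring. Qed.

Lemma tau_root z : z ^+ 9 = 1 -> tau z = z ^+ 4.
Proof. exact: (svalP (@Qn_aut_exists 4 9 isT)). Qed.

Lemma tau_zeta : tau zeta = omega * zeta.
Proof. by rewrite (tau_root zeta9) exprSr zeta3. Qed.

Lemma tau_omega : tau omega = omega.
Proof.
by rewrite omegaZ rmorphXn /= tau_zeta exprMn zeta3 omega3 mul1r.
Qed.

Lemma zeta_neq0 : zeta != 0.
Proof. by apply/eqP => h; move: zeta9; rewrite h expr0n => /eqP; rewrite eq_sym oner_eq0. Qed.
Lemma omega_neq0 : omega != 0.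
Proof. by rewrite omegaZ expf_neq0 // zeta_neq0. Qed.

Lemma conj_zeta : zeta^* = omega ^+ 2 * zeta ^+ 2.
Proof.
have n1 : `|zeta| = 1.
  by apply/eqP; rewrite -(pexpr_eq1 (n:=9)) // -normrX zeta9 normr1.
have -> : zeta^* = zeta^-1.
  by apply: (mulfI zeta_neq0); rewrite mulfV ?zeta_neq0 // -normCK n1 expr1n.
apply: (mulfI zeta_neq0); rewrite mulfV ?zeta_neq0 //.
by transitivity (zeta ^+ 9); [rewrite zeta9 | rewrite omegaZ; ring].
Qed.

Lemma conj_omega : omega^* = omega ^+ 2.
Proof.
rewrite {1}omegaZ rmorphXn /= conj_zeta.
transitivity ((omega ^+ 3) ^+ 2 * (zeta ^+ 3) ^+ 2); first by ring.
by rewrite omega3 zeta3 expr1n mul1r.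
Qed.

Definition inZw (x : algC) : Prop :=
  exists a b : int, x = a%:~R + b%:~R * omega.

(** Z[zeta] as the module over Z[omega] with basis [1], [zeta], [zeta^2], on which [tau] acts
    diagonally. *)
Definition inS (x : algC) : Prop :=
  exists x0 x1 x2, [/\ inZw x0, inZw x1, inZw x2 & x = x0 + x1 * zeta + x2 * zeta ^+ 2].

Lemma inZw_ring : subring_pred inZw.
Proof.
split.
- by exists 1, 0; rewrite mul0r addr0.
- move=> _ _ [a [b ->]] [c [d ->]]; exists (a - c), (b - d).
  by rewrite !rmorphB /=; ring.
- move=> _ _ [a [b ->]] [c [d ->]]; exists (a * c - b * d), (a * d + b * c - b * d).
  rewrite !(rmorphB, rmorphD, rmorphM) /=.
  transitivity (a%:~R * c%:~R + (a%:~R * d%:~R + b%:~R * c%:~R) * omega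
    + b%:~R * d%:~R * omega ^+ 2); first by ring.
  by rewrite omegaE; ring.
Qed.

Lemma inZw_omega : inZw omega.
Proof. by exists 0, 1; rewrite add0r mul1r. Qed.
Lemma inZw_int (n : int) : inZw n%:~R. Proof. exact: (Pint inZw_ring). Qed.
Lemma inZw_nat (n : nat) : inZw n%:R. Proof. exact: (Pnat inZw_ring). Qed.

Ltac pE := repeat first [assumption | exact: inZw_int | exact: inZw_nat | exact: inZw_omega
  | exact: (P1 inZw_ring) | exact: (P0 inZw_ring)
  | apply: (PX inZw_ring) | apply: (PM inZw_ring) | apply: (PB inZw_ring)
  | apply: (PN inZw_ring) | apply: (PD inZw_ring)].

Lemma inES x : inZw x -> inS x.
Proof. by move=> Ex; exists x, 0, 0; split=> //; [exact: inZw_nat 0 | exact: inZw_nat 0 | rewrite !mul0r !addr0]. Qed.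

Lemma inS_ring : subring_pred inS.
Proof.
split.
- by apply: inES; pE.
- move=> _ _ [x0 [x1 [x2 [e0 e1 e2 ->]]]] [y0 [y1 [y2 [f0 f1 f2 ->]]]].
  by exists (x0 - y0), (x1 - y1), (x2 - y2); split; pE; ring.
- move=> _ _ [x0 [x1 [x2 [e0 e1 e2 ->]]]] [y0 [y1 [y2 [f0 f1 f2 ->]]]].
  exists (x0 * y0 + omega * (x1 * y2 + x2 * y1)), (x0 * y1 + x1 * y0 + omega * (x2 * y2)),
    (x0 * y2 + x1 * y1 + x2 * y0); split; pE.
  by rewrite omegaZ; ring.
Qed.

Lemma inS_zeta : inS zeta.
Proof. by exists 0, 1, 0; split; pE; rewrite mul1r mul0r add0r addr0. Qed.
Lemma inS_omega : inS omega. Proof. by apply: inES; pE. Qed.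
Lemma inS_int (n : int) : inS n%:~R. Proof. exact: (Pint inS_ring). Qed.
Lemma inS_nat (n : nat) : inS n%:R. Proof. exact: (Pnat inS_ring). Qed.

Lemma conj_inZw x : inZw x -> inZw x^*.
Proof.
move=> [a [b ->]]; rewrite rmorphD rmorphM /= !rmorph_int conj_omega.
by pE.
Qed.

Lemma conjE x0 x1 x2 : (x0 + x1 * zeta + x2 * zeta ^+ 2)^*
  = x0^* + omega ^+ 2 * x2^* * zeta + omega ^+ 2 * x1^* * zeta ^+ 2.
Proof.
rewrite !(rmorphD, rmorphM, rmorphXn) /= conj_zeta.
apply: (@zeta_red _ _ (x2^* *zeta^+10 - x2^* *zeta^+7)).
by rewrite omegaZ; ring.
Qed.

Lemma conj_inS x : inS x -> inS x^*.
Proof.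
move=> [x0 [x1 [x2 [e0 e1 e2 ->]]]].
exists x0^*, (omega ^+ 2 * x2^*), (omega ^+ 2 * x1^*).
by split; try (by pE; exact: conj_inZw); rewrite conjE.
Qed.

Lemma tau_inZw x : inZw x -> tau x = x.
Proof. by move=> [a [b ->]]; rewrite rmorphD rmorphM /= !rmorph_int tau_omega. Qed.

Lemma tauE x0 x1 x2 : inZw x0 -> inZw x1 -> inZw x2 ->
  tau (x0 + x1 * zeta + x2 * zeta ^+ 2)
  = x0 + omega * x1 * zeta + omega ^+ 2 * x2 * zeta ^+ 2.
Proof.
move=> e0 e1 e2; rewrite !(rmorphD, rmorphM, rmorphXn) /= tau_zeta !tau_inZw //.
by ring.
Qed.

Lemma tau_inS x : inS x -> inS (tau x).
Proof.
move=> [x0 [x1 [x2 [e0 e1 e2 ->]]]]; rewrite tauE //.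
by exists x0, (omega * x1), (omega ^+ 2 * x2); split; pE.
Qed.

Lemma tau2E x0 x1 x2 : inZw x0 -> inZw x1 -> inZw x2 ->
  tau (tau (x0 + x1 * zeta + x2 * zeta ^+ 2))
  = x0 + omega ^+ 2 * x1 * zeta + omega * x2 * zeta ^+ 2.
Proof.
move=> e0 e1 e2; rewrite tauE // tauE //; try by pE.
have o4 : omega ^+ 4 = omega by rewrite (exprD _ 3 1) omega3 mul1r.
transitivity (x0 + omega ^+ 2 * x1 * zeta + omega ^+ 4 * x2 * zeta ^+ 2); first by ring.
by rewrite o4.
Qed.

Lemma tau3 x : inS x -> tau (tau (tau x)) = x.
Proof.
move=> [x0 [x1 [x2 [e0 e1 e2 ->]]]]; rewrite tauE // tau2E //; try by pE.
have o4 : omega ^+ 3 = 1 by exact: omega3.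
transitivity (x0 + omega ^+ 3 * x1 * zeta + omega ^+ 3 * x2 * zeta ^+ 2); first by ring.
by rewrite o4 !mul1r.
Qed.

Lemma tau_conj x : inS x -> tau x^* = (tau x)^*.
Proof.
move=> [x0 [x1 [x2 [e0 e1 e2 ->]]]]; rewrite conjE !tauE ?conjE //; try by pE; exact: conj_inZw.
rewrite !(rmorphM, rmorphXn) /= conj_omega.
transitivity (x0^* + omega ^+ 3 * x2^* * zeta + omega ^+ 4 * x1^* * zeta ^+ 2); first by ring.
transitivity (x0^* + omega ^+ 3 * omega ^+ 3 * x2^* * zeta + omega ^+ 4 * x1^* * zeta ^+ 2).
  by rewrite omega3 !mul1r.
by ring.
Qed.

(** * Relative trace and norm down to Z[omega] *)

Definition trM (x : algC) := x + tau x + tau (tau x).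
Definition NM (x : algC) := x * tau x * tau (tau x).

Lemma trME x0 x1 x2 : inZw x0 -> inZw x1 -> inZw x2 ->
  trM (x0 + x1 * zeta + x2 * zeta ^+ 2) = 3 * x0.
Proof.
move=> e0 e1 e2; rewrite /trM tau2E // tauE //.
transitivity (3 * x0 + (omega ^+ 2 + omega + 1) * (x1 * zeta + x2 * zeta ^+ 2)).
  by ring.
by rewrite omegaE; ring.
Qed.

(** The factorization of [a^3 + b^3 + c^3 - 3 a b c] by cube roots of unity. *)
Lemma prod3E x0 y1 y2 :
  (x0 + y1 + y2) * (x0 + omega * y1 + omega ^+ 2 * y2) * (x0 + omega ^+ 2 * y1 + omega * y2)
  = x0 ^+ 3 + y1 ^+ 3 + y2 ^+ 3 - 3 * x0 * y1 * y2.
Proof.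
apply: (@omega_red _ _ (- omega*x0*y1*y2 + omega*x0*y1^+2 + omega*x0*y2^+2 + omega*y1^+3
  + omega*y2^+3 + omega^+2*x0*y1*y2 + omega^+2*y1*y2^+2 + omega^+2*y1^+2*y2 + 3*x0*y1*y2
  + x0^+2*y1 + x0^+2*y2 - y1^+3 - y2^+3)).
ring.
Qed.

Lemma NME x0 x1 x2 : inZw x0 -> inZw x1 -> inZw x2 ->
  NM (x0 + x1 * zeta + x2 * zeta ^+ 2)
  = x0 ^+ 3 + omega * x1 ^+ 3 + omega ^+ 2 * x2 ^+ 3 - 3 * omega * x0 * x1 * x2.
Proof.
move=> e0 e1 e2; rewrite /NM tau2E // tauE // -![omega * x1 * _]mulrA -![omega ^+ 2 * x2 * _]mulrA.
rewrite -![omega ^+ 2 * x1 * _]mulrA -![omega * x2 * _]mulrA prod3E.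
by rewrite omegaZ; ring.
Qed.

Lemma NM_inZw x : inS x -> inZw (NM x).
Proof. by move=> [x0 [x1 [x2 [e0 e1 e2 ->]]]]; rewrite NME //; pE. Qed.

Lemma NMM x y : NM (x * y) = NM x * NM y.
Proof. by rewrite /NM !rmorphM /=; ring. Qed.

Lemma normE a b : `|a%:~R + b%:~R * omega| ^+ 2 = (a ^+ 2 - a * b + b ^+ 2)%:~R :> algC.
Proof.
rewrite normCK rmorphD rmorphM /= !rmorph_int conj_omega.
rewrite !(rmorphD, rmorphN, rmorphM, rmorphXn) /=.
have -> : (a%:~R + b%:~R * omega) * (a%:~R + b%:~R * omega ^+ 2)
  = a%:~R ^+ 2 + a%:~R * b%:~R * (omega ^+ 2 + omega) + b%:~R ^+ 2 * omega ^+ 3 :> algC by ring.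
by rewrite omega3 omegaE; ring.
Qed.

Lemma Eint_nat (a b : int) : exists n : nat, a ^+ 2 - a * b + b ^+ 2 = n%:Z.
Proof.
have h : 0 <= a ^+ 2 - a * b + b ^+ 2 by nia.
by exists (absz (a ^+ 2 - a * b + b ^+ 2)); rewrite gez0_abs.
Qed.

Lemma normE_nat x : inZw x -> exists n : nat, `|x| ^+ 2 = n%:R.
Proof.
move=> [a [b ->]]; rewrite normE; have [n ->] := Eint_nat a b.
by exists n.
Qed.

Lemma normM_nat x : inS x -> exists n : nat, `|NM x| ^+ 2 = n%:R.
Proof. by move/NM_inZw; exact: normE_nat. Qed.

Lemma tau_eq0 x : (tau x == 0) = (x == 0).
Proof. exact: fmorph_eq0. Qed.
Lemma NM_eq0 x : (NM x == 0) = (x == 0).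
Proof. by rewrite /NM !mulf_eq0 !tau_eq0 !orbb. Qed.

(** The inequality of arithmetic and geometric means for the three conjugates over Q(omega); with
    [sum_norm] it bounds the norm by the sizes of the coordinates. *)
Lemma amgm_NM x : inS x ->
  27 * `|NM x| ^+ 2 <= (`|x| ^+ 2 + `|tau x| ^+ 2 + `|tau (tau x)| ^+ 2) ^+ 3.
Proof.
move=> _; rewrite /NM !normrM !exprMn.
move: (normr_ge0 x) (normr_ge0 (tau x)) (normr_ge0 (tau (tau x))).
move: `|x| `|tau x| `|tau (tau x)| => a b c ha hb hc.
have := leif_AGM_scaled (I := 'I_3) (A := predT)
  (E := fun i => nth 0 [:: a ^+ 2; b ^+ 2; c ^+ 2] i).
rewrite cardT size_enum_ord !big_ord_recl !big_ord0 /=.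
case.
  by case=> [] [|[|[|//]]] hi _ /=; rewrite mulrn_wge0 // exprn_ge0.
rewrite !big_ord_recl !big_ord0 /= !mulr1 !addr0 => h _.
rewrite -addrA; apply: le_trans h; rewrite le_eqVlt; apply/orP; left; apply/eqP.
by rewrite mulr_natl !mulrnAl !mulrnAr -!mulrnA !mulrA.
Qed.

(** The basis [1], [zeta], [zeta^2] is orthogonal for the trace form, so rounding can be done
    coordinate by coordinate. *)
Lemma sum_norm x0 x1 x2 (x := x0 + x1 * zeta + x2 * zeta ^+ 2) :
  inZw x0 -> inZw x1 -> inZw x2 ->
  `|x| ^+ 2 + `|tau x| ^+ 2 + `|tau (tau x)| ^+ 2
  = 3 * (`|x0| ^+ 2 + `|x1| ^+ 2 + `|x2| ^+ 2).
Proof.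
move=> e0 e1 e2; rewrite /x tau2E // tauE // !normCK.
rewrite !(rmorphD, rmorphM, rmorphXn) /= conj_omega.
have nz : zeta * zeta^* = 1.
  by rewrite conj_zeta; transitivity (zeta ^+ 9); [rewrite omegaZ; ring | exact: zeta9].
move: nz; move: zeta^* x0^* x1^* x2^* => zb y0 y1 y2 nz.
transitivity (3 * (x0 * y0 + x1 * y1 * (zeta * zb) + x2 * y2 * (zeta * zb) ^+ 2)); last first.
  by rewrite nz expr1n !mulr1.
pose a := x1 * zeta; pose b := x2 * zeta ^+ 2; pose c := y1 * zb; pose d := y2 * zb ^+ 2.
apply: (@omega_red _ _ (- 2*a*c + 2*a*c*omega - a*c*omega^+3 + a*c*omega^+4 + a*d - a*d*omega + a*d*omega^+3 + a*y0 + b*c - b*c*omega + b*c*omega^+3 - 2*b*d + 2*b*d*omega - b*d*omega^+3 + b*d*omega^+4 + b*y0 - c*omega*x0 + c*omega^+2*x0 + c*x0 - d*omega*x0 + d*omega^+2*x0 + d*x0)).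
by rewrite /a /b /c /d; ring.
Qed.

Ltac pS := repeat first [assumption | exact: inS_int | exact: inS_nat | exact: inS_omega
  | exact: inS_zeta | exact: (P1 inS_ring) | exact: (P0 inS_ring) | apply: conj_inS | apply: tau_inS
  | apply: (PX inS_ring) | apply: (PM inS_ring) | apply: (PB inS_ring)
  | apply: (PN inS_ring) | apply: (PD inS_ring)].

(** Up to a factor [omega], each coordinate is a third of the trace of the element times a power of
    [zeta]. *)
Lemma coordS0 x0 x1 x2 : inZw x0 -> inZw x1 -> inZw x2 ->
  x0 + x1 * zeta + x2 * zeta ^+ 2 = 0 -> [/\ x0 = 0, x1 = 0 & x2 = 0].
Proof.
move=> e0 e1 e2 h.
have tr0 : trM 0 = 0 by rewrite /trM !rmorph0 !addr0.
have z3 : forall u : algC, 3 * u = 0 -> u = 0.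
  by move=> u /eqP; rewrite mulf_eq0 pnatr_eq0 => /eqP.
have om : forall u : algC, u * omega = 0 -> u = 0.
  by move=> u /eqP; rewrite mulf_eq0 (negbTE omega_neq0) orbF => /eqP.
split.
- by apply: z3; rewrite -(trME e0 e1 e2) h tr0.
- apply: om; apply: z3.
  have a1 : inZw (x1 * omega) by pE.
  have a2 : inZw (x2 * omega) by pE.
  rewrite -(trME a1 a2 e0).
  have -> : x1 * omega + x2 * omega * zeta + x0 * zeta ^+ 2
    = (x0 + x1 * zeta + x2 * zeta ^+ 2) * zeta ^+ 2 by rewrite omegaZ; ring.
  by rewrite h mul0r tr0.
- apply: om; apply: z3.
  have a2 : inZw (x2 * omega) by pE.
  rewrite -(trME a2 e0 e1).
  have -> : x2 * omega + x0 * zeta + x1 * zeta ^+ 2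
    = (x0 + x1 * zeta + x2 * zeta ^+ 2) * zeta by rewrite omegaZ; ring.
  by rewrite h mul0r tr0.
Qed.

Lemma coordS x0 x1 x2 y0 y1 y2 :
  inZw x0 -> inZw x1 -> inZw x2 -> inZw y0 -> inZw y1 -> inZw y2 ->
  x0 + x1 * zeta + x2 * zeta ^+ 2 = y0 + y1 * zeta + y2 * zeta ^+ 2 ->
  [/\ x0 = y0, x1 = y1 & x2 = y2].
Proof.
move=> e0 e1 e2 f0 f1 f2 h.
have [] := @coordS0 (x0 - y0) (x1 - y1) (x2 - y2) _ _ _ _; try by pE.
  have -> : x0 - y0 + (x1 - y1) * zeta + (x2 - y2) * zeta ^+ 2
    = (x0 + x1 * zeta + x2 * zeta ^+ 2) - (y0 + y1 * zeta + y2 * zeta ^+ 2) by ring.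
  by rewrite h subrr.
by move=> h0 h1 h2; split; apply/eqP; rewrite -subr_eq0 ?h0 ?h1 ?h2.
Qed.

Lemma hex_eq0 (p q : int) : p ^+ 2 - p * q + q ^+ 2 = 0 -> p = 0 /\ q = 0.
Proof.
move=> h.
have h1 : (2 * p - q) ^+ 2 + 3 * q ^+ 2 = 0.
  by transitivity (4 * (p ^+ 2 - p * q + q ^+ 2)); [ring | rewrite h mulr0].
have q0 : q ^+ 2 = 0 by have := sqr_ge0 (2 * p - q); have := sqr_ge0 q; lia.
have p0 : (2 * p - q) ^+ 2 = 0 by lia.
by move/eqP: q0 p0; rewrite sqrf_eq0 => /eqP -> /eqP; rewrite sqrf_eq0 => /eqP; lia.
Qed.

Lemma coordE a b c d : a%:~R + b%:~R * omega = c%:~R + d%:~R * omega :> algC -> a = c /\ b = d.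
Proof.
move=> h.
have : `|(a - c)%:~R + (b - d)%:~R * omega : algC| ^+ 2 = 0.
  have -> : (a - c)%:~R + (b - d)%:~R * omega =
    (a%:~R + b%:~R * omega) - (c%:~R + d%:~R * omega) :> algC by rewrite !rmorphB /=; ring.
  by rewrite h subrr normr0 expr0n.
by rewrite normE => /eqP; rewrite intr_eq0 => /eqP /hex_eq0; lia.
Qed.

(** * The real cubic ring, generated by [theta], which is [zeta + zeta^-1] *)

Definition theta : algC := zeta + omega ^+ 2 * zeta ^+ 2.

Definition inK (x : algC) : Prop := inS x /\ x^* = x.

Lemma inK_ring : subring_pred inK.
Proof.
split.
- by split; [pS | rewrite rmorph1].
- by move=> x y [Sx ex] [Sy ey]; split; [pS | rewrite rmorphB /= ex ey].
- by move=> x y [Sx ex] [Sy ey]; split; [pS | rewrite rmorphM /= ex ey].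
Qed.

Lemma inKS x : inK x -> inS x. Proof. by case. Qed.
Lemma inK_int (n : int) : inK n%:~R. Proof. exact: (Pint inK_ring). Qed.
Lemma inK_nat (n : nat) : inK n%:R. Proof. exact: (Pnat inK_ring). Qed.
Lemma inK_tau x : inK x -> inK (tau x).
Proof. by move=> [Sx ex]; split; [pS | rewrite -tau_conj // ex]. Qed.
Lemma inK_norm x : inS x -> inK (x * x^*).
Proof. by move=> Sx; split; [pS | rewrite rmorphM /= conjCK mulrC]. Qed.

Lemma inK_theta : inK theta.
Proof.
split; first by rewrite /theta; pS.
have -> : theta = 0 + 1 * zeta + omega ^+ 2 * zeta ^+ 2 by rewrite /theta; ring.
rewrite conjE rmorph0 rmorph1 rmorphXn /= conj_omega.
apply: (@omega_red _ _ (omega^+4*zeta - omega^+3*zeta+omega*zeta-zeta)).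
by ring.
Qed.

Ltac pK := repeat first [assumption | exact: inK_int | exact: inK_nat | exact: inK_theta
  | exact: (P1 inK_ring) | exact: (P0 inK_ring) | apply: inK_tau
  | apply: (PX inK_ring) | apply: (PM inK_ring) | apply: (PB inK_ring)
  | apply: (PN inK_ring) | apply: (PD inK_ring)].

Lemma thetaE : theta ^+ 3 = 3 * theta - 1.
Proof.
apply: (@zeta_red _ _ (- 3*zeta + 3*zeta^+11 - zeta^+15 + zeta^+18 + 3*zeta^+4 - zeta^+6
  - 3*zeta^+8 + zeta^+9 + 1)).
by rewrite /theta omegaZ; ring.
Qed.

Lemma tau_theta : tau theta = omega * zeta + omega * zeta ^+ 2.
Proof.
have -> : theta = 0 + 1 * zeta + omega ^+ 2 * zeta ^+ 2 by rewrite /theta; ring.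
rewrite tauE; try by pE.
by apply: (@omega_red _ _ ((omega ^+ 2 - omega) * zeta ^+ 2)); ring.
Qed.

(** Invariance under conjugation makes [x0] a rational integer and determines [x2] by [x1]; the two
    coordinates of [x1] in Z[omega] become those on [theta] and [tau theta]. *)
Lemma K_coord x : inK x -> exists a b c : int, x = a%:~R + b%:~R * theta + c%:~R * tau theta.
Proof.
move=> [[x0 [x1 [x2 [e0 e1 e2 ex]]]] rx].
have h : x0^* + omega ^+ 2 * x2^* * zeta + omega ^+ 2 * x1^* * zeta ^+ 2
  = x0 + x1 * zeta + x2 * zeta ^+ 2 by rewrite -conjE -ex rx.
have c0 := conj_inZw e0; have c1 := conj_inZw e1; have c2 := conj_inZw e2.
have [h0 h1 h2] : [/\ x0^* = x0, omega ^+ 2 * x2^* = x1 & omega ^+ 2 * x1^* = x2].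
  by apply: coordS h; pE.
case: e0 h0 => a [b ea] h0; case: e1 h2 => p [q e1'] h2.
have b0 : b = 0.
  move: h0; rewrite ea rmorphD rmorphM /= !rmorph_int conj_omega omegaE.
  have -> : a%:~R + b%:~R * (- 1 - omega) = (a - b)%:~R + (- b)%:~R * omega :> algC.
    by rewrite rmorphB rmorphN /=; ring.
  by move/coordE => []; lia.
exists a, p, q; rewrite ex -h2 e1' ea b0 /theta tau_theta rmorphD rmorphM /= !rmorph_int conj_omega.
apply: (@omega_red _ _ ((omega ^+ 2 - omega) * q%:~R * zeta ^+ 2)).
by ring.
Qed.

(** * Division with remainder by rounding to a nearby lattice point *)

Lemma hex_round (p q m : int) : 0 < m -> exists a b : int,
  let p' := p - a * m in let q' := q - b * m in
  [/\ -m <= 2 * p' - q' <= m, - m <= 2 * q' - p' <= m & -m <= p' + q' <= m].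
Proof.
move=> m0; have [n en] := Eint_nat p q.
elim/ltn_ind: n p q en => n IH p q en.
(* Whenever one of the six inequalities fails, subtracting [m] times a suitable unit of Z[omega]
   lowers the norm; the process ends in the Voronoi hexagon of the lattice [m Z[omega]]. *)
have step : forall s t : int, (p - s * m) ^+ 2 - (p - s * m) * (q - t * m) + (q - t * m) ^+ 2 < n%:Z ->
    exists a b : int, let p' := p - a * m in let q' := q - b * m in
  [/\ -m <= 2 * p' - q' <= m, - m <= 2 * q' - p' <= m & -m <= p' + q' <= m].
  move=> s t lt; have [k ek] := Eint_nat (p - s * m) (q - t * m).
  have ltk : (k < n)%N by move: lt; rewrite ek.
  have [a [b h]] := IH k ltk _ _ ek.
  exists (a + s), (b + t).
  by move: h => /=; rewrite !mulrDl [a * m + _]addrC [b * m + _]addrC !opprD !addrA.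
have [h1|h1] := ltP m (2 * p - q); first by apply: (step 1 0); rewrite -en; nia.
have [h2|h2] := ltP (2 * p - q) (- m); first by apply: (step (-1) 0); rewrite -en; nia.
have [h3|h3] := ltP m (2 * q - p); first by apply: (step 0 1); rewrite -en; nia.
have [h4|h4] := ltP (2 * q - p) (- m); first by apply: (step 0 (-1)); rewrite -en; nia.
have [h5|h5] := ltP m (p + q); first by apply: (step 1 1); rewrite -en; nia.
have [h6|h6] := ltP (p + q) (- m); first by apply: (step (-1) (-1)); rewrite -en; nia.
exists 0, 0 => /=; rewrite !mul0r !subr0; split; apply/andP; split; lia.
Qed.

(** In the coordinates [A], [B] three times the norm is [A^2 + A B + B^2], and the hexagon is given
    by [|A|], [|B|], [|A + B| <= m]. The bound is attained exactly at the vertices, where one of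
    these three forms vanishes. *)
Lemma hex_bound (p q m : int) : -m <= 2 * p - q <= m -> - m <= 2 * q - p <= m -> -m <= p + q <= m ->
  3 * (p ^+ 2 - p * q + q ^+ 2) <= m ^+ 2 /\
  (3 * (p ^+ 2 - p * q + q ^+ 2) = m ^+ 2 ->
   [\/ (2 * p - q) = 0, (2 * q - p) = 0 | p + q = 0]).
Proof.
pose A := 2 * p - q; pose B := 2 * q - p.
have eF : 3 * (p ^+ 2 - p * q + q ^+ 2) = A ^+ 2 + A * B + B ^+ 2 by rewrite /A /B; ring.
have eAB : p + q = A + B by rewrite /A /B; ring.
rewrite eF eAB -/A -/B; move: A B {eF eAB} => A B /andP[a1 a2] /andP[b1 b2] /andP[c1 c2].
have key : A ^+ 2 + A * B + B ^+ 2 <= m ^+ 2.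
  have [hA|hA] := lerP 0 A; have [hB|hB] := lerP 0 B; nia.
split=> // e.
have [->|nA] := eqVneq A 0; first by constructor 1.
have [->|nB] := eqVneq B 0; first by constructor 2.
have [->|nC] := eqVneq (A + B) 0; first by constructor 3.
exfalso; have [hA|hA] := lerP 0 A; have [hB|hB] := lerP 0 B; nia.
Qed.

Definition rt3 : algC := omega - omega ^+ 2.

Lemma rt3_sq : rt3 ^+ 2 = - 3.
Proof. by rewrite /rt3; apply: (@omega_red _ _ (omega ^+ 2 - 3 * omega + 3)); ring. Qed.

(* Either [3|r|^2 < m^2], or [r] is a vertex of the hexagonal Voronoi cell and
   then [9 r^3 = +- m^3 rt3]. *)
Lemma E_round (x : algC) (m : nat) : (0 < m)%N -> inZw x -> exists2 q, inZw q &
  [/\ inZw (x - m%:R * q), 3 * `|x - m%:R * q| ^+ 2 <= m%:R ^+ 2 &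
   3 * `|x - m%:R * q| ^+ 2 = m%:R ^+ 2 ->
   exists s : bool, 9 * (x - m%:R * q) ^+ 3 = (-1) ^+ s * m%:R ^+ 3 * rt3].
Proof.
move=> m0 [p [q ->]].
have [//|a [b /= [h1 h2 h3]]] := @hex_round p q m.
exists (a%:~R + b%:~R * omega); first by pE.
have [le eq] := hex_bound h1 h2 h3.
have -> : p%:~R + q%:~R * omega - m%:R * (a%:~R + b%:~R * omega)
  = (p - a * m%:Z)%:~R + (q - b * m%:Z)%:~R * omega :> algC.
  by rewrite !rmorphB !rmorphM /= !pmulrn; ring.
move: (p - _) (q - _) h1 h2 h3 le eq => {}p {}q h1 h2 h3 le eq.
have cast : 3 * (p ^+ 2 - p * q + q ^+ 2)%:~R = (3 * (p ^+ 2 - p * q + q ^+ 2))%:~R :> algC.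
  by rewrite [in RHS]rmorphM.
have castm : m%:R ^+ 2 = (m%:Z ^+ 2)%:~R :> algC by rewrite rmorphXn /= pmulrn.
rewrite normE cast castm; split; first by pE.
  by rewrite ler_int.
move/eqP; rewrite eqr_int => /eqP {}eq0.
have mq : forall u : int, u ^+ 2 = m%:Z ^+ 2 -> exists s : bool, u = (-1) ^+ s * m%:Z.
  move=> u /eqP; rewrite eqf_sqr => /orP[] /eqP ->.
    by exists false; rewrite mul1r.
  by exists true; rewrite mulN1r.
have sg : forall s : bool, ((-1) ^+ s) ^+ 3 = (-1) ^+ s :> algC by case; rewrite ?expr1n //; ring.
have fin : forall u v : int, forall w : algC, 3 * u = v ->
    3 * (p ^+ 2 - p * q + q ^+ 2) = v ^+ 2 -> 9 * w ^+ 3 = 27 * u%:~R ^+ 3 * rt3 ->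
    exists s : bool, 9 * w ^+ 3 = (-1) ^+ s * m%:R ^+ 3 * rt3.
  move=> u v w ux hx hw; have [s es] : exists s : bool, v = (-1) ^+ s * m%:Z.
    by apply: mq; rewrite -eq0 hx.
  exists s; rewrite -sg -exprMn.
  have -> : (-1) ^+ s * m%:R = 3 * u%:~R :> algC.
    have -> : m%:R = m%:~R :> algC by rewrite pmulrn.
    have -> : (-1) ^+ s = ((-1) ^+ s)%:~R :> algC by rewrite rmorphXn rmorphN1.
    by rewrite -rmorphM /= -es -ux rmorphM.
  by rewrite hw; ring.
case: (eq eq0) => e.
- have q2 : q = 2 * p by lia.
  apply: (fin (- p) (- 3 * p)); [by ring | by rewrite q2; ring |].
  rewrite q2 rmorphM rmorphN /= /rt3.
  apply: (@omega_red _ _ (72*omega * p%:~R ^+ 3 + 9 * p%:~R ^+ 3)).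
  by ring.
- have p2 : p = 2 * q by lia.
  apply: (fin q (3 * q)); [by ring | by rewrite p2; ring |].
  rewrite p2 rmorphM /= /rt3.
  apply: (@omega_red _ _ (9*omega * q%:~R ^+ 3 + 72 * q%:~R ^+ 3)).
  by ring.
- have q2 : q = - p by lia.
  apply: (fin (- p) (- 3 * p)); [by ring | by rewrite q2; ring |].
  rewrite q2 !rmorphN /= /rt3.
  apply: (@omega_red _ _ (- 9*omega * p%:~R ^+ 3 + 9 * p%:~R ^+ 3)).
  by ring.
Qed.

Lemma bezE : bezoutP inZw.
Proof.
apply: (@euclid_bezout inZw (fun x => `|x| ^+ 2)); [exact: inZw_ring | exact: normE_nat |].
move=> a b Ea Eb b0.
have [m em] := normE_nat Eb.
have m0 : (0 < m)%N.
  by rewrite lt0n; apply: contra_neq b0 => m0; apply/eqP; rewrite -normr_eq0 -sqrf_eq0 em m0.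
have Es : inZw (a * b^*) by pE; exact: conj_inZw.
have [q Eq [_ le _]] := E_round m0 Es.
exists q => //.
have eb : b * b^* = m%:R by rewrite -normCK.
have mm : (a - q * b) * b^* = a * b^* - m%:R * q by rewrite -eb; ring.
have m0' : 0 < m%:R :> algC by rewrite ltr0n.
have : 3 * `|a - q * b| ^+ 2 * m%:R <= m%:R ^+ 2.
  have -> : 3 * `|a - q * b| ^+ 2 * m%:R = 3 * `|a * b^* - m%:R * q| ^+ 2.
    by rewrite -mm normrM norm_conjC exprMn em; ring.
  by [].
rewrite expr2 ler_pM2r // => h; rewrite em.
have h' : `|a - q * b| ^+ 2 <= m%:R / 3 by rewrite ler_pdivlMr ?ltr0n // mulrC.
by apply: le_lt_trans h' _; rewrite ltr_pdivrMr ?ltr0n // ltr_pMr // (ltr_nat _ 1 3).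
Qed.

(** This is [|3 a - 2 b|^2 >= 0]. The weights suit the ratio 2 : 3 of the bounds on [|a|] and [|b|]
    in the borderline case of [S_round]. *)
Lemma norm_add_weighted (a b : algC) :
  6 * `|a + b| ^+ 2 <= 15 * `|a| ^+ 2 + 10 * `|b| ^+ 2.
Proof.
have h := exprn_ge0 2 (normr_ge0 (3 * a - 2 * b)).
have c1 : (3 * a - 2 * b)^* = 3 * a^* - 2 * b^*.
  by rewrite rmorphB /= !(rmorphM _ _%:R) /= !rmorph_nat.
have c2 : (a + b)^* = a^* + b^* by exact: rmorphD.
rewrite -subr_ge0; move: h; rewrite !normCK c1 c2.
by congr (0 <= _); ring.
Qed.

Lemma NM_nat (n : nat) : NM n%:R = n%:R ^+ 3.
Proof. by rewrite /NM !rmorph_nat; ring. Qed.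

(** Rounding each coordinate to within [m^2 / 3] and taking means gives only a weak inequality. It
    is strict unless all three remainders are vertices of the hexagon; there their cubes are known
    up to sign, and the norm form itself is estimated. *)
Lemma S_round x (m : nat) : (0 < m)%N -> inS x -> exists2 q, inS q &
  `|NM (x - m%:R * q)| ^+ 2 < m%:R ^+ 6.
Proof.
move=> m0 [x0 [x1 [x2 [e0 e1 e2 ->]]]].
have [q0 f0 [r0 le0 eq0]] := E_round m0 e0.
have [q1 f1 [r1 le1 eq1]] := E_round m0 e1.
have [q2 f2 [r2 le2 eq2]] := E_round m0 e2.
exists (q0 + q1 * zeta + q2 * zeta ^+ 2); first by exists q0, q1, q2.
have -> : x0 + x1 * zeta + x2 * zeta ^+ 2 - m%:R * (q0 + q1 * zeta + q2 * zeta ^+ 2)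
  = (x0 - m%:R * q0) + (x1 - m%:R * q1) * zeta + (x2 - m%:R * q2) * zeta ^+ 2 by ring.
move: (x0 - _) (x1 - _) (x2 - _) r0 r1 r2 le0 le1 le2 eq0 eq1 eq2 => y0 y1 y2 r0 r1 r2 le0 le1 le2 eq0 eq1 eq2.
have Sy : inS (y0 + y1 * zeta + y2 * zeta ^+ 2) by exists y0, y1, y2.
have ag := amgm_NM Sy; rewrite sum_norm // in ag.
have M0 : 0 < m%:R ^+ 2 :> algC by rewrite exprn_gt0 // ltr0n.
have n0 := exprn_ge0 2 (normr_ge0 y0).
have n1 := exprn_ge0 2 (normr_ge0 y1).
have n2 := exprn_ge0 2 (normr_ge0 y2).
have sum_le : 3 * (`|y0| ^+ 2 + `|y1| ^+ 2 + `|y2| ^+ 2) <= 3 * m%:R ^+ 2.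
  rewrite !mulrDr; have -> : 3 * m%:R ^+ 2 = m%:R ^+ 2 + m%:R ^+ 2 + m%:R ^+ 2 :> algC by ring.
  by rewrite !lerD.
have e6 : 27 * m%:R ^+ 6 = (3 * m%:R ^+ 2) ^+ 3 :> algC by ring.
have fromlt : 3 * (`|y0| ^+ 2 + `|y1| ^+ 2 + `|y2| ^+ 2) < 3 * m%:R ^+ 2 ->
   `|NM (y0 + y1 * zeta + y2 * zeta ^+ 2)| ^+ 2 < m%:R ^+ 6.
  move=> lt; rewrite -(ltr_pM2l (x := 27)) ?ltr0n // e6; apply: le_lt_trans ag _.
  by rewrite ltrXn2r // mulr_ge0 ?ler0n // !addr_ge0.
have [s0|s0] := eqVneq (3 * `|y0| ^+ 2) (m%:R ^+ 2); last first.
  apply: fromlt; rewrite !mulrDr.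
  have -> : 3 * m%:R ^+ 2 = m%:R ^+ 2 + m%:R ^+ 2 + m%:R ^+ 2 :> algC by ring.
  by apply: ltr_leD => //; apply: ltr_leD => //; rewrite lt_neqAle s0.
have [s1|s1] := eqVneq (3 * `|y1| ^+ 2) (m%:R ^+ 2); last first.
  apply: fromlt; rewrite !mulrDr.
  have -> : 3 * m%:R ^+ 2 = m%:R ^+ 2 + m%:R ^+ 2 + m%:R ^+ 2 :> algC by ring.
  by apply: ltr_leD => //; apply: ler_ltD => //; rewrite lt_neqAle s1.
have [s2|s2] := eqVneq (3 * `|y2| ^+ 2) (m%:R ^+ 2); last first.
  apply: fromlt; rewrite !mulrDr.
  have -> : 3 * m%:R ^+ 2 = m%:R ^+ 2 + m%:R ^+ 2 + m%:R ^+ 2 :> algC by ring.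
  by apply: ler_ltD; [apply: lerD | rewrite lt_neqAle s2].
have {eq0}[b0 c0] := eq0 s0; have {eq1}[b1 c1] := eq1 s1; have {eq2}[b2 c2] := eq2 s2.
(* The norm is [a + b], with [a] the part made of cubes. As [|T|^2] is 0 or 4, one has
   [27 |a|^2 <= 4 m^6], while [27 |b|^2 = 9 m^6]; together they give at most [25/27 m^6]. *)
pose T := (-1) ^+ b0 + omega * (-1) ^+ b1 + omega ^+ 2 * (-1) ^+ b2.
have nT : `|T| ^+ 2 <= 4.
  have ii : forall (i j : int), `|i%:~R + j%:~R * omega : algC| ^+ 2 = (i ^+ 2 - i * j + j ^+ 2)%:~R.
    exact: normE.
  have -> : T = ((-1) ^+ b0 - (-1) ^+ b2)%:~R + ((-1) ^+ b1 - (-1) ^+ b2)%:~R * omega.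
    rewrite /T omegaE !rmorphB /= !rmorphXn !rmorphN1; ring.
  by rewrite ii -[4](_ : (4%:Z)%:~R = _) // ler_int; case: b0 {c0 T}; case: b1 {c1}; case: b2 {c2}.
pose a := y0 ^+ 3 + omega * y1 ^+ 3 + omega ^+ 2 * y2 ^+ 3.
pose b := - 3 * omega * y0 * y1 * y2.
have ea : 9 * a = m%:R ^+ 3 * rt3 * T.
  rewrite /a mulrDr mulrDr (mulrCA 9 omega) (mulrCA 9 (omega ^+ 2)) c0 c1 c2 /T.
  by ring.
have n3 : `|rt3| ^+ 2 = 3 by rewrite -normrX rt3_sq normrN normr_nat.
have na : 27 * `|a| ^+ 2 <= 4 * m%:R ^+ 6.
  have : 81 * `|a| ^+ 2 = 3 * (m%:R ^+ 6 * `|T| ^+ 2).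
    have -> : 81 * `|a| ^+ 2 = `|9 * a| ^+ 2 by rewrite normrM exprMn normr_nat; ring.
    by rewrite ea !normrM !exprMn n3 ?normrX !normr_nat; ring.
  move=> e81; rewrite -(ler_pM2l (x := 3)) ?ltr0n // mulrA.
  have -> : 3 * 27 = 81 :> algC by ring.
  by rewrite e81 ler_pM2l ?ltr0n // mulrC ler_pM2r // exprn_gt0 // ltr0n.
have nw : `|omega| = 1.
  by apply/eqP; rewrite -(pexpr_eq1 (n:=3)) // -normrX omega3 normr1.
have nb : 27 * `|b| ^+ 2 = 9 * m%:R ^+ 6.
  rewrite /b !normrM normrN normr_nat nw mulr1.
  transitivity (9 * ((3 * `|y0| ^+ 2) * (3 * `|y1| ^+ 2) * (3 * `|y2| ^+ 2))); first by ring.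
  by rewrite s0 s1 s2; ring.
rewrite NME // -[X in `|X|](_ : a + b = _); last by rewrite /a /b; ring.
have w := norm_add_weighted a b.
have m6 : 0 < m%:R ^+ 6 :> algC by rewrite exprn_gt0 // ltr0n.
have : 162 * `|a + b| ^+ 2 <= 150 * m%:R ^+ 6.
  have -> : 162 * `|a + b| ^+ 2 = 27 * (6 * `|a + b| ^+ 2) by ring.
  apply: le_trans (_ : _ <= 27 * (15 * `|a| ^+ 2 + 10 * `|b| ^+ 2)) _.
    by rewrite ler_pM2l // ltr0n.
  have -> : 27 * (15 * `|a| ^+ 2 + 10 * `|b| ^+ 2) = 15 * (27 * `|a| ^+ 2) + 10 * (27 * `|b| ^+ 2) by ring.
  have -> : 150 * m%:R ^+ 6 = 15 * (4 * m%:R ^+ 6) + 10 * (9 * m%:R ^+ 6) :> algC by ring.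
  by rewrite nb lerD2r ler_pM2l // ltr0n.
move=> h; rewrite -(ltr_pM2l (x := 162)) ?ltr0n //; apply: le_lt_trans h _.
by rewrite ltr_pM2r // ltr_nat.
Qed.

(** To divide by [b], multiply by the product [c] of its other conjugates: [b c] is the natural
    number [m = |NM b|^2], and division by [m] is rounding. *)
Lemma round_bezout (P : algC -> Prop) : subring_pred P -> (forall x, P x -> inS x) ->
  (forall x, P x -> P (tau x)) -> (forall x, P x -> P x^*) ->
  (forall x (m : nat), (0 < m)%N -> P x -> exists2 q, P q &
     `|NM (x - m%:R * q)| ^+ 2 < m%:R ^+ 6) -> bezoutP P.
Proof.
move=> rP PS Pt Pc rd.
apply: (@euclid_bezout P (fun x => `|NM x| ^+ 2)) => //.
  by move=> x /PS; exact: normM_nat.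
move=> a b Pa Pb b0.
have [m em] := normM_nat (PS _ Pb).
have m0 : (0 < m)%N.
  rewrite lt0n; apply: contra_neq b0 => m0; apply/eqP.
  by rewrite -NM_eq0 -normr_eq0 -sqrf_eq0 em m0.
pose c := tau b * tau (tau b) * (NM b)^*.
have Pc' : P c.
  rewrite /c; apply: PM => //; first by apply: PM => //; [exact: Pt | exact: (Pt _ (Pt _ Pb))].
  apply: Pc; rewrite /NM; apply: PM => //; last exact: (Pt _ (Pt _ Pb)).
  by apply: PM => //; exact: Pt.
have bc : b * c = m%:R by rewrite -em normCK /c; move: (NM b)^* => X; rewrite /NM; ring.
have [q Pq lt] := rd (a * c) m m0 (PM rP Pa Pc').
exists q => //.
have m0' : 0 < m%:R :> algC by rewrite ltr0n.
have e : (a - q * b) * m%:R = (a * c - m%:R * q) * b by rewrite -bc; ring.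
have eN : NM (a - q * b) * m%:R ^+ 3 = NM (a * c - m%:R * q) * NM b.
  by rewrite -NM_nat -!NMM e.
have eN2 : `|NM (a - q * b)| ^+ 2 * m%:R ^+ 6 = `|NM (a * c - m%:R * q)| ^+ 2 * m%:R.
  transitivity (`|NM (a - q * b) * m%:R ^+ 3| ^+ 2).
    by rewrite (normrM (NM _) (_ ^+ 3)) exprMn normrX normr_nat; ring.
  by rewrite eN (normrM (NM _) (NM b)) exprMn em.
have m6 : 0 < m%:R ^+ 6 :> algC by rewrite exprn_gt0.
by rewrite em -(ltr_pM2r m6) eN2 mulrC ltr_pM2l.
Qed.

Lemma bezS : bezoutP inS.
Proof.
apply: round_bezout => //; [exact: inS_ring | exact: tau_inS | exact: conj_inS | ].
by move=> x m m0 Sx; exact: S_round.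
Qed.

Lemma half_round (a m : int) : 0 < m -> exists d : int, - m <= 2 * (a - d * m) <= m.
Proof.
move=> m0.
have e := divz_eq a m.
have r0 : 0 <= (a %% m)%Z by apply: modz_ge0; lia.
have r1 : (a %% m)%Z < m by apply: ltz_pmod.
move: e r0 r1; move: (a %/ m)%Z (a %% m)%Z => d r e r0 r1.
have [h|h] := lerP (2 * r) m; [exists d | exists (d + 1)]; nia.
Qed.

Lemma K_form (a b c : int) :
  a%:~R + b%:~R * theta + c%:~R * tau theta
  = a%:~R + (b%:~R + c%:~R * omega) * zeta
    + (omega * (c%:~R + b%:~R * omega)) * zeta ^+ 2 :> algC.
Proof. by rewrite tau_theta /theta; ring. Qed.

Lemma norm_omega : `|omega| = 1.
Proof. by apply/eqP; rewrite -(pexpr_eq1 (n:=3)) // -normrX omega3 normr1. Qed.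

(** The integer coordinate is rounded to within [m / 2], the pair of the other two as a point of
    Z[omega]. Since [1/4 + 1/3 + 1/3 < 1], the inequality is strict without a borderline case. *)
Lemma K_round x (m : nat) : (0 < m)%N -> inK x -> exists2 q, inK q &
  `|NM (x - m%:R * q)| ^+ 2 < m%:R ^+ 6.
Proof.
move=> m0 /K_coord [a [b [c ->]]].
have m0z : 0 < m%:Z by [].
have [d /andP[hd1 hd2]] := half_round a m0z.
have [e [f /= [h1 h2 h3]]] := hex_round b c m0z.
have [le _] := hex_bound h1 h2 h3.
exists (d%:~R + e%:~R * theta + f%:~R * tau theta); first by pK.
have -> : a%:~R + b%:~R * theta + c%:~R * tau theta
   - m%:R * (d%:~R + e%:~R * theta + f%:~R * tau theta)
  = (a - d * m%:Z)%:~R + (b - e * m%:Z)%:~R * theta + (c - f * m%:Z)%:~R * tau theta.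
  by rewrite !rmorphB !rmorphM /= !pmulrn; ring.
move: (a - _) (b - _) (c - _) hd1 hd2 le => {h1 h2 h3} {}a {}b {}c hd1 hd2 le.
rewrite K_form.
have e0 : inZw a%:~R by pE.
have e1 : inZw (b%:~R + c%:~R * omega) by pE.
have e2 : inZw (omega * (c%:~R + b%:~R * omega)) by pE.
set y0 := a%:~R in e0 *; set y1 := _ + _ * omega in e1 *; set y2 := omega * _ in e2 *.
have Sy : inS (y0 + y1 * zeta + y2 * zeta ^+ 2) by exists y0, y1, y2.
have ag := amgm_NM Sy; rewrite sum_norm // in ag.
have n0 : `|y0| ^+ 2 = (a ^+ 2)%:~R by rewrite /y0 normCK rmorph_int -intrM expr2.
have n1 : `|y1| ^+ 2 = (b ^+ 2 - b * c + c ^+ 2)%:~R by exact: normE.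
have n2 : `|y2| ^+ 2 = (c ^+ 2 - c * b + b ^+ 2)%:~R.
  by rewrite /y2 normrM norm_omega mul1r normE.
rewrite -(ltr_pM2l (x := 27)) ?ltr0n //; apply: le_lt_trans ag _.
have -> : 27 * m%:R ^+ 6 = (3 * m%:R ^+ 2) ^+ 3 :> algC by ring.
have ge : 0 <= 3 * (`|y0| ^+ 2 + `|y1| ^+ 2 + `|y2| ^+ 2) by rewrite mulr_ge0 ?ler0n // !addr_ge0 // exprn_ge0.
rewrite ltrXn2r // ltr_pM2l ?ltr0n // n0 n1 n2 -!rmorphD /=.
have -> : m%:R ^+ 2 = (m%:Z ^+ 2)%:~R :> algC by rewrite rmorphXn /= pmulrn.
by rewrite ltr_int; nia.
Qed.

Lemma bezK : bezoutP inK.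
Proof.
apply: round_bezout => //; [exact: inK_ring | exact: inKS | exact: inK_tau | |].
  by move=> x [Sx ex]; split; rewrite ex.
by move=> x m m0 Sx; exact: K_round.
Qed.

(** * The ramified prime [lam], which is [zeta - zeta^-1] *)

Definition lam : algC := zeta - omega ^+ 2 * zeta ^+ 2.

Lemma inS_lam : inS lam. Proof. by rewrite /lam; pS. Qed.
Lemma lamE : lam = 0 + 1 * zeta + (- omega ^+ 2) * zeta ^+ 2.
Proof. by rewrite /lam; ring. Qed.

Lemma NM_lam : NM lam = rt3.
Proof.
rewrite lamE NME; try by pE.
rewrite /rt3; apply: (@omega_red _ _ (omega ^+ 2 - omega ^+ 6 + omega ^+ 5 - omega ^+ 3)).
by ring.
Qed.

Lemma rt3_neq0 : rt3 != 0.
Proof. by rewrite -sqrf_eq0 rt3_sq oppr_eq0 pnatr_eq0. Qed.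
Lemma lam_neq0 : lam != 0.
Proof. by rewrite -NM_eq0 NM_lam rt3_neq0. Qed.

Lemma tau_lam : lam = - tau theta * tau lam.
Proof.
rewrite tau_theta lamE tauE; try by pE.
symmetry.
apply: (@zeta_red _ _ (- zeta - zeta ^+ 10 + zeta ^+ 12 + zeta ^+ 13 + zeta ^+ 4 - zeta ^+ 9)).
by rewrite omegaZ; ring.
Qed.

Lemma lam_dvd_1z : dvdP inS lam (1 - zeta).
Proof.
exists (- zeta * (1 + zeta ^+ 2 + zeta ^+ 4 + zeta ^+ 6 + zeta ^+ 8)); first by pS.
symmetry.
apply: (@zeta_red _ _ (zeta + zeta ^+ 11 - zeta ^+ 2 + zeta ^+ 3 - 2 * zeta ^+ 4 + zeta ^+ 5 - zeta ^+ 6 + zeta ^+ 7 - zeta ^+ 8 + zeta ^+ 9 - 1)).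
by rewrite /lam omegaZ; ring.
Qed.

Lemma lam_dvd_1w : dvdP inS lam (1 - omega).
Proof.
have -> : 1 - omega = (1 + zeta + zeta ^+ 2) * (1 - zeta) by rewrite omegaZ; ring.
by apply: (dvdP_mull inS_ring); [pS | exact: lam_dvd_1z].
Qed.

Lemma lam_dvd_3 : dvdP inS lam 3.
Proof.
have -> : 3 = (1 - omega ^+ 2) * (1 - omega) :> algC.
  by apply: (@omega_red _ _ (2 - omega)); ring.
by apply: (dvdP_mull inS_ring); [pS | exact: lam_dvd_1w].
Qed.

(** The residue field is F_3: modulo [lam] both [zeta] and [omega] are 1, and 3 is 0. *)
Lemma residue_S x : inS x -> exists2 r : int, (r == 0) || (r == 1) || (r == -1) &
  dvdP inS lam (x - r%:~R).
Proof.
have ints (n : int) : exists2 r : int, (r == 0) || (r == 1) || (r == -1) &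
    dvdP inS lam (n%:~R - r%:~R).
  have [r hr hn] : exists2 r : int, (r == 0) || (r == 1) || (r == -1) & (3 %| n - r)%Z.
    have e := divz_eq n 3; have r0 : 0 <= (n %% 3)%Z by apply: modz_ge0.
    have r1 : (n %% 3)%Z < 3 by apply: ltz_pmod.
    have [h|[h|h]] : (n %% 3)%Z = 0 \/ (n %% 3)%Z = 1 \/ (n %% 3)%Z = 2 by lia.
    - by exists 0 => //; apply/dvdzP; exists (n %/ 3)%Z; lia.
    - by exists 1 => //; apply/dvdzP; exists (n %/ 3)%Z; lia.
    - by exists (-1) => //; apply/dvdzP; exists ((n %/ 3)%Z + 1); lia.
  exists r => //; case/dvdzP: hn => k ek.
  rewrite -rmorphB /= ek rmorphM /=.
  by apply: (dvdP_mull inS_ring); [pS | exact: lam_dvd_3].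
have Es y : inZw y -> exists n : int, dvdP inS lam (y - n%:~R).
  move=> [a [b ->]]; exists (a + b).
  have -> : a%:~R + b%:~R * omega - (a + b)%:~R = (- b%:~R) * (1 - omega) :> algC.
    by rewrite rmorphD /=; ring.
  by apply: (dvdP_mull inS_ring); [pS | exact: lam_dvd_1w].
move=> [x0 [x1 [x2 [e0 e1 e2 ->]]]].
have [n hn] : exists n : int, dvdP inS lam (x0 + x1 * zeta + x2 * zeta ^+ 2 - n%:~R).
  have [n hn] := Es (x0 + x1 + x2) ltac:(by pE); exists n.
  have -> : x0 + x1 * zeta + x2 * zeta ^+ 2 - n%:~R =
    (x0 + x1 + x2 - n%:~R) - (x1 + x2 * (1 + zeta)) * (1 - zeta) by ring.
  apply: (dvdPB inS_ring) => //; apply: (dvdP_mull inS_ring); last exact: lam_dvd_1z.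
  by have s1 := inES e1; have s2 := inES e2; pS.
have [r hr h] := ints n; exists r => //.
have -> : x0 + x1 * zeta + x2 * zeta ^+ 2 - r%:~R
  = (x0 + x1 * zeta + x2 * zeta ^+ 2 - n%:~R) + (n%:~R - r%:~R) by ring.
exact: (dvdPD inS_ring).
Qed.

(** A nonzero residue [r] is 1 or -1, hence its own inverse modulo [lam]. *)
Lemma lam_coprime x : inS x -> ~ dvdP inS lam x -> coprimeP inS x lam.
Proof.
move=> Sx nd; have [r hr [c Sc e]] := residue_S Sx.
have rr : r * r = 1.
  case/orP: hr => [/orP[]|] /eqP er; rewrite er //.
  by case: nd; exists c => //; rewrite -e er subr0.
exists (r%:~R), (- r%:~R * c); split; try by pS.
have -> : x = c * lam + r%:~R by rewrite -e; ring.
by transitivity ((r * r)%:~R : algC); [rewrite rmorphM /=; ring | rewrite rr].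
Qed.

Lemma lam_nunit : ~ dvdP inS lam 1.
Proof.
move=> [c Sc e].
have [n en] := normM_nat Sc.
have : `|NM (c * lam)| ^+ 2 = 1 by rewrite -e /NM !rmorph1 !mulr1 normr1 expr1n.
rewrite NMM NM_lam normrM exprMn en -normrX rt3_sq normrN normr_nat -natrM => /eqP.
by rewrite pnatr_eq1 => /eqP; lia.
Qed.

Lemma lam_dec x : inS x -> dvdP inS lam x \/ ~ dvdP inS lam x.
Proof.
move=> Sx; have [r hr h] := residue_S Sx.
case/orP: hr => [/orP[]|] /eqP er; rewrite er in h; [left | right | right].
- by rewrite subr0 in h.
- move=> d; apply: lam_nunit; have -> : 1 = x - (x - 1%:~R) by rewrite opprB addrC subrK.
  exact: (dvdPB inS_ring).
- move=> d; apply: lam_nunit; have -> : 1 = (x - (-1)%:~R) - x by rewrite rmorphN1 opprK; ring.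
  exact: (dvdPB inS_ring).
Qed.

(** Each division by [lam] divides the natural number [|NM x|^2] by 3. *)
Lemma lam_val x : inS x -> x != 0 -> exists (l : nat) y,
  [/\ inS y, ~ dvdP inS lam y & x = lam ^+ l * y].
Proof.
move=> Sx x0; have [n en] := normM_nat Sx.
elim/ltn_ind: n x Sx x0 en => n IH x Sx x0 en.
have [[c Sc e]|nd] := lam_dec Sx; last by exists 0%N, x; rewrite expr0 mul1r.
have c0 : c != 0 by apply: contra_neq x0 => c0; rewrite e c0 mul0r.
have [m em] := normM_nat Sc.
have nm : n = (m * 3)%N.
  apply/eqP; rewrite -(eqr_nat algC) -en e NMM NM_lam normrM exprMn em -(normrX 2 rt3) rt3_sq normrN normr_nat.
  by rewrite natrM.
have m0 : (0 < m)%N.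
  by rewrite lt0n; apply: contra_neq c0 => m0; apply/eqP; rewrite -NM_eq0 -normr_eq0 -sqrf_eq0 em m0.
have [l [y [Sy nd ey]]] := IH m ltac:(by rewrite nm; lia) c Sc c0 em.
by exists l.+1, y; split=> //; rewrite e ey exprSr; ring.
Qed.

(** * Units of Z[zeta] modulo cubes *)

Lemma thetaM : theta * tau theta * tau (tau theta) = - 1.
Proof.
have -> : theta = 0 + 1 * zeta + omega ^+ 2 * zeta ^+ 2 by rewrite /theta; ring.
rewrite -/(NM _) NME; try by pE.
by apply: (@omega_red _ _ (omega ^+ 6 - omega ^+ 5 + omega ^+ 3 - omega ^+ 2 + 1)); ring.
Qed.

Lemma unit_theta : unitP inS theta.
Proof.
have St := inKS inK_theta.
exists (- (tau theta * tau (tau theta))); first by pS.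
by split=> //; rewrite mulNr -(mulrC theta) mulrA thetaM opprK.
Qed.

Lemma unit_tau x : unitP inS x -> unitP inS (tau x).
Proof.
move=> [f Sf [Sx e]]; exists (tau f); first by pS.
by split; [pS | rewrite -rmorphM /= e rmorph1].
Qed.

Lemma unit_zeta : unitP inS zeta.
Proof.
exists (zeta ^+ 8); first by pS.
by split; [pS | rewrite -exprSr zeta9].
Qed.

Lemma unitPX x n : unitP inS x -> unitP inS (x ^+ n).
Proof.
move=> u; elim: n => [|n IH]; last by rewrite exprS; apply: (unitPM inS_ring).
by rewrite expr0; exists 1; [pS | split; [pS | rewrite mulr1]].
Qed.

Lemma unit_sign (s : bool) : unitP inS ((-1) ^+ s).
Proof. by exists ((-1) ^+ s); [pS | split; [pS | rewrite -signr_addb addbb]]. Qed.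

Lemma unitE_form x : inZw x -> `|x| ^+ 2 = 1 -> exists (s : bool) (i : nat), x = (-1) ^+ s * omega ^+ i.
Proof.
move=> [a [b ->]]; rewrite normE => /eqP; rewrite -[1]/(1%:~R) eqr_int => /eqP h.
have hb : -1 <= b <= 1 by nia.
have ha : -1 <= a <= 1 by nia.
have [eb|[eb|eb]] : b = -1 \/ b = 0 \/ b = 1 by lia.
all: have [ea|[ea|ea]] : a = -1 \/ a = 0 \/ a = 1 by lia.
all: rewrite ea eb in h *.
all: try (exfalso; lia).
- by exists false, 2; rewrite omegaE rmorphN1; ring.
- by exists true, 1; rewrite rmorphN1; ring.
- by exists true, 0; rewrite rmorphN1; ring.
- by exists false, 0; ring.
- by exists false, 1; ring.
- by exists true, 2; rewrite omegaE; ring.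
Qed.

Lemma NM_unit e : unitP inS e -> exists (s : bool) (i : nat), NM e = (-1) ^+ s * omega ^+ i.
Proof.
move=> [f Sf [Se h]]; apply: unitE_form; first exact: NM_inZw.
have [n en] := normM_nat Se; have [m em] := normM_nat Sf.
have : `|NM (f * e)| ^+ 2 = 1 by rewrite h /NM !rmorph1 !mulr1 normr1 expr1n.
rewrite NMM (normrM (NM f) (NM e)) exprMn en em -natrM => /eqP.
rewrite pnatr_eq1 muln_eq1 => /andP[_ /eqP ->].
by [].
Qed.

Lemma NM_zeta : NM zeta = omega.
Proof.
have -> : zeta = 0 + 1 * zeta + 0 * zeta ^+ 2 by ring.
by rewrite NME; [ring | pE..].
Qed.

(** The twisted trace [g x] satisfies [g x = e * tau (g x)]. It cannot vanish at [1], [zeta] and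
    [zeta^2] together: divided by these arguments the three values add up to 3. *)
Lemma hilbert90 e : inS e -> NM e = 1 -> exists2 g, inS g /\ g != 0 & g = e * tau g.
Proof.
move=> Se Ne.
pose g x := x + e * tau x + e * tau e * tau (tau x).
have eg x : inS x -> g x = e * tau (g x).
  move=> Sx; rewrite /g !(rmorphD, rmorphM) /= tau3 //.
  by rewrite -{1}[x]mul1r -Ne /NM; ring.
have Sg x : inS x -> inS (g x) by move=> Sx; rewrite /g; pS.
have [h0|h0] := eqVneq (g 1) 0; last by exists (g 1); [split=> //; apply: Sg; pS | apply: eg; pS].
have [h1|h1] := eqVneq (g zeta) 0; last by exists (g zeta); [split=> //; apply: Sg; pS | apply: eg; pS].
have [h2|h2] := eqVneq (g (zeta ^+ 2)) 0; last by exists (g (zeta ^+ 2)); [split=> //; apply: Sg; pS | apply: eg; pS].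
exfalso.
have tz : tau (tau zeta) = omega ^+ 2 * zeta.
  by rewrite tau_zeta rmorphM /= tau_omega tau_zeta; ring.
have h1' : 1 + omega * e + omega ^+ 2 * (e * tau e) = 0.
  apply: (mulfI zeta_neq0); rewrite mulr0 -h1 /g tz tau_zeta; ring.
have h2' : 1 + omega ^+ 2 * e + omega ^+ 4 * (e * tau e) = 0.
  apply: (mulfI (expf_neq0 2 zeta_neq0)); rewrite mulr0 -h2 /g !rmorphXn /= tz tau_zeta; ring.
have h0' : 1 + e + e * tau e = 0 by rewrite -h0 /g !rmorph1 !mulr1.
have : 3 = 0 :> algC.
  rewrite -[RHS]addr0 -{1}h1' -h2' -[RHS]addr0 -h0'.
  apply: (@omega_red _ _ (- (e + (omega ^+ 2 - omega + 1) * (e * tau e)))); ring.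
by apply/eqP; rewrite pnatr_eq0.
Qed.

(** Write [e = g / tau g] and divide [g] by its content over Z[omega]. The primitive quotient [h]
    generates an ideal stable under [tau], so it divides the traces of its multiples, hence 3 times
    each coordinate, hence 3. Thus [h] is a power of [lam] times a unit, and [lam / tau lam] is
    [- tau theta]. *)
Lemma unit_norm1 e : unitP inS e -> NM e = 1 -> exists (l : nat) k,
  unitP inS k /\ e = (- tau theta) ^+ l * (k / tau k).
Proof.
move=> ue Ne; have Se := unitP_P ue.
have [g [Sg g0] eg] := hilbert90 Se Ne.
case: Sg => x0 [x1 [x2 [e0 e1 e2 exg]]].
have [d1 [u [v [Eu Ev ed1 [a0 Ea0 ha0] [a1 Ea1 ha1]]]]] := bezE e0 e1.
have Ed1 : inZw d1 by rewrite ed1; pE.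
have [d [s [t [Es Et ed [b1 Eb1 hb1] [b2 Eb2 hb2]]]]] := bezE Ed1 e2.
have Ed : inZw d by rewrite ed; pE.
have d0 : d != 0.
  by apply: contra_neq g0 => d0; rewrite exg ha0 ha1 hb1 hb2 d0; ring.
pose y0 := a0 * b1; pose y1 := a1 * b1.
pose h := y0 + y1 * zeta + b2 * zeta ^+ 2.
have Ey0 : inZw y0 by rewrite /y0; pE.
have Ey1 : inZw y1 by rewrite /y1; pE.
have egh : g = d * h by rewrite exg ha0 ha1 hb2 hb1 /h /y0 /y1; ring.
have Sh : inS h by exists y0, y1, b2.
have h0 : h != 0 by apply: contra_neq g0 => h0; rewrite egh h0 mulr0.
have eh : h = e * tau h.
  by apply: (mulfI d0); rewrite -egh eg egh rmorphM /= (tau_inZw Ed); ring.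
have y0d : y0 * d = x0 by rewrite ha0 hb1 /y0 mulrA.
have y1d : y1 * d = x1 by rewrite ha1 hb1 /y1 mulrA.
have one : s * u * y0 + s * v * y1 + t * b2 = 1.
  apply: (mulIf d0); rewrite mul1r.
  transitivity (s * (u * x0 + v * x1) + t * x2); last by rewrite -ed1 -ed.
  by rewrite -y0d -y1d hb2; ring.
have th : tau h = e^-1 * h by rewrite {2}eh (mulKf (unitP_neq0 ue)).
have Sei := unitP_inv ue.
(* [tau h] is [h] divided by the unit [e], so every conjugate of [h y] is a multiple of [h]. *)
have dtau y : inS y -> dvdP inS h (trM (h * y)).
  move=> Sy; rewrite /trM !rmorphM /= th rmorphM /= th.
  exists (y + e^-1 * tau y + tau e^-1 * e^-1 * tau (tau y)); first by pS.
  by ring.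
have d3 : dvdP inS h 3.
  have w2 : omega * omega ^+ 2 = 1 by rewrite -exprS omega3.
  have -> : 3 = s * u * trM (h * 1) + s * v * omega ^+ 2 * trM (h * zeta ^+ 2)
      + t * omega ^+ 2 * trM (h * zeta).
    have -> : h * 1 = y0 + y1 * zeta + b2 * zeta ^+ 2 by rewrite mulr1.
    have -> : h * zeta ^+ 2 = y1 * omega + (b2 * omega) * zeta + y0 * zeta ^+ 2.
      by rewrite /h omegaZ; ring.
    have -> : h * zeta = b2 * omega + y0 * zeta + y1 * zeta ^+ 2 by rewrite /h omegaZ; ring.
    rewrite !trME; try by pE.
    transitivity (3 * (s * u * y0 + s * v * y1 * (omega * omega ^+ 2) + t * b2 * (omega * omega ^+ 2))).
      by rewrite w2 !mulr1 one mulr1.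
    by ring.
  have Ss := inES Es; have Su := inES Eu; have Sv := inES Ev; have St := inES Et.
  by apply: (dvdPD inS_ring); [apply: (dvdPD inS_ring) |]; apply: (dvdP_mull inS_ring); try (by pS);
    apply: dtau; pS.
have [l [y [Sy nd ey]]] := lam_val Sh h0.
have lt : lam = - tau theta * tau lam := tau_lam.
have tl0 : tau lam != 0 by rewrite tau_eq0 lam_neq0.
have uy : unitP inS y.
  have co : coprimeP inS y lam := lam_coprime Sy nd.
  have d1' : dvdP inS (tau lam) lam.
    by exists (- tau theta) => //; have Kt := inKS inK_theta; pS.
  have d2' : dvdP inS (tau (tau lam)) (tau lam).
    exists (- tau (tau theta)); first by have Kt := inKS inK_theta; pS.
    by rewrite {1}lt rmorphM rmorphN.
  have Sl := inS_lam.
  have co1 := coprime_dvdr inS_ring d1' co.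
  have co2 := coprime_dvdr inS_ring d2' co1.
  have cor : coprimeP inS y rt3.
    rewrite -NM_lam /NM; apply: (coprimePM inS_ring) => //; try by pS.
    by apply: (coprimePM inS_ring) => //; pS.
  have Sr : inS rt3 by rewrite /rt3; pS.
  apply: (unit_coprime inS_ring) (coprimePM inS_ring Sy Sr Sr cor cor) _ => //; first by pS.
  have -> : rt3 * rt3 = - 3 by rewrite -expr2 rt3_sq.
  apply: (dvdPN inS_ring); apply: dvdP_trans d3; first exact: inS_ring.
  by exists (lam ^+ l) => //; pS.
exists l, y; split=> //.
have ty0 : tau y != 0 by rewrite tau_eq0 (unitP_neq0 uy).
have : lam ^+ l * y = e * (tau lam ^+ l * tau y).
  by rewrite -ey {1}eh ey rmorphM rmorphXn.
rewrite {1}lt exprMn => eq.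
apply: (mulIf (mulf_neq0 (expf_neq0 l tl0) ty0)).
by rewrite -eq; field.
Qed.

(** The relative norm of a unit is a root of unity of Z[omega], and a signed power of [zeta] has the
    same norm; the quotient falls under [unit_norm1]. *)
Lemma unit_form1 e : unitP inS e -> exists (s : bool) (i l : nat) k,
  unitP inS k /\ e = (-1) ^+ s * zeta ^+ i * (- tau theta) ^+ l * (k / tau k).
Proof.
move=> ue; have [s [i en]] := NM_unit ue.
pose f := (-1) ^+ s * zeta ^+ i.
have uf : unitP inS f.
  by apply: (unitPM inS_ring); [exact: unit_sign | exact: unitPX unit_zeta].
have f0 := unitP_neq0 uf.
have Nf : NM f = NM e.
  rewrite NMM en; congr (_ * _).
    by rewrite /NM !rmorphXn /= !rmorphN1 -!signr_addb addbb addFb.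
  by rewrite /NM !rmorphXn /= -!exprMn -/(NM zeta) NM_zeta.
have uef : unitP inS (e / f) by apply: (unitPM inS_ring) => //; exact: unitPV.
have Nef : NM (e / f) = 1.
  have n0 : NM f != 0 by rewrite NM_eq0.
  by apply: (mulIf n0); rewrite mul1r -NMM divfK // Nf.
have [l [k [uk ek]]] := unit_norm1 uef Nef.
exists s, i, l, k; split=> //.
by rewrite -[LHS](divfK f0) ek /f; ring.
Qed.

(** The computation of [k / tau k] for [units_mod_cubes], with variables in place of the units so
    that [field] applies. *)
Lemma ratio_field (F : fieldType) (s z a n b c k0 k1 k2 : F) :
  s != 0 -> z != 0 -> a != 0 -> n != 0 -> c != 0 -> k0 != 0 -> k1 != 0 -> k2 != 0 ->
  (s * z * (n * b) * (k0 / k1)) / (s * (a * z) * (n * c) * (k1 / k2))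
  = a^-1 * (b / c) * (k0 * k1 * k2 / k1 ^+ 3).
Proof. by move=> s0 z0 a0 n0 c0 k00 k10 k20; field; rewrite s0 z0 a0 n0 c0 k10 k20. Qed.

(** [unit_form1] is applied to [e] and again to the unit [k] it returns. Because
    [(1 - tau)^2 = 1 + tau + tau^2 - 3 tau], the second unit [k'] contributes [NM k'], a root of
    unity, divided by a cube. *)
Lemma units_mod_cubes e : unitP inS e -> exists (s : bool) (i j k : nat) c,
  unitP inS c /\ e = (-1) ^+ s * zeta ^+ i * theta ^+ j * tau theta ^+ k * c ^+ 3.
Proof.
move=> ue; have [s [i [l [k [uk ek]]]]] := unit_form1 ue.
have [s' [i' [l' [k' [uk' ek']]]]] := unit_form1 uk.
have [s2 [m en]] := NM_unit uk'.
have ut := unit_theta; have utt := unit_tau ut; have uttt := unit_tau utt.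
have t0 := unitP_neq0 ut; have t1 := unitP_neq0 utt; have t2 := unitP_neq0 uttt.
have z0 := zeta_neq0; have o0 := omega_neq0.
have k0 := unitP_neq0 uk'.
have k1 : tau k' != 0 by rewrite tau_eq0.
have k2 : tau (tau k') != 0 by rewrite tau_eq0.
have tk : tau k = (-1) ^+ s' * (omega * zeta) ^+ i' * (- tau (tau theta)) ^+ l' * (tau k' / tau (tau k')).
  by rewrite ek' !(rmorphM, rmorphXn, rmorphN, rmorph1, fmorphV) /= tau_zeta.
have sg0 (b : bool) : (-1) ^+ b != 0 :> algC by rewrite signr_eq0.
have ratio : k / tau k = (omega ^+ i')^-1 * ((tau theta) ^+ l' / (tau (tau theta)) ^+ l') *
   (NM k' / tau k' ^+ 3).
  rewrite tk ek' /NM (exprNn (tau theta)) (exprNn (tau (tau theta))) exprMn.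
  by apply: ratio_field; rewrite ?signr_eq0 ?expf_neq0 ?oppr_eq0 ?oner_eq0.
have tt : (tau (tau theta))^-1 = - (theta * tau theta).
  by apply: (mulfI t2); rewrite mulfV // mulrN [_ * (theta * _)]mulrC thetaM opprK.
have cub (b : bool) : (-1) ^+ b = ((-1) ^+ b) ^+ 3 :> algC by case: b; ring.
(* Powers of [omega] are cubes of powers of [zeta], so the root of unity [NM k'] and the power of
   [omega] in [ratio] are absorbed in [c]. *)
pose c := (-1) ^+ s2 * (zeta ^+ i')^-1 * zeta ^+ m / tau k'.
exists (s (+) odd l (+) odd l'), i, l', (l + 2 * l')%N, c; split.
  rewrite /c; apply: (unitPM inS_ring); last by apply: unitPV; exact: unit_tau.
  apply: (unitPM inS_ring); last exact: unitPX unit_zeta.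
  by apply: (unitPM inS_ring); [exact: unit_sign | apply: unitPV; exact: unitPX unit_zeta].
rewrite ek ratio en -(exprVn (tau (tau theta))) tt /c.
rewrite (exprNn (tau theta)) (exprNn (theta * _)) !exprMn exprD exprM -![(-1) ^+ l]signr_odd -![(-1) ^+ l']signr_odd !signr_addb.
rewrite -cub !exprVn -![(zeta ^+ _) ^+ 3]exprM !(mulnC _ 3) !exprM zeta3.
rewrite -(exprM (tau theta) 2 l') (mulnC 2 l') exprM.
ring.
Qed.

Lemma mod3 (n : nat) : exists q r : nat, n = (3 * q + r)%N /\ (r < 3)%N.
Proof. by exists (n %/ 3)%N, (n %% 3)%N; split; [rewrite mulnC -divn_eq | rewrite ltn_mod]. Qed.

Lemma units_mod_cubes3 e : unitP inS e -> exists (i j k : nat) c,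
  [/\ unitP inS c, (j < 3)%N, (k < 3)%N & e = zeta ^+ i * theta ^+ j * tau theta ^+ k * c ^+ 3].
Proof.
move=> /units_mod_cubes [s [i [j [k [c [uc ->]]]]]].
have [qj [rj [ej lj]]] := mod3 j; have [qk [rk [ek lk]]] := mod3 k.
exists i, rj, rk, ((-1) ^+ s * theta ^+ qj * tau theta ^+ qk * c); split=> //.
  apply: (unitPM inS_ring) => //; apply: (unitPM inS_ring); last exact: (unitPX _ (unit_tau unit_theta)).
  by apply: (unitPM inS_ring); [exact: unit_sign | exact: (unitPX _ unit_theta)].
have e3 q r (x : algC) : x ^+ (3 * q + r) = (x ^+ q) ^+ 3 * x ^+ r.
  by rewrite exprD; congr (_ * _); rewrite mulnC exprM.
rewrite ej ek !e3 !exprMn.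
have -> : ((-1) ^+ s) ^+ 3 = (-1) ^+ s :> algC by case: s; ring.
by ring.
Qed.

Lemma omega_root x : x ^+ 3 = 1 -> exists l : nat, x = omega ^+ l.
Proof.
move=> h.
have : (x - 1) * ((x - omega) * (x - omega ^+ 2)) = 0.
  transitivity (x ^+ 3 - 1); last by rewrite h subrr.
  by apply: (@omega_red _ _ (- x ^+ 2 + x * omega - omega + 1)); ring.
move/eqP; rewrite !mulf_eq0 !subr_eq0 => /orP[/eqP ->|/orP[/eqP ->|/eqP ->]].
- by exists 0%N. - by exists 1%N. - by exists 2%N.
Qed.

(** The quotient of the conjugate of [x] by [x] is a cube root of unity [omega^l], and
    [omega^(2 l) * x] is real. *)
Lemma real_cube x : inS x -> x != 0 -> (x ^+ 3)^* = x ^+ 3 -> exists2 y, inK y & y ^+ 3 = x ^+ 3.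
Proof.
move=> Sx x0 h.
have xc0 : x^* != 0 by rewrite conjC_eq0.
have [l el] : exists l : nat, x^* / x = omega ^+ l.
  by apply: omega_root; rewrite expr_div_n -rmorphXn /= h divff // expf_neq0.
exists (omega ^+ (2 * l) * x).
  split; first by pS.
  rewrite rmorphM rmorphXn /= conj_omega -exprM.
  have -> : x^* = omega ^+ l * x by rewrite -el divfK.
  rewrite mulrA -exprD.
  have -> : (2 * (2 * l) + l = 3 * l + 2 * l)%N by lia.
  by rewrite exprD exprM omega3 expr1n mul1r.
by rewrite exprMn -exprM mulnC exprM omega3 expr1n mul1r.
Qed.

Lemma zeta_exp9 x : x ^+ 9 = 1 -> exists l : nat, x = zeta ^+ l.
Proof. by move=> h; have [i ->] := prim_rootP zeta_prim h; exists i. Qed.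

(* [zeta ^+ i] is a cube in the field only if [3 %| i]: the norm down to
   [Q(omega)] of a cube root would be a 9-th root of unity fixed by [tau]. *)
Lemma zeta_cube a b i : inS a -> inS b -> b != 0 -> a ^+ 3 = zeta ^+ i * b ^+ 3 -> (3 %| i)%N.
Proof.
move=> Sa Sb b0 h.
have Nb0 : NM b != 0 by rewrite NM_eq0.
have hN : (NM a / NM b) ^+ 3 = omega ^+ i.
  have NX x n : NM (x ^+ n) = NM x ^+ n by rewrite /NM !rmorphXn /= !exprMn.
  by rewrite expr_div_n -!NX h NMM NX NM_zeta NX mulfK // expf_neq0.
have [l el] : exists l : nat, NM a / NM b = zeta ^+ l.
  by apply: zeta_exp9; rewrite (exprM _ 3 3) hN -exprM mulnC exprM omega3 expr1n.
have tf : tau (NM a / NM b) = NM a / NM b.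
  by rewrite rmorphM fmorphV /= !tau_inZw //; exact: NM_inZw.
have l3 : (9 %| 3 * l)%N.
  move: tf; rewrite el rmorphXn /= tau_zeta exprMn => /eqP.
  rewrite -[X in _ == X]mul1r (inj_eq (mulIf (expf_neq0 l zeta_neq0))) omegaZ -exprM.
  by rewrite -(prim_order_dvd zeta_prim).
have : zeta ^+ (3 * i) = 1.
  by rewrite exprM zeta3 -hN el -exprM; apply/eqP; rewrite -(prim_order_dvd zeta_prim); lia.
by move/eqP; rewrite -(prim_order_dvd zeta_prim); lia.
Qed.

(** Comparing [zeta^i * g^3] with its conjugate shows that [zeta^(2 i)] is a cube; then 3 divides
    [i] by [zeta_cube], and [real_cube] replaces the cube by that of a real element. *)
Lemma real_unit_cube x e c : inK x -> x != 0 -> unitP inS e -> inS c -> x = e * c ^+ 3 ->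
  exists (j k : nat) y, [/\ inK y, (j < 3)%N, (k < 3)%N & x = theta ^+ j * tau theta ^+ k * y ^+ 3].
Proof.
move=> Kx x0 ue Sc ex.
have [i [j [k [d [ud lj lk ed]]]]] := units_mod_cubes3 ue.
pose r := theta ^+ j * tau theta ^+ k.
have Kr : inK r by rewrite /r; pK.
have r0 : r != 0.
  by rewrite mulf_neq0 ?expf_neq0 ?tau_eq0 // (unitP_neq0 unit_theta).
pose g := d * c.
have Sg : inS g by have Sd := unitP_P ud; rewrite /g; pS.
have ex' : x = zeta ^+ i * r * g ^+ 3 by rewrite ex ed /r /g; ring.
have g0 : g != 0.
  by apply: contra_neq x0 => g0; rewrite ex' g0 expr0n mulr0.
have zc : zeta^* * zeta = 1 by rewrite conj_zeta -zeta9 omegaZ; ring.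
have hc : (g^* ) ^+ 3 = zeta ^+ (2 * i) * g ^+ 3.
  have h : (zeta^* ) ^+ i * r * (g^* ) ^+ 3 = zeta ^+ i * r * g ^+ 3.
    rewrite -ex'; case: Kx => _ <-; rewrite ex' !(rmorphM _ (_ * _)) (rmorphM _ (_ ^+ _)) !rmorphXn /=.
    by have -> : r^* = r by case: Kr.
  apply: (mulfI r0); transitivity (zeta ^+ i * ((zeta^* ) ^+ i * r * (g^* ) ^+ 3)).
    by rewrite !mulrA -exprMn (mulrC zeta) zc expr1n mul1r.
  by rewrite h mul2n -addnn exprD; ring.
have i3 : (3 %| i)%N.
  by have := zeta_cube (conj_inS Sg) Sg g0 hc; lia.
case/dvdnP: i3 => q eq.
have ex3 : x = r * (zeta ^+ q * g) ^+ 3 by rewrite ex' eq (exprM zeta); ring.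
have [y Ky ey] : exists2 y, inK y & y ^+ 3 = (zeta ^+ q * g) ^+ 3.
  apply: real_cube; [by pS | by rewrite mulf_neq0 // expf_neq0 // zeta_neq0 |].
  apply: (mulfI r0); rewrite -ex3; case: Kx => _ <-; rewrite ex3 (rmorphM _ r) /=.
  by have -> : r^* = r by case: Kr.
by exists j, k, y; rewrite ey.
Qed.

(** * The prime above 3 in the real cubic subfield *)

(** Up to a unit this is [lam^2], so it generates the prime above 3 of the cubic ring. The unit
    [eps] is the cofactor in [3 = eps * pi3^3] and the inverse of [pi3^2 - 1]. *)
Definition pi3 : algC := theta + 1.
Definition eps : algC := - 1 + 3 * pi3 - pi3 ^+ 2.

Lemma theta_lin : tau theta = 2 - theta - theta ^+ 2.
Proof.
rewrite tau_theta /theta.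
apply: (@zeta_red _ _ (zeta + zeta ^+ 10 + zeta ^+ 2 + 2 * zeta ^+ 3 - zeta ^+ 7 - 2)).
by rewrite omegaZ; ring.
Qed.

Lemma theta_red a b c : a - b = (theta ^+ 3 - 3 * theta + 1) * c -> a = b.
Proof. by move=> h; apply/eqP; rewrite -subr_eq0 h thetaE; apply/eqP; ring. Qed.

Lemma eps_pi : 3 = eps * pi3 ^+ 3.
Proof. by apply: (@theta_red _ _ (theta ^+ 2 + 2 * theta + 2)); rewrite /eps /pi3; ring. Qed.

Lemma pi_lam : pi3 = - theta * lam ^+ 2.
Proof.
symmetry; rewrite /pi3 /theta /lam.
apply: (@zeta_red _ _ (- zeta + zeta ^+ 11 + zeta ^+ 15 - zeta ^+ 18 + zeta ^+ 4 + zeta ^+ 6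
  - zeta ^+ 8 - zeta ^+ 9 - 1)).
by rewrite omegaZ; ring.
Qed.

Lemma inK_pi : inK pi3. Proof. by rewrite /pi3; pK. Qed.
Lemma inK_eps : inK eps. Proof. by rewrite /eps; have := inK_pi; move=> ?; pK. Qed.

Lemma pi_dvd_1w : dvdP inS pi3 (1 - omega).
Proof.
exists (zeta - zeta ^+ 2); first by pS.
rewrite /pi3 /theta; symmetry.
apply: (@zeta_red _ _ (zeta + zeta ^+ 3 - zeta ^+ 4 - 1)).
by rewrite omegaZ; ring.
Qed.

Ltac pK' := repeat first [assumption | exact: inK_int | exact: inK_nat | exact: inK_theta
  | exact: inK_pi | exact: inK_eps
  | exact: (P1 inK_ring) | exact: (P0 inK_ring) | apply: inK_tau
  | apply: (PX inK_ring) | apply: (PM inK_ring) | apply: (PB inK_ring)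
  | apply: (PN inK_ring) | apply: (PD inK_ring)].

Lemma pi_neq0 : pi3 != 0.
Proof.
by rewrite pi_lam mulf_neq0 ?oppr_eq0 ?(unitP_neq0 unit_theta) // expf_neq0 // lam_neq0.
Qed.

Lemma lam_dvd_pi : dvdP inS lam pi3.
Proof.
exists (- theta * lam); last by rewrite pi_lam; ring.
by have h := inKS inK_theta; have h' := inS_lam; pS.
Qed.

Notation pid := (dvdP inK pi3).
Definition tri (r : int) := (r == 0) || (r == 1) || (r == -1).

Lemma dvdKS d x : dvdP inK d x -> dvdP inS d x.
Proof. by move=> [c [Sc _] e]; exists c. Qed.

Lemma pi_nunit : ~ pid 1.
Proof. by move/dvdKS => h; apply: lam_nunit; exact: (dvdP_trans inS_ring) lam_dvd_pi h. Qed.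

Lemma residue_int (n : int) : exists2 r : int, tri r & exists q : int, n = 3 * q + r.
Proof.
have e := divz_eq n 3; have r0 : 0 <= (n %% 3)%Z by apply: modz_ge0.
have r1 : (n %% 3)%Z < 3 by apply: ltz_pmod.
have [h|[h|h]] : (n %% 3)%Z = 0 \/ (n %% 3)%Z = 1 \/ (n %% 3)%Z = 2 by lia.
- by exists 0 => //; exists (n %/ 3)%Z; lia.
- by exists 1 => //; exists (n %/ 3)%Z; lia.
- by exists (-1) => //; exists ((n %/ 3)%Z + 1); lia.
Qed.

Lemma residue_K x : inK x -> exists2 r : int, tri r & exists2 y, inK y & x = r%:~R + pi3 * y.
Proof.
move/K_coord => [a [b [c ->]]].
have [r hr [q e]] := residue_int (a - b + 2 * c).
exists r => //; exists (eps * pi3 ^+ 2 * q%:~R + b%:~R + c%:~R - c%:~R * pi3); first by pK'.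
rewrite theta_lin.
have -> : theta = pi3 - 1 by rewrite /pi3; ring.
have e' : a%:~R - b%:~R + 2 * c%:~R = eps * pi3 ^+ 3 * q%:~R + r%:~R :> algC.
  transitivity ((a - b + 2 * c)%:~R : algC); first by rewrite rmorphD rmorphB rmorphM.
  by rewrite e rmorphD rmorphM /= (eps_pi : 3%:~R = _).
transitivity ((a%:~R - b%:~R + 2 * c%:~R) + pi3 * (b%:~R + c%:~R - c%:~R * pi3)); first by ring.
by rewrite e'; ring.
Qed.

Lemma pid_mulr x : inK x -> pid (pi3 * x).
Proof. by move=> Kx; exists x => //; rewrite mulrC. Qed.

Lemma pid_int (r : int) : tri r -> pid r%:~R -> r = 0.
Proof.
case/orP => [/orP[]|] /eqP -> //; first by move/pi_nunit.
move/(dvdPN inK_ring); rewrite rmorphN1 opprK => /pi_nunit [].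
Qed.

Lemma residue_0 r x y : tri r -> inK y -> x = r%:~R + pi3 * y -> pid x -> r = 0.
Proof.
move=> hr Ky e h; apply: pid_int => //.
have -> : r%:~R = x - pi3 * y by rewrite e addrK.
by apply: (dvdPB inK_ring) => //; exact: pid_mulr.
Qed.

Lemma residue_unit x : inK x -> ~ pid x -> exists2 r : int, (r = 1 \/ r = -1) &
  exists2 y, inK y & x = r%:~R + pi3 * y.
Proof.
move=> Kx nd; have [r hr [y Ky e]] := residue_K Kx; exists r; last by exists y.
case/orP: hr => [/orP[]|] /eqP er; [|by left|by right].
by case: nd; rewrite e er add0r; exact: pid_mulr.
Qed.

Lemma pid_dec x : inK x -> pid x \/ ~ pid x.
Proof.
move=> Kx; have [r hr [y Ky e]] := residue_K Kx.
have [r0|r0] := eqVneq r 0; [left | right].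
  by rewrite e r0 add0r; exact: pid_mulr.
by move/(residue_0 hr Ky e) => h; rewrite h eqxx in r0.
Qed.

Lemma pid_prime x y : inK x -> inK y -> ~ pid x -> ~ pid y -> ~ pid (x * y).
Proof.
move=> Kx Ky nx ny h.
have [r hr [x' Kx' ex]] := residue_unit Kx nx.
have [s hs [y' Ky' ey]] := residue_unit Ky ny.
have : pid ((r * s)%:~R).
  have -> : (r * s)%:~R = x * y - pi3 * (x' * y + r%:~R * y') by rewrite rmorphM /= ex ey; ring.
  by apply: (dvdPB inK_ring) => //; apply: pid_mulr; pK'.
by move/pid_int; case: hr => ->; case: hs => -> /(_ isT).
Qed.

Lemma pid_primeX x n : inK x -> ~ pid x -> ~ pid (x ^+ n).
Proof.
move=> Kx nx; elim: n => [|n IH]; first exact: pi_nunit.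
by rewrite exprS; apply: pid_prime => //; pK'.
Qed.

Lemma pid_addl x y : pid y -> ~ pid x -> ~ pid (x + y).
Proof.
move=> dy nx d; apply: nx; have -> : x = x + y - y by rewrite addrK.
exact: (dvdPB inK_ring).
Qed.

Lemma pi_val x : inK x -> x != 0 -> exists (l : nat) y, [/\ inK y, ~ pid y & x = pi3 ^+ l * y].
Proof.
move=> Kx x0; have [n en] := normM_nat (inKS Kx).
elim/ltn_ind: n x Kx x0 en => n IH x Kx x0 en.
have [[c Kc e]|nd] := pid_dec Kx; last by exists 0%N, x; rewrite expr0 mul1r.
have c0 : c != 0 by apply: contra_neq x0 => c0; rewrite e c0 mul0r.
have [m em] := normM_nat (inKS Kc).
have [k ek] := normM_nat (inKS inK_pi).
have k1 : (1 < k)%N.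
  have [j ej] := normM_nat inS_lam.
  have nl : `|NM lam| ^+ 2 = 3 by rewrite NM_lam -normrX rt3_sq normrN normr_nat.
  have [i ei] := normM_nat (inKS inK_theta).
  have i0 : (0 < i)%N.
    rewrite lt0n; apply/negP => /eqP i0; move/eqP: ei; rewrite i0 sqrf_eq0 normr_eq0 NM_eq0.
    by rewrite (negbTE (unitP_neq0 unit_theta)).
  have : k%:R = (i * 9)%:R :> algC.
    rewrite -ek pi_lam NMM (normrM (NM _) (NM _)) exprMn expr2 NMM (normrM (NM _) (NM _)) exprMn nl natrM -ei.
    have -> : NM (- theta) = - NM theta by rewrite /NM !rmorphN /=; ring.
    by rewrite normrN; ring.
  by move/eqP; rewrite eqr_nat => /eqP ->; lia.
have nm : n = (m * k)%N.
  apply/eqP; rewrite -(eqr_nat algC) -en e NMM (normrM (NM _) (NM _)) exprMn em ek.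
  by rewrite natrM.
have m0 : (0 < m)%N.
  by rewrite lt0n; apply: contra_neq c0 => m0; apply/eqP; rewrite -NM_eq0 -normr_eq0 -sqrf_eq0 em m0.
have [l [y [Sy nd ey]]] := IH m ltac:(by rewrite nm; nia) c Kc c0 em.
by exists l.+1, y; split=> //; rewrite e ey exprSr; ring.
Qed.

Lemma pi_val_uniq a b x y : inK x -> inK y -> ~ pid x -> ~ pid y ->
  pi3 ^+ a * x = pi3 ^+ b * y -> a = b.
Proof.
have main : forall a b x y, inK x -> inK y -> ~ pid x -> pi3 ^+ a * x = pi3 ^+ b * y -> (b <= a)%N.
  move=> {}a {}b {}x {}y Kx Ky nx e; rewrite leqNgt; apply/negP => lt; apply: nx.
  pose k := (b - a).-1; have eb : b = (a + k + 1)%N by rewrite /k; lia.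
  exists (pi3 ^+ k * y); first by pK'.
  by apply: (mulfI (expf_neq0 a pi_neq0)); rewrite e eb !exprD expr1; ring.
move=> Kx Ky nx ny e; apply/eqP; rewrite eqn_leq.
by rewrite (main _ _ _ _ Ky Kx ny (esym e)) (main _ _ _ _ Kx Ky nx e).
Qed.

(** Cubing improves a congruence from [pi3] to [pi3^3], because the binomial coefficient 3 is
    divisible by [pi3^3] and [r^3 = r]. *)
Lemma cube_mod r y : tri r -> inK y -> exists2 w, inK w & (r%:~R + pi3 * y) ^+ 3 = r%:~R + pi3 ^+ 3 * w.
Proof.
move=> hr Ky.
exists (eps * r%:~R ^+ 2 * pi3 * y + eps * r%:~R * pi3 ^+ 2 * y ^+ 2 + y ^+ 3); first by pK'.
have r3 : r%:~R ^+ 3 = r%:~R :> algC by rewrite -rmorphXn; case/orP: hr => [/orP[]|] /eqP ->.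
transitivity (r%:~R ^+ 3 + 3 * (r%:~R ^+ 2 * pi3 * y + r%:~R * pi3 ^+ 2 * y ^+ 2) + pi3 ^+ 3 * y ^+ 3).
  by ring.
by rewrite r3 {1}eps_pi; ring.
Qed.

(* No point of the cubic is [pi]-adically close to the line [V = 0]. *)
Lemma local_obstruction t U V : inK t -> inK U -> inK V ->
  t ^+ 3 + 2 * U ^+ 3 - V ^+ 3 = 3 * t * U * V -> pid V -> ~ pid U -> False.
Proof.
move=> Kt KU KV eq [v Kv eV] nU; rewrite mulrC in eV.
have [u hu [U' KU' eU]] := residue_unit KU nU.
have hu' : tri u by case: hu => ->.
(* Modulo [pi3] the equation reads [t + 2 U = 0], that is [t = U]. *)
have [x Kx et] : exists2 x, inK x & t = U + pi3 * x.
  have [r hr [t' Kt' et]] := residue_K Kt.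
  have [w Kw ew] := cube_mod hr Kt'; have [w' Kw' ew'] := cube_mod hu' KU'.
  have ru : r = u.
    have [d hd [q eq']] := residue_int (r - u).
    have d0 : d = 0.
      apply: pid_int => //.
      have -> : d%:~R = (r - u)%:~R - 3 * q%:~R :> algC by rewrite eq' rmorphD rmorphM /=; ring.
      have -> : (r - u)%:~R - 3 * q%:~R
        = pi3 * (pi3 ^+ 2 * v ^+ 3 + eps * pi3 ^+ 2 * (t * U * V) - pi3 ^+ 2 * w
           - 2 * pi3 ^+ 2 * w' - eps * pi3 ^+ 2 * u%:~R - eps * pi3 ^+ 2 * q%:~R) :> algC.
        have h : r%:~R + 2 * u%:~R = V ^+ 3 + 3 * t * U * V - pi3 ^+ 3 * w - 2 * pi3 ^+ 3 * w' :> algC.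
          by rewrite -eq {1}et {1}eU ew ew'; ring.
        rewrite rmorphB /=; transitivity ((r%:~R + 2 * u%:~R) - 3 * u%:~R - 3 * q%:~R : algC); first by ring.
        rewrite h eV -!mulrA; move: (U * _) => UV; rewrite {1 2 3}eps_pi; ring.
      by apply: pid_mulr; pK'.
    by move: eq'; rewrite d0; case/orP: hr => [/orP[]|] /eqP ->; case: hu => ->; lia.
  exists (t' - U'); first by pK'.
  by rewrite et eU ru; ring.
have [a ha [x' Kx' ex]] := residue_K Kx.
have [b hb [v' Kv' ev]] := residue_K Kv.
have [w1 Kw1 ew1] := cube_mod hu' KU'.
have [w2 Kw2 ew2] := cube_mod ha Kx'.
have [w3 Kw3 ew3] := cube_mod hb Kv'.
(* The equation divided by [pi3^3]. *)
have eqd : eps * U ^+ 3 + x ^+ 3 - v ^+ 3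
   + eps * pi3 * (U ^+ 2 * x + pi3 * U * x ^+ 2 - (U + pi3 * x) * U * v) = 0.
  apply: (mulfI (expf_neq0 3 pi_neq0)); rewrite mulr0.
  transitivity ((U + pi3 * x) ^+ 3 + 2 * U ^+ 3 - (pi3 * v) ^+ 3
     - 3 * (U + pi3 * x) * U * (pi3 * v)); last by rewrite -et -eV eq subrr.
  transitivity (eps * pi3 ^+ 3 * (U ^+ 3 + pi3 * U ^+ 2 * x + pi3 ^+ 2 * U * x ^+ 2
     - pi3 * (U + pi3 * x) * U * v) + pi3 ^+ 3 * (x ^+ 3 - v ^+ 3)); first by ring.
  by rewrite -eps_pi; ring.
pose k := eps * pi3 ^+ 2 - 1.
have ek : eps = - 1 + pi3 ^+ 2 * k.
  by rewrite /k; transitivity (- 1 + pi3 * (eps * pi3 ^+ 3) - pi3 ^+ 2); [rewrite -eps_pi /eps; ring | ring].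
have Kk : inK k by rewrite /k; pK'.
have eU3 : U ^+ 3 = u%:~R + pi3 ^+ 3 * w1 by rewrite eU.
have ex3 : x ^+ 3 = a%:~R + pi3 ^+ 3 * w2 by rewrite ex.
have ev3 : v ^+ 3 = b%:~R + pi3 ^+ 3 * w3 by rewrite ev.
have u2 : u%:~R ^+ 2 = 1 :> algC by rewrite -rmorphXn; case: hu => ->.
pose X := k * (u%:~R + pi3 ^+ 3 * w1) - pi3 * w1 + pi3 * (w2 - w3)
  - ((x' - v') + (2 * u%:~R * U' + pi3 * U' ^+ 2) * (x - v)) - (U * x ^+ 2 - x * U * v)
  + pi3 * k * (U ^+ 2 * x + pi3 * U * x ^+ 2 - (U + pi3 * x) * U * v).
have KX : inK X by rewrite /X; pK'.
(* Here [a], [b], [u] are the residues of [x], [v], [U]. The integer [a - b - u] is divisible by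
   [pi3], hence by 3 and so by [pi3^3]; the next order of this equation then makes [a - b] divisible
   by [pi3], and [u] would vanish. *)
have main : (a - b - u)%:~R = pi3 * ((a - b)%:~R - pi3 * X) :> algC.
  apply/eqP; rewrite -subr_eq0; apply/eqP.
  transitivity ((eps * U ^+ 3 + x ^+ 3 - v ^+ 3
   + eps * pi3 * (U ^+ 2 * x + pi3 * U * x ^+ 2 - (U + pi3 * x) * U * v))
   + pi3 * (u%:~R ^+ 2 - 1) * (x - v)); last by rewrite eqd u2 subrr mulr0 mul0r addr0.
  rewrite eU3 ex3 ev3 /X ek; move: k w1 w2 w3 {Kk Kw1 Kw2 Kw3 ew1 ew2 ew3 eU3 ex3 ev3 X KX ek} => k w1 w2 w3.
  by rewrite eU ex ev !rmorphB /=; ring.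
have pab : pid (a - b)%:~R.
  have [d hd [q eq']] := residue_int (a - b - u).
  have d0 : d = 0.
    apply: pid_int => //; have -> : d%:~R = (a - b - u)%:~R - 3 * q%:~R :> algC.
      by rewrite eq' rmorphD rmorphM /=; ring.
    have -> : 3 * q%:~R = pi3 * (eps * pi3 ^+ 2 * q%:~R) by rewrite {1}eps_pi; ring.
    rewrite main -mulrBr; apply: pid_mulr; pK'.
  have e : (a - b)%:~R = pi3 * (X + eps * pi3 * q%:~R) :> algC.
    apply: (mulfI pi_neq0); transitivity ((a - b - u)%:~R + pi3 ^+ 2 * X : algC); first by rewrite main; ring.
    rewrite eq' d0 addr0 rmorphM /= (eps_pi : 3%:~R = _); ring.
  by rewrite e; apply: pid_mulr; pK'.
have [d hd [q eq']] := residue_int (a - b).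
have d0 : d = 0.
  apply: pid_int => //; have -> : d%:~R = (a - b)%:~R - 3 * q%:~R :> algC.
    by rewrite eq' rmorphD rmorphM /=; ring.
  apply: (dvdPB inK_ring) => //; rewrite eps_pi.
  have -> : eps * pi3 ^+ 3 * q%:~R = pi3 * (eps * pi3 ^+ 2 * q%:~R) by ring.
  by apply: pid_mulr; pK'.
have [d' hd' [q' eq'']] := residue_int (a - b - u).
have d'0 : d' = 0.
  apply: pid_int => //; have -> : d'%:~R = (a - b - u)%:~R - 3 * q'%:~R :> algC.
    by rewrite eq'' rmorphD rmorphM /=; ring.
  apply: (dvdPB inK_ring); first by rewrite main; apply: pid_mulr; pK'.
  have -> : 3 * q'%:~R = pi3 * (eps * pi3 ^+ 2 * q'%:~R) by rewrite {1}eps_pi; ring.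
  by apply: pid_mulr; pK'.
by case: hu eq'' => ->; rewrite d'0 eq' d0; lia.
Qed.

Lemma lam_pid x : inK x -> dvdP inS lam x -> pid x.
Proof.
move=> Kx d; have [r hr [y Ky e]] := residue_K Kx.
suff r0 : r = 0 by rewrite e r0 add0r; exact: pid_mulr.
have dr : dvdP inS lam r%:~R.
  have -> : r%:~R = x - pi3 * y by rewrite e addrK.
  apply: (dvdPB inS_ring) => //; apply: (dvdP_mulr inS_ring); [exact: inKS | exact: lam_dvd_pi].
case/orP: hr => [/orP[]|] /eqP er //; rewrite er in dr; first by case: lam_nunit.
by move/(dvdPN inS_ring): dr; rewrite rmorphN1 opprK => /lam_nunit.
Qed.

Lemma pid_lam x : pid x -> dvdP inS lam x.
Proof. by move/dvdKS => h; exact: (dvdP_trans inS_ring) lam_dvd_pi h. Qed.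

Lemma conj_rt3 : rt3^* = - rt3.
Proof.
rewrite /rt3 rmorphB rmorphXn /= conj_omega.
by apply: (@omega_red _ _ (omega - omega ^+ 2)); ring.
Qed.

(** [pi3] has valuation 2 at [lam], whereas [zeta^i - r] has valuation at most 1 when 3 does not
    divide [i]. The proof compares [|NM|^2], which is 9 for [pi3] and 1 or 3 for the difference. *)
Lemma zeta_mod_pi i (r : int) : (r = 1 \/ r = -1) -> dvdP inS pi3 (zeta ^+ i - r%:~R) -> (3 %| i)%N.
Proof.
move=> hr; have [q [i0 [-> li]]] := mod3 i => d.
have o1 : forall m, dvdP inS pi3 (omega ^+ m - 1).
  elim=> [|m IH]; first by rewrite expr0 subrr; exact: (dvdP0 inS_ring).
  have -> : omega ^+ m.+1 - 1 = omega * (omega ^+ m - 1) - (1 - omega) by rewrite exprS; ring.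
  apply: (dvdPB inS_ring); last exact: pi_dvd_1w.
  by apply: (dvdP_mull inS_ring) => //; pS.
have d0 : dvdP inS pi3 (zeta ^+ i0 - r%:~R).
  have -> : zeta ^+ i0 - r%:~R = (zeta ^+ (3 * q + i0) - r%:~R) - zeta ^+ i0 * (omega ^+ q - 1).
    by rewrite exprD exprM zeta3; ring.
  apply: (dvdPB inS_ring) => //; apply: (dvdP_mull inS_ring) => //; by pS.
have np : `|NM pi3| ^+ 2 = 9.
  rewrite pi_lam NMM expr2 NMM NM_lam.
  have -> : NM (- theta) = 1.
    transitivity (- (theta * tau theta * tau (tau theta))); first by rewrite /NM !rmorphN /=; ring.
    by rewrite thetaM opprK.
  have -> : rt3 * rt3 = - 3 by rewrite -expr2 rt3_sq.
  by rewrite mul1r normrN normr_nat; ring.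
have key : forall x n, NM x = n -> `|n| ^+ 2 = 1 \/ `|n| ^+ 2 = 3 -> ~ dvdP inS pi3 x.
  move=> x n nx hn [c Sc e]; have [m em] := normM_nat Sc.
  have h9 : `|n| ^+ 2 = (9 * m)%:R.
    by rewrite -nx e NMM (normrM (NM _) (NM _)) exprMn em np natrM mulrC.
  case: hn; rewrite h9 => /eqP; first by rewrite pnatr_eq1 => /eqP; lia.
  by rewrite eqr_nat => /eqP; lia.
have i01 : i0 = 0%N \/ i0 = 1%N \/ i0 = 2%N by lia.
have nE (a b : int) n x : x = a%:~R + b%:~R * omega -> a ^+ 2 - a * b + b ^+ 2 = n -> `|x| ^+ 2 = n%:~R :> algC.
  by move=> -> <-; exact: normE.
case: i01 => [->|i01]; first by rewrite addn0 dvdn_mulr.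
have hz : NM (zeta - r%:~R) = (- r%:~R) ^+ 3 + omega.
  have -> : zeta - r%:~R = (- r%:~R) + 1 * zeta + 0 * zeta ^+ 2 by ring.
  by rewrite NME; [ring | pE..].
have hz2 : NM (zeta ^+ 2 - r%:~R) = (- r%:~R) ^+ 3 + omega ^+ 2.
  have -> : zeta ^+ 2 - r%:~R = (- r%:~R) + 0 * zeta + 1 * zeta ^+ 2 by ring.
  by rewrite NME; [ring | pE..].
exfalso; case: i01 => ei; rewrite ei in d0.
  rewrite expr1 in d0; apply: key hz _ d0; case: hr => ->; [right|left].
    by apply: (nE (-1) 1 3) => //; ring.
  by apply: (nE 1 1 1) => //; ring.
apply: key hz2 _ d0; case: hr => ->; [right|left].
  by apply: (nE (-2) (-1) 3) => //; rewrite omegaE; ring.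
by apply: (nE 0 (-1) 1) => //; rewrite omegaE; ring.
Qed.

(** [rt3] is the product of the conjugates of [lam], and each of them divides [lam]. *)
Lemma coprime_rt3 y : inS y -> coprimeP inS y lam -> coprimeP inS y rt3.
Proof.
move=> Sy co.
have lt : lam = - tau theta * tau lam := tau_lam.
have d1' : dvdP inS (tau lam) lam.
  by exists (- tau theta) => //; have Kt := inKS inK_theta; pS.
have d2' : dvdP inS (tau (tau lam)) (tau lam).
  exists (- tau (tau theta)); first by have Kt := inKS inK_theta; pS.
  by rewrite {1}lt rmorphM rmorphN.
have Sl := inS_lam.
have co1 := coprime_dvdr inS_ring d1' co.
have co2 := coprime_dvdr inS_ring d2' co1.
rewrite -NM_lam /NM; apply: (coprimePM inS_ring) => //; try by pS.
by apply: (coprimePM inS_ring) => //; pS.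
Qed.

Lemma coprime_1w y : inS y -> coprimeP inS y lam -> coprimeP inS y (1 - omega).
Proof.
move=> Sy co; apply: (coprime_dvdr inS_ring) (coprime_rt3 Sy co).
by exists omega; [pS | rewrite /rt3; ring].
Qed.

Lemma dvd_unit d : inS d -> dvdP inS d 1 -> unitP inS d.
Proof. by move=> Sd [c Sc e]; exists c. Qed.

Lemma coprime_common h x y : inS h -> dvdP inS h x -> dvdP inS h y -> coprimeP inS x y -> unitP inS h.
Proof.
move=> Sh hx hy [a [b [Sa Sb e]]]; apply: dvd_unit => //; rewrite -e.
by apply: (dvdPD inS_ring); apply: (dvdP_mull inS_ring).
Qed.

(** Cubing turns a congruence modulo [lam] into one modulo [pi3], since 3 and [lam^2] are multiples
    of [pi3]. *)
Lemma cubeS_mod c : inS c -> exists2 r : int, tri r & dvdP inS pi3 (c ^+ 3 - r%:~R) /\ dvdP inS lam (c - r%:~R).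
Proof.
move=> Sc; have [r hr d] := residue_S Sc; exists r => //; split=> //.
case: d => m Sm e.
have Sl := inS_lam; have St := inKS inK_theta.
have dl : dvdP inS pi3 (lam ^+ 2).
  have [f Sf [_ ef]] := unit_theta; exists (- f) => //; first by pS.
  by rewrite pi_lam mulrA mulrNN ef mul1r.
have d3 : dvdP inS pi3 3.
  exists (eps * pi3 ^+ 2); first by have a1 := inKS inK_eps; have a2 := inKS inK_pi; pS.
  by rewrite {1}eps_pi; ring.
have r3 : r%:~R ^+ 3 = r%:~R :> algC by rewrite -rmorphXn; case/orP: hr => [/orP[]|] /eqP ->.
have -> : c ^+ 3 - r%:~R = (r%:~R ^+ 2 * m * lam + r%:~R * m ^+ 2 * lam ^+ 2) * 3 + m ^+ 3 * lam * lam ^+ 2.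
  transitivity (c ^+ 3 - r%:~R ^+ 3); first by rewrite r3.
  have -> : c = m * lam + r%:~R by rewrite -e subrK.
  by ring.
by apply: (dvdPD inS_ring); apply: (dvdP_mull inS_ring) => //; pS.
Qed.

Lemma eps_unit : eps * (pi3 ^+ 2 - 1) = 1.
Proof.
apply: (mulfI (expf_neq0 3 pi_neq0)); rewrite mulr1 mulrA [_ * eps]mulrC -eps_pi /pi3.
by apply: (@theta_red _ _ (- 1)); ring.
Qed.

Lemma pi3_3 : pi3 ^+ 3 = 3 * (pi3 ^+ 2 - 1).
Proof. by rewrite {1}eps_pi mulrAC eps_unit mul1r. Qed.

Lemma unit_K_inv x : inK x -> unitP inS x -> inK x^-1.
Proof. by move=> [Sx ex] ux; split; [exact: unitP_inv | rewrite fmorphV /= ex]. Qed.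

Lemma pid_unit x : inK x -> unitP inS x -> ~ pid x.
Proof.
move=> Kx ux d; apply: pi_nunit.
have -> : 1 = x^-1 * x by rewrite mulVf // (unitP_neq0 ux).
by apply: (dvdP_mull inK_ring) => //; exact: unit_K_inv.
Qed.

(** * Descent on a twisted cubic over the real cubic field *)

(** In [L0 = t - U - V] the cubic has lower coefficients [3 (U + V)], [3 (U^2 + U V + V^2)] and
    [3 U^3]. Its Newton polygon at [pi3] allows only the valuations [3/2] and [3 u] for [L0]; the
    first is not an integer, so [L0] has valuation [3 u] and is divisible by 3. *)
Lemma stepA_val t U V u U1 : inK t -> inK U -> inK V -> inK U1 ->
  t ^+ 3 + 2 * U ^+ 3 - V ^+ 3 = 3 * t * U * V -> ~ pid V ->
  U = pi3 ^+ u * U1 -> ~ pid U1 -> (0 < u)%N ->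
  exists2 L, inK L & [/\ t - U - V = 3 * L &
    9 * L ^+ 3 + 9 * (U + V) * L ^+ 2 + 3 * (U ^+ 2 + U * V + V ^+ 2) * L + U ^+ 3 = 0].
Proof.
move=> Kt KU KV KU1 eq nV eU nU1 u0.
pose L0 := t - U - V.
have KL0 : inK L0 by rewrite /L0; pK'.
have eqL : L0 ^+ 3 + 3 * (U + V) * L0 ^+ 2 + 3 * (U ^+ 2 + U * V + V ^+ 2) * L0 + 3 * U ^+ 3 = 0.
  transitivity (t ^+ 3 + 2 * U ^+ 3 - V ^+ 3 - 3 * t * U * V); last by rewrite eq subrr.
  by rewrite /L0; ring.
have U10 : U1 != 0 by apply/eqP => h; apply: nU1; rewrite h; exact: (dvdP0 inK_ring).
have U0 : U != 0 by rewrite eU mulf_neq0 // expf_neq0 // pi_neq0.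
have L00 : L0 != 0.
  apply/eqP => h; move/eqP: eqL; rewrite h !expr0n !mulr0 !add0r mulf_eq0 pnatr_eq0 /=.
  by rewrite expf_eq0 (negbTE U0).
have [l [l1 [Kl1 nl1 el]]] := pi_val KL0 L00.
have dU : pid U by rewrite eU; case: u u0 {eU} => // u _; exists (pi3 ^+ u * U1); [pK' | rewrite exprS; ring].
pose W := U ^+ 2 + U * V + V ^+ 2.
have KW : inK W by rewrite /W; pK'.
have nW : ~ pid W.
  rewrite /W addrC; apply: pid_addl; last exact: pid_primeX.
  have -> : U ^+ 2 + U * V = (U + V) * U by ring.
  by apply: (dvdP_mull inK_ring) => //; pK'.
have neps : ~ pid eps.
  move=> h; apply: pi_nunit; rewrite -eps_unit; apply: (dvdP_mulr inK_ring) => //.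
  by pK'.
have bad : forall Y, inK Y -> l1 ^+ 3 = pi3 * Y -> False.
  by move=> Y KY e; apply: (pid_primeX (n := 3) Kl1 nl1); rewrite e; exact: pid_mulr.
(* With valuation 0 or 1 the cube of [L0] would be the only term of least valuation. *)
have l2 : (1 < l)%N.
  case: l el => [|[|l]] el //; exfalso.
    rewrite expr0 mul1r in el; rewrite el in eqL.
    apply: (bad (- (eps * pi3 ^+ 2 * ((U + V) * l1 ^+ 2 + W * l1 + U ^+ 3)))); first by pK'.
    transitivity (- (3 * ((U + V) * l1 ^+ 2 + W * l1 + U ^+ 3))); last by rewrite {1}eps_pi; ring.
    by apply/eqP; rewrite -subr_eq0 opprK -[X in _ == X]eqL /W; apply/eqP; ring.
  rewrite expr1 in el; rewrite el in eqL.
  case: dU => U' KU' eU'.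
  apply: (bad (- (eps * ((U + V) * pi3 * l1 ^+ 2 + W * l1 + pi3 ^+ 2 * U' ^+ 3)))); first by pK'.
  apply: (mulfI (expf_neq0 3 pi_neq0)).
  transitivity (- (eps * pi3 ^+ 3) * ((U + V) * pi3 ^+ 2 * l1 ^+ 2 + pi3 * W * l1 + (U' * pi3) ^+ 3)); last by ring.
  rewrite -eps_pi -eU' /W; apply/eqP; rewrite -subr_eq0 -[X in _ == X]eqL; apply/eqP; ring.
have l3u : l = (3 * u)%N.
  pose m := (l - 2)%N; have em : l = m.+2 by rewrite /m; lia.
  pose Z := pi3 ^+ (2 * m) * l1 ^+ 3 * 1 + eps * (U + V) * pi3 ^+ (m.+1) * l1 ^+ 2.
  have KZ : inK Z by rewrite /Z; pK'.
  have e : pi3 ^+ l * (eps * W * l1 + pi3 * Z) = pi3 ^+ (3 * u) * (- eps * U1 ^+ 3).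
    have A1 : pi3 ^+ 3 * pi3 ^+ l * pi3 * pi3 ^+ (2 * m) = (pi3 ^+ l) ^+ 3.
      by rewrite -exprD -exprSr -exprD -exprM; congr (_ ^+ _); lia.
    have A2 : pi3 * pi3 ^+ m.+1 = pi3 ^+ l by rewrite -exprS em.
    have A3 : pi3 ^+ (3 * u) * U1 ^+ 3 = U ^+ 3 by rewrite eU exprMn -exprM mulnC.
    apply: (mulfI (expf_neq0 3 pi_neq0)); apply/eqP; rewrite -subr_eq0 -[X in _ == X]eqL el; apply/eqP.
    transitivity (pi3 ^+ 3 * pi3 ^+ l * pi3 * pi3 ^+ (2 * m) * l1 ^+ 3
      + (eps * pi3 ^+ 3) * (W * pi3 ^+ l * l1 + (U + V) * (pi3 ^+ l * (pi3 * pi3 ^+ m.+1)) * l1 ^+ 2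
         + pi3 ^+ (3 * u) * U1 ^+ 3)).
      by rewrite /Z; ring.
    by rewrite -eps_pi A1 A2 A3 /W; ring.
  apply: pi_val_uniq e; try by pK'.
  - apply: pid_addl; first exact: pid_mulr.
    by apply: pid_prime => //; [pK' | apply: pid_prime => //; exact: inK_eps].
  - have -> : - eps * U1 ^+ 3 = (- 1) * (eps * U1 ^+ 3) by ring.
    apply: pid_prime; [by pK'|by pK'|by move/(dvdPN inK_ring); rewrite opprK; exact: pi_nunit|].
    by apply: pid_prime => //; [exact: inK_eps | pK' | exact: pid_primeX].
exists ((pi3 ^+ 2 - 1) * (pi3 ^+ (l - 3) * l1)); first by pK'.
have eL : L0 = 3 * ((pi3 ^+ 2 - 1) * (pi3 ^+ (l - 3) * l1)).
  rewrite mulrA -pi3_3 mulrA -exprD el; congr (_ ^+ _ * _); lia.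
split=> //.
move: eqL; rewrite {1 2 3}eL; set L := (pi3 ^+ 2 - 1) * _ => h.
apply: (mulfI (x := 3)); first by rewrite pnatr_eq0.
by rewrite mulr0 -h; ring.
Qed.

Lemma inS_rt3 : inS rt3. Proof. by rewrite /rt3; pS. Qed.

Lemma dvdS_1w2 d : dvdP inS d (1 - omega) -> dvdP inS d (1 - omega ^+ 2).
Proof.
move=> h; have -> : 1 - omega ^+ 2 = (1 + omega) * (1 - omega) by ring.
by apply: (dvdP_mull inS_ring) => //; pS.
Qed.

(** Modulo [pi3] the real numbers [rho] and [V] and the cube of [c] are all 1 or -1, so [zeta^i] is
    as well and [zeta_mod_pi] applies. *)
Lemma residue_zeta i rho c V : inK rho -> ~ pid rho -> inS c -> inK V -> ~ pid V ->
  ~ dvdP inS lam c -> dvdP inS pi3 (zeta ^+ i * rho * c ^+ 3 - V) -> (3 %| i)%N.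
Proof.
move=> Kr nr Sc KV nV nc d.
have [r1 h1 [a Ka e1]] := residue_unit Kr nr.
have [r2 h2 [b Kb e2]] := residue_unit KV nV.
have [r3 h3 [[b3 Sb3 e3] d3]] := cubeS_mod Sc.
have {}h3 : r3 = 1 \/ r3 = -1.
  case/orP: h3 => [/orP[]|] /eqP er; [|by left|by right].
  by case: nc; move: d3; rewrite er subr0.
have Sa := inKS Ka; have Sb := inKS Kb; have Sp := inKS inK_pi.
apply: (@zeta_mod_pi i (r1 * r2 * r3)).
  by case: h1 h2 h3 => -> [] -> [] ->; rewrite ?mul1r ?mulr1 ?mulrN1 ?opprK; auto.
have q : forall r : int, (r = 1 \/ r = -1) -> r%:~R ^+ 2 = 1 :> algC.
  by move=> r [] ->; rewrite -rmorphXn.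
have e3' : c ^+ 3 = r3%:~R + b3 * pi3 by rewrite -e3; ring.
have -> : zeta ^+ i - (r1 * r2 * r3)%:~R
  = r1%:~R * r3%:~R * (zeta ^+ i * rho * c ^+ 3 - V)
    - (r1%:~R * r3%:~R) * (zeta ^+ i * (r1%:~R * b3 + a * c ^+ 3) - b) * pi3.
  rewrite e2 e3' e1 !rmorphM /=.
  have := q _ h1; have := q _ h3; move: (r1%:~R) (r3%:~R) (r2%:~R) => x y w y2 x2.
  transitivity (zeta ^+ i * (x ^+ 2 * y ^+ 2) - x * w * y); first by rewrite x2 y2; ring.
  ring.
apply: (dvdPB inS_ring); first by apply: (dvdP_mull inS_ring) => //; pS.
by exists (r1%:~R * r3%:~R * (zeta ^+ i * (r1%:~R * b3 + a * c ^+ 3) - b)) => //; pS.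
Qed.

(** First descent map. Over Z[zeta] the equation for [L] says that [- U^3] is the product of [3 L],
    [M] and the conjugate of [M]. [M] is coprime to the other two, so it is a unit times a cube; as
    [M = V] modulo [pi3], the power of [zeta] in that unit is a cube and the unit may be taken real.
    The remaining factor [3 L] is then the same unit times [c0^3], and the linear relation [rel3]
    becomes the equation in [c0] and [c1]. *)
Lemma stepA t U V u U1 : inK t -> inK U -> inK V -> inK U1 ->
  t ^+ 3 + 2 * U ^+ 3 - V ^+ 3 = 3 * t * U * V -> coprimeP inS U V ->
  U = pi3 ^+ u * U1 -> ~ pid U1 -> (0 < u)%N ->
  exists c0 c1 rho, [/\ inK c0, inS c1, (inK rho /\ unitP inS rho) &
   [/\ ~ dvdP inS lam c1, coprimeP inS c1 c1^*, U = - rho * c0 * (c1 * c1^*) &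
       c0 ^+ 3 + rt3 * (c1 ^+ 3 - c1^* ^+ 3) = 3 * c0 * (c1 * c1^*)]].
Proof.
move=> Kt KU KV KU1 eq coUV eU nU1 u0.
have dU : pid U by rewrite eU; case: u u0 {eU} => // u _; exists (pi3 ^+ u * U1); [pK' | rewrite exprS; ring].
have nV : ~ pid V.
  move=> dV; have Sl := inS_lam.
  have [f Sf [_ e]] := coprime_common Sl (pid_lam dU) (pid_lam dV) coUV.
  by apply: lam_nunit; exists f.
have [L KL [eL eqL]] := stepA_val Kt KU KV KU1 eq nV eU nU1 u0.
have U10 : U1 != 0 by apply/eqP => h; apply: nU1; rewrite h; exact: (dvdP0 inK_ring).
have U0 : U != 0 by rewrite eU mulf_neq0 // expf_neq0 // pi_neq0.
have SU := inKS KU; have SV := inKS KV; have SL := inKS KL; have Srt := inS_rt3.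
(* A linear factor over Z[omega] of [3 L^2 + 3 (U + V) L + U^2 + U V + V^2]; the conjugate is the
   other one. *)
pose M := V - omega ^+ 2 * U + (1 - omega ^+ 2) * L.
have SM : inS M by rewrite /M; pS.
have eMc : M^* = V - omega * U + (1 - omega) * L.
  have o4 : omega ^+ 4 = omega by rewrite (exprD _ 3 1) omega3 mul1r.
  have cw2 : (omega ^+ 2)^* = omega by rewrite rmorphXn /= conj_omega -exprM o4.
  have gen : forall w : algC, (V - w * U + (1 - w) * L)^* = V - w^* * U + (1 - w^*) * L.
    move=> w; rewrite rmorphD rmorphB !(rmorphM, rmorphB) /= rmorph1.
    by case: KU KV KL => _ -> [_ ->] [_ ->].
  by rewrite /M gen cw2.
have SMc : inS M^* by pS.
have prodM : M * (- (M^* * (3 * L))) = U ^+ 3.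
  apply/eqP; rewrite -subr_eq0 -oppr_eq0 -[X in _ == X]eqL eMc /M; apply/eqP.
  apply: (@omega_red _ _ (- 3 * L * U * V - 3 * L * U ^+ 2 + 3 * L * U ^+ 2 * omega - 9 * L ^+ 2 * U + 6 * L ^+ 2 * U * omega - 3 * L ^+ 2 * V + 3 * L ^+ 3 * omega - 6 * L ^+ 3)).
  by ring.
have rel1 : (1 - omega) * M - (1 - omega ^+ 2) * M^* = - (rt3 * (V - U)).
  by rewrite eMc /M /rt3; ring.
have rel2 : (1 - omega) * M = (1 - omega) * (V - omega ^+ 2 * U) + 3 * L.
  by apply: (@omega_red _ _ (L * omega - 2 * L)); rewrite /M; ring.
have rel3 : 3 * L + rt3 * (M - M^*) = - 3 * U.
  by rewrite eMc /M /rt3; apply: (@omega_red _ _ (- 3 * L * omega + L * omega ^+ 2 + 3 * L - 3 * U * omega + U * omega ^+ 2 + 3 * U)); ring.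
have MV : dvdP inS pi3 (M - V).
  have -> : M - V = (- omega ^+ 2) * U + L * (1 - omega ^+ 2) by rewrite /M; ring.
  apply: (dvdPD inS_ring); apply: (dvdP_mull inS_ring); try by pS.
    exact: dvdKS.
  by apply: dvdS_1w2; exact: pi_dvd_1w.
have nM : ~ dvdP inS lam M.
  move=> d; apply: nV; apply: lam_pid => //.
  have -> : V = M - (M - V) by ring.
  by apply: (dvdPB inS_ring) => //; apply: (dvdP_trans inS_ring) MV; exact: lam_dvd_pi.
(* A divisor [d] of [M] is prime to [lam] and divides [U^3]. Either alternative gives [V = w U]
   modulo [d], and as [U] and [V] are coprime, [d] is a unit. *)
have coM : forall d x, inS d -> dvdP inS d M -> dvdP inS d x -> inS x ->
    (dvdP inS d ((1 - omega) * (V - omega ^+ 2 * U)) \/ dvdP inS d (rt3 * (V - U))) -> unitP inS d.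
  move=> d x Sd dM dx Sx h.
  have col : coprimeP inS d lam.
    by apply: (coprime_dvdl inS_ring) dM _; exact: lam_coprime.
  have dU3 : dvdP inS d (U ^+ 3).
    by rewrite -prodM; apply: (dvdP_mulr inS_ring) => //; pS.
  have h2 : exists2 w, inS w & dvdP inS d (V - w * U).
    case: h => h; [exists (omega ^+ 2); first by pS| exists 1; first by pS].
      by apply: gaussP h; [exact: inS_ring | pS | pS | exact: coprime_1w].
    rewrite mul1r; apply: gaussP h; [exact: inS_ring | pS | pS | exact: coprime_rt3].
  case: h2 => w Sw dV.
  have coU : coprimeP inS d U.
    apply: (gcdP_coprime inS_ring bezS) => // g Sg gd gU.
    apply: (@coprime_common g U V) => //.
    have -> : V = (V - w * U) + w * U by ring.
    apply: (dvdPD inS_ring); first exact: (dvdP_trans inS_ring) gd dV.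
    exact: (dvdP_mull inS_ring).
  have coU3 : coprimeP inS d (U ^+ 3) by apply: (coprimePX inS_ring).
  by apply: (unit_coprime inS_ring Sd _ coU3 dU3); pS.
have coMMc : coprimeP inS M M^*.
  apply: (gcdP_coprime inS_ring bezS) => // d Sd d1 d2.
  apply: (coM d _ Sd d1 d2) => //; right.
  have -> : rt3 * (V - U) = - ((1 - omega) * M - (1 - omega ^+ 2) * M^*) by rewrite rel1 opprK.
  by apply: (dvdPN inS_ring); apply: (dvdPB inS_ring); apply: (dvdP_mull inS_ring) => //; pS.
have coM3L : coprimeP inS M (3 * L).
  apply: (gcdP_coprime inS_ring bezS) => //; first by pS.
  move=> d Sd d1 d2; apply: (coM d _ Sd d1 d2); first by pS.
  left; have -> : (1 - omega) * (V - omega ^+ 2 * U) = (1 - omega) * M - 3 * L by rewrite rel2; ring.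
  by apply: (dvdPB inS_ring) => //; apply: (dvdP_mull inS_ring) => //; pS.
have coMN : coprimeP inS M (- (M^* * (3 * L))).
  apply: (coprime_dvdr inS_ring) (_ : coprimeP inS M (M^* * (3 * L))).
    by exists (-1); [pS | ring].
  by apply: (coprimePM inS_ring) => //; pS.
have SN : inS (- (M^* * (3 * L))) by pS.
have [e [d [ue Sd eM]]] := coprime_cube inS_ring bezS SM SN SU coMN prodM.
have [i [j [k [c [uc _ _ ee]]]]] := units_mod_cubes3 ue.
have Sc := unitP_P uc.
pose rho := theta ^+ j * tau theta ^+ k.
have Kr : inK rho by rewrite /rho; pK.
have ur : unitP inS rho.
  by apply: (unitPM inS_ring); apply: unitPX; [|apply: unit_tau]; exact: unit_theta.
have eM2 : M = zeta ^+ i * rho * (c * d) ^+ 3 by rewrite eM ee /rho exprMn; ring.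
have ncd : ~ dvdP inS lam (c * d).
  move=> h; apply: nM; rewrite eM2 exprS mulrA; apply: (dvdP_mulr inS_ring); first by pS.
  apply: (dvdP_mull inS_ring) => //; have := inKS Kr; move=> ?; pS.
have /dvdnP[q ei] : (3 %| i)%N.
  apply: (@residue_zeta i rho (c * d) V) => //; [exact: pid_unit | pS | by rewrite -eM2].
pose c1 := zeta ^+ q * (c * d).
have Sc1 : inS c1 by rewrite /c1; pS.
have eM3 : M = rho * c1 ^+ 3 by rewrite eM2 /c1 [(zeta ^+ q * _) ^+ 3]exprMn -exprM -ei; ring.
have eMc3 : M^* = rho * c1^* ^+ 3 by rewrite eM3 rmorphM rmorphXn /= (proj2 Kr).
have M0 : M != 0 by apply/eqP => h; apply: nM; rewrite h; exact: (dvdP0 inS_ring).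
have r0 := unitP_neq0 ur.
have c10 : c1 != 0 by apply: contra_neq M0 => h; rewrite eM3 h expr0n mulr0.
have c1c0 : c1^* != 0 by rewrite conjC_eq0.
pose N := c1 * c1^*; have KN : inK N by exact: inK_norm.
have N0 : N != 0 by rewrite mulf_neq0.
have ec0 : (- U / (rho * N)) ^+ 3 = 3 * L / rho.
  have -> : (- U / (rho * N)) ^+ 3 = - (U ^+ 3) / (rho ^+ 3 * N ^+ 3).
    by rewrite expr_div_n exprMn exprNn; congr (_ / _); ring.
  rewrite -prodM eMc3 eM3 /N (exprMn 3 c1 c1^*).
  have fld : forall l r a b : algC, r != 0 -> a != 0 -> b != 0 ->
      - (r * a ^+ 3 * - (r * b ^+ 3 * l)) / (r ^+ 3 * (a ^+ 3 * b ^+ 3)) = l / r.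
    by move=> l r a b ???; field; apply/and3P.
  exact: fld.
pose c0 := - U / (rho * N).
have Kc0 : inK c0.
  apply: (cube_closed inK_ring bezK); [by pK|by pK|by rewrite mulf_neq0|].
  rewrite ec0; have := unit_K_inv Kr ur; move=> ?; pK.
have eU0 : U = - rho * c0 * N.
  have fld : forall x r n : algC, r != 0 -> n != 0 -> x = - r * (- x / (r * n)) * n.
    by move=> x r n ??; field; apply/andP.
  exact: fld.
exists c0, c1, rho; split=> //; split=> //.
- move=> h; apply: nM; rewrite eM3 exprS mulrCA; apply: (dvdP_mulr inS_ring) => //.
  have := inKS Kr; move=> ?; pS.
- have Sr := inKS Kr.
  apply: (coprime_dvdl inS_ring) (_ : coprimeP inS M c1^*).
    by exists (rho * c1 ^+ 2); [pS | rewrite eM3; ring].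
  apply: (coprime_dvdr inS_ring) coMMc.
  by exists (rho * c1^* ^+ 2); [pS | rewrite eMc3; ring].
apply: (mulfI r0); rewrite mulrDr [in LHS]ec0 -/N.
transitivity (3 * L + rt3 * (M - M^*)).
  have e3 : rho * (3 * L / rho) = 3 * L by rewrite mulrC divfK.
  by rewrite e3 eMc3 eM3; ring.
by rewrite rel3 [in LHS]eU0; ring.
Qed.

Lemma epsM : exists2 k, inK k & eps = - 1 + pi3 ^+ 2 * k.
Proof.
exists (eps * pi3 ^+ 2 - 1); first by pK'.
by transitivity (- 1 + pi3 * (eps * pi3 ^+ 3) - pi3 ^+ 2); [rewrite -eps_pi /eps; ring | ring].
Qed.

Lemma neps : ~ pid eps.
Proof.
move=> h; apply: pi_nunit; rewrite -eps_unit; apply: (dvdP_mulr inK_ring) => //.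
by pK'.
Qed.

Lemma pid_cube x : inK x -> pid (x ^+ 3) -> pid x.
Proof. by move=> Kx; have [|n] := pid_dec Kx => // /(pid_primeX (n := 3) Kx n). Qed.

Lemma pid_cube_of x y : inK x -> inK y -> x ^+ 3 = pi3 * y -> exists2 z, inK z & x = pi3 * z.
Proof.
move=> Kx Ky e; have [|c Kc ->] := pid_cube Kx; first by rewrite e; exact: pid_mulr.
by exists c => //; rewrite mulrC.
Qed.

Lemma tri_pid_sub r s (X : algC) : tri r -> tri s -> inK X -> r%:~R = s%:~R + pi3 * X -> r = s.
Proof.
move=> hr hs KX e; have [d hd [q eq']] := residue_int (r - s).
have d0 : d = 0.
  apply: pid_int => //; have -> : d%:~R = (r - s)%:~R - 3 * q%:~R :> algC.
    by rewrite eq' rmorphD rmorphM /=; ring.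
  have -> : (r - s)%:~R = pi3 * X :> algC by rewrite rmorphB /= e; ring.
  have -> : 3 * q%:~R = pi3 * (eps * pi3 ^+ 2 * q%:~R) by rewrite {1}eps_pi; ring.
  by rewrite -mulrBr; apply: pid_mulr; pK'.
by move: eq'; rewrite d0; case/orP: hr => [/orP[]|] /eqP ->; case/orP: hs => [/orP[]|] /eqP ->; lia.
Qed.

(** The factors 3 and 9 force [pi3] into [y], and each division by [pi3] improves the next
    congruence. Valuations 1 and 2 of [c0] are excluded on the way. At the end [z^3 = z] and
    [eps^2 N = 1] modulo [pi3] cancel [z] and leave [c] divisible by [pi3], so that [c0] has
    valuation at least 4. *)
Lemma y_val c0 y N u C : inK c0 -> inK y -> inK N -> inK C -> pid (N - 1) ->
  c0 = pi3 ^+ u * C -> ~ pid C -> (0 < u)%N -> y ^+ 3 = 3 * c0 ^+ 3 + 9 * N * (y - c0) ->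
  exists z c, [/\ inK z, inK c, y = pi3 ^+ 3 * z, c0 = pi3 ^+ 3 * c & pid c].
Proof.
move=> Kc0 Ky KN KC [n Kn eN] ec0 nC u0 eq.
have {}eN : N = 1 + pi3 * n by rewrite -[LHS](subrK 1) eN; ring.
have [k Kk ek] := epsM.
have p3 : pi3 ^+ 3 != 0 by rewrite expf_neq0 // pi_neq0.
have e9 : 9 = eps ^+ 2 * pi3 ^+ 6.
  by transitivity ((3 : algC) ^+ 2); [ring | rewrite eps_pi; ring].
have eq1 : y ^+ 3 = eps * pi3 ^+ 3 * c0 ^+ 3 + eps ^+ 2 * pi3 ^+ 6 * N * (y - c0).
  by rewrite eq -eps_pi -e9.
have [y1 Ky1 ey] := @pid_cube_of y (eps * pi3 ^+ 2 * c0 ^+ 3 + eps ^+ 2 * pi3 ^+ 5 * N * (y - c0)) Ky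
   ltac:(pK') ltac:(rewrite eq1; ring).
case: u u0 ec0 => // u _ ec0.
pose C1 := pi3 ^+ u * C; have KC1 : inK C1 by rewrite /C1; pK'.
have ec1 : c0 = pi3 * C1 by rewrite ec0 /C1 exprS; ring.
have eq2 : y1 ^+ 3 = eps * pi3 ^+ 3 * C1 ^+ 3 + eps ^+ 2 * pi3 ^+ 4 * N * (y1 - C1).
  by apply: (mulfI p3); move: eq1; rewrite ey ec1 => h; rewrite -exprMn h; ring.
have [y2 Ky2 ey2] := @pid_cube_of y1 (eps * pi3 ^+ 2 * C1 ^+ 3 + eps ^+ 2 * pi3 ^+ 3 * N * (y1 - C1)) Ky1
   ltac:(pK') ltac:(rewrite eq2; ring).
have eq3 : y2 ^+ 3 = eps * C1 ^+ 3 + eps ^+ 2 * pi3 * N * (pi3 * y2 - C1).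
  by apply: (mulfI p3); move: eq2; rewrite ey2 => h; rewrite -exprMn h; ring.
(* Valuation 1: to lowest order [y2 = - C] is consistent, and the contradiction appears one order
   further. *)
case: u ec0 @C1 KC1 ec1 eq2 eq3 => [|u] ec0 C1 KC1 ec1 eq2 eq3.
  exfalso; have eC : C1 = C by rewrite /C1 expr0 mul1r.
  rewrite {}eC in eq3.
  have [r hr [C' KC' eC]] := residue_unit KC nC.
  have hr' : tri r by case: hr => ->.
  have [s hs [y' Ky' ey']] := residue_K Ky2.
  have [w1 Kw1 ew1] := cube_mod hr' KC'; have [w2 Kw2 ew2] := cube_mod hs Ky'.
  pose X := pi3 * k * C ^+ 3 - pi3 ^+ 2 * w1 - pi3 ^+ 2 * w2 + eps ^+ 2 * N * (pi3 * y2 - C).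
  have KX : inK X by rewrite /X; pK'.
  have e1 : s%:~R = - r%:~R + pi3 * X :> algC.
    have -> : s%:~R = y2 ^+ 3 - pi3 ^+ 3 * w2 by rewrite ey' ew2; ring.
    have C3 : C ^+ 3 = r%:~R + pi3 ^+ 3 * w1 by rewrite -ew1 -eC.
    have -> : - r%:~R = - C ^+ 3 + pi3 ^+ 3 * w1 by rewrite C3; ring.
    by rewrite eq3 /X {1}ek; ring.
  have sr : s = - r.
    apply: (tri_pid_sub (X := X)) => //; last by rewrite rmorphN.
    by case: hr => ->.
  have X0 : X = 0.
    apply: (mulfI pi_neq0); rewrite mulr0; move: e1; rewrite sr rmorphN /= => h.
    by apply: (addrI (- r%:~R)); rewrite addr0 -h.
  apply: nC; have -> : C = pi3 * (k * C ^+ 3 - pi3 * w1 - pi3 * w2 + N * y2 * eps ^+ 2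
     - C * (n + pi3 * (2 * - k + pi3 ^+ 2 * k ^+ 2) * N)).
    apply/eqP; rewrite -subr_eq0 -[X in _ == X]oppr0 -X0 /X {2}ek [in X in - X]ek eN; apply/eqP; ring.
  by apply: pid_mulr; pK'.
pose C2 := pi3 ^+ u * C; have KC2 : inK C2 by rewrite /C2; pK'.
have eC2 : C1 = pi3 * C2 by rewrite /C1 /C2 exprS; ring.
rewrite eC2 in ec1 eq2 eq3.
have [z Kz ez] := @pid_cube_of y2 (eps * pi3 ^+ 2 * C2 ^+ 3 + eps ^+ 2 * pi3 * N * (y2 - C2)) Ky2
   ltac:(pK') ltac:(rewrite eq3; ring).
have eq4 : pi3 * z ^+ 3 = eps * pi3 * C2 ^+ 3 + eps ^+ 2 * N * (pi3 * z - C2).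
  apply: (mulfI (expf_neq0 2 pi_neq0)).
  by move: eq3; rewrite ez => h; transitivity ((pi3 * z) ^+ 3); [ring | rewrite h; ring].
(* Valuation 2: modulo [pi3] the equation [eq4] leaves only [eps^2 N C], which is nonzero there. *)
case: u ec0 @C1 KC1 @C2 KC2 eC2 ec1 eq2 eq3 eq4 => [|u] ec0 C1 KC1 C2 KC2 eC2 ec1 eq2 eq3 eq4.
  exfalso; have eC : C2 = C by rewrite /C2 expr0 mul1r.
  have : pid (eps ^+ 2 * (N * C)).
    have -> : eps ^+ 2 * (N * C) = pi3 * (eps * C ^+ 3 + eps ^+ 2 * N * z - z ^+ 3).
      rewrite eC in eq4; apply/eqP; rewrite -subr_eq0; apply/eqP.
      transitivity (pi3 * z ^+ 3 - (eps * pi3 * C ^+ 3 + eps ^+ 2 * N * (pi3 * z - C))); first by ring.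
      by rewrite eq4 subrr.
    by apply: pid_mulr; pK'.
  apply: pid_prime; [by pK'|by pK'| |]; first by apply: pid_primeX => //; [pK' | exact: neps].
  apply: pid_prime => // => h; apply: pi_nunit.
  have -> : 1 = N - pi3 * n by rewrite eN; ring.
  by apply: (dvdPB inK_ring) => //; exact: pid_mulr.
pose c := pi3 ^+ u * C; have Kc : inK c by rewrite /c; pK'.
have ec : C2 = pi3 * c by rewrite /c /C2 exprS; ring.
exists z, c; split=> //; [by rewrite ey ey2 ez; ring | by rewrite ec1 ec; ring |].
have eq5 : z ^+ 3 = eps * pi3 ^+ 3 * c ^+ 3 + eps ^+ 2 * N * (z - c).
  by apply: (mulfI pi_neq0); rewrite eq4 ec; ring.
have [r hr [z' Kz' ez']] := residue_K Kz; have [w Kw ew] := cube_mod hr Kz'.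
have -> : c = pi3 * (- pi3 ^+ 2 * w + z' + eps * pi3 ^+ 2 * c ^+ 3
   + (pi3 * (2 * - k + pi3 ^+ 2 * k ^+ 2) * N + n) * (z - c)).
  apply/eqP; rewrite -subr_eq0; apply/eqP.
  transitivity ((z ^+ 3 - (eps * pi3 ^+ 3 * c ^+ 3 + eps ^+ 2 * N * (z - c)))
     - (z ^+ 3 - (r%:~R + pi3 ^+ 3 * w)) + (z - (r%:~R + pi3 * z'))).
    rewrite ek eN; ring.
  have z3 : z ^+ 3 = r%:~R + pi3 ^+ 3 * w by rewrite {1}ez' ew.
  by rewrite -eq5 -z3 -ez' !subrr; ring.
by apply: pid_mulr; pK'.
Qed.

Definition descent_data (c0 c1 : algC) : Prop :=
  [/\ inS c1, ~ dvdP inS lam c1, coprimeP inS c1 c1^* &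
      c0 ^+ 3 + rt3 * (c1 ^+ 3 - c1^* ^+ 3) = 3 * c0 * (c1 * c1^*)].

(** By this oddness a congruence modulo [lam] passes to the conjugate in [data_res]. *)
Lemma conj_lam : lam^* = - lam.
Proof. by rewrite /lam -conj_zeta rmorphB /= conjCK opprB. Qed.

Lemma conj_omegaM c : (omega * c)^* = omega ^+ 2 * c^*.
Proof. by rewrite rmorphM /= conj_omega. Qed.

Lemma omega_triple c : omega * (omega * (omega * c)) = c.
Proof. by transitivity (omega ^+ 3 * c); [ring | rewrite omega3 mul1r]. Qed.

(** The equation involves [c1] only through its cube, that of its conjugate and their product, so
    [c1] may be turned by a cube root of unity; the three choices give the three roots of the cubic
    in [yv_cube]. *)
Lemma data_rot c0 c1 : descent_data c0 c1 -> descent_data c0 (omega * c1).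
Proof.
move=> [S1 n1 [u [v [Su Sv co]]] eq]; rewrite /descent_data conj_omegaM.
have w3 := omega3; have w6 : (omega ^+ 2) ^+ 3 = 1 by rewrite exprAC omega3 expr1n.
split; first by pS.
- move=> d; apply: n1; rewrite -(omega_triple c1); do 2 (apply: (dvdP_mull inS_ring); first by pS).
  exact: d.
- exists (u * omega ^+ 2), (v * omega); split; [by pS|by pS|].
  transitivity (omega ^+ 3 * (u * c1 + v * c1^*)); first by ring.
  by rewrite w3 co mulr1.
- rewrite (exprMn 3 omega) (exprMn 3 (omega ^+ 2)) w3 w6 !mul1r eq.
  transitivity (3 * c0 * (omega ^+ 3 * (c1 * c1^*))); last by ring.
  by rewrite w3 mul1r.
Qed.

Lemma data_res c0 c1 : descent_data c0 c1 -> exists2 r : int, r = 1 \/ r = -1 &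
  dvdP inS lam (c1 - r%:~R) /\ dvdP inS lam (c1^* - r%:~R).
Proof.
move=> [S1 n1 _ _]; have [r hr d] := residue_S S1; exists r.
  case/orP: hr => [/orP[]|] /eqP er; [|by left|by right].
  by case: n1; move: d; rewrite er subr0.
split=> //; case: d => q Sq e; exists (- q^*); first by pS.
by rewrite mulNr -mulrN -conj_lam -rmorphM -e rmorphB /= rmorph_int.
Qed.

Lemma data_N1 c0 c1 : descent_data c0 c1 -> pid (c1 * c1^* - 1).
Proof.
move=> D; have [r hr [d1 d2]] := data_res D; case: D => S1 _ _ _.
apply: lam_pid; first by have := inK_norm S1; move=> ?; pK.
have r2 : r%:~R ^+ 2 = 1 :> algC by rewrite -rmorphXn; case: hr => ->.
have -> : c1 * c1^* - 1 = c1 * (c1^* - r%:~R) + r%:~R * (c1 - r%:~R).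
  by transitivity (c1 * c1^* - r%:~R ^+ 2); [rewrite r2 | ring].
by apply: (dvdPD inS_ring); apply: (dvdP_mull inS_ring) => //; pS.
Qed.

Lemma data_g c0 c1 : descent_data c0 c1 -> inK (c1 + c1^*) /\ ~ pid (c1 + c1^*).
Proof.
move=> D; have [r hr [d1 d2]] := data_res D; case: D => S1 _ _ _; split.
  by split; [pS | rewrite rmorphD /= conjCK addrC].
move/pid_lam => d; apply: lam_nunit.
have r2 : r%:~R ^+ 2 = 1 :> algC by rewrite -rmorphXn; case: hr => ->.
have -> : 1 = r%:~R * (3 * r%:~R - (c1 + c1^*) + (c1 - r%:~R) + (c1^* - r%:~R)) by rewrite -[LHS]r2; ring.
apply: (dvdP_mull inS_ring); first by pS.
do 2 (apply: (dvdPD inS_ring) => //); apply: (dvdPB inS_ring) => //.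
by apply: (dvdP_mulr inS_ring); [pS | exact: lam_dvd_3].
Qed.

(** A real multiple of the imaginary part of [c]. *)
Definition yv c := rt3 * (c - c^*).

Lemma inK_yv c : inS c -> inK (yv c).
Proof.
move=> Sc; split; first by rewrite /yv; have := inS_rt3; move=> ?; pS.
by rewrite /yv rmorphM /= conj_rt3 rmorphB /= conjCK; ring.
Qed.

Lemma yv_cube c0 c1 : descent_data c0 c1 ->
  yv c1 ^+ 3 = 3 * c0 ^+ 3 + 9 * (c1 * c1^*) * (yv c1 - c0).
Proof.
move=> [_ _ _ eq]; rewrite /yv; move: c1^* eq => b; move: c1 => a eq.
apply/eqP; rewrite -subr_eq0; apply/eqP.
transitivity (- 3 * (c0 ^+ 3 + rt3 * (a ^+ 3 - b ^+ 3) - 3 * c0 * (a * b))); last by rewrite eq subrr mulr0.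
transitivity ((rt3 ^+ 2 + 3) * rt3 * (a - b) ^+ 3 - 3 * (c0 ^+ 3 + rt3 * (a ^+ 3 - b ^+ 3) - 3 * c0 * (a * b))); first by ring.
by rewrite rt3_sq; ring.
Qed.

Lemma yv_diff c : yv c - yv (omega * c) = - 3 * ((omega * (omega * c)) + (omega * (omega * c))^*).
Proof.
have w4 : omega ^+ 4 = omega by rewrite (exprD _ 3 1) omega3 mul1r.
rewrite /yv !conj_omegaM /rt3; move: c^* => b.
have -> : omega ^+ 2 * (omega ^+ 2 * b) = omega * b by rewrite mulrA -exprD w4.
by apply: (@omega_red _ _ (c * omega + 2 * b * omega - b * omega ^+ 2)); ring.
Qed.

(** By [yv_diff] the difference of two roots is -3 times the trace to the real field of a rotated
    [c1], which is prime to [pi3]; the factor 3 is used up by the division by [pi3^3]. *)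
Lemma z_diff c0 c1 z z' : descent_data c0 c1 -> inK z -> inK z' ->
  yv c1 = pi3 ^+ 3 * z -> yv (omega * c1) = pi3 ^+ 3 * z' -> ~ pid (z - z').
Proof.
move=> D Kz Kz' e e'; have [Kg ng] := data_g (data_rot (data_rot D)).
move: (yv_diff c1); rewrite e e'; move: (_ + _^*) Kg ng => g Kg ng h.
have -> : z - z' = - 1 * (eps * g).
  apply: (mulfI (expf_neq0 3 pi_neq0)); rewrite mulrBr h.
  by transitivity (- (eps * pi3 ^+ 3) * g); [rewrite -eps_pi | ring].
apply: pid_prime; [by pK'|by pK'|by move/(dvdPN inK_ring); rewrite opprK; exact: pi_nunit|].
by apply: pid_prime => //; [exact: inK_eps | exact: neps].
Qed.

(** By [z_diff] the three values have distinct residues in F_3, so exactly one is divisible by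
    [pi3]; turning [c1] puts it in front. *)
Lemma stepA2 c0 c1 u C : descent_data c0 c1 -> inK c0 -> inK C -> c0 = pi3 ^+ u * C -> ~ pid C ->
  (0 < u)%N -> exists c d z0 z1 z2,
  [/\ descent_data c0 d, inK c, c0 = pi3 ^+ 3 * c & pid c] /\
  [/\ inK z0, inK z1 & inK z2] /\
  [/\ yv d = pi3 ^+ 3 * z0, yv (omega * d) = pi3 ^+ 3 * z1 & yv (omega * (omega * d)) = pi3 ^+ 3 * z2] /\
  [/\ pid z0, ~ pid z1 & ~ pid z2].
Proof.
move=> D0 Kc0 KC e nC u0.
have D1 := data_rot D0; have D2 := data_rot D1.
have get : forall d, descent_data c0 d -> exists z c, [/\ inK z, inK c, yv d = pi3 ^+ 3 * z, c0 = pi3 ^+ 3 * c & pid c].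
  move=> d D; case: (D) => Sd _ _ _.
  exact: (y_val Kc0 (inK_yv Sd) (inK_norm Sd) KC (data_N1 D) e nC u0 (yv_cube D)).
have [z0 [c [Kz0 Kc e0 ec pc]]] := get _ D0.
have [z1 [_ [Kz1 _ e1 _ _]]] := get _ D1.
have [z2 [_ [Kz2 _ e2 _ _]]] := get _ D2.
have e3 : yv (omega * (omega * (omega * c1))) = pi3 ^+ 3 * z0 by rewrite omega_triple.
have n01 := z_diff D0 Kz0 Kz1 e0 e1.
have n12 := z_diff D1 Kz1 Kz2 e1 e2.
have n20 := z_diff D2 Kz2 Kz0 e2 e3.
have sw : forall a b, pid b -> ~ pid (a - b) -> ~ pid a.
  by move=> a b h n h'; apply: n; exact: (dvdPB inK_ring).
have sw' : forall a b, pid a -> ~ pid (a - b) -> ~ pid b.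
  by move=> a b h n h'; apply: n; exact: (dvdPB inK_ring).
have [r0 h0 [x0 Kx0 f0]] := residue_K Kz0.
have [r1 h1 [x1 Kx1 f1]] := residue_K Kz1.
have [r2 h2 [x2 Kx2 f2]] := residue_K Kz2.
have ne : forall a b (r s : int) x y, inK x -> inK y -> a = r%:~R + pi3 * x -> b = s%:~R + pi3 * y -> ~ pid (a - b) -> r <> s.
  move=> a b r s x y Kx Ky -> -> n rs; apply: n; rewrite rs.
  have -> : s%:~R + pi3 * x - (s%:~R + pi3 * y) = pi3 * (x - y) by ring.
  by apply: pid_mulr; pK.
have r01 := ne _ _ _ _ _ _ Kx0 Kx1 f0 f1 n01.
have r12 := ne _ _ _ _ _ _ Kx1 Kx2 f1 f2 n12.
have r20 := ne _ _ _ _ _ _ Kx2 Kx0 f2 f0 n20.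
have pz : forall a (r : int) x, inK x -> a = r%:~R + pi3 * x -> r = 0 -> pid a.
  by move=> a r x Kx -> ->; rewrite add0r; exact: pid_mulr.
have [r|[r|r]] : r0 = 0 \/ r1 = 0 \/ r2 = 0.
  by move: r01 r12 r20; case/orP: h0 => [/orP[]|] /eqP ->; case/orP: h1 => [/orP[]|] /eqP ->;
     case/orP: h2 => [/orP[]|] /eqP ->; auto.
- have p0 := pz _ _ _ Kx0 f0 r.
  by exists c, c1, z0, z1, z2; do !split=> //; [exact: sw' n01 | exact: sw n20].
- have p1 := pz _ _ _ Kx1 f1 r.
  by exists c, (omega * c1), z1, z2, z0; do !split=> //; [exact: sw' n12 | exact: sw n01].
- have p2 := pz _ _ _ Kx2 f2 r; have e4 : yv (omega * (omega * (omega * (omega * c1)))) = pi3 ^+ 3 * z1 by rewrite omega_triple.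
  by exists c, (omega * (omega * c1)), z2, z0, z1; do !split=> //; [exact: sw' n20 | exact: sw n12].
Qed.

(** The [y_i = pi3^3 z_i] are the roots of [Y^3 - 9 N Y + 9 N c0 - 3 c0^3]. Hence the [c0 - y_i]
    have sum [3 c0], and their product is the value [- 2 c0^3] of this cubic at [c0]; the
    [a_i = c - z_i] are these numbers divided by [pi3^3]. A Fourier transform of order 3 recovers
    [d] and its conjugate from them. *)
Lemma stepA3 c0 c1 u C : descent_data c0 c1 -> inK c0 -> inK C -> c0 = pi3 ^+ u * C -> ~ pid C ->
  (0 < u)%N -> exists c d a0 a1 a2,
  [/\ inK c, c0 = pi3 ^+ 3 * c, pid c & coprimeP inS d d^*] /\ inS d /\
  [/\ inK a0, inK a1 & inK a2] /\
  [/\ a0 + a1 + a2 = 3 * c, a0 * a1 * a2 = - 2 * c ^+ 3, rt3 * eps * d = - (a0 + omega ^+ 2 * a1 + omega * a2) &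
      rt3 * eps * d^* = a0 + omega * a1 + omega ^+ 2 * a2] /\
  [/\ pid a0, ~ pid a1 & ~ pid a2].
Proof.
move=> D0 Kc0 KC e nC u0.
have [c [d [z0 [z1 [z2 [[[Sd nd cod eq] Kc ec pc] [[K0 K1 K2] [[e0 e1 e2] [p0 p1 p2]]]]]]]]] :=
  stepA2 D0 Kc0 KC e nC u0.
have p3 : pi3 ^+ 3 != 0 by rewrite expf_neq0 // pi_neq0.
have hw : omega ^+ 2 + omega + 1 = 0 by apply: (@omega_red _ _ 1); ring.
exists c, d, (c - z0), (c - z1), (c - z2); split; first by split.
split=> //; split; first by split; pK.
have w4 : omega ^+ 4 = omega by rewrite (exprD _ 3 1) omega3 mul1r.
have ww : omega ^+ 2 * (omega ^+ 2 * d^*) = omega * d^* by rewrite mulrA -exprD w4.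
have f0 : pi3 ^+ 3 * z0 = (omega - omega ^+ 2) * (d - d^*) by rewrite -e0.
have f1 : pi3 ^+ 3 * z1 = (omega - omega ^+ 2) * (omega * d - omega ^+ 2 * d^*).
  by rewrite -e1 /yv conj_omegaM.
have f2 : pi3 ^+ 3 * z2 = (omega - omega ^+ 2) * (omega ^+ 2 * d - omega * d^*).
  by rewrite -e2 /yv !conj_omegaM ww mulrA.
rewrite /rt3 in eq *; clear e0 e1 e2 ww cod; move: d^* f0 f1 f2 eq => b f0 f1 f2 eq.
split; last first.
  split; first exact: (dvdPB inK_ring).
    by rewrite addrC => h; apply: p1; move/(dvdPB inK_ring pc): h; rewrite opprD opprK addrCA subrr addr0.
  by rewrite addrC => h; apply: p2; move/(dvdPB inK_ring pc): h; rewrite opprD opprK addrCA subrr addr0.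
split.
- apply: (mulfI p3); transitivity (3 * (pi3 ^+ 3 * c) - (pi3 ^+ 3 * z0 + pi3 ^+ 3 * z1 + pi3 ^+ 3 * z2)); first by ring.
  rewrite f0 f1 f2; transitivity (3 * (pi3 ^+ 3 * c) - 0); last by ring.
  congr (_ - _); apply: (@omega_red _ _ (d * omega - d * omega ^+ 2 - b * omega + b * omega ^+ 2)); ring.
- apply: (mulfI (expf_neq0 3 p3)).
  transitivity ((c0 - pi3 ^+ 3 * z0) * (c0 - pi3 ^+ 3 * z1) * (c0 - pi3 ^+ 3 * z2)); first by rewrite ec; ring.
  transitivity (- 2 * c0 ^+ 3); last by rewrite ec; ring.
  rewrite f0 f1 f2; move: eq; clear; move: d => a eq.
  transitivity (- 2 * c0 ^+ 3 + 3 * (c0 ^+ 3 + (omega - omega ^+ 2) * (a ^+ 3 - b ^+ 3) - 3 * c0 * (a * b))); last by rewrite eq; ring.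
  apply: (@omega_red _ _ (9 * a * b * c0 - 9 * a * b * c0 * omega + 7 * a * b * c0 * omega ^+ 3 - 6 * a * b * c0 * omega ^+ 4 + 3 * a * b * c0 * omega ^+ 5 - a * b * c0 * omega ^+ 6 - a * b ^+ 2 * omega ^+ 5 + 3 * a * b ^+ 2 * omega ^+ 6 - 3 * a * b ^+ 2 * omega ^+ 7 + a * b ^+ 2 * omega ^+ 8 - a * c0 ^+ 2 * omega + a * c0 ^+ 2 * omega ^+ 2 + a ^+ 2 * b * omega ^+ 5 - 3 * a ^+ 2 * b * omega ^+ 6 + 3 * a ^+ 2 * b * omega ^+ 7 - a ^+ 2 * b * omega ^+ 8 + a ^+ 2 * c0 * omega ^+ 3 - 2 * a ^+ 2 * c0 * omega ^+ 4 + a ^+ 2 * c0 * omega ^+ 5 - 3 * a ^+ 3 * omega + 6 * a ^+ 3 * omega ^+ 2 - 3 * a ^+ 3 * omega ^+ 3 - 3 * a ^+ 3 * omega ^+ 4 + 6 * a ^+ 3 * omega ^+ 5 - 4 * a ^+ 3 * omega ^+ 6 + a ^+ 3 * omega ^+ 7 + b * c0 ^+ 2 * omega - b * c0 ^+ 2 * omega ^+ 2 + b ^+ 2 * c0 * omega ^+ 3 - 2 * b ^+ 2 * c0 * omega ^+ 4 + b ^+ 2 * c0 * omega ^+ 5 + 3 * b ^+ 3 * omega - 6 * b ^+ 3 * omega ^+ 2 + 3 * b ^+ 3 * omega ^+ 3 + 3 * b ^+ 3 * omega ^+ 4 - 6 * b ^+ 3 * omega ^+ 5 + 4 * b ^+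 3 * omega ^+ 6 - b ^+ 3 * omega ^+ 7)); ring.
- apply: (mulfI p3).
  transitivity (3 * ((omega - omega ^+ 2) * d)); first by rewrite eps_pi; ring.
  transitivity (pi3 ^+ 3 * z0 + omega ^+ 2 * (pi3 ^+ 3 * z1) + omega * (pi3 ^+ 3 * z2) - (omega ^+ 2 + omega + 1) * (pi3 ^+ 3 * c)); last by ring.
  rewrite f0 f1 f2 hw mul0r subr0; symmetry.
  apply: (@omega_red _ _ (- 2 * d * omega + 4 * d * omega ^+ 2 - 2 * d * omega ^+ 3 - b * omega + 2 * b * omega ^+ 2 - 2 * b * omega ^+ 3 + b * omega ^+ 4)); ring.
- apply: (mulfI p3).
  transitivity (3 * ((omega - omega ^+ 2) * b)); first by rewrite eps_pi; ring.
  transitivity (- (pi3 ^+ 3 * z0) - omega * (pi3 ^+ 3 * z1) - omega ^+ 2 * (pi3 ^+ 3 * z2) + (omega ^+ 2 + omega + 1) * (pi3 ^+ 3 * c)); last by ring.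
  rewrite f0 f1 f2 hw mul0r addr0; symmetry.
  apply: (@omega_red _ _ (- d * omega + 2 * d * omega ^+ 2 - 2 * d * omega ^+ 3 + d * omega ^+ 4 - 2 * b * omega + 4 * b * omega ^+ 2 - 2 * b * omega ^+ 3)); ring.
Qed.

(** * Reductions of the cubic ring modulo 2 and 3 *)

Lemma K_theta x : inK x -> exists a b c : int, x = a%:~R + b%:~R * theta + c%:~R * theta ^+ 2.
Proof.
move/K_coord => [a [b [c ->]]]; exists (a + 2 * c), (b - c), (- c).
by rewrite theta_lin rmorphD rmorphM rmorphB rmorphN /=; ring.
Qed.

Lemma coordK (a b c a' b' c' : int) :
  a%:~R + b%:~R * theta + c%:~R * theta ^+ 2 = a'%:~R + b'%:~R * theta + c'%:~R * theta ^+ 2 :> algC ->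
  [/\ a = a', b = b' & c = c'].
Proof.
have swap : forall a b c : int, a%:~R + b%:~R * theta + c%:~R * theta ^+ 2
   = (a + 2 * c)%:~R + (b - c)%:~R * theta + (- c)%:~R * tau theta :> algC.
  by move=> x y z; rewrite theta_lin rmorphD rmorphM rmorphB rmorphN /=; ring.
rewrite !swap !K_form => /coordS [].
- by pE. - by pE. - by pE. - by pE. - by pE. - by pE.
move=> e0 /coordE [e1 e2] _.
have h0 : (a + 2 * c) = (a' + 2 * c') by apply/eqP; rewrite -(eqr_int algC); apply/eqP.
by move: e1 e2 h0 => e1 e2 h0; split; lia.
Qed.

(** 2 is inert: each of the seven nonzero residues modulo 2 has an explicit inverse. *)
Lemma two_coprime x : inK x -> dvdP inK 2 x \/ coprimeP inK x 2.
Proof.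
move/K_theta => [a [b [c ->]]].
have h (n : int) : exists q : int, n = 2 * q \/ n = 2 * q + 1.
  by exists (n %/ 2)%Z; have := divz_eq n 2; have := modz_ge0 n (isT : (2 : int) != 0); have := ltz_pmod n (isT : (0 : int) < 2); lia.
have [qa ha] := h a; have [qb hb] := h b; have [qc hc] := h c.
pose q := qa%:~R + qb%:~R * theta + qc%:~R * theta ^+ 2 : algC.
have Kq : inK q by rewrite /q; pK.
have main : forall rho rho' s, inK rho' -> inK s ->
   a%:~R + b%:~R * theta + c%:~R * theta ^+ 2 = rho + 2 * q -> rho * rho' = 1 + 2 * s ->
   coprimeP inK (a%:~R + b%:~R * theta + c%:~R * theta ^+ 2) 2.
  move=> rho rho' s K1 K2 -> e; exists rho', (- s - rho' * q); split=> //; first by pK.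
  by transitivity (rho * rho' - 2 * s); [ring | rewrite e; ring].
case: ha => ea; case: hb => eb; case: hc => ec.
- by left; exists q => //; rewrite ea eb ec !rmorphM /= /q; ring.
- right; apply: (main (theta ^+ 2) (theta ^+ 2 + theta + 1) (2 * theta ^+ 2 + theta - 1)); [by pK|by pK| |].
    by rewrite ea eb ec !(rmorphD, rmorphM) /= /q; ring.
  by apply: (@theta_red _ _ (theta + 1)); ring.
- right; apply: (main theta (theta ^+ 2 + 1) (2 * theta - 1)); [by pK|by pK| |].
    by rewrite ea eb ec !(rmorphD, rmorphM) /= /q; ring.
  by apply: (@theta_red _ _ 1); ring.
- right; apply: (main (theta + theta ^+ 2) (theta + 1) (theta ^+ 2 + 2 * theta - 1)); [by pK|by pK| |].
    by rewrite ea eb ec !(rmorphD, rmorphM) /= /q; ring.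
  by apply: (@theta_red _ _ 1); ring.
- right; apply: (main 1 1 0); [by pK|by pK| |].
    by rewrite ea eb ec !(rmorphD, rmorphM) /= /q; ring.
  by ring.
- right; apply: (main (1 + theta ^+ 2) theta (2 * theta - 1)); [by pK|by pK| |].
    by rewrite ea eb ec !(rmorphD, rmorphM) /= /q; ring.
  by apply: (@theta_red _ _ 1); ring.
- right; apply: (main (1 + theta) (theta ^+ 2 + theta) (theta ^+ 2 + 2 * theta - 1)); [by pK|by pK| |].
    by rewrite ea eb ec !(rmorphD, rmorphM) /= /q; ring.
  by apply: (@theta_red _ _ 1); ring.
- right; apply: (main (1 + theta + theta ^+ 2) (theta ^+ 2) (2 * theta ^+ 2 + theta - 1)); [by pK|by pK| |].
    by rewrite ea eb ec !(rmorphD, rmorphM) /= /q; ring.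
  by apply: (@theta_red _ _ (theta + 1)); ring.
Qed.

Lemma two_nunit : ~ dvdP inK 2 1.
Proof.
move=> [f Kf e]; have [a [b [c ef]]] := K_theta Kf.
have : 1%:~R + 0%:~R * theta + 0%:~R * theta ^+ 2
   = (a * 2)%:~R + (b * 2)%:~R * theta + (c * 2)%:~R * theta ^+ 2 :> algC.
  by transitivity (1 : algC); [ring | rewrite [LHS]e ef !rmorphM /=; ring].
by case/coordK; lia.
Qed.

(* Arithmetic of [Z[theta]] on coordinate triples, used to compare units modulo 3 by computation. *)
Definition trip := (int * int * int)%type.
Definition tev (t : trip) : algC := t.1.1%:~R + t.1.2%:~R * theta + t.2%:~R * theta ^+ 2.
Definition tth (t : trip) : trip := (- t.2, t.1.1 + 3 * t.2, t.1.2).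
Definition tbe (t : trip) : trip :=
  let t1 := tth t in let t2 := tth t1 in
  (2 * t.1.1 - t1.1.1 - t2.1.1, 2 * t.1.2 - t1.1.2 - t2.1.2, 2 * t.2 - t1.2 - t2.2).
Definition tunit (j k : nat) : trip := iter j tth (iter k tbe (1, 0, 0)).

Lemma tev_th t : tev (tth t) = theta * tev t.
Proof.
case: t => [[a b] c]; rewrite /tev /tth /=.
apply: (@theta_red _ _ (- c%:~R)); rewrite rmorphN rmorphD rmorphM /=; ring.
Qed.

Lemma tev_be t : tev (tbe t) = tau theta * tev t.
Proof.
have -> : tev (tbe t) = 2 * tev t - tev (tth t) - tev (tth (tth t)).
  by rewrite /tev /tbe /= !rmorphB !rmorphM /=; ring.
by rewrite !tev_th theta_lin; ring.
Qed.

Lemma tev_unit j k : tev (tunit j k) = theta ^+ j * tau theta ^+ k.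
Proof.
have B : tev (iter k tbe (1, 0, 0)) = tau theta ^+ k.
  elim: k => [|k IH]; first by rewrite /tev /= expr0; ring.
  by rewrite iterS tev_be IH exprS.
elim: j => [|j IH]; first by rewrite expr0 mul1r.
by rewrite /tunit iterS tev_th -/(tunit j k) IH exprS mulrA.
Qed.

Definition tdvd3 (s : int) (t t' : trip) :=
  [&& (3 %| t.1.1 - s * t'.1.1)%Z, (3 %| t.1.2 - s * t'.1.2)%Z & (3 %| t.2 - s * t'.2)%Z].

Lemma tdvd3P s t t' : dvdP inK 3 (tev t - s%:~R * tev t') -> tdvd3 s t t'.
Proof.
move=> [q Kq e]; have [a [b [c eq]]] := K_theta Kq.
have : (t.1.1 - s * t'.1.1)%:~R + (t.1.2 - s * t'.1.2)%:~R * theta + (t.2 - s * t'.2)%:~R * theta ^+ 2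
   = (a * 3)%:~R + (b * 3)%:~R * theta + (c * 3)%:~R * theta ^+ 2 :> algC.
  transitivity (tev t - s%:~R * tev t').
    by rewrite /tev !rmorphB !rmorphM /=; ring.
  by rewrite e eq !rmorphM /=; ring.
by case/coordK => e0 e1 e2; rewrite /tdvd3 e0 e1 e2 !dvdz_mull ?dvdzz.
Qed.

(** The nine unit classes modulo cubes stay distinct modulo 3, even up to sign. A congruence modulo
    3 therefore suffices to identify two of them. *)
Lemma unit_mod3 (s : int) j k j' k' : s = 1 \/ s = -1 -> (j < 3)%N -> (k < 3)%N -> (j' < 3)%N -> (k' < 3)%N ->
  dvdP inK 3 (theta ^+ j * tau theta ^+ k - s%:~R * (theta ^+ j' * tau theta ^+ k')) -> j = j' /\ k = k'.
Proof.
move=> hs hj hk hj' hk'; rewrite -!tev_unit => /tdvd3P h.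
have chk : forall (s : int) (i i' l l' : nat), (s == 1) || (s == -1) -> i \in iota 0 3 -> i' \in iota 0 3 ->
    l \in iota 0 3 -> l' \in iota 0 3 -> tdvd3 s (tunit i l) (tunit i' l') -> (i == i') && (l == l').
  have : all (fun s => all (fun i => all (fun i' => all (fun l => all (fun l' =>
    tdvd3 s (tunit i l) (tunit i' l') ==> (i == i') && (l == l')) (iota 0 3)) (iota 0 3)) (iota 0 3)) (iota 0 3)) [:: 1; -1 : int].
    by vm_compute.
  move=> /allP A s0 i i' l l' hs0 hi hi' hl hl'.
  have := A s0; rewrite !in_cons in_nil orbF hs0 => /(_ isT) /allP /(_ _ hi) /allP /(_ _ hi') /allP /(_ _ hl) /allP /(_ _ hl').
  by move/implyP.
have := chk s j j' k k'; rewrite !mem_iota /= !add0n hj hk hj' hk' h.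
by case: hs => -> /(_ isT isT isT isT isT isT) /andP [/eqP -> /eqP ->].
Qed.

Lemma unitKS x : unitP inK x -> unitP inS x.
Proof. by move=> [f [Sf _] [[Sx _] e]]; exists f. Qed.

Lemma coprimeKS x y : coprimeP inK x y -> coprimeP inS x y.
Proof. by move=> [u [v [[Su _] [Sv _] e]]]; exists u, v. Qed.

Lemma unitSK x : inK x -> unitP inS x -> unitP inK x.
Proof. by move=> Kx ux; exists x^-1; [exact: unit_K_inv | rewrite mulVf // (unitP_neq0 ux)]. Qed.

Lemma two_dvd_cube x : inK x -> dvdP inK 2 (x ^+ 3) -> dvdP inK 2 x.
Proof.
move=> Kx d; have [//|co] := two_coprime Kx; exfalso; apply: two_nunit.
have co2 : coprimeP inK 2 (x ^+ 3) by apply: (coprimePX inK_ring) => //; [pK | exact: coprimePC].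
have [f Kf [_ e]] := unit_coprime inK_ring (inK_nat 2) (PX inK_ring 3 Kx) co2 d.
by exists f.
Qed.

(** Let [d] divide [x] and [y]. A common divisor of [d] and [c] also divides [w] by the sum
    relation, so [d] is prime to [c], while the product relation makes [d] divide [2 c^3]. If 2
    divided [d], then 4 would divide [2 c^3] and 2 would divide [c]. *)
Lemma pair_coprime x y w c : inK x -> inK y -> inK w -> inK c ->
  x + y + w = 3 * c -> x * y * w = - 2 * c ^+ 3 ->
  (forall g, inK g -> dvdP inK g x -> dvdP inK g y -> dvdP inK g w -> unitP inK g) ->
  coprimeP inK x y.
Proof.
move=> Kx Ky Kw Kc es ep com.
apply: (gcdP_coprime inK_ring bezK) => // d Kd dx dy.
have codc : coprimeP inK d c.
  apply: (gcdP_coprime inK_ring bezK) => // g Kg gd gc.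
  have gx := dvdP_trans inK_ring gd dx; have gy := dvdP_trans inK_ring gd dy.
  apply: com => //; have -> : w = 3 * c - x - y by rewrite -es; ring.
  by do 2 (apply: (dvdPB inK_ring) => //); apply: (dvdP_mull inK_ring) => //; pK.
have [d2|co2] := two_coprime Kd.
  exfalso; apply: two_nunit.
  have [x' Kx' ex] := dvdP_trans inK_ring d2 dx; have [y' Ky' ey] := dvdP_trans inK_ring d2 dy.
  have c2 : dvdP inK 2 c.
    apply: two_dvd_cube => //; exists (- (x' * y' * w)); first by pK.
    apply: (mulfI (x := - 2)); first by rewrite oppr_eq0 pnatr_eq0.
    by rewrite -ep ex ey; ring.
  case: codc => [a [b [Ka Kb e]]].
  have : dvdP inK 2 (a * d + b * c) by apply: (dvdPD inK_ring); apply: (dvdP_mull inK_ring).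
  by rewrite e.
have d2c : dvdP inK d (2 * c ^+ 3).
  have -> : 2 * c ^+ 3 = - (y * w) * x by transitivity (- (x * y * w)); [rewrite ep; ring | ring].
  by apply: (dvdP_mull inK_ring) => //; pK.
have Kc3 : inK (c ^+ 3) by pK.
have dc3 := gaussP inK_ring (inK_nat 2) Kc3 co2 d2c.
by apply: (unit_coprime inK_ring Kd Kc3 _ dc3); exact: (coprimePX inK_ring).
Qed.

Lemma cube_mod3 b : inK b -> ~ pid b -> exists2 r : int, r = 1 \/ r = -1 & dvdP inK 3 (b ^+ 3 - r%:~R).
Proof.
move=> Kb nb; have [r hr [y Ky e]] := residue_unit Kb nb; exists r => //.
have hr' : tri r by case: hr => ->.
have [w Kw ew] := cube_mod hr' Ky; rewrite e ew addrC addKr pi3_3.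
by exists ((pi3 ^+ 2 - 1) * w); [pK' | ring].
Qed.

(** [y] and [w] are units times cubes, and cubes prime to [pi3] are 1 or -1 modulo 3; so the
    congruence between [y] and [w] shows through [unit_mod3] that their units agree. The product
    being a cube, [x] carries the same unit. *)
Lemma common_cubes x y w c (e1 e2 : int) : inK x -> inK y -> inK w -> inK c -> c != 0 ->
  e1 = 1 \/ e1 = -1 -> e2 = 1 \/ e2 = -1 ->
  coprimeP inK y (x * w) -> coprimeP inK w (x * y) -> x * y * w = (- c) ^+ 3 ->
  ~ pid y -> ~ pid w -> dvdP inK 3 (e1%:~R * y + e2%:~R * w) ->
  exists rho a b d, [/\ inK rho, unitP inS rho & inK a] /\ [/\ inK b, inK d, ~ pid b & ~ pid d] /\
   [/\ x = rho * a ^+ 3, y = rho * b ^+ 3, w = rho * d ^+ 3 & c = - rho * a * b * d].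
Proof.
move=> Kx Ky Kw Kc c0 h1 h2 coy cow ep ny nw d3.
have ep0 : x * y * w != 0 by rewrite ep expf_neq0 // oppr_eq0.
have [x0 y0 w0] : [/\ x != 0, y != 0 & w != 0].
  by move: ep0; rewrite !mulf_eq0 !negb_or -andbA => /and3P.
have Kxw : inK (x * w) by pK. have Kxy : inK (x * y) by pK. have KNc : inK (- c) by pK.
have epy : y * (x * w) = (- c) ^+ 3 by rewrite -ep; ring.
have epw : w * (x * y) = (- c) ^+ 3 by rewrite -ep; ring.
have [ey [by0 [uy Kb0 eqy]]] := coprime_cube inK_ring bezK Ky Kxw KNc coy epy.
have [ew [bw0 [uw Kd0 eqw]]] := coprime_cube inK_ring bezK Kw Kxy KNc cow epw.
have [j [k [b [Kb hj hk eyb]]]] := real_unit_cube Ky y0 (unitKS uy) (inKS Kb0) eqy.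
have [j' [k' [d [Kd hj' hk' ewd]]]] := real_unit_cube Kw w0 (unitKS uw) (inKS Kd0) eqw.
have Kr : forall j k, inK (theta ^+ j * tau theta ^+ k) by move=> *; pK.
have nb : ~ pid b.
  move=> h; apply: ny; rewrite eyb exprS; apply: (dvdP_mull inK_ring) => //; apply: (dvdP_mulr inK_ring) => //; pK.
have nd : ~ pid d.
  move=> h; apply: nw; rewrite ewd exprS; apply: (dvdP_mull inK_ring) => //; apply: (dvdP_mulr inK_ring) => //; pK.
have [r1 hr1 [m1 Km1 eb]] := cube_mod3 Kb nb.
have [r2 hr2 [m2 Km2 ed]] := cube_mod3 Kd nd.
have [ej ek] : j = j' /\ k = k'.
  apply: (@unit_mod3 (- (e1 * r1 * e2 * r2))) => //.
    by case: h1 h2 hr1 hr2 => -> [] -> [] -> [] ->; rewrite ?mul1r ?mulr1 ?mulrN1 ?opprK; auto.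
  have sq : (e1 * r1)%:~R ^+ 2 = 1 :> algC by rewrite -rmorphXn; case: h1 hr1 => -> [] ->.
  case: d3 => m3 Km3; rewrite eyb ewd.
  have -> : b ^+ 3 = r1%:~R + m1 * 3 by rewrite -eb; ring.
  have -> : d ^+ 3 = r2%:~R + m2 * 3 by rewrite -ed; ring.
  move: (theta ^+ j * _) (theta ^+ j' * _) (Kr j k) (Kr j' k') => R1 R2 KR1 KR2 e.
  exists ((e1 * r1)%:~R * (m3 - e1%:~R * R1 * m1 - e2%:~R * R2 * m2)); first by pK.
  transitivity ((e1 * r1)%:~R * ((e1%:~R * (R1 * (r1%:~R + m1 * 3)) + e2%:~R * (R2 * (r2%:~R + m2 * 3)))
     - 3 * (e1%:~R * R1 * m1 + e2%:~R * R2 * m2))); last by rewrite e; ring.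
  transitivity ((e1 * r1)%:~R ^+ 2 * R1 - (- (e1 * r1 * e2 * r2))%:~R * R2); first by rewrite sq mul1r.
  by rewrite rmorphN !rmorphM /=; ring.
rewrite -ej -ek in ewd; pose rho := theta ^+ j * tau theta ^+ k.
have ur : unitP inS rho.
  by apply: (unitPM inS_ring); apply: unitPX; [|apply: unit_tau]; exact: unit_theta.
have r0 := unitP_neq0 ur.
rewrite -/rho in eyb ewd; have KR : inK rho by exact: Kr.
have b0 : b != 0 by apply: contra_neq y0 => h; rewrite eyb h expr0n mulr0.
have d0 : d != 0 by apply: contra_neq w0 => h; rewrite ewd h expr0n mulr0.
have KRi := unit_K_inv KR ur.
have e3 : (- c / (rho * b * d)) ^+ 3 = x / rho.
  have fld : forall x r b d : algC, r != 0 -> b != 0 -> d != 0 ->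
      x * (r * b ^+ 3) * (r * d ^+ 3) / (r * b * d) ^+ 3 = x / r.
    by move=> ???? h1' h2' h3'; field; rewrite ?h1' ?h2' ?h3'.
  by rewrite expr_div_n -ep eyb ewd fld.
have Ka : inK (- c / (rho * b * d)).
  apply: (cube_closed inK_ring bezK KNc _ _ _); [by pK | by apply: mulf_neq0 => //; apply: mulf_neq0 | ].
  by rewrite e3; pK.
exists rho, (- c / (rho * b * d)), b, d; split; first by split.
split; first by split.
split=> //; first by rewrite e3 mulrC divfK.
have fld : forall c r b d : algC, r != 0 -> b != 0 -> d != 0 -> c = - r * (- c / (r * b * d)) * b * d.
  by move=> ???? h1' h2' h3'; field; rewrite ?h1' ?h2' ?h3'.
exact: fld.
Qed.

(** Second descent map. The [a_i] are pairwise coprime with product [- 2 c^3], and 2 is inert, so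
    exactly one of them is even. Halving it leaves three numbers whose product is a cube, hence a
    common unit times cubes, and the sum relation becomes a point of the twisted cubic. If [a0] is
    the even one, the new [U] has the valuation of [c]; otherwise [pi3] divides the new [V], against
    [local_obstruction]. *)
Lemma stepB c d a0 a1 a2 m C :
  inK c -> inK C -> c = pi3 ^+ m * C -> ~ pid C -> (0 < m)%N -> inS d -> coprimeP inS d d^* ->
  inK a0 -> inK a1 -> inK a2 ->
  a0 + a1 + a2 = 3 * c -> a0 * a1 * a2 = - 2 * c ^+ 3 ->
  rt3 * eps * d = - (a0 + omega ^+ 2 * a1 + omega * a2) ->
  rt3 * eps * d^* = a0 + omega * a1 + omega ^+ 2 * a2 ->
  ~ pid a1 -> ~ pid a2 ->
  exists t U V U1, [/\ inK t, inK U, inK V & inK U1] /\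
    [/\ t ^+ 3 + 2 * U ^+ 3 - V ^+ 3 = 3 * t * U * V, coprimeP inS U V,
        U = pi3 ^+ m * U1 & ~ pid U1].
Proof.
move=> Kc KC ec nC m0 Sd cod K0 K1 K2 es ep ed1 ed2 n1 n2.
have C0 : C != 0 by apply/eqP => h; apply: nC; rewrite h; exact: (dvdP0 inK_ring).
have c0 : c != 0 by rewrite ec mulf_neq0 // expf_neq0 // pi_neq0.
have pc : pid c by rewrite ec -(prednK m0) exprS -mulrA; apply: pid_mulr; pK'.
have com : forall g, inK g -> dvdP inK g a0 -> dvdP inK g a1 -> dvdP inK g a2 -> unitP inK g.
  move=> g Kg /dvdKS g0 /dvdKS g1 /dvdKS g2; have Sg := inKS Kg.
  have col : coprimeP inS g lam.
    apply: (coprime_dvdl inS_ring) g1 _; apply: lam_coprime; first exact: inKS.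
    by move=> h; apply: n1; exact: lam_pid.
  have cor := coprime_rt3 Sg col; have Srt := inS_rt3; have Sp := inKS inK_pi.
  have red : forall x, inS x -> dvdP inS g (rt3 * eps * x) -> dvdP inS g x.
    move=> x Sx h; apply: gaussP cor _ => //; first exact: inS_ring.
    have -> : rt3 * x = (pi3 ^+ 2 - 1) * (rt3 * eps * x).
      by transitivity (rt3 * x * (eps * (pi3 ^+ 2 - 1))); [rewrite eps_unit mulr1 | ring].
    by apply: (dvdP_mull inS_ring) => //; pS.
  apply: unitSK => //; apply: coprime_common cod => //; apply: red; try (by pS); rewrite ?ed1 ?ed2.
    by apply: (dvdPN inS_ring); apply: (dvdPD inS_ring); [apply: (dvdPD inS_ring) => // |]; apply: (dvdP_mull inS_ring) => //; pS.
  by apply: (dvdPD inS_ring); [apply: (dvdPD inS_ring) => // |]; apply: (dvdP_mull inS_ring) => //; pS.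
have co01 : coprimeP inK a0 a1 by apply: (pair_coprime K0 K1 K2 Kc).
have co02 : coprimeP inK a0 a2.
  apply: (pair_coprime K0 K2 K1 Kc); [by rewrite -es; ring | by rewrite -ep; ring |].
  by move=> g Kg g0 g2 g1; exact: com.
have co12 : coprimeP inK a1 a2.
  apply: (pair_coprime K1 K2 K0 Kc); [by rewrite -es; ring | by rewrite -ep; ring |].
  by move=> g Kg g1 g2 g0; exact: com.
(* [a1] and [a2] are prime to [pi3], so the factor [pi3^3] of the product falls to [a0]; hence
   [a1 = - a2] modulo 3. *)
have a03 : dvdP inK 3 a0.
  have [q Kq eq] : exists2 q, inK q & c = pi3 * q by case: pc => q Kq ->; exists q; rewrite 1?mulrC.
  have cop : forall x, inK x -> ~ pid x -> coprimeP inK pi3 x.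
    move=> x Kx nx; have [r hr [y Ky e]] := residue_unit Kx nx.
    exists (- r%:~R * y), r%:~R; split; [by pK|by pK|].
    have r2 : r%:~R ^+ 2 = 1 :> algC by rewrite -rmorphXn; case: hr => ->.
    by rewrite e -[RHS]r2; ring.
  have Kp := inK_pi; have K12 : inK (a1 * a2) by pK.
  have cop3 : coprimeP inK (pi3 ^+ 3) (a1 * a2).
    apply: coprimePC; apply: (coprimePX inK_ring) => //; apply: coprimePC.
    by apply: (coprimePM inK_ring) => //; exact: cop.
  have : dvdP inK (pi3 ^+ 3) ((a1 * a2) * a0).
    have -> : (a1 * a2) * a0 = - 2 * c ^+ 3 by rewrite -ep; ring.
    by exists (- 2 * q ^+ 3); [pK | rewrite eq; ring].
  move/(gaussP inK_ring K12 K0 cop3) => [f Kf ->].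
  by exists (f * (pi3 ^+ 2 - 1)); [pK' | rewrite pi3_3; ring].
have a123 : dvdP inK 3 (a1 + a2).
  have -> : a1 + a2 = 3 * c - a0 by rewrite -es; ring.
  by apply: (dvdPB inK_ring) => //; exists c => //; ring.
have fin : forall rho a b e, inK rho -> unitP inS rho -> inK a -> inK b -> inK e -> ~ pid b -> ~ pid e ->
    c = - rho * a * b * e -> exists2 A, inK A & a = pi3 ^+ m * A /\ ~ pid A.
  move=> rho a b e Kr ur Ka Kb Ke nb ne ecc.
  have a0' : a != 0 by apply: contra_neq c0 => h; rewrite ecc h mulr0 !mul0r.
  have [l [A [KA nA eA]]] := pi_val Ka a0'.
  exists A => //; split=> //; suff <- : l = m by [].
  apply: (@pi_val_uniq l m (- 1 * (rho * A * b * e)) C) => //; [by pK| |by rewrite -ec ecc eA; ring].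
  apply: pid_prime; [by pK|by pK|by move/(dvdPN inK_ring); rewrite opprK; exact: pi_nunit|].
  by do 3 (apply: pid_prime => //; try by pK); exact: pid_unit.
have hh1 : (1 : int) = 1 \/ (1 : int) = -1 by left.
have hm1 : (-1 : int) = 1 \/ (-1 : int) = -1 by right.
have two : forall x y : algC, inK x -> dvdP inK 3 (2 * x + y) -> dvdP inK 3 ((-1)%:~R * x + 1%:~R * y).
  move=> x y Kx [q Kq e]; exists (q - x); first by pK.
  by transitivity ((2 * x + y) - x * 3); [rewrite rmorphN /=; ring | rewrite e; ring].
have n20 : (2 : algC) != 0 by rewrite pnatr_eq0.
have pida : forall a A, inK A -> a = pi3 ^+ m * A -> pid a.
  by move=> a A KA ->; rewrite -(prednK m0) exprS -mulrA; apply: pid_mulr; pK'.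
have cancel : forall x y z rho a b e, unitP inS rho -> x = rho * a ^+ 3 -> y = rho * b ^+ 3 -> z = rho * e ^+ 3 ->
    forall s1 s2 s3, s1 * x + s2 * y + s3 * z = 3 * c -> c = - rho * a * b * e ->
    s1 * a ^+ 3 + s2 * b ^+ 3 + s3 * e ^+ 3 = - 3 * a * b * e.
  move=> x y z rho a b e ur -> -> -> s1 s2 s3 h ecc.
  apply: (mulfI (unitP_neq0 ur)); transitivity (3 * c); last by rewrite ecc; ring.
  by rewrite -h; ring.
have [[x Kx ex]|f0] := two_coprime K0.
  have dx : dvdP inK x a0 by exists 2; [pK | rewrite ex; ring].
  have [||||||rho [a [b [e [[Kr ur Ka] [[Kb Ke nb ne] [e0 e1 e2 ecc]]]]]]] :=
     @common_cubes x a1 a2 c 1 1 Kx K1 K2 Kc c0 hh1 hh1.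
  - by apply: (coprimePM inK_ring) => //; apply: coprimePC; apply: (coprime_dvdl inK_ring) dx _.
  - apply: (coprimePM inK_ring) => //; last exact: coprimePC.
    by apply: coprimePC; apply: (coprime_dvdl inK_ring) dx _.
  - by apply: (mulfI n20); transitivity (a0 * a1 * a2); [rewrite ex | rewrite ep]; ring.
  - by []. - by [].
  - by rewrite !mul1r.
  have [A KA [eA nA]] := fin _ _ _ _ Kr ur Ka Kb Ke nb ne ecc.
  exists b, a, (- e), A; split; first by split=> //; pK.
  split=> //.
  - have := cancel _ _ _ _ _ _ _ ur e0 e1 e2 2 1 1; rewrite !mul1r => /(_ _ ecc) h.
    transitivity (2 * a ^+ 3 + b ^+ 3 + e ^+ 3); first by ring.
    by rewrite h; [ring | rewrite -es ex; ring].
  - apply: coprimeKS.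
    have da : dvdP inK a a0 by rewrite ex e0; exists (2 * rho * a ^+ 2); [pK | ring].
    have de : dvdP inK (- e) a2 by rewrite e2; exists (- rho * e ^+ 2); [pK | ring].
    by apply: (coprime_dvdl inK_ring) da _; apply: (coprime_dvdr inK_ring) de _.
have [[x Kx ex]|f1] := two_coprime K1.
  exfalso; have dx : dvdP inK x a1 by exists 2; [pK | rewrite ex; ring].
  have nx : ~ pid x by move=> h; apply: n1; rewrite ex; apply: (dvdP_mulr inK_ring) => //; pK.
  have [||||||rho [a [b [e [[Kr ur Ka] [[Kb Ke nb ne] [e0 e1 e2 ecc]]]]]]] :=
     @common_cubes a0 x a2 c (-1) 1 K0 Kx K2 Kc c0 hm1 hh1.
  - by apply: (coprimePM inK_ring) => //; apply: (coprime_dvdl inK_ring) dx _ => //; exact: coprimePC.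
  - apply: (coprimePM inK_ring) => //; first exact: coprimePC.
    by apply: (coprime_dvdr inK_ring) dx _; exact: coprimePC.
  - by apply: (mulfI n20); transitivity (a0 * a1 * a2); [rewrite ex | rewrite ep]; ring.
  - by []. - by [].
  - by apply: two => //; rewrite -[2 * x]mulrC -ex.
  have [A KA [eA nA]] := fin _ _ _ _ Kr ur Ka Kb Ke nb ne ecc.
  have eqn : a ^+ 3 + 2 * b ^+ 3 + e ^+ 3 = - 3 * a * b * e.
    have := cancel _ _ _ _ _ _ _ ur e0 e1 e2 1 2 1; rewrite !mul1r; apply=> //.
    by rewrite -es ex; ring.
  apply: (@local_obstruction e b (- a)) => //; first by pK.
    by transitivity (a ^+ 3 + 2 * b ^+ 3 + e ^+ 3); [ring | rewrite eqn; ring].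
  by apply: (dvdPN inK_ring); exact: pida eA.
have [[x Kx ex]|f2] := two_coprime K2.
  exfalso; have dx : dvdP inK x a2 by exists 2; [pK | rewrite ex; ring].
  have nx : ~ pid x by move=> h; apply: n2; rewrite ex; apply: (dvdP_mulr inK_ring) => //; pK.
  have [||||||rho [a [b [e [[Kr ur Ka] [[Kb Ke nb ne] [e0 e1 e2 ecc]]]]]]] :=
     @common_cubes a0 x a1 c (-1) 1 K0 Kx K1 Kc c0 hm1 hh1.
  - by apply: (coprimePM inK_ring) => //; apply: (coprime_dvdl inK_ring) dx _ => //; exact: coprimePC.
  - apply: (coprimePM inK_ring) => //; first exact: coprimePC.
    by apply: (coprime_dvdr inK_ring) dx _.
  - by apply: (mulfI n20); transitivity (a0 * a1 * a2); [rewrite ex | rewrite ep]; ring.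
  - by []. - by [].
  - by apply: two => //; rewrite -[2 * x]mulrC -ex addrC.
  have [A KA [eA nA]] := fin _ _ _ _ Kr ur Ka Kb Ke nb ne ecc.
  have eqn : a ^+ 3 + 2 * b ^+ 3 + e ^+ 3 = - 3 * a * b * e.
    have := cancel _ _ _ _ _ _ _ ur e0 e1 e2 1 2 1; rewrite !mul1r; apply=> //.
    by rewrite -es ex; ring.
  apply: (@local_obstruction e b (- a)) => //; first by pK.
    by transitivity (a ^+ 3 + 2 * b ^+ 3 + e ^+ 3); [ring | rewrite eqn; ring].
  by apply: (dvdPN inK_ring); exact: pida eA.
exfalso; apply: two_nunit.
have K2' := inK_nat 2; have K012 : inK (a0 * a1 * a2) by pK.
have co : coprimeP inK 2 (a0 * a1 * a2).
  by apply: (coprimePM inK_ring) => //; [pK | apply: (coprimePM inK_ring) => //|]; exact: coprimePC.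
have [|f Kf [_ e]] := unit_coprime inK_ring K2' K012 co; last by exists f.
by rewrite ep; exists (- c ^+ 3); [pK | ring].
Qed.

(** One round through [stepA3] and [stepB] lowers the valuation of [U] by exactly 3: [c0] has the
    valuation of [U], and [c = c0 / pi3^3] that of the new [U]. *)
Theorem cubic_descent u t U V U1 : inK t -> inK U -> inK V -> inK U1 ->
  t ^+ 3 + 2 * U ^+ 3 - V ^+ 3 = 3 * t * U * V -> coprimeP inS U V ->
  U = pi3 ^+ u * U1 -> ~ pid U1 -> (0 < u)%N -> False.
Proof.
elim/ltn_ind: u t U V U1 => u IH t U V U1 Kt KU KV KU1 eq co eU n1 u0.
have [c0 [c1 [rho [Kc0 Sc1 [Kr ur] [nl cop eU' eqc]]]]] := stepA Kt KU KV KU1 eq co eU n1 u0.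
have U10 : U1 != 0 by apply/eqP => h; apply: n1; rewrite h; exact: (dvdP0 inK_ring).
have U0 : U != 0 by rewrite eU mulf_neq0 // expf_neq0 // pi_neq0.
have c00 : c0 != 0 by apply: contra_neq U0 => h; rewrite eU' h mulr0 mul0r.
have D : descent_data c0 c1 by split.
have KN := inK_norm Sc1.
have nN : ~ pid (c1 * c1^*).
  move=> h; apply: pi_nunit; have -> : 1 = c1 * c1^* - (c1 * c1^* - 1) by rewrite opprB addrC subrK.
  by apply: (dvdPB inK_ring) => //; exact: data_N1 D.
have [l [C [KC nC eC]]] := pi_val Kc0 c00.
have lu : l = u.
  apply: (@pi_val_uniq l u (- 1 * (rho * C * (c1 * c1^*))) U1) => //; [by pK| |by rewrite -eU eU' eC; ring].
  apply: pid_prime; [by pK|by pK|by move/(dvdPN inK_ring); rewrite opprK; exact: pi_nunit|].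
  by do 2 (apply: pid_prime => //; try by pK); exact: pid_unit.
have l0 : (0 < l)%N by rewrite lu.
have [c [d [a0 [a1 [a2 [[Kc ec pc cod] [Sd [[K0 K1 K2] [[es ep ed1 ed2] [p0 q1 q2]]]]]]]]]] :=
  stepA3 D Kc0 KC eC nC l0.
have c0' : c != 0 by apply: contra_neq c00 => h; rewrite ec h mulr0.
have [m [C' [KC' nC' eC']]] := pi_val Kc c0'.
have m0 : (0 < m)%N.
  by case: m eC' => // e; case: nC'; move: pc; rewrite e expr0 mul1r.
have mu : (3 + m)%N = u.
  rewrite -lu; apply: (@pi_val_uniq _ _ C' C) => //.
  by rewrite exprD -mulrA -eC' -ec.
have [t' [U' [V' [U1' [[Kt' KU' KV' KU1'] [eq' co' eU'' n1']]]]]] :=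
  stepB Kc KC' eC' nC' m0 Sd cod K0 K1 K2 es ep ed1 ed2 q1 q2.
by apply: (IH m _ t' U' V' U1') => //; rewrite -mu; lia.
Qed.

(** * Rational 3-cycles of quadratic polynomials *)

(** The cubic equation of the trace zero element [e theta + f tau theta]; its coefficients are the
    forms [norm3] and [form3] below. *)
Lemma theta_norm (e f : algC) :
  (e * theta + f * tau theta) ^+ 3 + (e ^+ 3 + 3 * e ^+ 2 * f - 6 * e * f ^+ 2 + f ^+ 3)
  = 3 * (e ^+ 2 - e * f + f ^+ 2) * (e * theta + f * tau theta).
Proof.
rewrite theta_lin.
apply: (@theta_red _ _ (6 * e * f ^+ 2 * theta + 3 * e * f ^+ 2 * theta ^+ 2 - 3 * e ^+ 2 * f - 3 * e ^+ 2 * f * theta + e ^+ 3 - 3 * f ^+ 3 * theta ^+ 2 - f ^+ 3 * theta ^+ 3 + 3 * f ^+ 3)).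
ring.
Qed.

(* Translation on the cubic by its point [(theta : 1 : 1)]. *)
Lemma cubic_translate (t U V : algC) : t ^+ 3 + 2 * U ^+ 3 - V ^+ 3 = 3 * t * U * V ->
  let X := theta * t ^+ 2 + U * V in let Y := t * V - theta * U ^+ 2 in
  let Z := V ^+ 2 + theta ^+ 2 * t * U in
  X ^+ 3 + 2 * Y ^+ 3 - Z ^+ 3 = 3 * X * Y * Z.
Proof.
move=> e X Y Z.
have e0 : t ^+ 3 + 2 * U ^+ 3 - V ^+ 3 - 3 * t * U * V = 0 by rewrite e subrr.
pose B := 3 * U * V * t * theta ^+ 2 - 3 * U ^+ 3 * theta + U ^+ 3 + V ^+ 3 + 3 * t ^+ 3 * theta - t ^+ 3.
transitivity (3 * X * Y * Z + (t ^+ 3 + 2 * U ^+ 3 - V ^+ 3 - 3 * t * U * V) * B); last by rewrite e0 mul0r addr0.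
apply: (@theta_red _ _ (- 3 * U * V * t ^+ 4 - 3 * U ^+ 2 * V ^+ 2 * t ^+ 2 * theta + U ^+ 3 * t ^+ 3 - U ^+ 3 * t ^+ 3 * theta ^+ 3 + 3 * U ^+ 4 * V * t - 2 * U ^+ 6 + t ^+ 6)).
rewrite /X /Y /Z /B; ring.
Qed.

(** In lowest terms the denominator divides the cube of the numerator, hence is a unit. *)
Lemma cubic_integral (x h al be : algC) : inK x -> inK h -> h != 0 -> inK al -> inK be ->
  (x / h) ^+ 3 = al * (x / h) + be -> inK (x / h).
Proof.
move=> Kx Kh h0 Ka Kb e.
have [d [u [v [Ku Kv ed [p Kp ep] [q Kq eq]]]]] := bezK Kx Kh.
have d0 : d != 0 by apply: contra_neq h0 => d0; rewrite eq d0 mulr0.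
have q0 : q != 0 by apply: contra_neq h0 => q0; rewrite eq q0 mul0r.
have exh : x / h = p / q by rewrite ep eq -mulf_div divff // mulr1.
have cop : coprimeP inK q p.
  exists v, u; split=> //; apply: (mulIf d0); rewrite mul1r [RHS]ed ep eq; ring.
have ep3 : p ^+ 3 = (al * p * q + be * q ^+ 2) * q.
  have q3 : q ^+ 3 != 0 by rewrite expf_neq0.
  have -> : p ^+ 3 = (p / q) ^+ 3 * q ^+ 3 by rewrite expr_div_n divfK.
  rewrite -exh e exh; have fld : forall al be p q : algC, q != 0 -> (al * (p / q) + be) * q ^+ 3 = (al * p * q + be * q ^+ 2) * q.
    by move=> ???? hq; field.
  exact: fld.
have uq : unitP inK q.
  apply: (unit_coprime inK_ring Kq (PX inK_ring 3 Kp)); first exact: (coprimePX inK_ring).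
  by exists (al * p * q + be * q ^+ 2) => //; pK.
rewrite exh; have := unitP_inv uq; move=> ?; pK.
Qed.

Lemma npid_int (e : int) : ~~ (3 %| e)%Z -> ~ pid e%:~R.
Proof.
move=> n3; have [r hr [q eq]] := residue_int e.
move=> d; have r0 : r = 0.
  apply: pid_int => //; have -> : r%:~R = e%:~R - pi3 * (eps * pi3 ^+ 2 * q%:~R) :> algC.
    by rewrite eq rmorphD rmorphM /= (eps_pi : 3%:~R = _); ring.
  by apply: (dvdPB inK_ring) => //; apply: pid_mulr; pK'.
by move: n3; rewrite eq r0 addr0 dvdz_mulr.
Qed.

(** With [t = e theta + 3 f tau theta] the hypotheses give a point [(t : U : V)] of the cubic that
    is [(theta : 1 : 1)] modulo 3, and [cubic_translate] carries that point to [(1 : 0 : 1)]. After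
    common factors are removed, the second coordinate of the translate is divisible by [pi3], so
    [cubic_descent] forces it to vanish; this happens only for [f = 0]. *)
Lemma x18_local (e f a b : int) : ~~ (3 %| e)%Z ->
  e ^+ 2 - e * (3 * f) + (3 * f) ^+ 2 = (e + 3 * a) * (e + 3 * b) ->
  e ^+ 3 + 3 * e ^+ 2 * (3 * f) - 6 * e * (3 * f) ^+ 2 + (3 * f) ^+ 3 = 2 * (e + 3 * a) ^+ 3 - (e + 3 * b) ^+ 3 ->
  f = 0.
Proof.
move=> n3 en eG.
(* The norm equation to first order in 3. *)
have [k ek] : exists k, f = 3 * k - a - b.
  have h : e * (a + b + f) = 3 * (f ^+ 2 - a * b) by lia.
  have : (3 %| e * (a + b + f))%Z by rewrite h dvdz_mulr.
  case/(@prime_mulz _ _ 3 isT); first by rewrite (negbTE n3).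
  by case/dvdzP => k ek; exists k; lia.
have [//|f0] := eqVneq f 0; exfalso.
pose E : algC := e%:~R; pose F : algC := f%:~R; pose A : algC := a%:~R; pose b' : algC := b%:~R; pose k' : algC := k%:~R.
have eF : F = 3 * k' - A - b' by rewrite /F ek !rmorphB rmorphM /=.
pose U := E + 3 * A; pose V := E + 3 * b'; pose B := tau theta; pose t := E * theta + 3 * F * B.
have eB : B = 2 - theta - theta ^+ 2 by exact: theta_lin.
have eth : theta = pi3 - 1 by rewrite /pi3 addrK.
have [KE KF KA Kb Kk] : [/\ inK E, inK F, inK A, inK b' & inK k'] by split; exact: inK_int.
have KB : inK B by apply: inK_tau; exact: inK_theta.
have nUV : E ^+ 2 - E * (3 * F) + (3 * F) ^+ 2 = U * V.
  have := congr1 (fun x : int => x%:~R : algC) en; rewrite /= => h.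
  have -> : U * V = ((e + 3 * a) * (e + 3 * b))%:~R by rewrite /U /V /E /A /b'; rewrite ?(rmorphD, rmorphN, rmorphXn, rmorphM) /= ?(rmorphD, rmorphN, rmorphXn, rmorphM) /= ?(rmorphD, rmorphN, rmorphXn, rmorphM) /=; ring.
  by rewrite -h /E /F; rewrite ?(rmorphD, rmorphN, rmorphXn, rmorphM) /= ?(rmorphD, rmorphN, rmorphXn, rmorphM) /= ?(rmorphD, rmorphN, rmorphXn, rmorphM) /=; ring.
have gUV : E ^+ 3 + 3 * E ^+ 2 * (3 * F) - 6 * E * (3 * F) ^+ 2 + (3 * F) ^+ 3 = 2 * U ^+ 3 - V ^+ 3.
  have := congr1 (fun x : int => x%:~R : algC) eG; rewrite /= => h.
  have -> : 2 * U ^+ 3 - V ^+ 3 = (2 * (e + 3 * a) ^+ 3 - (e + 3 * b) ^+ 3)%:~R.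
    by rewrite /U /V /E /A /b'; rewrite ?(rmorphD, rmorphN, rmorphXn, rmorphM) /= ?(rmorphD, rmorphN, rmorphXn, rmorphM) /= ?(rmorphD, rmorphN, rmorphXn, rmorphM) /=; ring.
  by rewrite -h /E /F; rewrite ?(rmorphD, rmorphN, rmorphXn, rmorphM) /= ?(rmorphD, rmorphN, rmorphXn, rmorphM) /= ?(rmorphD, rmorphN, rmorphXn, rmorphM) /=; ring.
have eqt : t ^+ 3 + 2 * U ^+ 3 - V ^+ 3 = 3 * t * U * V.
  have h := theta_norm E (3 * F).
  have -> : t ^+ 3 + 2 * U ^+ 3 - V ^+ 3 = t ^+ 3 + (2 * U ^+ 3 - V ^+ 3) by ring.
  by rewrite -gUV h nUV /t /B; ring.
have := cubic_translate eqt; cbv zeta.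
(* [X'], [Y'], [Z'] are the coordinates of the translate divided by 3. *)
pose c := E * b' - 2 * E * A - 3 * A ^+ 2.
pose X' := E ^+ 2 * theta + 2 * E * F * theta ^+ 2 * B + 3 * F ^+ 2 * theta * B ^+ 2 + E * (A + b') + 3 * A * b'.
pose Y' := theta * c + F * B * V.
pose Z' := 2 * E * b' - E * A + 3 * b' ^+ 2 + theta * E * U + F * B * theta ^+ 2 * U.
have KU : inK U by rewrite /U; pK. have KV : inK V by rewrite /V; pK.
have KX : inK X' by rewrite /X'; pK. have KY : inK Y' by rewrite /Y' /c; pK. have KZ : inK Z' by rewrite /Z'; pK.
have -> : theta * t ^+ 2 + U * V = 3 * X'.
  by apply: (@theta_red _ _ (E ^+ 2)); rewrite /t /X' /U /V; ring.
have -> : t * V - theta * U ^+ 2 = 3 * Y' by rewrite /t /Y' /c /U /V; ring.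
have -> : V ^+ 2 + theta ^+ 2 * t * U = 3 * Z'.
  by apply: (@theta_red _ _ (E * U)); rewrite /t /Z' /U /V; ring.
move=> eq27.
have eqn : X' ^+ 3 + 2 * Y' ^+ 3 - Z' ^+ 3 = 3 * X' * Y' * Z'.
  by apply: (mulfI (x := 27)); [rewrite pnatr_eq0 | move: eq27 => h; apply: etrans (etrans _ h) _; ring].
have p3 : pid 3 by rewrite eps_pi; exists (eps * pi3 ^+ 2); [pK' | ring].
have pY : pid Y'.
  have -> : Y' = (A ^+ 2 + 2 * F * b' + 2 * E * k' - E * b') * 3 + pi3 * (c + F * V * (1 - pi3)).
    by rewrite /Y' eB eth /c /V eF; ring.
  apply: (dvdPD inK_ring); first by apply: (dvdP_mull inK_ring) => //; pK.
  by apply: pid_mulr; rewrite /c; pK'.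
have nE := npid_int n3.
have nZ : ~ pid Z'.
  pose w := - pi3 ^+ 3 + 3 * pi3 ^+ 2 - pi3 - 3.
  have eZ : Z' = - E ^+ 2 + ((2 * E * k' - 2 * E * A + b' ^+ 2 + 2 * F * A) * 3 + pi3 * (E * U + F * U * w)).
    by rewrite /Z' /w eB eth /U eF; ring.
  rewrite eZ; apply: pid_addl.
    apply: (dvdPD inK_ring); first by apply: (dvdP_mull inK_ring) => //; pK.
    by apply: pid_mulr; rewrite /w; pK'.
  by move/(dvdPN inK_ring); rewrite opprK; exact: pid_primeX.
have Y0 : Y' != 0.
  apply/eqP => h; have : (2 * f * (e + 3 * b))%:~R + (e * b - 2 * e * a - 3 * a ^+ 2 - f * (e + 3 * b))%:~R * theta
     + (- (f * (e + 3 * b)))%:~R * theta ^+ 2 = 0%:~R + 0%:~R * theta + 0%:~R * theta ^+ 2 :> algC.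
    transitivity Y'; last by rewrite h; ring.
    by rewrite /Y' eB /c /V /E /F /A /b'; rewrite ?(rmorphD, rmorphN, rmorphXn, rmorphM) /= ?(rmorphD, rmorphN, rmorphXn, rmorphM) /= ?(rmorphD, rmorphN, rmorphXn, rmorphM) /=; ring.
  case/coordK => /eqP; rewrite !mulf_eq0 /= (negbTE f0) /= => /eqP h3 _ _.
  by move: n3; have -> : e = 3 * (- b) by [move: h3; clear; lia]; rewrite dvdz_mulr.
have Z0 : Z' != 0 by apply/eqP => h; apply: nZ; rewrite h; exact: (dvdP0 inK_ring).
have [h [u [v [Ku Kv eh [y Ky ey] [z Kz ez]]]]] := bezK KY KZ.
have Kh : inK h by rewrite eh; pK.
have h0 : h != 0 by apply: contra_neq Z0 => h0; rewrite ez h0 mulr0.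
have coyz : coprimeP inK y z.
  by exists u, v; split=> //; apply: (mulIf h0); rewrite mul1r [RHS]eh ey ez; ring.
have nh : ~ pid h by move=> ph; apply: nZ; rewrite ez; exact: (dvdP_mull inK_ring).
have y0 : y != 0 by apply: contra_neq Y0 => y0; rewrite ey y0 mul0r.
have py : pid y by have [//|ny] := pid_dec Ky; case: (pid_prime Ky Kh ny nh); rewrite -ey.
have eqx : (X' / h) ^+ 3 + 2 * y ^+ 3 - z ^+ 3 = 3 * (X' / h) * y * z.
  apply: (mulIf (expf_neq0 3 h0)).
  have fld : forall x h y z : algC, h != 0 -> ((x / h) ^+ 3 + 2 * y ^+ 3 - z ^+ 3) * h ^+ 3
     = x ^+ 3 + 2 * (y * h) ^+ 3 - (z * h) ^+ 3 by move=> ???? hq; field.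
  have fld' : forall x h y z : algC, h != 0 -> 3 * (x / h) * y * z * h ^+ 3
     = 3 * x * (y * h) * (z * h) by move=> ???? hq; field.
  by rewrite fld // fld' // -ey -ez eqn.
have Kx : inK (X' / h).
  apply: (@cubic_integral X' h (3 * y * z) (z ^+ 3 - 2 * y ^+ 3)) => //; [by pK|by pK|].
  transitivity ((X' / h) ^+ 3 + 2 * y ^+ 3 - z ^+ 3 + (z ^+ 3 - 2 * y ^+ 3)); first by ring.
  by rewrite eqx; ring.
have [l [y1 [Ky1 ny1 ey1]]] := pi_val Ky y0.
apply: (cubic_descent Kx Ky Kz Ky1 eqx (coprimeKS coyz) ey1 ny1).
by case: l ey1 => // e1; case: ny1; move: py; rewrite e1 expr0 mul1r.
Qed.

Lemma cube_split (A B n : int) : 0 < n -> coprimez A B -> A * B = n ^+ 3 ->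
  exists x y : int, [/\ A = x ^+ 3, B = y ^+ 3 & n = x * y].
Proof.
move=> n0 co e.
have nA : A * B > 0 by rewrite e exprn_gt0.
have [A0|A0] := leP 0 A.
  have B0 : 0 <= B by nia.
  have [x [y [[x0 y0 ex ey] [en _]]]] := coprime_powz (isT : (0 < 3)%N) A0 B0 co e.
  by exists x, y; split=> //; rewrite -en gtr0_norm.
have A0' : 0 <= - A by lia. have B0' : 0 <= - B by nia.
have co' : coprimez (- A) (- B) by rewrite coprimezN coprimeNz.
have e' : - A * - B = n ^+ 3 by rewrite mulrNN.
have [x [y [[x0 y0 ex ey] [en _]]]] := coprime_powz (isT : (0 < 3)%N) A0' B0' co' e'.
exists (- x), (- y); split; [by rewrite -[A]opprK ex; ring|by rewrite -[B]opprK ey; ring|].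
by rewrite mulrNN -en gtr0_norm.
Qed.

Definition norm3 (e f : int) := e ^+ 2 - e * f + f ^+ 2.
(** Both forms are invariant under the rotation [(e, f) -> (f - e, - e)] of order 3. *)
Definition form3 (e f : int) := e ^+ 3 + 3 * e ^+ 2 * f - 6 * e * f ^+ 2 + f ^+ 3.

(** Modulo 3 the equations become [U V = e^2] and [2 U - V = e], with the only solution [U = V = e];
    this is the situation of [x18_local]. *)
Lemma x18_rot (e f U V : int) : ~~ (3 %| norm3 e f)%Z -> (3 %| f)%Z ->
  norm3 e f = U * V -> form3 e f = 2 * U ^+ 3 - V ^+ 3 -> f = 0.
Proof.
move=> n3 /dvdzP [f' ef] en eG; rewrite mulrC in ef.
have ne : ~~ (3 %| e)%Z.
  apply: contra n3 => /dvdzP [q eq]; apply/dvdzP; exists (3 * q ^+ 2 - q * f + f' * f).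
  by rewrite /norm3 eq ef; ring.
have cube : forall r : int, tri r -> r ^+ 3 = r by move=> r /orP[/orP[]|] /eqP ->.
have [re hre [e0 ee]] := residue_int e.
have [ru hru [u0 eu]] := residue_int U.
have [rv hrv [v0 ev]] := residue_int V.
have re0 : re <> 0 by move=> h; move: ne; rewrite ee h addr0 dvdz_mulr.
have h1 : exists q, ru * rv = re ^+ 2 + 3 * q.
  exists (3 * e0 ^+ 2 + 2 * e0 * re - e * f' + 3 * f' ^+ 2 - 3 * u0 * v0 - u0 * rv - v0 * ru).
  have -> : ru * rv = U * V - 3 * (3 * u0 * v0 + u0 * rv + v0 * ru) by rewrite eu ev; ring.
  by rewrite -en /norm3 ef [in e ^+ 2]ee; ring.
have h2 : exists q, 2 * ru - rv = re + 3 * q.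
  pose k (x y : int) := 9 * x ^+ 3 + 9 * x ^+ 2 * y + 3 * x * y ^+ 2.
  exists (k e0 re + 3 * e ^+ 2 * f' - 18 * e * f' ^+ 2 + 9 * f' ^+ 3 - 2 * k u0 ru + k v0 rv).
  have cu : forall x y : int, tri y -> (3 * x + y) ^+ 3 = y + 3 * k x y.
    by move=> x y hy; transitivity (y ^+ 3 + 3 * k x y); [rewrite /k; ring | rewrite cube].
  have eU := cu u0 ru hru; have eV := cu v0 rv hrv; have eE := cu e0 re hre.
  rewrite -eu in eU; rewrite -ev in eV; rewrite -ee in eE.
  have hu : ru = U ^+ 3 - 3 * k u0 ru by rewrite eU addrK.
  have hv : rv = V ^+ 3 - 3 * k v0 rv by rewrite eV addrK.
  have he : re = e ^+ 3 - 3 * k e0 re by rewrite eE addrK.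
  move: hu hv he; move: (k u0 ru) (k v0 rv) (k e0 re) => K1 K2 K3 hu hv he.
  rewrite hu hv he; transitivity (2 * U ^+ 3 - V ^+ 3 - 6 * K1 + 3 * K2); first by ring.
  by rewrite -eG /form3 ef; ring.
have [ea eb] : ru = re /\ rv = re.
  case: h1 h2 => [q1 h1] [q2 h2]; move: h1 h2 re0; clear -hre hru hrv.
  case/orP: hre => [/orP[]|] /eqP ->; case/orP: hru => [/orP[]|] /eqP ->; case/orP: hrv => [/orP[]|] /eqP ->; lia.
have eU : U = e + 3 * (u0 - e0) by rewrite eu ee ea; ring.
have eV : V = e + 3 * (v0 - e0) by rewrite ev ee eb; ring.
rewrite ef (@x18_local e f' (u0 - e0) (v0 - e0)) ?mulr0 //.
  by rewrite -eU -eV -en /norm3 ef.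
by rewrite -eU -eV -eG /form3 ef.
Qed.

(** The genus 2 model of X_1(18). The halves of [s - G] and [s + G] are coprime with product
    [2 n^3], whence [n = U V] and [G = 2 U^3 - V^3]. Modulo 3 one of [e], [f], [e - f] vanishes, and
    the rotation of order 3 moves it to the second place, where [x18_rot] applies. *)
Lemma x18_coprime (e f s : int) : coprimez e f -> s ^+ 2 = form3 e f ^+ 2 + 8 * norm3 e f ^+ 3 ->
  [\/ e = 0, f = 0 | e = f].
Proof.
move=> co es.
set n := norm3 e f; set G := form3 e f.
(* If 3 divides [n], then [n = 3 n1] and [G = 9 G1]; dividing the equation by powers of 3 shows that
   3 divides [n1], then [f], then [e]. *)
have n3 : ~~ (3 %| n)%Z.
  apply/negP => d3.
  have : (3 %| (e + f) ^+ 2)%Z by apply: (dvd_comb d3 (dvdzz 3) (x := 1) (y := e * f)); rewrite /n /norm3; ring.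
  move/(@prime_expz _ 3 2 isT)/dvdzP => [k ek].
  have ee : e = 3 * k - f by move: ek; clear; lia.
  pose n1 := f ^+ 2 - 3 * f * k + 3 * k ^+ 2; pose G1 := 3 * k ^+ 3 - 3 * k * f ^+ 2 + f ^+ 3.
  have es1 : s ^+ 2 = 27 * (3 * G1 ^+ 2 + 8 * n1 ^+ 3) by rewrite es /norm3 /form3 ee /n1 /G1; ring.
  have [s1 e1] : exists q, s = q * 3.
    by apply/dvdzP; apply: (@prime_expz _ 3 2 isT); rewrite es1; apply/dvdzP; exists (9 * (3 * G1 ^+ 2 + 8 * n1 ^+ 3)); ring.
  have es2 : s1 ^+ 2 = 3 * (3 * G1 ^+ 2 + 8 * n1 ^+ 3).
    by apply: (mulfI (x := 9)) => //; transitivity (s ^+ 2); [rewrite e1 | rewrite es1]; ring.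
  have [s2 e2] : exists q, s1 = q * 3.
    by apply/dvdzP; apply: (@prime_expz _ 3 2 isT); rewrite es2 dvdz_mulr.
  have es3 : 3 * s2 ^+ 2 = 3 * G1 ^+ 2 + 8 * n1 ^+ 3.
    by apply: (mulfI (x := 3)) => //; rewrite -es2 e2; ring.
  have : (3 %| n1)%Z.
    (* The witness amounts to [3 n1^3 - (s2^2 - G1^2)], from [n1^3 = 9 n1^3 - 8 n1^3]. *)
    apply: (@prime_expz _ 3 3 isT); apply/dvdzP; exists (s2 ^+ 2 - G1 ^+ 2 - 0 + (3 * n1 ^+ 3) - 2 * (s2 ^+ 2 - G1 ^+ 2) + 0).
    by move: es3; clear; lia.
  case/dvdzP => q eq; have : (3 %| f ^+ 2)%Z.
    by apply/dvdzP; exists (q + f * k - k ^+ 2); move: eq; rewrite /n1; clear; lia.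
  move/(@prime_expz _ 3 2 isT) => d; apply: (cop_prime co (isT : prime 3)) => //.
  by rewrite ee; apply: (dvd_comb (dvdzz 3) d (x := k) (y := -1)); ring.
have conG : forall p : nat, prime p -> (p %| n)%Z -> (p %| G)%Z -> False.
  move=> p pp pn pG.
  have n3p : p <> 3%N by move=> h; move: n3; rewrite h in pn; rewrite pn.
  have pf : (p %| f)%Z -> False.
    move=> h; apply: (cop_prime co pp) => //; apply: (prime_expz (k := 2) pp).
    by apply: (dvd_comb pn h (x := 1) (y := e - f)); rewrite /n /norm3; ring.
  have pe : (p %| e)%Z -> False.
    move=> h; apply: pf; apply: (prime_expz (k := 2) pp).
    by apply: (dvd_comb pn h (x := 1) (y := f - e)); rewrite /n /norm3; ring.
  have p3 : (p %| 3)%Z -> False by move/(@prime_dvd_eq p 3 pp isT).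
  have : (p %| 3 * (e * (f * (e - 2 * f))))%Z.
    by apply: (dvd_comb pn pG (x := - (e + f)) (y := 1)); rewrite /n /G /norm3 /form3; ring.
  case/(prime_mulz pp) => // /(prime_mulz pp) [] // /(prime_mulz pp) [] // h.
  have : (p %| 3 * f ^+ 2)%Z by apply: (dvd_comb pn h (x := 1) (y := - (e + f))); rewrite /n /norm3; ring.
  by case/(prime_mulz pp) => // /(prime_expz pp).
have n0 : 0 < n.
  have h4 : 4 * n = (2 * e - f) ^+ 2 + 3 * f ^+ 2 by rewrite /n /norm3; ring.
  have h1 : 0 <= (2 * e - f) ^+ 2 by rewrite exprn_even_ge0.
  have h2 : 0 <= f ^+ 2 by rewrite exprn_even_ge0.
  have hn : n <> 0 by move=> h; move: n3; rewrite h dvdz0.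
  by move: h4 h1 h2 hn; clear; lia.
have [A [B [eA eB]]] : exists A B, s - G = 2 * A /\ s + G = 2 * B.
  have es' : s ^+ 2 = G ^+ 2 + 8 * n ^+ 3 by exact: es.
  have [a [ea|ea]] := parity G; have [z [ez|ez]] := parity s.
  - by exists (z - a), (z + a); split; [rewrite ea ez | rewrite ea ez]; ring.
  - by exfalso; move: es'; rewrite ea ez; clear; lia.
  - by exfalso; move: es'; rewrite ea ez; clear; lia.
  - by exists (z - a), (z + a + 1); split; [rewrite ea ez | rewrite ea ez]; ring.
have AB : A * B = 2 * n ^+ 3.
  apply: (mulfI (x := 4)) => //; transitivity (s ^+ 2 - G ^+ 2); last by rewrite es -/n -/G; ring.
  by transitivity ((2 * A) * (2 * B)); [ring | rewrite -eA -eB; ring].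
have BA : B - A = G by apply: (mulfI (x := 2)) => //; rewrite mulrBr -eA -eB; ring.
have coAB : coprimez A B.
  apply: prime_cop => p pp pA pB.
  have pG : (p %| G)%Z by rewrite -BA; apply: (dvd_comb pA pB (x := -1) (y := 1)); ring.
  apply: (conG p pp _ pG); apply: (prime_expz (k := 3) pp).
  case/dvdzP: (pA) => u eu; case/dvdzP: (pB) => v ev.
  have : (p %| 2 * n ^+ 3)%Z by rewrite -AB; exact: dvdz_mulr.
  case/(prime_mulz pp) => // /(prime_2 pp) l2; apply/dvdzP; exists (u * v).
  by apply: (mulfI (x := 2)) => //; rewrite -AB eu ev l2; ring.
have [U [V [eU eV]]] : exists U V, n = U * V /\ G = 2 * U ^+ 3 - V ^+ 3.
  have : (2 %| A * B)%Z by rewrite AB dvdz_mulr.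
  case/(@prime_mulz _ _ 2 isT) => /dvdzP [h eh].
    have hB : h * B = n ^+ 3 by apply: (mulfI (x := 2)) => //; rewrite -AB eh; ring.
    have coh : coprimez h B by apply: prime_cop => p pp ph pd; apply: (cop_prime coAB pp) => //; rewrite eh; exact: dvdz_mulr.
    have [x [y [ex ey exy]]] := cube_split n0 coh hB.
    exists (- x), (- y); split; first by rewrite exy; ring.
    by rewrite -BA eh ex ey; ring.
  have hA : h * A = n ^+ 3 by apply: (mulfI (x := 2)) => //; rewrite -AB eh; ring.
  have coh : coprimez h A by apply: prime_cop => p pp ph pd; apply: (cop_prime coAB pp) => //; rewrite eh; exact: dvdz_mulr.
  have [x [y [ex ey exy]]] := cube_split n0 coh hA.
  exists x, y; split=> //.
  by rewrite -BA eh ex ey; ring.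
have [re hre [e0 ee]] := residue_int e; have [rf hrf [f0 ef]] := residue_int f.
have [h|[h|h]] : rf = 0 \/ re = 0 \/ re = rf.
  have : ~~ (3 %| re + rf)%Z.
    apply: contra n3 => /dvdzP [q eq]; apply/dvdzP.
    exists ((q + e0 + f0) * (e + f) - e * f).
    have hq : e + f = 3 * (q + e0 + f0) by move: ee ef eq; clear; lia.
    by transitivity ((e + f) * (e + f) - 3 * (e * f)); [rewrite /n /norm3; ring | rewrite {1}hq; ring].
  by case/orP: hre => [/orP[]|] /eqP ->; case/orP: hrf => [/orP[]|] /eqP ->; auto.
- have f3 : (3 %| f)%Z by rewrite ef h addr0 dvdz_mulr.
  by apply: Or32; apply: (x18_rot n3 f3 eU eV).
- have f3 : (3 %| - e)%Z by rewrite ee h addr0 -mulrN dvdz_mulr.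
  have en' : norm3 (f - e) (- e) = n by rewrite /n /norm3; ring.
  have eG' : form3 (f - e) (- e) = G by rewrite /G /form3; ring.
  apply: Or31; apply/eqP; rewrite -oppr_eq0; apply/eqP.
  by apply: (@x18_rot (f - e) (- e) U V); rewrite ?en' ?eG'.
- have f3 : (3 %| e - f)%Z by apply/dvdzP; exists (e0 - f0); rewrite ee ef h; ring.
  have en' : norm3 (- f) (e - f) = n by rewrite /n /norm3; ring.
  have eG' : form3 (- f) (e - f) = G by rewrite /G /form3; ring.
  apply: Or33; apply/eqP; rewrite -subr_eq0; apply/eqP.
  by apply: (@x18_rot (- f) (e - f) U V); rewrite ?en' ?eG'.
Qed.

(** [p], [q], [r] are the differences from the fixed point to the points of the 3-cycle. In terms of
    [e], [f] and the sum [sg], nine times the condition is the quadratic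
    [norm3 sg^2 + form3 sg - 2 norm3^2 = 0]; [W] is its derivative, so [W^2] is the discriminant. *)
Theorem three_cycle (p q r : int) :
  p ^+ 3 * q + q ^+ 3 * r + r ^+ 3 * p = p ^+ 2 * q ^+ 2 + q ^+ 2 * r ^+ 2 + r ^+ 2 * p ^+ 2 ->
  [\/ p = q, p = r | q = r].
Proof.
move=> F0; pose e := q - p; pose f := r - p; pose sg := p + q + r.
have [h|ef] := eqVneq e 0; first by apply: Or31; apply/esym/eqP; rewrite -subr_eq0 -/e h.
have [g [e' [f' [g0 ee ef' co]]]] : exists g a' b' : int, [/\ g != 0, e = g * a', f = g * b' & coprimez a' b'].
  by apply: coprime_scale; rewrite ef.
pose W := 2 * norm3 e f * sg + form3 e f.
have eW : W ^+ 2 = (form3 e' f' ^+ 2 + 8 * norm3 e' f' ^+ 3) * (g ^+ 3) ^+ 2.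
  transitivity (form3 e f ^+ 2 + 8 * norm3 e f ^+ 3); last by rewrite /form3 /norm3 ee ef'; ring.
  transitivity (form3 e f ^+ 2 + 8 * norm3 e f ^+ 3 + 36 * norm3 e f *
    (p ^+ 3 * q + q ^+ 3 * r + r ^+ 3 * p - (p ^+ 2 * q ^+ 2 + q ^+ 2 * r ^+ 2 + r ^+ 2 * p ^+ 2))).
    by rewrite /W /form3 /norm3 /sg /e /f; ring.
  by rewrite F0 subrr mulr0 addr0.
have [s es] : exists s, W = s * g ^+ 3 by apply/dvdzP; apply: dvd_sqz; rewrite eW dvdz_mull.
have es2 : s ^+ 2 = form3 e' f' ^+ 2 + 8 * norm3 e' f' ^+ 3.
  by apply: (mulIf (expf_neq0 2 (expf_neq0 3 g0))); rewrite -eW es; ring.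
case: (x18_coprime co es2) => h.
- by apply: Or31; apply/esym/eqP; rewrite -subr_eq0 -/e ee h mulr0.
- by apply: Or32; apply/esym/eqP; rewrite -subr_eq0 -/f ef' h mulr0.
- apply: Or33; apply/eqP; rewrite -subr_eq0.
  have -> : q - r = e - f by rewrite /e /f; ring.
  by rewrite ee ef' h subrr.
Qed.

(** * Exceptional signatures *)

From mathcomp.multinomials Require Import mpoly.

(* [bev [:: c_0; ...; c_d] a b] is the binary form [\sum_i c_i a^(d-i) b^i]. *)
Fixpoint bev (L : seq int) (a b : int) : int :=
  if L is c :: L' then c * a ^+ size L' + b * bev L' a b else 0.

Lemma bev_scale L (g a b : int) : g * bev L (g * a) (g * b) = g ^+ size L * bev L a b.
Proof.
elim: L => [|c L IH] /=; first by rewrite !mulr0.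
rewrite exprMn mulrDr mulrDr [g ^+ _.+1]exprS; congr (_ + _); first by ring.
by transitivity (g * b * (g * bev L (g * a) (g * b))); [ring | rewrite IH; ring].
Qed.

Lemma bev_mod L (p a b u v : int) : (p %| bev L (a + p * u) (b + p * v) - bev L a b)%Z.
Proof.
elim: L => [|c L IH] /=; first by rewrite subrr dvdz0.
have pw n : (p %| (a + p * u) ^+ n - a ^+ n)%Z.
  elim: n => [|n IHn]; first by rewrite !expr0 subrr dvdz0.
  rewrite !exprS; have -> : (a + p * u) * (a + p * u) ^+ n - a * a ^+ n
    = (a + p * u) * ((a + p * u) ^+ n - a ^+ n) + u * a ^+ n * p by ring.
  by apply: rpredD; [exact: dvdz_mull | exact: dvdz_mull].
set A := (a + p * u) ^+ _; set A' := a ^+ _; set B := bev L _ _; set B' := bev L a b.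
have -> : c * A + (b + p * v) * B - (c * A' + b * B')
  = c * (A - A') + (b + p * v) * (B - B') + v * B' * p by ring.
by apply: rpredD; [apply: rpredD | exact: dvdz_mull]; apply: dvdz_mull; [exact: pw | exact: IH].
Qed.

Definition no_root_mod (p : nat) (L : seq int) : bool :=
  all (fun i : nat => all (fun j : nat => (i == 0)%N && (j == 0)%N || ~~ (p %| bev L i j)%Z) (iota 0 p)) (iota 0 p).

(** After division by the gcd of [a] and [b] a zero is still nontrivial modulo [p]. *)
Lemma binary_no_root (p : nat) (L : seq int) (a b : int) :
  prime p -> no_root_mod p L -> bev L a b = 0 -> a = 0.
Proof.
move=> pp chk e; have [//|a0] := eqVneq a 0; exfalso.
have [g [a' [b' [g0 ea eb co]]]] : exists g a' b' : int, [/\ g != 0, a = g * a', b = g * b' & coprimez a' b'].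
  by apply: coprime_scale; rewrite a0.
have e' : bev L a' b' = 0.
  apply: (mulfI (expf_neq0 (size L) g0)); rewrite mulr0 -bev_scale -ea -eb e; exact: mulr0.
have p0 : (p : int) != 0 by rewrite -lt0n in pp *; case: p pp {chk}.
have res (n : int) : exists (r : nat) (q : int), (r < p)%N /\ n = r%:Z + p%:Z * q.
  exists `|(n %% p)%Z|%N, (n %/ p)%Z; have h0 := modz_ge0 n p0.
  have pz : (0 : int) < p by case: p pp {chk p0 h0}.
  have h1 := ltz_pmod n pz; split; first by move: h0 h1; move: (n %% p)%Z => m; lia.
  by rewrite gez0_abs // {1}(divz_eq n p); ring.
have [i [u [li ei]]] := res a'; have [j [v [lj ej]]] := res b'.
have d : (p %| bev L i j)%Z.
  have := bev_mod L p i j u v; rewrite -ei -ej e' sub0r => h.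
  by rewrite -[bev L i j]opprK rpredN.
move/allP: chk => /(_ i); rewrite mem_iota /= add0n li => /(_ isT) /allP /(_ j).
rewrite mem_iota /= add0n lj d orbF => /(_ isT) /andP[/eqP i0 /eqP j0].
apply: (cop_prime co pp); [rewrite ei i0 | rewrite ej j0]; rewrite add0r; exact: dvdz_mulr.
Qed.

(** [c] collects the monomials and linear forms, positive on the octant, that split off from a
    resultant. *)
Lemma no_root_absurd (p : nat) (L : seq int) (a b c : int) :
  prime p -> no_root_mod p L -> 0 < a -> 0 < c -> c * bev L a b = 0 -> False.
Proof.
move=> pp chk a0 c0 /eqP; rewrite mulf_eq0 (negbTE (lt0r_neq0 c0)) /= => /eqP e.
by move: a0; rewrite (binary_no_root pp chk e) ltxx.
Qed.

Lemma pos_absurd (a : int) : 0 < a -> a = 0 -> False.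
Proof. by move=> + e; rewrite e ltxx. Qed.

Lemma comb2 (f g a b r : int) : f = 0 -> g = 0 -> r = a * f + b * g -> r = 0.
Proof. by move=> -> -> ->; rewrite !mulr0 addr0. Qed.

Ltac ps := repeat first [assumption | apply: addr_gt0 | apply: mulr_gt0 | apply: exprn_gt0 | done].

(** * Signature forms at integer points *)

Definition b1 (x y z : int) : int := - y * (x + z) * (x + y + z).
Definition b2 (x y z : int) : int := (x + y) * (x + z) * (2 * x + y + z).
Definition b3 (x y z : int) : int := - x * (2 * x + y + z) * (x + y + z).
Definition b4 (x y z : int) : int := x * y * (x + y).

Ltac bring := rewrite /b1 /b2 /b3 /b4; ring.

Definition aN (j : nat) (x y z : int) : int :=
  match j with
  | 1%N => b1 x y z
  | 2%N => b2 x y z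
  | 3%N => b3 x y z
  | 4%N => b4 x y z
  | _ => 0
  end.

Definition aZ (i : int) (x y z : int) : int :=
  match i with Posz j => aN j x y z | Negz j => - aN j.+1 x y z end.

Definition sig1 (I : signature) (x y z : int) : int :=
  let: (i1, i2, i3, i4) := I in aZ i1 x y z + aZ i2 x y z + aZ i3 x y z + aZ i4 x y z.

(** Half of the value of [p2]: the factor 2 of the cross terms is left out. *)
Definition sig2 (I : signature) (x y z : int) : int :=
  let: (i1, i2, i3, i4) := I in aZ i2 x y z * x + aZ i3 x y z * (x + y) + aZ i4 x y z * (2 * x + y + z).

(* The condition under which a non-trivial signature is degenerate; 0 stands for never. *)
Definition cnd (c : nat) (x y z : int) : Prop :=
  match c with
  | 1%N => in_ray 1 1 1 x y z
  | 2%N => in_ray 1 3 2 x y z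
  | 3%N => in_ray 1 4 4 x y z
  | 4%N => in_ray 2 1 1 x y z
  | 5%N => 2 * x ^+ 2 + x * z - y * z = 0
  | 6%N => x ^+ 2 - y * z = 0
  | 7%N => x ^+ 2 + x * z - y ^+ 2 = 0
  | 8%N => 2 * x ^+ 3 + 4 * x ^+ 2 * y + x ^+ 2 * z + 2 * x * y ^+ 2 - y ^+ 2 * z - y * z ^+ 2 = 0
  | 9%N => 4 * x ^+ 3 + 4 * x ^+ 2 * y + 4 * x ^+ 2 * z + 2 * x * y * z + x * z ^+ 2 - y ^+ 2 * z = 0
  | _ => False
  end.

(** The pattern of most proofs below: [f0] and [g0] are [sig1] and [sig2] freed of positive factors,
    and [r0] is a pseudo-remainder eliminating one variable, with cofactors [a] and [b]. What is
    left is a binary form without zeros modulo a small prime, or one with coefficients of one sign.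
    Where [r0] still contains the eliminated variable linearly, a second pseudo-division follows in
    the last line. *)
Lemma deg1 (x y z : int) : 0 < x -> 0 < y -> 0 < z ->
  sig1 (0, 1, -3, 1) x y z = 0 -> sig2 (0, 1, -3, 1) x y z = 0 -> cnd 0 x y z.
Proof.
move=> x0 y0 z0 h1 h2.
have {}h1 : 0 + b1 x y z + (- b3 x y z) + b1 x y z = 0 := h1.
have {}h2 : (b1 x y z) * x + (- b3 x y z) * (x + y) + (b1 x y z) * (2 * x + y + z) = 0 := h2.
have f0 : 2 * x ^+ 2 - x * y + x * z - 2 * y * z = 0.
  apply: (mulfI (x := 1 * (x + y + z))); first by apply: lt0r_neq0; ps.
  by rewrite mulr0 -[RHS]h1; bring.
have g0 : 2 * x ^+ 3 + x ^+ 2 * z - 3 * x * y * z - y ^+ 2 * z - y * z ^+ 2 = 0.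
  apply: (mulfI (x := 1 * (x + y + z))); first by apply: lt0r_neq0; ps.
  by rewrite mulr0 -[RHS]h2; bring.
have r0 : - x ^+ 4 * y - 3 * x ^+ 3 * y ^+ 2 + 2 * x * y ^+ 4 = 0 by apply: (comb2 f0 g0 (a := - (x ^+ 3 - 3 * x ^+ 2 * y + 4 * x * y ^+ 2 - x * y * z + 2 * y ^+ 3 + 2 * y ^+ 2 * z)) (b := (x - 2 * y) ^+ 2)); ring.
by apply: (@no_root_absurd 5 [:: -1; -2; 2] x y (1 * x ^+ 1 * y ^+ 1 * (x + y))); [|vm_compute|by []|ps|apply: (comb2 r0 r0 (a := 1) (b := 0)); rewrite /bev /=; ring].
Qed.

Lemma deg2 (x y z : int) : 0 < x -> 0 < y -> 0 < z ->
  sig1 (0, 1, 2, 1) x y z = 0 -> sig2 (0, 1, 2, 1) x y z = 0 -> cnd 0 x y z.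
Proof.
move=> x0 y0 z0 h1 h2.
have {}h1 : 0 + b1 x y z + b2 x y z + b1 x y z = 0 := h1.
have {}h2 : (b1 x y z) * x + (b2 x y z) * (x + y) + (b1 x y z) * (2 * x + y + z) = 0 := h2.
have f0 : 2 * x ^+ 2 + x * y + x * z - y ^+ 2 - y * z = 0.
  apply: (mulfI (x := 1 * (x + z))); first by apply: lt0r_neq0; ps.
  by rewrite mulr0 -[RHS]h1; bring.
have g0 : 2 * x ^+ 3 + 2 * x ^+ 2 * y + x ^+ 2 * z - 2 * x * y * z - y ^+ 2 * z - y * z ^+ 2 = 0.
  apply: (mulfI (x := 1 * (x + z))); first by apply: lt0r_neq0; ps.
  by rewrite mulr0 -[RHS]h2; bring.
have r0 : - x ^+ 4 * y - 4 * x ^+ 3 * y ^+ 2 - x ^+ 2 * y ^+ 3 + 2 * x * y ^+ 4 = 0 by apply: (comb2 f0 g0 (a := - (x ^+ 3 - x ^+ 2 * y + 2 * x * y ^+ 2 - x * y * z + y ^+ 2 * z)) (b := (x - y) ^+ 2)); ring.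
by apply: (@no_root_absurd 3 [:: -1; -3; 2] x y (1 * x ^+ 1 * y ^+ 1 * (x + y))); [|vm_compute|by []|ps|apply: (comb2 r0 r0 (a := 1) (b := 0)); rewrite /bev /=; ring].
Qed.

Lemma deg3 (x y z : int) : 0 < x -> 0 < y -> 0 < z ->
  sig1 (0, 3, -1, 3) x y z = 0 -> sig2 (0, 3, -1, 3) x y z = 0 -> cnd 0 x y z.
Proof.
move=> x0 y0 z0 h1 h2.
have {}h1 : 0 + b3 x y z + (- b1 x y z) + b3 x y z = 0 := h1.
have {}h2 : (b3 x y z) * x + (- b1 x y z) * (x + y) + (b3 x y z) * (2 * x + y + z) = 0 := h2.
have f0 : - 4 * x ^+ 2 - x * y - 2 * x * z + y * z = 0.
  apply: (mulfI (x := 1 * (x + y + z))); first by apply: lt0r_neq0; ps.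
  by rewrite mulr0 -[RHS]h1; bring.
have g0 : - 6 * x ^+ 3 - 4 * x ^+ 2 * y - 5 * x ^+ 2 * z - x * y * z - x * z ^+ 2 + y ^+ 2 * z = 0.
  apply: (mulfI (x := 1 * (x + y + z))); first by apply: lt0r_neq0; ps.
  by rewrite mulr0 -[RHS]h2; bring.
have r0 : - 2 * x ^+ 4 * y - 6 * x ^+ 3 * y ^+ 2 - 3 * x ^+ 2 * y ^+ 3 + x * y ^+ 4 = 0 by apply: (comb2 f0 g0 (a := - (6 * x ^+ 3 - 4 * x ^+ 2 * y + 2 * x ^+ 2 * z - 3 * x * y ^+ 2 - x * y * z + y ^+ 3)) (b := (- 2 * x + y) ^+ 2)); ring.
by apply: (@no_root_absurd 7 [:: -2; -4; 1] x y (1 * x ^+ 1 * y ^+ 1 * (x + y))); [|vm_compute|by []|ps|apply: (comb2 r0 r0 (a := 1) (b := 0)); rewrite /bev /=; ring].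
Qed.

(** The resultant is [x y^2 (x + y) (y - 3 x)]: its only factor that can vanish is linear, and it
    defines the ray. *)
Lemma deg4 (x y z : int) : 0 < x -> 0 < y -> 0 < z ->
  sig1 (0, 3, 2, 3) x y z = 0 -> sig2 (0, 3, 2, 3) x y z = 0 -> cnd 2 x y z.
Proof.
move=> x0 y0 z0 h1 h2.
have {}h1 : 0 + b3 x y z + b2 x y z + b3 x y z = 0 := h1.
have {}h2 : (b3 x y z) * x + (b2 x y z) * (x + y) + (b3 x y z) * (2 * x + y + z) = 0 := h2.
have f0 : - x ^+ 2 - x * y - x * z + y * z = 0.
  apply: (mulfI (x := 1 * (2 * x + y + z))); first by apply: lt0r_neq0; ps.
  by rewrite mulr0 -[RHS]h1; bring.
have g0 : - 2 * x ^+ 3 - 2 * x ^+ 2 * y - 3 * x ^+ 2 * z - x * z ^+ 2 + y ^+ 2 * z = 0.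
  apply: (mulfI (x := 1 * (2 * x + y + z))); first by apply: lt0r_neq0; ps.
  by rewrite mulr0 -[RHS]h2; bring.
have r0 : - 3 * x ^+ 3 * y ^+ 2 - 2 * x ^+ 2 * y ^+ 3 + x * y ^+ 4 = 0.
  transitivity ((- x + y) ^+ 2 * (- 2 * x ^+ 3 - 2 * x ^+ 2 * y - 3 * x ^+ 2 * z - x * z ^+ 2 + y ^+ 2 * z) - (2 * x ^+ 3 - 4 * x ^+ 2 * y + x ^+ 2 * z - x * y ^+ 2 - x * y * z + y ^+ 3) * (- x ^+ 2 - x * y - x * z + y * z)); first by ring.
  by rewrite f0 g0 !mulr0 subrr.
have ey : y = 3 * x.
  apply/eqP; rewrite -subr_eq0; apply/eqP; apply: (mulfI (x := 1 * x ^+ 1 * y ^+ 2 * (x + y) * 1)); first by apply: lt0r_neq0; ps.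
  by rewrite mulr0 -[RHS]r0; ring.
have ez : z = 2 * x.
  have : x * (z - 2 * x) = 0 by move: f0; rewrite ey; clear; lia.
  by move/eqP; rewrite mulf_eq0 (negbTE (lt0r_neq0 x0)) /= subr_eq0 => /eqP.
exists `|x|%N; first by move: x0; clear; lia.
by rewrite gtz0_abs // ey ez; split; ring.
Qed.

Lemma deg5 (x y z : int) : 0 < x -> 0 < y -> 0 < z ->
  sig1 (0, 4, -2, -3) x y z = 0 -> sig2 (0, 4, -2, -3) x y z = 0 -> cnd 0 x y z.
Proof.
move=> x0 y0 z0 h1 h2.
have {}h1 : 0 + b4 x y z + (- b2 x y z) + (- b3 x y z) = 0 := h1.
have {}h2 : (b4 x y z) * x + (- b2 x y z) * (x + y) + (- b3 x y z) * (2 * x + y + z) = 0 := h2.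
have f0 : x ^+ 2 + x * y - 2 * x * z - y * z - z ^+ 2 = 0.
  apply: (mulfI (x := 1 * y)); first by apply: lt0r_neq0; ps.
  by rewrite mulr0 -[RHS]h1; bring.
have g0 : 2 * x ^+ 4 + 4 * x ^+ 3 * y + 5 * x ^+ 3 * z + 2 * x ^+ 2 * y ^+ 2 + 3 * x ^+ 2 * y * z + 4 * x ^+ 2 * z ^+ 2 - 2 * x * y ^+ 2 * z + x * y * z ^+ 2 + x * z ^+ 3 - y ^+ 3 * z - y ^+ 2 * z ^+ 2 = 0.
  apply: (mulfI (x := 1)); first by apply: lt0r_neq0; ps.
  by rewrite mulr0 -[RHS]h2; bring.
have r0 : x ^+ 6 * z + 5 * x ^+ 5 * z ^+ 2 - 8 * x ^+ 3 * z ^+ 4 - 5 * x ^+ 2 * z ^+ 5 - x * z ^+ 6 = 0 by apply: (comb2 f0 g0 (a := - (2 * x ^+ 5 + 2 * x ^+ 4 * y + 2 * x ^+ 4 * z - 5 * x ^+ 3 * y * z - 4 * x ^+ 3 * z ^+ 2 - x ^+ 2 * y ^+ 2 * z + 2 * x ^+ 2 * y * z ^+ 2 - 4 * x ^+ 2 * z ^+ 3 + 2 * x * y ^+ 2 * z ^+ 2 + x * y * z ^+ 3 - y ^+ 2 * z ^+ 3)) (b := (x - z) ^+ 3)); ring.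
by apply: (@no_root_absurd 3 [:: 1; 4; -4; -4; -1] x z (1 * x ^+ 1 * z ^+ 1 * (x + z))); [|vm_compute|by []|ps|apply: (comb2 r0 r0 (a := 1) (b := 0)); rewrite /bev /=; ring].
Qed.

Lemma deg6 (x y z : int) : 0 < x -> 0 < y -> 0 < z ->
  sig1 (0, 4, -2, -1) x y z = 0 -> sig2 (0, 4, -2, -1) x y z = 0 -> cnd 0 x y z.
Proof.
move=> x0 y0 z0 h1 h2.
have {}h1 : 0 + b4 x y z + (- b2 x y z) + (- b1 x y z) = 0 := h1.
have {}h2 : (b4 x y z) * x + (- b2 x y z) * (x + y) + (- b1 x y z) * (2 * x + y + z) = 0 := h2.
have f0 : - 2 * x ^+ 2 - x * y - 3 * x * z + y ^+ 2 - 2 * y * z - z ^+ 2 = 0.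
  apply: (mulfI (x := 1 * x)); first by apply: lt0r_neq0; ps.
  by rewrite mulr0 -[RHS]h1; bring.
have g0 : - 2 * x ^+ 4 - 2 * x ^+ 3 * y - 3 * x ^+ 3 * z - 2 * x ^+ 2 * y * z - x ^+ 2 * z ^+ 2 + 2 * x * y * z ^+ 2 + y ^+ 2 * z ^+ 2 + y * z ^+ 3 = 0.
  apply: (mulfI (x := 1)); first by apply: lt0r_neq0; ps.
  by rewrite mulr0 -[RHS]h2; bring.
have r0 : x ^+ 3 * y + 2 * x ^+ 2 * y ^+ 2 + x ^+ 2 * y * z + 4 * x * y ^+ 2 * z - y ^+ 4 + 3 * y ^+ 3 * z = 0 by apply: (comb2 f0 g0 (a := - (x ^+ 2 + x * y + y ^+ 2 - y * z)) (b := (- 1) ^+ 2)); ring.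
by apply: (@no_root_absurd 3 [:: -1; -8; -6; 2] x y (1 * y ^+ 3 * (x + y) * (x + y))); [|vm_compute|by []|ps|apply: (comb2 f0 r0 (a := (x ^+ 2 * y + 4 * x * y ^+ 2 + 3 * y ^+ 3) ^+ 2) (b := - ((- x ^+ 2 * y - 4 * x * y ^+ 2 - 3 * y ^+ 3) * z + (- 2 * x ^+ 3 * y - 12 * x ^+ 2 * y ^+ 2 - 17 * x * y ^+ 3 - 7 * y ^+ 4)))); rewrite /bev /=; ring].
Qed.

Lemma deg7 (x y z : int) : 0 < x -> 0 < y -> 0 < z ->
  sig1 (0, 4, 1, -3) x y z = 0 -> sig2 (0, 4, 1, -3) x y z = 0 -> cnd 0 x y z.
Proof.
move=> x0 y0 z0 h1 h2.
have {}h1 : 0 + b4 x y z + b1 x y z + (- b3 x y z) = 0 := h1.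
have {}h2 : (b4 x y z) * x + (b1 x y z) * (x + y) + (- b3 x y z) * (2 * x + y + z) = 0 := h2.
have f0 : x ^+ 2 + x * y + x * z - y * z = 0.
  apply: (mulfI (x := 1 * (2 * x + y + z))); first by apply: lt0r_neq0; ps.
  by rewrite mulr0 -[RHS]h1; bring.
have g0 : 4 * x ^+ 4 + 8 * x ^+ 3 * y + 8 * x ^+ 3 * z + 4 * x ^+ 2 * y ^+ 2 + 8 * x ^+ 2 * y * z + 5 * x ^+ 2 * z ^+ 2 + 2 * x * y * z ^+ 2 + x * z ^+ 3 - y ^+ 3 * z - y ^+ 2 * z ^+ 2 = 0.
  apply: (mulfI (x := 1)); first by apply: lt0r_neq0; ps.
  by rewrite mulr0 -[RHS]h2; bring.
have r0 : x ^+ 5 * y ^+ 2 - 6 * x ^+ 3 * y ^+ 4 - 4 * x ^+ 2 * y ^+ 5 + x * y ^+ 6 = 0 by apply: (comb2 f0 g0 (a := - (4 * x ^+ 5 - 8 * x ^+ 4 * y + 4 * x ^+ 4 * z - x ^+ 3 * y ^+ 2 - 8 * x ^+ 3 * y * z + x ^+ 3 * z ^+ 2 + 9 * x ^+ 2 * y ^+ 3 + x ^+ 2 * y ^+ 2 * z - 2 * x ^+ 2 * y * z ^+ 2 + x * y ^+ 4 + 4 * x * y ^+ 3 * z + x * y ^+ 2 * z ^+ 2 - y ^+ 5 - y ^+ 4 * z)) (b := (x - y) ^+ 3)); ring.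
by apply: (@no_root_absurd 3 [:: 1; -1; -5; 1] x y (1 * x ^+ 1 * y ^+ 2 * (x + y))); [|vm_compute|by []|ps|apply: (comb2 r0 r0 (a := 1) (b := 0)); rewrite /bev /=; ring].
Qed.

Lemma deg8 (x y z : int) : 0 < x -> 0 < y -> 0 < z ->
  sig1 (0, 4, 1, 4) x y z = 0 -> sig2 (0, 4, 1, 4) x y z = 0 -> cnd 0 x y z.
Proof.
move=> x0 y0 z0 h1 h2.
have {}h1 : 0 + b4 x y z + b1 x y z + b4 x y z = 0 := h1.
have {}h2 : (b4 x y z) * x + (b1 x y z) * (x + y) + (b4 x y z) * (2 * x + y + z) = 0 := h2.
have f0 : x ^+ 2 + x * y - 2 * x * z - y * z - z ^+ 2 = 0.
  apply: (mulfI (x := 1 * y)); first by apply: lt0r_neq0; ps.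
  by rewrite mulr0 -[RHS]h1; bring.
have g0 : 2 * x ^+ 2 - x * z - y * z - z ^+ 2 = 0.
  apply: (mulfI (x := 1 * y * (x + y))); first by apply: lt0r_neq0; ps.
  by rewrite mulr0 -[RHS]h2; bring.
have r0 : 2 * x ^+ 3 - 2 * x ^+ 2 * z - 2 * x * z ^+ 2 = 0 by apply: (comb2 f0 g0 (a := - (- z)) (b := (x - z) ^+ 1)); ring.
by apply: (@no_root_absurd 3 [:: 2; -2; -2] x z (1 * x ^+ 1)); [|vm_compute|by []|ps|apply: (comb2 r0 r0 (a := 1) (b := 0)); rewrite /bev /=; ring].
Qed.

Lemma deg9 (x y z : int) : 0 < x -> 0 < y -> 0 < z ->
  sig1 (0, 4, 3, -1) x y z = 0 -> sig2 (0, 4, 3, -1) x y z = 0 -> cnd 0 x y z.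
Proof.
move=> x0 y0 z0 h1 h2.
have {}h1 : 0 + b4 x y z + b3 x y z + (- b1 x y z) = 0 := h1.
have {}h2 : (b4 x y z) * x + (b3 x y z) * (x + y) + (- b1 x y z) * (2 * x + y + z) = 0 := h2.
have f0 : - 2 * x ^+ 2 - x * y - x * z + y ^+ 2 + y * z = 0.
  apply: (mulfI (x := 1 * (x + z))); first by apply: lt0r_neq0; ps.
  by rewrite mulr0 -[RHS]h1; bring.
have g0 : - 2 * x ^+ 4 - 2 * x ^+ 3 * y - 3 * x ^+ 3 * z - x ^+ 2 * z ^+ 2 + 3 * x * y ^+ 2 * z + 3 * x * y * z ^+ 2 + y ^+ 3 * z + 2 * y ^+ 2 * z ^+ 2 + y * z ^+ 3 = 0.
  apply: (mulfI (x := 1)); first by apply: lt0r_neq0; ps.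
  by rewrite mulr0 -[RHS]h2; bring.
have r0 : x ^+ 6 * y + 6 * x ^+ 5 * y ^+ 2 + 4 * x ^+ 4 * y ^+ 3 - 2 * x ^+ 3 * y ^+ 4 - x ^+ 2 * y ^+ 5 = 0 by apply: (comb2 f0 g0 (a := - (- x ^+ 5 + 3 * x ^+ 4 * y - x ^+ 4 * z + x ^+ 3 * y ^+ 2 + 3 * x ^+ 3 * y * z + x ^+ 2 * y ^+ 3 - 4 * x ^+ 2 * y ^+ 2 * z + x ^+ 2 * y * z ^+ 2 + x * y ^+ 3 * z - 2 * x * y ^+ 2 * z ^+ 2 + y ^+ 4 * z + y ^+ 3 * z ^+ 2)) (b := (- x + y) ^+ 3)); ring.
by apply: (@no_root_absurd 3 [:: 1; 5; -1; -1] x y (1 * x ^+ 2 * y ^+ 1 * (x + y))); [|vm_compute|by []|ps|apply: (comb2 r0 r0 (a := 1) (b := 0)); rewrite /bev /=; ring].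
Qed.

Lemma deg10 (x y z : int) : 0 < x -> 0 < y -> 0 < z ->
  sig1 (1, -4, -3, 1) x y z = 0 -> sig2 (1, -4, -3, 1) x y z = 0 -> cnd 0 x y z.
Proof.
move=> x0 y0 z0 h1 h2.
have {}h1 : b1 x y z + (- b4 x y z) + (- b3 x y z) + b1 x y z = 0 := h1.
have {}h2 : (- b4 x y z) * x + (- b3 x y z) * (x + y) + (b1 x y z) * (2 * x + y + z) = 0 := h2.
have f0 : 2 * x ^+ 2 + x * z - 2 * y ^+ 2 - 2 * y * z = 0.
  apply: (mulfI (x := 1 * (x + z))); first by apply: lt0r_neq0; ps.
  by rewrite mulr0 -[RHS]h1; bring.
have g0 : 2 * x ^+ 4 + 2 * x ^+ 3 * y + 3 * x ^+ 3 * z + x ^+ 2 * z ^+ 2 - 3 * x * y ^+ 2 * z - 3 * x * y * z ^+ 2 - y ^+ 3 * z - 2 * y ^+ 2 * z ^+ 2 - y * z ^+ 3 = 0.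
  apply: (mulfI (x := 1)); first by apply: lt0r_neq0; ps.
  by rewrite mulr0 -[RHS]h2; bring.
have r0 : 2 * x ^+ 6 * y + 8 * x ^+ 5 * y ^+ 2 - 6 * x ^+ 4 * y ^+ 3 - 10 * x ^+ 3 * y ^+ 4 + 2 * x ^+ 2 * y ^+ 5 = 0 by apply: (comb2 f0 g0 (a := - (x ^+ 5 - 6 * x ^+ 4 * y + x ^+ 4 * z + 3 * x ^+ 3 * y ^+ 2 - 5 * x ^+ 3 * y * z + x ^+ 2 * y ^+ 3 + 10 * x ^+ 2 * y ^+ 2 * z - x ^+ 2 * y * z ^+ 2 - 6 * x * y ^+ 3 * z + 4 * x * y ^+ 2 * z ^+ 2 - 4 * y ^+ 4 * z - 4 * y ^+ 3 * z ^+ 2)) (b := (x - 2 * y) ^+ 3)); ring.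
by apply: (@no_root_absurd 2 [:: 1; 3; -6; 1] x y (2 * x ^+ 2 * y ^+ 1 * (x + y))); [|vm_compute|by []|ps|apply: (comb2 r0 r0 (a := 1) (b := 0)); rewrite /bev /=; ring].
Qed.

Lemma deg11 (x y z : int) : 0 < x -> 0 < y -> 0 < z ->
  sig1 (1, -4, 2, 1) x y z = 0 -> sig2 (1, -4, 2, 1) x y z = 0 -> cnd 0 x y z.
Proof.
move=> x0 y0 z0 h1 h2.
have {}h1 : b1 x y z + (- b4 x y z) + b2 x y z + b1 x y z = 0 := h1.
have {}h2 : (- b4 x y z) * x + (b2 x y z) * (x + y) + (b1 x y z) * (2 * x + y + z) = 0 := h2.
have f0 : 2 * x ^+ 3 + 3 * x ^+ 2 * z - 2 * x * y ^+ 2 + x * z ^+ 2 - y ^+ 2 * z - y * z ^+ 2 = 0.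
  apply: (mulfI (x := 1)); first by apply: lt0r_neq0; ps.
  by rewrite mulr0 -[RHS]h1; bring.
have g0 : 2 * x ^+ 4 + 2 * x ^+ 3 * y + 3 * x ^+ 3 * z + 2 * x ^+ 2 * y * z + x ^+ 2 * z ^+ 2 - 2 * x * y * z ^+ 2 - y ^+ 2 * z ^+ 2 - y * z ^+ 3 = 0.
  apply: (mulfI (x := 1)); first by apply: lt0r_neq0; ps.
  by rewrite mulr0 -[RHS]h2; bring.
have r0 : - 4 * x ^+ 5 - 4 * x ^+ 4 * y - 8 * x ^+ 4 * z - 6 * x ^+ 3 * y * z - 3 * x ^+ 3 * z ^+ 2 + 2 * x ^+ 2 * y * z ^+ 2 + 2 * x ^+ 2 * z ^+ 3 + 4 * x * y * z ^+ 3 + x * z ^+ 4 = 0 by apply: (comb2 f0 g0 (a := - (- z ^+ 2)) (b := (- 2 * x - z) ^+ 1)); ring.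
by apply: (@no_root_absurd 5 [:: -6; -1; 3] x z (1 * x ^+ 2 * z ^+ 2 * (x + z) * (x + z) * (x + z) * (2 * x + z) * (2 * x + z))); [|vm_compute|by []|ps|apply: (comb2 f0 r0 (a := (- 4 * x ^+ 4 - 6 * x ^+ 3 * z + 2 * x ^+ 2 * z ^+ 2 + 4 * x * z ^+ 3) ^+ 2) (b := - ((8 * x ^+ 5 + 16 * x ^+ 4 * z + 2 * x ^+ 3 * z ^+ 2 - 10 * x ^+ 2 * z ^+ 3 - 4 * x * z ^+ 4) * y + (- 8 * x ^+ 6 - 20 * x ^+ 5 * z - 10 * x ^+ 4 * z ^+ 2 + 7 * x ^+ 3 * z ^+ 3 + 2 * x ^+ 2 * z ^+ 4 - 3 * x * z ^+ 5)))); rewrite /bev /=; ring].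
Qed.

Lemma deg12 (x y z : int) : 0 < x -> 0 < y -> 0 < z ->
  sig1 (1, -3, -4, -4) x y z = 0 -> sig2 (1, -3, -4, -4) x y z = 0 -> cnd 0 x y z.
Proof.
move=> x0 y0 z0 h1 h2.
have {}h1 : b1 x y z + (- b3 x y z) + (- b4 x y z) + (- b4 x y z) = 0 := h1.
have {}h2 : (- b3 x y z) * x + (- b4 x y z) * (x + y) + (- b4 x y z) * (2 * x + y + z) = 0 := h2.
have f0 : 2 * x ^+ 3 + 3 * x ^+ 2 * z - 2 * x * y ^+ 2 + x * z ^+ 2 - y ^+ 2 * z - y * z ^+ 2 = 0.
  apply: (mulfI (x := 1)); first by apply: lt0r_neq0; ps.
  by rewrite mulr0 -[RHS]h1; bring.
have g0 : 2 * x ^+ 3 + 3 * x ^+ 2 * z - 4 * x * y ^+ 2 + x * y * z + x * z ^+ 2 - 2 * y ^+ 3 - y ^+ 2 * z = 0.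
  apply: (mulfI (x := 1 * x)); first by apply: lt0r_neq0; ps.
  by rewrite mulr0 -[RHS]h2; bring.
have r0 : 2 * x ^+ 3 * y + 2 * x ^+ 2 * y ^+ 2 + 2 * x ^+ 2 * y * z - 2 * x * y ^+ 3 + x * y ^+ 2 * z - 2 * y ^+ 4 - y ^+ 3 * z = 0 by apply: (comb2 g0 f0 (a := - (x - y)) (b := (x) ^+ 1)); ring.
by apply: (@no_root_absurd 2 [:: -3; 1; 1] x y (2 * x ^+ 1 * y ^+ 3 * (x + y) * (x + y) * (x + y))); [|vm_compute|by []|ps|apply: (comb2 g0 r0 (a := (2 * x ^+ 2 * y + x * y ^+ 2 - y ^+ 3) ^+ 2) (b := - ((2 * x ^+ 3 * y + x ^+ 2 * y ^+ 2 - x * y ^+ 3) * z + (4 * x ^+ 4 * y + 3 * x ^+ 3 * y ^+ 2 - 2 * x ^+ 2 * y ^+ 3 + y ^+ 5)))); rewrite /bev /=; ring].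
Qed.

Lemma deg13 (x y z : int) : 0 < x -> 0 < y -> 0 < z ->
  sig1 (1, -3, -4, 0) x y z = 0 -> sig2 (1, -3, -4, 0) x y z = 0 -> cnd 0 x y z.
Proof.
move=> x0 y0 z0 h1 h2.
have {}h1 : b1 x y z + (- b3 x y z) + (- b4 x y z) + 0 = 0 := h1.
have {}h2 : (- b3 x y z) * x + (- b4 x y z) * (x + y) + (0) * (2 * x + y + z) = 0 := h2.
have f0 : 2 * x ^+ 2 + x * y + x * z - y ^+ 2 - y * z = 0.
  apply: (mulfI (x := 1 * (x + z))); first by apply: lt0r_neq0; ps.
  by rewrite mulr0 -[RHS]h1; bring.
have g0 : 2 * x ^+ 3 + 2 * x ^+ 2 * y + 3 * x ^+ 2 * z - x * y ^+ 2 + 2 * x * y * z + x * z ^+ 2 - y ^+ 3 = 0.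
  apply: (mulfI (x := 1 * x)); first by apply: lt0r_neq0; ps.
  by rewrite mulr0 -[RHS]h2; bring.
have r0 : x ^+ 4 * y + 2 * x ^+ 3 * y ^+ 2 + 2 * x ^+ 2 * y ^+ 3 - y ^+ 5 = 0 by apply: (comb2 f0 g0 (a := - (x ^+ 3 - 2 * x ^+ 2 * y + x ^+ 2 * z - x * y ^+ 2 - x * y * z)) (b := (x - y) ^+ 2)); ring.
by apply: (@no_root_absurd 3 [:: 1; 1; 1; -1] x y (1 * y ^+ 1 * (x + y))); [|vm_compute|by []|ps|apply: (comb2 r0 r0 (a := 1) (b := 0)); rewrite /bev /=; ring].
Qed.

Lemma deg14 (x y z : int) : 0 < x -> 0 < y -> 0 < z ->
  sig1 (1, -3, -3, 1) x y z = 0 -> sig2 (1, -3, -3, 1) x y z = 0 -> cnd 0 x y z.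
Proof.
move=> x0 y0 z0 h1 h2.
have {}h1 : b1 x y z + (- b3 x y z) + (- b3 x y z) + b1 x y z = 0 := h1.
have {}h2 : (- b3 x y z) * x + (- b3 x y z) * (x + y) + (b1 x y z) * (2 * x + y + z) = 0 := h2.
have f0 : 2 * x ^+ 2 + x * z - y * z = 0.
  apply: (mulfI (x := 2 * (x + y + z))); first by apply: lt0r_neq0; ps.
  by rewrite mulr0 -[RHS]h1; bring.
have g0 : 2 * x ^+ 2 - y * z = 0.
  apply: (mulfI (x := 1 * (x + y + z) * (2 * x + y + z))); first by apply: lt0r_neq0; ps.
  by rewrite mulr0 -[RHS]h2; bring.
have r0 : 2 * x ^+ 3 = 0 by apply: (comb2 f0 g0 (a := - (- y)) (b := (x - y) ^+ 1)); ring.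
by apply: (@pos_absurd (1 * x ^+ 3 * (2))); [ps | apply: (comb2 r0 r0 (a := 1) (b := 0)); ring].
Qed.

(** [p1] vanishes identically, and [p2 = 0] equates star and triangle at the point [x + y]. *)
Lemma deg15 (x y z : int) : 0 < x -> 0 < y -> 0 < z ->
  sig1 (1, -3, -1, 3) x y z = 0 -> sig2 (1, -3, -1, 3) x y z = 0 -> cnd 0 x y z.
Proof.
move=> x0 y0 z0 h1 h2.
have {}h1 : b1 x y z + (- b3 x y z) + (- b1 x y z) + b3 x y z = 0 := h1.
have {}h2 : (- b3 x y z) * x + (- b1 x y z) * (x + y) + (b3 x y z) * (2 * x + y + z) = 0 := h2.
have g0 : - 2 * x ^+ 3 - 2 * x ^+ 2 * y - 3 * x ^+ 2 * z - x * y * z - x * z ^+ 2 + y ^+ 2 * z = 0.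
  apply: (mulfI (x := 1 * (x + y + z))); first by apply: lt0r_neq0; ps.
  by rewrite mulr0 -[RHS]h2; bring.
apply: (@star_triangle (- (x + y)) (- y) (x + z)); try (apply/eqP; move: x0 y0 z0; clear; lia).
apply/eqP; rewrite -subr_eq0; apply/eqP.
by transitivity (- (- 2 * x ^+ 3 - 2 * x ^+ 2 * y - 3 * x ^+ 2 * z - x * y * z - x * z ^+ 2 + y ^+ 2 * z)); [ring | rewrite g0 ?oppr0].
Qed.

Lemma deg16 (x y z : int) : 0 < x -> 0 < y -> 0 < z ->
  sig1 (1, -3, 0, -4) x y z = 0 -> sig2 (1, -3, 0, -4) x y z = 0 -> cnd 0 x y z.
Proof.
move=> x0 y0 z0 h1 h2.
have {}h1 : b1 x y z + (- b3 x y z) + 0 + (- b4 x y z) = 0 := h1.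
have {}h2 : (- b3 x y z) * x + (0) * (x + y) + (- b4 x y z) * (2 * x + y + z) = 0 := h2.
have f0 : 2 * x ^+ 2 + x * y + x * z - y ^+ 2 - y * z = 0.
  apply: (mulfI (x := 1 * (x + z))); first by apply: lt0r_neq0; ps.
  by rewrite mulr0 -[RHS]h1; bring.
have g0 : x ^+ 2 + x * z - y ^+ 2 = 0.
  apply: (mulfI (x := 1 * x * (2 * x + y + z))); first by apply: lt0r_neq0; ps.
  by rewrite mulr0 -[RHS]h2; bring.
have r0 : - x ^+ 3 - 2 * x ^+ 2 * y + y ^+ 3 = 0 by apply: (comb2 f0 g0 (a := - (x)) (b := (x - y) ^+ 1)); ring.
by apply: (@no_root_absurd 2 [:: -1; -1; 1] x y (1 * (x + y))); [|vm_compute|by []|ps|apply: (comb2 r0 r0 (a := 1) (b := 0)); rewrite /bev /=; ring].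
Qed.

Lemma deg17 (x y z : int) : 0 < x -> 0 < y -> 0 < z ->
  sig1 (1, -3, 1, -4) x y z = 0 -> sig2 (1, -3, 1, -4) x y z = 0 -> cnd 0 x y z.
Proof.
move=> x0 y0 z0 h1 h2.
have {}h1 : b1 x y z + (- b3 x y z) + b1 x y z + (- b4 x y z) = 0 := h1.
have {}h2 : (- b3 x y z) * x + (b1 x y z) * (x + y) + (- b4 x y z) * (2 * x + y + z) = 0 := h2.
have f0 : 2 * x ^+ 2 + x * z - 2 * y ^+ 2 - 2 * y * z = 0.
  apply: (mulfI (x := 1 * (x + z))); first by apply: lt0r_neq0; ps.
  by rewrite mulr0 -[RHS]h1; bring.
have g0 : 2 * x ^+ 4 + 3 * x ^+ 3 * z - 4 * x ^+ 2 * y ^+ 2 - x ^+ 2 * y * z + x ^+ 2 * z ^+ 2 - 2 * x * y ^+ 3 - 4 * x * y ^+ 2 * z - x * y * z ^+ 2 - y ^+ 3 * z - y ^+ 2 * z ^+ 2 = 0.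
  apply: (mulfI (x := 1)); first by apply: lt0r_neq0; ps.
  by rewrite mulr0 -[RHS]h2; bring.
have r0 : 2 * x ^+ 5 * y + 2 * x ^+ 4 * y ^+ 2 - 6 * x ^+ 3 * y ^+ 3 - 4 * x ^+ 2 * y ^+ 4 + 2 * x * y ^+ 5 = 0 by apply: (comb2 f0 g0 (a := - (x ^+ 4 - 5 * x ^+ 3 * y + x ^+ 3 * z + 2 * x ^+ 2 * y ^+ 2 - 3 * x ^+ 2 * y * z + 5 * x * y ^+ 3 + x * y ^+ 2 * z + 2 * y ^+ 3 * z)) (b := (x - 2 * y) ^+ 2)); ring.
by apply: (@no_root_absurd 2 [:: 1; 0; -3; 1] x y (2 * x ^+ 1 * y ^+ 1 * (x + y))); [|vm_compute|by []|ps|apply: (comb2 r0 r0 (a := 1) (b := 0)); rewrite /bev /=; ring].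
Qed.

Lemma deg18 (x y z : int) : 0 < x -> 0 < y -> 0 < z ->
  sig1 (1, -3, 1, 0) x y z = 0 -> sig2 (1, -3, 1, 0) x y z = 0 -> cnd 1 x y z.
Proof.
move=> x0 y0 z0 h1 h2.
have {}h1 : b1 x y z + (- b3 x y z) + b1 x y z + 0 = 0 := h1.
have {}h2 : (- b3 x y z) * x + (b1 x y z) * (x + y) + (0) * (2 * x + y + z) = 0 := h2.
have f0 : 2 * x ^+ 2 - x * y + x * z - 2 * y * z = 0.
  apply: (mulfI (x := 1 * (x + y + z))); first by apply: lt0r_neq0; ps.
  by rewrite mulr0 -[RHS]h1; bring.
have g0 : 2 * x ^+ 3 + x ^+ 2 * z - x * y ^+ 2 - x * y * z - y ^+ 2 * z = 0.
  apply: (mulfI (x := 1 * (x + y + z))); first by apply: lt0r_neq0; ps.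
  by rewrite mulr0 -[RHS]h2; bring.
have r0 : - x ^+ 3 * y + x * y ^+ 3 = 0.
  transitivity ((x - 2 * y) ^+ 1 * (2 * x ^+ 3 + x ^+ 2 * z - x * y ^+ 2 - x * y * z - y ^+ 2 * z) - (x ^+ 2 - x * y - y ^+ 2) * (2 * x ^+ 2 - x * y + x * z - 2 * y * z)); first by ring.
  by rewrite f0 g0 !mulr0 subrr.
have ey : y = 1 * x.
  apply/eqP; rewrite -subr_eq0; apply/eqP; apply: (mulfI (x := 1 * x ^+ 1 * y ^+ 1 * (x + y) * 1)); first by apply: lt0r_neq0; ps.
  by rewrite mulr0 -[RHS]r0; ring.
have ez : z = 1 * x.
  have : x * (z - 1 * x) = 0 by move: f0; rewrite ey; clear; lia.
  by move/eqP; rewrite mulf_eq0 (negbTE (lt0r_neq0 x0)) /= subr_eq0 => /eqP.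
exists `|x|%N; first by move: x0; clear; lia.
by rewrite gtz0_abs // ey ez; split; ring.
Qed.

Lemma deg19 (x y z : int) : 0 < x -> 0 < y -> 0 < z ->
  sig1 (1, -3, 2, 1) x y z = 0 -> sig2 (1, -3, 2, 1) x y z = 0 -> cnd 0 x y z.
Proof.
move=> x0 y0 z0 h1 h2.
have {}h1 : b1 x y z + (- b3 x y z) + b2 x y z + b1 x y z = 0 := h1.
have {}h2 : (- b3 x y z) * x + (b2 x y z) * (x + y) + (b1 x y z) * (2 * x + y + z) = 0 := h2.
have f0 : 4 * x ^+ 3 + 4 * x ^+ 2 * y + 6 * x ^+ 2 * z + 2 * x * y * z + 2 * x * z ^+ 2 - y ^+ 2 * z - y * z ^+ 2 = 0.
  apply: (mulfI (x := 1)); first by apply: lt0r_neq0; ps.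
  by rewrite mulr0 -[RHS]h1; bring.
have g0 : 2 * x ^+ 3 + 2 * x ^+ 2 * y + 2 * x ^+ 2 * z - y * z ^+ 2 = 0.
  apply: (mulfI (x := 1 * (2 * x + y + z))); first by apply: lt0r_neq0; ps.
  by rewrite mulr0 -[RHS]h2; bring.
have r0 : 2 * x ^+ 3 + 2 * x ^+ 2 * y + 2 * x ^+ 2 * z - y * z ^+ 2 = 0 by apply: (comb2 f0 g0 (a := - (0)) (b := (- z) ^+ 0)); ring.
by apply: (@no_root_absurd 5 [:: -2; -2; 0; 1] x z (2 * x ^+ 1 * z ^+ 1 * (x + z) * (x + z))); [|vm_compute|by []|ps|apply: (comb2 f0 r0 (a := (2 * x ^+ 2 - z ^+ 2) ^+ 2) (b := - ((- 2 * x ^+ 2 * z + z ^+ 3) * y + (8 * x ^+ 4 + 6 * x ^+ 3 * z - 4 * x ^+ 2 * z ^+ 2 - 2 * x * z ^+ 3 + z ^+ 4)))); rewrite /bev /=; ring].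
Qed.

Lemma deg20 (x y z : int) : 0 < x -> 0 < y -> 0 < z ->
  sig1 (1, 0, -3, 1) x y z = 0 -> sig2 (1, 0, -3, 1) x y z = 0 -> cnd 1 x y z.
Proof.
move=> x0 y0 z0 h1 h2.
have {}h1 : b1 x y z + 0 + (- b3 x y z) + b1 x y z = 0 := h1.
have {}h2 : (0) * x + (- b3 x y z) * (x + y) + (b1 x y z) * (2 * x + y + z) = 0 := h2.
have f0 : 2 * x ^+ 2 - x * y + x * z - 2 * y * z = 0.
  apply: (mulfI (x := 1 * (x + y + z))); first by apply: lt0r_neq0; ps.
  by rewrite mulr0 -[RHS]h1; bring.
have g0 : x ^+ 2 - y * z = 0.
  apply: (mulfI (x := 1 * (x + y + z) * (2 * x + y + z))); first by apply: lt0r_neq0; ps.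
  by rewrite mulr0 -[RHS]h2; bring.
have r0 : x ^+ 3 - x * y ^+ 2 = 0.
  transitivity ((x - 2 * y) ^+ 1 * (x ^+ 2 - y * z) - (- y) * (2 * x ^+ 2 - x * y + x * z - 2 * y * z)); first by ring.
  by rewrite f0 g0 !mulr0 subrr.
have ey : y = 1 * x.
  apply/eqP; rewrite -subr_eq0; apply/eqP; apply: (mulfI (x := 1 * x ^+ 1 * (x + y))); first by apply: lt0r_neq0; ps.
  by rewrite mulr0 -[RHS]oppr0 -[in RHS]r0; ring.
have ez : z = 1 * x.
  have : x * (z - 1 * x) = 0 by move: f0; rewrite ey; clear; lia.
  by move/eqP; rewrite mulf_eq0 (negbTE (lt0r_neq0 x0)) /= subr_eq0 => /eqP.
exists `|x|%N; first by move: x0; clear; lia.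
by rewrite gtz0_abs // ey ez; split; ring.
Qed.

Lemma deg21 (x y z : int) : 0 < x -> 0 < y -> 0 < z ->
  sig1 (1, 0, 2, 1) x y z = 0 -> sig2 (1, 0, 2, 1) x y z = 0 -> cnd 0 x y z.
Proof.
move=> x0 y0 z0 h1 h2.
have {}h1 : b1 x y z + 0 + b2 x y z + b1 x y z = 0 := h1.
have {}h2 : (0) * x + (b2 x y z) * (x + y) + (b1 x y z) * (2 * x + y + z) = 0 := h2.
have f0 : 2 * x ^+ 2 + x * y + x * z - y ^+ 2 - y * z = 0.
  apply: (mulfI (x := 1 * (x + z))); first by apply: lt0r_neq0; ps.
  by rewrite mulr0 -[RHS]h1; bring.
have g0 : x ^+ 2 + x * y - y * z = 0.
  apply: (mulfI (x := 1 * (x + z) * (2 * x + y + z))); first by apply: lt0r_neq0; ps.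
  by rewrite mulr0 -[RHS]h2; bring.
have r0 : x ^+ 3 + 2 * x ^+ 2 * y - y ^+ 3 = 0 by apply: (comb2 f0 g0 (a := - (- y)) (b := (x - y) ^+ 1)); ring.
by apply: (@no_root_absurd 2 [:: 1; 1; -1] x y (1 * (x + y))); [|vm_compute|by []|ps|apply: (comb2 r0 r0 (a := 1) (b := 0)); rewrite /bev /=; ring].
Qed.

Lemma deg22 (x y z : int) : 0 < x -> 0 < y -> 0 < z ->
  sig1 (1, 1, -3, 1) x y z = 0 -> sig2 (1, 1, -3, 1) x y z = 0 -> cnd 0 x y z.
Proof.
move=> x0 y0 z0 h1 h2.
have {}h1 : b1 x y z + b1 x y z + (- b3 x y z) + b1 x y z = 0 := h1.
have {}h2 : (b1 x y z) * x + (- b3 x y z) * (x + y) + (b1 x y z) * (2 * x + y + z) = 0 := h2.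
have f0 : 2 * x ^+ 2 - 2 * x * y + x * z - 3 * y * z = 0.
  apply: (mulfI (x := 1 * (x + y + z))); first by apply: lt0r_neq0; ps.
  by rewrite mulr0 -[RHS]h1; bring.
have g0 : 2 * x ^+ 3 + x ^+ 2 * z - 3 * x * y * z - y ^+ 2 * z - y * z ^+ 2 = 0.
  apply: (mulfI (x := 1 * (x + y + z))); first by apply: lt0r_neq0; ps.
  by rewrite mulr0 -[RHS]h2; bring.
have r0 : - 2 * x ^+ 4 * y - 2 * x ^+ 3 * y ^+ 2 + 6 * x ^+ 2 * y ^+ 3 + 6 * x * y ^+ 4 = 0 by apply: (comb2 f0 g0 (a := - (x ^+ 3 - 4 * x ^+ 2 * y + 6 * x * y ^+ 2 - x * y * z + 3 * y ^+ 3 + 3 * y ^+ 2 * z)) (b := (x - 3 * y) ^+ 2)); ring.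
by apply: (@no_root_absurd 5 [:: -1; 0; 3] x y (2 * x ^+ 1 * y ^+ 1 * (x + y))); [|vm_compute|by []|ps|apply: (comb2 r0 r0 (a := 1) (b := 0)); rewrite /bev /=; ring].
Qed.

Lemma deg23 (x y z : int) : 0 < x -> 0 < y -> 0 < z ->
  sig1 (1, 1, 2, 1) x y z = 0 -> sig2 (1, 1, 2, 1) x y z = 0 -> cnd 0 x y z.
Proof.
move=> x0 y0 z0 h1 h2.
have {}h1 : b1 x y z + b1 x y z + b2 x y z + b1 x y z = 0 := h1.
have {}h2 : (b1 x y z) * x + (b2 x y z) * (x + y) + (b1 x y z) * (2 * x + y + z) = 0 := h2.
have f0 : 2 * x ^+ 2 + x * z - 2 * y ^+ 2 - 2 * y * z = 0.
  apply: (mulfI (x := 1 * (x + z))); first by apply: lt0r_neq0; ps.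
  by rewrite mulr0 -[RHS]h1; bring.
have g0 : 2 * x ^+ 3 + 2 * x ^+ 2 * y + x ^+ 2 * z - 2 * x * y * z - y ^+ 2 * z - y * z ^+ 2 = 0.
  apply: (mulfI (x := 1 * (x + z))); first by apply: lt0r_neq0; ps.
  by rewrite mulr0 -[RHS]h2; bring.
have r0 : - 2 * x ^+ 4 * y - 4 * x ^+ 3 * y ^+ 2 + 4 * x ^+ 2 * y ^+ 3 + 6 * x * y ^+ 4 = 0 by apply: (comb2 f0 g0 (a := - (x ^+ 3 - 2 * x ^+ 2 * y + 3 * x * y ^+ 2 - x * y * z + 2 * y ^+ 2 * z)) (b := (x - 2 * y) ^+ 2)); ring.
by apply: (@no_root_absurd 2 [:: -1; -1; 3] x y (2 * x ^+ 1 * y ^+ 1 * (x + y))); [|vm_compute|by []|ps|apply: (comb2 r0 r0 (a := 1) (b := 0)); rewrite /bev /=; ring].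
Qed.

(** Both forms are positive multiples of the same quadric, hence a curve of solutions. *)
Lemma deg24 (x y z : int) : 0 < x -> 0 < y -> 0 < z ->
  sig1 (1, 2, 1, 4) x y z = 0 -> sig2 (1, 2, 1, 4) x y z = 0 -> cnd 5 x y z.
Proof.
move=> x0 y0 z0 h1 h2.
have {}h1 : b1 x y z + b2 x y z + b1 x y z + b4 x y z = 0 := h1.
have {}h2 : (b2 x y z) * x + (b1 x y z) * (x + y) + (b4 x y z) * (2 * x + y + z) = 0 := h2.
have f0 : 2 * x ^+ 2 + x * z - y * z = 0.
  apply: (mulfI (x := 1 * (x + y + z))); first by apply: lt0r_neq0; ps.
  by rewrite mulr0 -[RHS]h1; bring.
have g0 : 2 * x ^+ 2 + x * z - y * z = 0.
  apply: (mulfI (x := 1 * (x + y) * (x + y + z))); first by apply: lt0r_neq0; ps.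
  by rewrite mulr0 -[RHS]h2; bring.
exact: f0.
Qed.

Lemma deg25 (x y z : int) : 0 < x -> 0 < y -> 0 < z ->
  sig1 (1, 4, -3, 1) x y z = 0 -> sig2 (1, 4, -3, 1) x y z = 0 -> cnd 0 x y z.
Proof.
move=> x0 y0 z0 h1 h2.
have {}h1 : b1 x y z + b4 x y z + (- b3 x y z) + b1 x y z = 0 := h1.
have {}h2 : (b4 x y z) * x + (- b3 x y z) * (x + y) + (b1 x y z) * (2 * x + y + z) = 0 := h2.
have f0 : 2 * x ^+ 3 + 2 * x ^+ 2 * y + 3 * x ^+ 2 * z - 2 * x * y * z + x * z ^+ 2 - 2 * y ^+ 2 * z - 2 * y * z ^+ 2 = 0.
  apply: (mulfI (x := 1)); first by apply: lt0r_neq0; ps.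
  by rewrite mulr0 -[RHS]h1; bring.
have g0 : 2 * x ^+ 4 + 4 * x ^+ 3 * y + 3 * x ^+ 3 * z + 2 * x ^+ 2 * y ^+ 2 + x ^+ 2 * z ^+ 2 - 3 * x * y ^+ 2 * z - 3 * x * y * z ^+ 2 - y ^+ 3 * z - 2 * y ^+ 2 * z ^+ 2 - y * z ^+ 3 = 0.
  apply: (mulfI (x := 1)); first by apply: lt0r_neq0; ps.
  by rewrite mulr0 -[RHS]h2; bring.
have r0 : 4 * x ^+ 5 * z + 4 * x ^+ 4 * y * z + 6 * x ^+ 4 * z ^+ 2 - 2 * x ^+ 3 * z ^+ 3 - 6 * x ^+ 2 * y * z ^+ 3 - 6 * x ^+ 2 * z ^+ 4 - 2 * x * y * z ^+ 4 - 2 * x * z ^+ 5 = 0 by apply: (comb2 f0 g0 (a := - (- 2 * x ^+ 2 * z + 4 * x * z ^+ 2 + 2 * y * z ^+ 2 + 2 * z ^+ 3)) (b := (- 2 * z) ^+ 2)); ring.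
by apply: (@no_root_absurd 5 [:: -4; 2; 3] x z (4 * x ^+ 3 * z ^+ 4 * (x + z) * (x + z) * (x + z) * (2 * x + z))); [|vm_compute|by []|ps|apply: (comb2 f0 r0 (a := (4 * x ^+ 4 * z - 6 * x ^+ 2 * z ^+ 3 - 2 * x * z ^+ 4) ^+ 2) (b := - ((- 8 * x ^+ 4 * z ^+ 2 + 12 * x ^+ 2 * z ^+ 4 + 4 * x * z ^+ 5) * y + (8 * x ^+ 6 * z - 8 * x ^+ 4 * z ^+ 3 + 4 * x ^+ 3 * z ^+ 4 + 4 * x ^+ 2 * z ^+ 5)))); rewrite /bev /=; ring].
Qed.

Lemma deg26 (x y z : int) : 0 < x -> 0 < y -> 0 < z ->
  sig1 (1, 4, 2, 1) x y z = 0 -> sig2 (1, 4, 2, 1) x y z = 0 -> cnd 0 x y z.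
Proof.
move=> x0 y0 z0 h1 h2.
have {}h1 : b1 x y z + b4 x y z + b2 x y z + b1 x y z = 0 := h1.
have {}h2 : (b4 x y z) * x + (b2 x y z) * (x + y) + (b1 x y z) * (2 * x + y + z) = 0 := h2.
have f0 : 2 * x ^+ 2 + x * z - y * z = 0.
  apply: (mulfI (x := 1 * (x + y + z))); first by apply: lt0r_neq0; ps.
  by rewrite mulr0 -[RHS]h1; bring.
have g0 : 2 * x ^+ 4 + 4 * x ^+ 3 * y + 3 * x ^+ 3 * z + 2 * x ^+ 2 * y ^+ 2 + 2 * x ^+ 2 * y * z + x ^+ 2 * z ^+ 2 - 2 * x * y * z ^+ 2 - y ^+ 2 * z ^+ 2 - y * z ^+ 3 = 0.
  apply: (mulfI (x := 1)); first by apply: lt0r_neq0; ps.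
  by rewrite mulr0 -[RHS]h2; bring.
have r0 : 8 * x ^+ 6 + 16 * x ^+ 5 * z + 8 * x ^+ 4 * z ^+ 2 - 3 * x ^+ 3 * z ^+ 3 - 4 * x ^+ 2 * z ^+ 4 - x * z ^+ 5 = 0 by apply: (comb2 f0 g0 (a := - (- 4 * x ^+ 4 - 6 * x ^+ 3 * z - 2 * x ^+ 2 * y * z + 3 * x * z ^+ 3 + y * z ^+ 3 + z ^+ 4)) (b := (- z) ^+ 2)); ring.
by apply: (@no_root_absurd 3 [:: 4; 2; -1; -1] x z (1 * x ^+ 1 * (x + z) * (2 * x + z))); [|vm_compute|by []|ps|apply: (comb2 r0 r0 (a := 1) (b := 0)); rewrite /bev /=; ring].
Qed.

(** The permutation fixes the point 0 and cycles the other three, whose differences from 0 enter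
    [three_cycle]. *)
Lemma deg27 (x y z : int) : 0 < x -> 0 < y -> 0 < z ->
  sig1 (1, 4, 2, 3) x y z = 0 -> sig2 (1, 4, 2, 3) x y z = 0 -> cnd 0 x y z.
Proof.
move=> x0 y0 z0 h1 h2.
have {}h1 : b1 x y z + b4 x y z + b2 x y z + b3 x y z = 0 := h1.
have {}h2 : (b4 x y z) * x + (b2 x y z) * (x + y) + (b3 x y z) * (2 * x + y + z) = 0 := h2.
have := @three_cycle (x) (x + y) (2 * x + y + z); case=> [|h|h|h]; try (move: h x0 y0 z0; clear; lia).
apply/eqP; rewrite -subr_eq0; apply/eqP.
by transitivity (- (- 2 * x ^+ 4 - 2 * x ^+ 3 * y - 5 * x ^+ 3 * z - 3 * x ^+ 2 * y * z - 4 * x ^+ 2 * z ^+ 2 + 2 * x * y ^+ 2 * z - x * y * z ^+ 2 - x * z ^+ 3 + y ^+ 3 * z + y ^+ 2 * z ^+ 2)); [ring | rewrite -[RHS]oppr0 -[in RHS]h2; bring].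
Qed.

(** Star and triangle at the point 0. *)
Lemma deg28 (x y z : int) : 0 < x -> 0 < y -> 0 < z ->
  sig1 (2, -2, 1, -1) x y z = 0 -> sig2 (2, -2, 1, -1) x y z = 0 -> cnd 0 x y z.
Proof.
move=> x0 y0 z0 h1 h2.
have {}h1 : b2 x y z + (- b2 x y z) + b1 x y z + (- b1 x y z) = 0 := h1.
have {}h2 : (- b2 x y z) * x + (b1 x y z) * (x + y) + (- b1 x y z) * (2 * x + y + z) = 0 := h2.
have g0 : - 2 * x ^+ 3 - 2 * x ^+ 2 * y - x ^+ 2 * z + x * y * z + y ^+ 2 * z + y * z ^+ 2 = 0.
  apply: (mulfI (x := 1 * (x + z))); first by apply: lt0r_neq0; ps.
  by rewrite mulr0 -[RHS]h2; bring.
apply: (@star_triangle x (x + y) (2 * x + y + z)); try (apply/eqP; move: x0 y0 z0; clear; lia).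
apply/eqP; rewrite -subr_eq0; apply/eqP.
by transitivity ((- 2 * x ^+ 3 - 2 * x ^+ 2 * y - x ^+ 2 * z + x * y * z + y ^+ 2 * z + y * z ^+ 2)); [ring | rewrite g0 ?oppr0].
Qed.

Lemma deg29 (x y z : int) : 0 < x -> 0 < y -> 0 < z ->
  sig1 (2, 1, -2, -3) x y z = 0 -> sig2 (2, 1, -2, -3) x y z = 0 -> cnd 0 x y z.
Proof.
move=> x0 y0 z0 h1 h2.
have {}h1 : b2 x y z + b1 x y z + (- b2 x y z) + (- b3 x y z) = 0 := h1.
have {}h2 : (b1 x y z) * x + (- b2 x y z) * (x + y) + (- b3 x y z) * (2 * x + y + z) = 0 := h2.
have f0 : 2 * x ^+ 2 + x * z - y * z = 0.
  apply: (mulfI (x := 1 * (x + y + z))); first by apply: lt0r_neq0; ps.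
  by rewrite mulr0 -[RHS]h1; bring.
have g0 : 2 * x ^+ 4 + 2 * x ^+ 3 * y + 5 * x ^+ 3 * z + x ^+ 2 * y * z + 4 * x ^+ 2 * z ^+ 2 - 3 * x * y ^+ 2 * z + x * z ^+ 3 - y ^+ 3 * z - y ^+ 2 * z ^+ 2 = 0.
  apply: (mulfI (x := 1)); first by apply: lt0r_neq0; ps.
  by rewrite mulr0 -[RHS]h2; bring.
have r0 : - 2 * x ^+ 6 * y - 4 * x ^+ 5 * y ^+ 2 - 4 * x ^+ 4 * y ^+ 3 + 2 * x ^+ 2 * y ^+ 5 = 0 by apply: (comb2 f0 g0 (a := - (x ^+ 5 - x ^+ 4 * y + 2 * x ^+ 4 * z + 2 * x ^+ 3 * y ^+ 2 - 6 * x ^+ 3 * y * z + x ^+ 3 * z ^+ 2 + 4 * x ^+ 2 * y ^+ 3 + 3 * x ^+ 2 * y ^+ 2 * z - 2 * x ^+ 2 * y * z ^+ 2 - x * y ^+ 4 + 2 * x * y ^+ 3 * z + x * y ^+ 2 * z ^+ 2 - y ^+ 5 - y ^+ 4 * z)) (b := (x - y) ^+ 3)); ring.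
by apply: (@no_root_absurd 3 [:: -1; -1; -1; 1] x y (2 * x ^+ 2 * y ^+ 1 * (x + y))); [|vm_compute|by []|ps|apply: (comb2 r0 r0 (a := 1) (b := 0)); rewrite /bev /=; ring].
Qed.

Lemma deg30 (x y z : int) : 0 < x -> 0 < y -> 0 < z ->
  sig1 (2, 1, -2, -1) x y z = 0 -> sig2 (2, 1, -2, -1) x y z = 0 -> cnd 8 x y z.
Proof.
move=> x0 y0 z0 h1 h2.
have {}h1 : b2 x y z + b1 x y z + (- b2 x y z) + (- b1 x y z) = 0 := h1.
have {}h2 : (b1 x y z) * x + (- b2 x y z) * (x + y) + (- b1 x y z) * (2 * x + y + z) = 0 := h2.
have g0 : - 2 * x ^+ 3 - 4 * x ^+ 2 * y - x ^+ 2 * z - 2 * x * y ^+ 2 + y ^+ 2 * z + y * z ^+ 2 = 0.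
  apply: (mulfI (x := 1 * (x + z))); first by apply: lt0r_neq0; ps.
  by rewrite mulr0 -[RHS]h2; bring.
rewrite /cnd; apply: etrans (_ : - (- 2 * x ^+ 3 - 4 * x ^+ 2 * y - x ^+ 2 * z - 2 * x * y ^+ 2 + y ^+ 2 * z + y * z ^+ 2) = 0); [ring | by rewrite g0 ?oppr0].
Qed.

Lemma deg31 (x y z : int) : 0 < x -> 0 < y -> 0 < z ->
  sig1 (2, 1, 1, -3) x y z = 0 -> sig2 (2, 1, 1, -3) x y z = 0 -> cnd 0 x y z.
Proof.
move=> x0 y0 z0 h1 h2.
have {}h1 : b2 x y z + b1 x y z + b1 x y z + (- b3 x y z) = 0 := h1.
have {}h2 : (b1 x y z) * x + (b1 x y z) * (x + y) + (- b3 x y z) * (2 * x + y + z) = 0 := h2.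
have f0 : 4 * x ^+ 3 + 4 * x ^+ 2 * y + 6 * x ^+ 2 * z + 2 * x * y * z + 2 * x * z ^+ 2 - y ^+ 2 * z - y * z ^+ 2 = 0.
  apply: (mulfI (x := 1)); first by apply: lt0r_neq0; ps.
  by rewrite mulr0 -[RHS]h1; bring.
have g0 : 4 * x ^+ 3 + 2 * x ^+ 2 * y + 4 * x ^+ 2 * z + x * z ^+ 2 - y ^+ 2 * z = 0.
  apply: (mulfI (x := 1 * (x + y + z))); first by apply: lt0r_neq0; ps.
  by rewrite mulr0 -[RHS]h2; bring.
have r0 : - 4 * x ^+ 4 + 4 * x ^+ 3 * y - 2 * x ^+ 3 * z + 2 * x ^+ 2 * y ^+ 2 + 6 * x ^+ 2 * y * z + x * y ^+ 2 * z - y ^+ 3 * z = 0 by apply: (comb2 g0 f0 (a := - (2 * x - y)) (b := (x) ^+ 1)); ring.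
by apply: (@no_root_absurd 5 [:: 4; 8; 8; 0; -1] x y (2 * x ^+ 3 * y ^+ 1 * (x + y))); [|vm_compute|by []|ps|apply: (comb2 g0 r0 (a := (- 2 * x ^+ 3 + 6 * x ^+ 2 * y + x * y ^+ 2 - y ^+ 3) ^+ 2) (b := - ((- 2 * x ^+ 4 + 6 * x ^+ 3 * y + x ^+ 2 * y ^+ 2 - x * y ^+ 3) * z + (- 4 * x ^+ 5 + 20 * x ^+ 4 * y + 4 * x ^+ 3 * y ^+ 2 - 10 * x ^+ 2 * y ^+ 3 - x * y ^+ 4 + y ^+ 5)))); rewrite /bev /=; ring].
Qed.

Lemma deg32 (x y z : int) : 0 < x -> 0 < y -> 0 < z ->
  sig1 (2, 3, -2, -3) x y z = 0 -> sig2 (2, 3, -2, -3) x y z = 0 -> cnd 7 x y z.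
Proof.
move=> x0 y0 z0 h1 h2.
have {}h1 : b2 x y z + b3 x y z + (- b2 x y z) + (- b3 x y z) = 0 := h1.
have {}h2 : (b3 x y z) * x + (- b2 x y z) * (x + y) + (- b3 x y z) * (2 * x + y + z) = 0 := h2.
have g0 : x ^+ 2 + x * z - y ^+ 2 = 0.
  apply: (mulfI (x := 1 * z * (2 * x + y + z))); first by apply: lt0r_neq0; ps.
  by rewrite mulr0 -[RHS]h2; bring.
rewrite /cnd; apply: etrans (_ : (x ^+ 2 + x * z - y ^+ 2) = 0); [ring | by rewrite g0 ?oppr0].
Qed.

Lemma deg33 (x y z : int) : 0 < x -> 0 < y -> 0 < z ->
  sig1 (2, 3, -2, -1) x y z = 0 -> sig2 (2, 3, -2, -1) x y z = 0 -> cnd 0 x y z.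
Proof.
move=> x0 y0 z0 h1 h2.
have {}h1 : b2 x y z + b3 x y z + (- b2 x y z) + (- b1 x y z) = 0 := h1.
have {}h2 : (b3 x y z) * x + (- b2 x y z) * (x + y) + (- b1 x y z) * (2 * x + y + z) = 0 := h2.
have f0 : - 2 * x ^+ 2 - x * z + y * z = 0.
  apply: (mulfI (x := 1 * (x + y + z))); first by apply: lt0r_neq0; ps.
  by rewrite mulr0 -[RHS]h1; bring.
have g0 : - 2 * x ^+ 3 - 2 * x ^+ 2 * y - 2 * x ^+ 2 * z + y * z ^+ 2 = 0.
  apply: (mulfI (x := 1 * (2 * x + y + z))); first by apply: lt0r_neq0; ps.
  by rewrite mulr0 -[RHS]h2; bring.
have r0 : - 4 * x ^+ 4 - 4 * x ^+ 3 * z + x * z ^+ 3 = 0 by apply: (comb2 f0 g0 (a := - (- 2 * x ^+ 2 + z ^+ 2)) (b := (z) ^+ 1)); ring.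
by apply: (@no_root_absurd 3 [:: -4; -4; 0; 1] x z (1 * x ^+ 1)); [|vm_compute|by []|ps|apply: (comb2 r0 r0 (a := 1) (b := 0)); rewrite /bev /=; ring].
Qed.

Lemma deg34 (x y z : int) : 0 < x -> 0 < y -> 0 < z ->
  sig1 (2, 3, 3, -1) x y z = 0 -> sig2 (2, 3, 3, -1) x y z = 0 -> cnd 0 x y z.
Proof.
move=> x0 y0 z0 h1 h2.
have {}h1 : b2 x y z + b3 x y z + b3 x y z + (- b1 x y z) = 0 := h1.
have {}h2 : (b3 x y z) * x + (b3 x y z) * (x + y) + (- b1 x y z) * (2 * x + y + z) = 0 := h2.
have f0 : - 2 * x ^+ 3 - 2 * x ^+ 2 * y - 3 * x ^+ 2 * z + 2 * x * y * z - x * z ^+ 2 + 2 * y ^+ 2 * z + 2 * y * z ^+ 2 = 0.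
  apply: (mulfI (x := 1)); first by apply: lt0r_neq0; ps.
  by rewrite mulr0 -[RHS]h1; bring.
have g0 : - 2 * x ^+ 2 + y * z = 0.
  apply: (mulfI (x := 1 * (x + y + z) * (2 * x + y + z))); first by apply: lt0r_neq0; ps.
  by rewrite mulr0 -[RHS]h2; bring.
have r0 : - 2 * x ^+ 2 + y * z = 0 by apply: (comb2 f0 g0 (a := - (0)) (b := (- x + 2 * y) ^+ 0)); ring.
by apply: (@no_root_absurd 5 [:: -4; 2; 2; 2] x y (1 * x ^+ 2)); [|vm_compute|by []|ps|apply: (comb2 f0 r0 (a := (y) ^+ 2) (b := - ((- x * y + 2 * y ^+ 2) * z + (- 2 * x ^+ 3 + x ^+ 2 * y + 2 * x * y ^+ 2 + 2 * y ^+ 3)))); rewrite /bev /=; ring].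
Qed.

Lemma deg35 (x y z : int) : 0 < x -> 0 < y -> 0 < z ->
  sig1 (3, -4, -1, 3) x y z = 0 -> sig2 (3, -4, -1, 3) x y z = 0 -> cnd 0 x y z.
Proof.
move=> x0 y0 z0 h1 h2.
have {}h1 : b3 x y z + (- b4 x y z) + (- b1 x y z) + b3 x y z = 0 := h1.
have {}h2 : (- b4 x y z) * x + (- b1 x y z) * (x + y) + (b3 x y z) * (2 * x + y + z) = 0 := h2.
have f0 : - 2 * x ^+ 2 - 2 * x * y - 2 * x * z + y * z = 0.
  apply: (mulfI (x := 1 * (2 * x + y + z))); first by apply: lt0r_neq0; ps.
  by rewrite mulr0 -[RHS]h1; bring.
have g0 : - 4 * x ^+ 4 - 8 * x ^+ 3 * y - 8 * x ^+ 3 * z - 4 * x ^+ 2 * y ^+ 2 - 8 * x ^+ 2 * y * z - 5 * x ^+ 2 * z ^+ 2 - 2 * x * y * z ^+ 2 - x * z ^+ 3 + y ^+ 3 * z + y ^+ 2 * z ^+ 2 = 0.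
  apply: (mulfI (x := 1)); first by apply: lt0r_neq0; ps.
  by rewrite mulr0 -[RHS]h2; bring.
have r0 : 4 * x ^+ 6 * y - 4 * x ^+ 4 * y ^+ 3 - 8 * x ^+ 3 * y ^+ 4 - 6 * x ^+ 2 * y ^+ 5 + 2 * x * y ^+ 6 = 0 by apply: (comb2 f0 g0 (a := - (- 16 * x ^+ 5 + 10 * x ^+ 4 * y - 16 * x ^+ 4 * z + 10 * x ^+ 3 * y ^+ 2 + 14 * x ^+ 3 * y * z - 4 * x ^+ 3 * z ^+ 2 - 10 * x ^+ 2 * y ^+ 3 + 5 * x ^+ 2 * y ^+ 2 * z + 4 * x ^+ 2 * y * z ^+ 2 - 2 * x * y ^+ 4 - 6 * x * y ^+ 3 * z - x * y ^+ 2 * z ^+ 2 + y ^+ 5 + y ^+ 4 * z)) (b := (- 2 * x + y) ^+ 3)); ring.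
by apply: (@no_root_absurd 5 [:: 2; -2; 0; -4; 1] x y (2 * x ^+ 1 * y ^+ 1 * (x + y))); [|vm_compute|by []|ps|apply: (comb2 r0 r0 (a := 1) (b := 0)); rewrite /bev /=; ring].
Qed.

Lemma deg36 (x y z : int) : 0 < x -> 0 < y -> 0 < z ->
  sig1 (3, -4, 2, 3) x y z = 0 -> sig2 (3, -4, 2, 3) x y z = 0 -> cnd 0 x y z.
Proof.
move=> x0 y0 z0 h1 h2.
have {}h1 : b3 x y z + (- b4 x y z) + b2 x y z + b3 x y z = 0 := h1.
have {}h2 : (- b4 x y z) * x + (b2 x y z) * (x + y) + (b3 x y z) * (2 * x + y + z) = 0 := h2.
have f0 : - 2 * x ^+ 3 - 4 * x ^+ 2 * y - 3 * x ^+ 2 * z - 2 * x * y ^+ 2 - x * z ^+ 2 + y ^+ 2 * z + y * z ^+ 2 = 0.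
  apply: (mulfI (x := 1)); first by apply: lt0r_neq0; ps.
  by rewrite mulr0 -[RHS]h1; bring.
have g0 : - 2 * x ^+ 4 - 4 * x ^+ 3 * y - 5 * x ^+ 3 * z - 2 * x ^+ 2 * y ^+ 2 - 3 * x ^+ 2 * y * z - 4 * x ^+ 2 * z ^+ 2 + 2 * x * y ^+ 2 * z - x * y * z ^+ 2 - x * z ^+ 3 + y ^+ 3 * z + y ^+ 2 * z ^+ 2 = 0.
  apply: (mulfI (x := 1)); first by apply: lt0r_neq0; ps.
  by rewrite mulr0 -[RHS]h2; bring.
have r0 : - 2 * x ^+ 5 * y - 8 * x ^+ 4 * y ^+ 2 - 8 * x ^+ 3 * y ^+ 3 - 3 * x ^+ 3 * y ^+ 2 * z - 2 * x ^+ 2 * y ^+ 3 * z + 2 * x * y ^+ 5 + x * y ^+ 4 * z = 0 by apply: (comb2 f0 g0 (a := - (x ^+ 3 - 3 * x ^+ 2 * y + x ^+ 2 * z - x * y ^+ 2 - x * y * z + y ^+ 3)) (b := (- x + y) ^+ 2)); ring.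
have R0 : 2 * x ^+ 2 * y ^+ 2 * (x + y) * (x + y) * (x + y) * (- 2 * x ^+ 4 - 3 * x ^+ 3 * y - 2 * x * y ^+ 3 + y ^+ 4) * (- x + y) * (- x + y) = 0.
  transitivity ((- 3 * x ^+ 3 * y ^+ 2 - 2 * x ^+ 2 * y ^+ 3 + x * y ^+ 4) ^+ 2 * (- 2 * x ^+ 3 - 4 * x ^+ 2 * y - 3 * x ^+ 2 * z - 2 * x * y ^+ 2 - x * z ^+ 2 + y ^+ 2 * z + y * z ^+ 2) - ((3 * x ^+ 4 * y ^+ 2 - x ^+ 3 * y ^+ 3 - 3 * x ^+ 2 * y ^+ 4 + x * y ^+ 5) * z + (- 2 * x ^+ 6 * y + 3 * x ^+ 5 * y ^+ 2 + 6 * x ^+ 4 * y ^+ 3 + 2 * x ^+ 3 * y ^+ 4 - x * y ^+ 6)) * (- 2 * x ^+ 5 * y - 8 * x ^+ 4 * y ^+ 2 - 8 * x ^+ 3 * y ^+ 3 - 3 * x ^+ 3 * y ^+ 2 * z - 2 * x ^+ 2 * y ^+ 3 * z + 2 * x * y ^+ 5 + x * y ^+ 4 * z)); first by ring.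
  by rewrite f0 r0 !mulr0 subrr.
(* The factor [(y - x)^2] stems from the leading coefficient in the pseudo-division; on [y = x] the
   first form has one sign. *)
have [e0|ne] := eqVneq (- x + y) 0.
  have ey : y = x by move: e0; clear; lia.
  have hp : 0 < 8 * x ^+ 3 + 2 * x ^+ 2 * z by ps.
  by move: f0 hp; rewrite ey; clear; lia.
move/eqP: R0; rewrite mulf_eq0 (negbTE ne) orbF => /eqP R0.
move/eqP: R0; rewrite mulf_eq0 (negbTE ne) orbF => /eqP R0.
have B0 : bev [:: -2; -3; 0; -2; 1] x y = 0.
  apply: (mulfI (x := 2 * x ^+ 2 * y ^+ 2 * (x + y) * (x + y) * (x + y))); first by apply: lt0r_neq0; ps.
  by rewrite mulr0 -[RHS]R0 /bev /=; ring.
have chk : no_root_mod 5 [:: -2; -3; 0; -2; 1] by vm_compute.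
by move: x0; rewrite (binary_no_root (isT : prime 5) chk B0) ltxx.
Qed.

Lemma deg37 (x y z : int) : 0 < x -> 0 < y -> 0 < z ->
  sig1 (3, -3, -1, 1) x y z = 0 -> sig2 (3, -3, -1, 1) x y z = 0 -> cnd 6 x y z.
Proof.
move=> x0 y0 z0 h1 h2.
have {}h1 : b3 x y z + (- b3 x y z) + (- b1 x y z) + b1 x y z = 0 := h1.
have {}h2 : (- b3 x y z) * x + (- b1 x y z) * (x + y) + (b1 x y z) * (2 * x + y + z) = 0 := h2.
have g0 : 2 * x ^+ 3 + x ^+ 2 * z - 2 * x * y * z - y * z ^+ 2 = 0.
  apply: (mulfI (x := 1 * (x + y + z))); first by apply: lt0r_neq0; ps.
  by rewrite mulr0 -[RHS]h2; bring.
apply: (mulfI (x := 2 * x + z)); first by apply: lt0r_neq0; ps.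
by rewrite mulr0 -[RHS]g0; ring.
Qed.

Lemma deg38 (x y z : int) : 0 < x -> 0 < y -> 0 < z ->
  sig1 (3, -3, 4, -4) x y z = 0 -> sig2 (3, -3, 4, -4) x y z = 0 -> cnd 0 x y z.
Proof.
move=> x0 y0 z0 h1 h2.
have {}h1 : b3 x y z + (- b3 x y z) + b4 x y z + (- b4 x y z) = 0 := h1.
have {}h2 : (- b3 x y z) * x + (b4 x y z) * (x + y) + (- b4 x y z) * (2 * x + y + z) = 0 := h2.
have g0 : 2 * x ^+ 3 + 2 * x ^+ 2 * y + 3 * x ^+ 2 * z + x * y * z + x * z ^+ 2 - y ^+ 2 * z = 0.
  apply: (mulfI (x := 1 * x)); first by apply: lt0r_neq0; ps.
  by rewrite mulr0 -[RHS]h2; bring.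
apply: (@star_triangle (- (x + y)) (- y) (x + z)); try (apply/eqP; move: x0 y0 z0; clear; lia).
apply/eqP; rewrite -subr_eq0; apply/eqP.
by transitivity ((2 * x ^+ 3 + 2 * x ^+ 2 * y + 3 * x ^+ 2 * z + x * y * z + x * z ^+ 2 - y ^+ 2 * z)); [ring | rewrite g0 ?oppr0].
Qed.

Lemma deg39 (x y z : int) : 0 < x -> 0 < y -> 0 < z ->
  sig1 (3, -1, -4, -4) x y z = 0 -> sig2 (3, -1, -4, -4) x y z = 0 -> cnd 0 x y z.
Proof.
move=> x0 y0 z0 h1 h2.
have {}h1 : b3 x y z + (- b1 x y z) + (- b4 x y z) + (- b4 x y z) = 0 := h1.
have {}h2 : (- b1 x y z) * x + (- b4 x y z) * (x + y) + (- b4 x y z) * (2 * x + y + z) = 0 := h2.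
have f0 : - 2 * x ^+ 3 - 4 * x ^+ 2 * y - 3 * x ^+ 2 * z - 2 * x * y ^+ 2 - x * z ^+ 2 + y ^+ 2 * z + y * z ^+ 2 = 0.
  apply: (mulfI (x := 1)); first by apply: lt0r_neq0; ps.
  by rewrite mulr0 -[RHS]h1; bring.
have g0 : - 2 * x ^+ 2 - 4 * x * y + x * z - 2 * y ^+ 2 + z ^+ 2 = 0.
  apply: (mulfI (x := 1 * x * y)); first by apply: lt0r_neq0; ps.
  by rewrite mulr0 -[RHS]h2; bring.
have r0 : 10 * x ^+ 2 * z + 4 * x * y * z + 3 * x * z ^+ 2 - 2 * y * z ^+ 2 - z ^+ 3 = 0 by apply: (comb2 g0 f0 (a := - (- 2 * x + z)) (b := (- 2) ^+ 1)); ring.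
by apply: (@no_root_absurd 5 [:: -18; 1; 1] x z (2 * z ^+ 2 * (x + z) * (2 * x + z))); [|vm_compute|by []|ps|apply: (comb2 g0 r0 (a := (4 * x * z - 2 * z ^+ 2) ^+ 2) (b := - ((- 8 * x * z + 4 * z ^+ 2) * y + (4 * x ^+ 2 * z + 14 * x * z ^+ 2 - 2 * z ^+ 3)))); rewrite /bev /=; ring].
Qed.

Lemma deg40 (x y z : int) : 0 < x -> 0 < y -> 0 < z ->
  sig1 (3, -1, -4, 0) x y z = 0 -> sig2 (3, -1, -4, 0) x y z = 0 -> cnd 0 x y z.
Proof.
move=> x0 y0 z0 h1 h2.
have {}h1 : b3 x y z + (- b1 x y z) + (- b4 x y z) + 0 = 0 := h1.
have {}h2 : (- b1 x y z) * x + (- b4 x y z) * (x + y) + (0) * (2 * x + y + z) = 0 := h2.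
have f0 : - x ^+ 2 - x * y - x * z + y * z = 0.
  apply: (mulfI (x := 1 * (2 * x + y + z))); first by apply: lt0r_neq0; ps.
  by rewrite mulr0 -[RHS]h1; bring.
have g0 : - x * y + 2 * x * z - y ^+ 2 + y * z + z ^+ 2 = 0.
  apply: (mulfI (x := 1 * x * y)); first by apply: lt0r_neq0; ps.
  by rewrite mulr0 -[RHS]h2; bring.
have r0 : - x ^+ 4 + 4 * x ^+ 2 * y ^+ 2 + 2 * x * y ^+ 3 - y ^+ 4 = 0 by apply: (comb2 f0 g0 (a := - (- x ^+ 2 + 2 * x * y - x * z + y ^+ 2 + y * z)) (b := (- x + y) ^+ 2)); ring.
by apply: (@no_root_absurd 3 [:: -1; 1; 3; -1] x y (1 * (x + y))); [|vm_compute|by []|ps|apply: (comb2 r0 r0 (a := 1) (b := 0)); rewrite /bev /=; ring].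
Qed.

Lemma deg41 (x y z : int) : 0 < x -> 0 < y -> 0 < z ->
  sig1 (3, -1, -3, 1) x y z = 0 -> sig2 (3, -1, -3, 1) x y z = 0 -> cnd 0 x y z.
Proof.
move=> x0 y0 z0 h1 h2.
have {}h1 : b3 x y z + (- b1 x y z) + (- b3 x y z) + b1 x y z = 0 := h1.
have {}h2 : (- b1 x y z) * x + (- b3 x y z) * (x + y) + (b1 x y z) * (2 * x + y + z) = 0 := h2.
have g0 : 2 * x ^+ 3 + 2 * x ^+ 2 * y + x ^+ 2 * z - x * y * z - y ^+ 2 * z - y * z ^+ 2 = 0.
  apply: (mulfI (x := 1 * (x + y + z))); first by apply: lt0r_neq0; ps.
  by rewrite mulr0 -[RHS]h2; bring.
apply: (@star_triangle x (x + y) (2 * x + y + z)); try (apply/eqP; move: x0 y0 z0; clear; lia).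
apply/eqP; rewrite -subr_eq0; apply/eqP.
by transitivity (- (2 * x ^+ 3 + 2 * x ^+ 2 * y + x ^+ 2 * z - x * y * z - y ^+ 2 * z - y * z ^+ 2)); [ring | rewrite g0 ?oppr0].
Qed.

Lemma deg42 (x y z : int) : 0 < x -> 0 < y -> 0 < z ->
  sig1 (3, -1, -1, 3) x y z = 0 -> sig2 (3, -1, -1, 3) x y z = 0 -> cnd 0 x y z.
Proof.
move=> x0 y0 z0 h1 h2.
have {}h1 : b3 x y z + (- b1 x y z) + (- b1 x y z) + b3 x y z = 0 := h1.
have {}h2 : (- b1 x y z) * x + (- b1 x y z) * (x + y) + (b3 x y z) * (2 * x + y + z) = 0 := h2.
have f0 : - 2 * x ^+ 2 - x * z + y * z = 0.
  apply: (mulfI (x := 2 * (x + y + z))); first by apply: lt0r_neq0; ps.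
  by rewrite mulr0 -[RHS]h1; bring.
have g0 : - 4 * x ^+ 3 - 2 * x ^+ 2 * y - 4 * x ^+ 2 * z - x * z ^+ 2 + y ^+ 2 * z = 0.
  apply: (mulfI (x := 1 * (x + y + z))); first by apply: lt0r_neq0; ps.
  by rewrite mulr0 -[RHS]h2; bring.
have r0 : - 2 * x ^+ 4 * y - 2 * x ^+ 3 * y ^+ 2 = 0 by apply: (comb2 f0 g0 (a := - (2 * x ^+ 3 - 4 * x ^+ 2 * y + x ^+ 2 * z - x * y ^+ 2 - x * y * z + y ^+ 3)) (b := (- x + y) ^+ 2)); ring.
by apply: (@pos_absurd (2 * x ^+ 3 * y ^+ 1 * (x + y) * (1))); [ps | apply: (comb2 r0 r0 (a := -1) (b := 0)); ring].
Qed.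

Lemma deg43 (x y z : int) : 0 < x -> 0 < y -> 0 < z ->
  sig1 (3, -1, 0, -4) x y z = 0 -> sig2 (3, -1, 0, -4) x y z = 0 -> cnd 0 x y z.
Proof.
move=> x0 y0 z0 h1 h2.
have {}h1 : b3 x y z + (- b1 x y z) + 0 + (- b4 x y z) = 0 := h1.
have {}h2 : (- b1 x y z) * x + (0) * (x + y) + (- b4 x y z) * (2 * x + y + z) = 0 := h2.
have f0 : - x ^+ 2 - x * y - x * z + y * z = 0.
  apply: (mulfI (x := 1 * (2 * x + y + z))); first by apply: lt0r_neq0; ps.
  by rewrite mulr0 -[RHS]h1; bring.
have g0 : - x ^+ 2 - 2 * x * y + x * z - y ^+ 2 + z ^+ 2 = 0.
  apply: (mulfI (x := 1 * x * y)); first by apply: lt0r_neq0; ps.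
  by rewrite mulr0 -[RHS]h2; bring.
have r0 : - x ^+ 4 + 2 * x ^+ 3 * y + 4 * x ^+ 2 * y ^+ 2 - y ^+ 4 = 0 by apply: (comb2 f0 g0 (a := - (2 * x * y - x * z + y * z)) (b := (- x + y) ^+ 2)); ring.
by apply: (@no_root_absurd 3 [:: -1; 3; 1; -1] x y (1 * (x + y))); [|vm_compute|by []|ps|apply: (comb2 r0 r0 (a := 1) (b := 0)); rewrite /bev /=; ring].
Qed.

Lemma deg44 (x y z : int) : 0 < x -> 0 < y -> 0 < z ->
  sig1 (3, -1, 1, -3) x y z = 0 -> sig2 (3, -1, 1, -3) x y z = 0 -> cnd 9 x y z.
Proof.
move=> x0 y0 z0 h1 h2.
have {}h1 : b3 x y z + (- b1 x y z) + b1 x y z + (- b3 x y z) = 0 := h1.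
have {}h2 : (- b1 x y z) * x + (b1 x y z) * (x + y) + (- b3 x y z) * (2 * x + y + z) = 0 := h2.
have g0 : 4 * x ^+ 3 + 4 * x ^+ 2 * y + 4 * x ^+ 2 * z + 2 * x * y * z + x * z ^+ 2 - y ^+ 2 * z = 0.
  apply: (mulfI (x := 1 * (x + y + z))); first by apply: lt0r_neq0; ps.
  by rewrite mulr0 -[RHS]h2; bring.
rewrite /cnd; apply: etrans (_ : (4 * x ^+ 3 + 4 * x ^+ 2 * y + 4 * x ^+ 2 * z + 2 * x * y * z + x * z ^+ 2 - y ^+ 2 * z) = 0); [ring | by rewrite g0 ?oppr0].
Qed.

Lemma deg45 (x y z : int) : 0 < x -> 0 < y -> 0 < z ->
  sig1 (3, -1, 2, 3) x y z = 0 -> sig2 (3, -1, 2, 3) x y z = 0 -> cnd 0 x y z.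
Proof.
move=> x0 y0 z0 h1 h2.
have {}h1 : b3 x y z + (- b1 x y z) + b2 x y z + b3 x y z = 0 := h1.
have {}h2 : (- b1 x y z) * x + (b2 x y z) * (x + y) + (b3 x y z) * (2 * x + y + z) = 0 := h2.
have f0 : - 2 * x ^+ 3 - 2 * x ^+ 2 * y - 3 * x ^+ 2 * z + 2 * x * y * z - x * z ^+ 2 + 2 * y ^+ 2 * z + 2 * y * z ^+ 2 = 0.
  apply: (mulfI (x := 1)); first by apply: lt0r_neq0; ps.
  by rewrite mulr0 -[RHS]h1; bring.
have g0 : - 2 * x ^+ 4 - 2 * x ^+ 3 * y - 5 * x ^+ 3 * z - x ^+ 2 * y * z - 4 * x ^+ 2 * z ^+ 2 + 3 * x * y ^+ 2 * z - x * z ^+ 3 + y ^+ 3 * z + y ^+ 2 * z ^+ 2 = 0.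
  apply: (mulfI (x := 1)); first by apply: lt0r_neq0; ps.
  by rewrite mulr0 -[RHS]h2; bring.
have r0 : 4 * x ^+ 5 * z + 4 * x ^+ 4 * y * z + 6 * x ^+ 4 * z ^+ 2 - 6 * x ^+ 3 * z ^+ 3 - 10 * x ^+ 2 * y * z ^+ 3 - 12 * x ^+ 2 * z ^+ 4 - 6 * x * y * z ^+ 4 - 4 * x * z ^+ 5 = 0 by apply: (comb2 f0 g0 (a := - (2 * x ^+ 2 * z + 4 * x * z ^+ 2 + 2 * y * z ^+ 2)) (b := (2 * z) ^+ 2)); ring.
by apply: (@no_root_absurd 5 [:: 4; 6; -11; -13; -4] x z (4 * x ^+ 2 * z ^+ 4 * (x + z) * (x + z) * (2 * x + z))); [|vm_compute|by []|ps|apply: (comb2 f0 r0 (a := (4 * x ^+ 4 * z - 10 * x ^+ 2 * z ^+ 3 - 6 * x * z ^+ 4) ^+ 2) (b := - ((8 * x ^+ 4 * z ^+ 2 - 20 * x ^+ 2 * z ^+ 4 - 12 * x * z ^+ 5) * y + (- 8 * x ^+ 6 * z + 16 * x ^+ 4 * z ^+ 3 + 4 * x ^+ 3 * z ^+ 4 - 8 * x ^+ 2 * z ^+ 5 - 4 * x * z ^+ 6)))); rewrite /bev /=; ring].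
Qed.

Lemma deg46 (x y z : int) : 0 < x -> 0 < y -> 0 < z ->
  sig1 (3, 0, -1, 3) x y z = 0 -> sig2 (3, 0, -1, 3) x y z = 0 -> cnd 3 x y z.
Proof.
move=> x0 y0 z0 h1 h2.
have {}h1 : b3 x y z + 0 + (- b1 x y z) + b3 x y z = 0 := h1.
have {}h2 : (0) * x + (- b1 x y z) * (x + y) + (b3 x y z) * (2 * x + y + z) = 0 := h2.
have f0 : - 4 * x ^+ 2 - x * y - 2 * x * z + y * z = 0.
  apply: (mulfI (x := 1 * (x + y + z))); first by apply: lt0r_neq0; ps.
  by rewrite mulr0 -[RHS]h1; bring.
have g0 : - 4 * x ^+ 3 - 3 * x ^+ 2 * y - 4 * x ^+ 2 * z - x * y * z - x * z ^+ 2 + y ^+ 2 * z = 0.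
  apply: (mulfI (x := 1 * (x + y + z))); first by apply: lt0r_neq0; ps.
  by rewrite mulr0 -[RHS]h2; bring.
have r0 : - 4 * x ^+ 4 * y - 7 * x ^+ 3 * y ^+ 2 - 2 * x ^+ 2 * y ^+ 3 + x * y ^+ 4 = 0.
  transitivity ((- 2 * x + y) ^+ 2 * (- 4 * x ^+ 3 - 3 * x ^+ 2 * y - 4 * x ^+ 2 * z - x * y * z - x * z ^+ 2 + y ^+ 2 * z) - (4 * x ^+ 3 - 3 * x ^+ 2 * y + 2 * x ^+ 2 * z - 3 * x * y ^+ 2 - x * y * z + y ^+ 3) * (- 4 * x ^+ 2 - x * y - 2 * x * z + y * z)); first by ring.
  by rewrite f0 g0 !mulr0 subrr.
have ey : y = 4 * x.
  apply/eqP; rewrite -subr_eq0; apply/eqP; apply: (mulfI (x := 1 * x ^+ 1 * y ^+ 1 * (x + y) * (x + y) * 1)); first by apply: lt0r_neq0; ps.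
  by rewrite mulr0 -[RHS]r0; ring.
have ez : z = 4 * x.
  have : x * (z - 4 * x) = 0 by move: f0; rewrite ey; clear; lia.
  by move/eqP; rewrite mulf_eq0 (negbTE (lt0r_neq0 x0)) /= subr_eq0 => /eqP.
exists `|x|%N; first by move: x0; clear; lia.
by rewrite gtz0_abs // ey ez; split; ring.
Qed.

Lemma deg47 (x y z : int) : 0 < x -> 0 < y -> 0 < z ->
  sig1 (3, 0, 2, 3) x y z = 0 -> sig2 (3, 0, 2, 3) x y z = 0 -> cnd 0 x y z.
Proof.
move=> x0 y0 z0 h1 h2.
have {}h1 : b3 x y z + 0 + b2 x y z + b3 x y z = 0 := h1.
have {}h2 : (0) * x + (b2 x y z) * (x + y) + (b3 x y z) * (2 * x + y + z) = 0 := h2.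
have f0 : - x ^+ 2 - x * y - x * z + y * z = 0.
  apply: (mulfI (x := 1 * (2 * x + y + z))); first by apply: lt0r_neq0; ps.
  by rewrite mulr0 -[RHS]h1; bring.
have g0 : - x ^+ 3 - x ^+ 2 * y - 2 * x ^+ 2 * z - x * z ^+ 2 + y ^+ 2 * z = 0.
  apply: (mulfI (x := 1 * (2 * x + y + z))); first by apply: lt0r_neq0; ps.
  by rewrite mulr0 -[RHS]h2; bring.
have r0 : - x ^+ 4 * y - 3 * x ^+ 3 * y ^+ 2 - x ^+ 2 * y ^+ 3 + x * y ^+ 4 = 0 by apply: (comb2 f0 g0 (a := - (x ^+ 3 - 3 * x ^+ 2 * y + x ^+ 2 * z - x * y ^+ 2 - x * y * z + y ^+ 3)) (b := (- x + y) ^+ 2)); ring.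
by apply: (@no_root_absurd 3 [:: -1; -2; 1] x y (1 * x ^+ 1 * y ^+ 1 * (x + y))); [|vm_compute|by []|ps|apply: (comb2 r0 r0 (a := 1) (b := 0)); rewrite /bev /=; ring].
Qed.

Lemma deg48 (x y z : int) : 0 < x -> 0 < y -> 0 < z ->
  sig1 (3, 2, -4, -4) x y z = 0 -> sig2 (3, 2, -4, -4) x y z = 0 -> cnd 0 x y z.
Proof.
move=> x0 y0 z0 h1 h2.
have {}h1 : b3 x y z + b2 x y z + (- b4 x y z) + (- b4 x y z) = 0 := h1.
have {}h2 : (b2 x y z) * x + (- b4 x y z) * (x + y) + (- b4 x y z) * (2 * x + y + z) = 0 := h2.
have f0 : - 2 * x ^+ 2 - 2 * x * y + 2 * x * z + y * z + z ^+ 2 = 0.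
  apply: (mulfI (x := 1 * y)); first by apply: lt0r_neq0; ps.
  by rewrite mulr0 -[RHS]h1; bring.
have g0 : 2 * x ^+ 2 - 2 * x * y + 3 * x * z - 2 * y ^+ 2 + z ^+ 2 = 0.
  apply: (mulfI (x := 1 * x * (x + y))); first by apply: lt0r_neq0; ps.
  by rewrite mulr0 -[RHS]h2; bring.
have r0 : 4 * x ^+ 2 + x * z - 2 * y ^+ 2 - y * z = 0 by apply: (comb2 f0 g0 (a := - (1)) (b := (1) ^+ 1)); ring.
by apply: (@no_root_absurd 2 [:: 3; 0; -3; 1] x y (2 * (x + y))); [|vm_compute|by []|ps|apply: (comb2 f0 r0 (a := (x - y) ^+ 2) (b := - ((x - y) * z + (- 2 * x ^+ 2 - x * y + y ^+ 2)))); rewrite /bev /=; ring].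
Qed.

Lemma deg49 (x y z : int) : 0 < x -> 0 < y -> 0 < z ->
  sig1 (3, 2, -4, 0) x y z = 0 -> sig2 (3, 2, -4, 0) x y z = 0 -> cnd 0 x y z.
Proof.
move=> x0 y0 z0 h1 h2.
have {}h1 : b3 x y z + b2 x y z + (- b4 x y z) + 0 = 0 := h1.
have {}h2 : (b2 x y z) * x + (- b4 x y z) * (x + y) + (0) * (2 * x + y + z) = 0 := h2.
have f0 : - x ^+ 2 - x * y + 2 * x * z + y * z + z ^+ 2 = 0.
  apply: (mulfI (x := 1 * y)); first by apply: lt0r_neq0; ps.
  by rewrite mulr0 -[RHS]h1; bring.
have g0 : 2 * x ^+ 2 + 3 * x * z - y ^+ 2 + y * z + z ^+ 2 = 0.
  apply: (mulfI (x := 1 * x * (x + y))); first by apply: lt0r_neq0; ps.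
  by rewrite mulr0 -[RHS]h2; bring.
have r0 : 3 * x ^+ 2 + x * y + x * z - y ^+ 2 = 0 by apply: (comb2 f0 g0 (a := - (1)) (b := (1) ^+ 1)); ring.
by apply: (@no_root_absurd 3 [:: 2; -2; -2; 1] x y (1 * (x + y))); [|vm_compute|by []|ps|apply: (comb2 f0 r0 (a := (x) ^+ 2) (b := - ((x) * z + (- x ^+ 2 + y ^+ 2)))); rewrite /bev /=; ring].
Qed.

Lemma deg50 (x y z : int) : 0 < x -> 0 < y -> 0 < z ->
  sig1 (3, 2, -2, -3) x y z = 0 -> sig2 (3, 2, -2, -3) x y z = 0 -> cnd 0 x y z.
Proof.
move=> x0 y0 z0 h1 h2.
have {}h1 : b3 x y z + b2 x y z + (- b2 x y z) + (- b3 x y z) = 0 := h1.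
have {}h2 : (b2 x y z) * x + (- b2 x y z) * (x + y) + (- b3 x y z) * (2 * x + y + z) = 0 := h2.
have g0 : 2 * x ^+ 3 + 2 * x ^+ 2 * y + 3 * x ^+ 2 * z + x * y * z + x * z ^+ 2 - y ^+ 2 * z = 0.
  apply: (mulfI (x := 1 * (2 * x + y + z))); first by apply: lt0r_neq0; ps.
  by rewrite mulr0 -[RHS]h2; bring.
apply: (@star_triangle (- (x + y)) (- y) (x + z)); try (apply/eqP; move: x0 y0 z0; clear; lia).
apply/eqP; rewrite -subr_eq0; apply/eqP.
by transitivity ((2 * x ^+ 3 + 2 * x ^+ 2 * y + 3 * x ^+ 2 * z + x * y * z + x * z ^+ 2 - y ^+ 2 * z)); [ring | rewrite g0 ?oppr0].
Qed.

Lemma deg51 (x y z : int) : 0 < x -> 0 < y -> 0 < z ->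
  sig1 (3, 2, 0, -4) x y z = 0 -> sig2 (3, 2, 0, -4) x y z = 0 -> cnd 0 x y z.
Proof.
move=> x0 y0 z0 h1 h2.
have {}h1 : b3 x y z + b2 x y z + 0 + (- b4 x y z) = 0 := h1.
have {}h2 : (b2 x y z) * x + (0) * (x + y) + (- b4 x y z) * (2 * x + y + z) = 0 := h2.
have f0 : - x ^+ 2 - x * y + 2 * x * z + y * z + z ^+ 2 = 0.
  apply: (mulfI (x := 1 * y)); first by apply: lt0r_neq0; ps.
  by rewrite mulr0 -[RHS]h1; bring.
have g0 : x - y + z = 0.
  apply: (mulfI (x := 1 * x * (x + y) * (2 * x + y + z))); first by apply: lt0r_neq0; ps.
  by rewrite mulr0 -[RHS]h2; bring.
have r0 : x - y + z = 0 by apply: (comb2 f0 g0 (a := - (0)) (b := (1) ^+ 0)); ring.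
by apply: (@no_root_absurd 3 [:: -2; -2; 2] x y (1)); [|vm_compute|by []|ps|apply: (comb2 f0 r0 (a := (1) ^+ 2) (b := - ((1) * z + (x + 2 * y)))); rewrite /bev /=; ring].
Qed.

Lemma deg52 (x y z : int) : 0 < x -> 0 < y -> 0 < z ->
  sig1 (3, 2, 1, 4) x y z = 0 -> sig2 (3, 2, 1, 4) x y z = 0 -> cnd 5 x y z.
Proof.
move=> x0 y0 z0 h1 h2.
have {}h1 : b3 x y z + b2 x y z + b1 x y z + b4 x y z = 0 := h1.
have {}h2 : (b2 x y z) * x + (b1 x y z) * (x + y) + (b4 x y z) * (2 * x + y + z) = 0 := h2.
have g0 : 2 * x ^+ 2 + x * z - y * z = 0.
  apply: (mulfI (x := 1 * (x + y) * (x + y + z))); first by apply: lt0r_neq0; ps.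
  by rewrite mulr0 -[RHS]h2; bring.
rewrite /cnd; apply: etrans (_ : (2 * x ^+ 2 + x * z - y * z) = 0); [ring | by rewrite g0 ?oppr0].
Qed.

Lemma deg53 (x y z : int) : 0 < x -> 0 < y -> 0 < z ->
  sig1 (3, 2, 3, 4) x y z = 0 -> sig2 (3, 2, 3, 4) x y z = 0 -> cnd 5 x y z.
Proof.
move=> x0 y0 z0 h1 h2.
have {}h1 : b3 x y z + b2 x y z + b3 x y z + b4 x y z = 0 := h1.
have {}h2 : (b2 x y z) * x + (b3 x y z) * (x + y) + (b4 x y z) * (2 * x + y + z) = 0 := h2.
have f0 : - 2 * x ^+ 2 - x * z + y * z = 0.
  apply: (mulfI (x := 1 * (x + y + z))); first by apply: lt0r_neq0; ps.
  by rewrite mulr0 -[RHS]h1; bring.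
rewrite /cnd; apply: etrans (_ : - (- 2 * x ^+ 2 - x * z + y * z) = 0); [ring | by rewrite f0 ?oppr0].
Qed.

(** Here the point [x] is fixed, and the other three have differences [- x], [x + y + z] and [y]
    from it. *)
Lemma deg54 (x y z : int) : 0 < x -> 0 < y -> 0 < z ->
  sig1 (3, 2, 4, 1) x y z = 0 -> sig2 (3, 2, 4, 1) x y z = 0 -> cnd 0 x y z.
Proof.
move=> x0 y0 z0 h1 h2.
have {}h1 : b3 x y z + b2 x y z + b4 x y z + b1 x y z = 0 := h1.
have {}h2 : (b2 x y z) * x + (b4 x y z) * (x + y) + (b1 x y z) * (2 * x + y + z) = 0 := h2.
have := @three_cycle (- x) (x + y + z) (y); case=> [|h|h|h]; try (move: h x0 y0 z0; clear; lia).
apply/eqP; rewrite -subr_eq0; apply/eqP.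
by transitivity (- (2 * x ^+ 4 + 2 * x ^+ 3 * y + 3 * x ^+ 3 * z - x ^+ 2 * y * z + x ^+ 2 * z ^+ 2 - 4 * x * y ^+ 2 * z - 3 * x * y * z ^+ 2 - y ^+ 3 * z - 2 * y ^+ 2 * z ^+ 2 - y * z ^+ 3)); [ring | rewrite -[RHS]oppr0 -[in RHS]h2; bring].
Qed.

Lemma deg55 (x y z : int) : 0 < x -> 0 < y -> 0 < z ->
  sig1 (3, 3, -1, 3) x y z = 0 -> sig2 (3, 3, -1, 3) x y z = 0 -> cnd 0 x y z.
Proof.
move=> x0 y0 z0 h1 h2.
have {}h1 : b3 x y z + b3 x y z + (- b1 x y z) + b3 x y z = 0 := h1.
have {}h2 : (b3 x y z) * x + (- b1 x y z) * (x + y) + (b3 x y z) * (2 * x + y + z) = 0 := h2.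
have f0 : - 6 * x ^+ 2 - 2 * x * y - 3 * x * z + y * z = 0.
  apply: (mulfI (x := 1 * (x + y + z))); first by apply: lt0r_neq0; ps.
  by rewrite mulr0 -[RHS]h1; bring.
have g0 : - 6 * x ^+ 3 - 4 * x ^+ 2 * y - 5 * x ^+ 2 * z - x * y * z - x * z ^+ 2 + y ^+ 2 * z = 0.
  apply: (mulfI (x := 1 * (x + y + z))); first by apply: lt0r_neq0; ps.
  by rewrite mulr0 -[RHS]h2; bring.
have r0 : - 6 * x ^+ 4 * y - 14 * x ^+ 3 * y ^+ 2 - 6 * x ^+ 2 * y ^+ 3 + 2 * x * y ^+ 4 = 0 by apply: (comb2 f0 g0 (a := - (9 * x ^+ 3 - 4 * x ^+ 2 * y + 3 * x ^+ 2 * z - 4 * x * y ^+ 2 - x * y * z + y ^+ 3)) (b := (- 3 * x + y) ^+ 2)); ring.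
by apply: (@no_root_absurd 5 [:: -3; -4; 1] x y (2 * x ^+ 1 * y ^+ 1 * (x + y))); [|vm_compute|by []|ps|apply: (comb2 r0 r0 (a := 1) (b := 0)); rewrite /bev /=; ring].
Qed.

Lemma deg56 (x y z : int) : 0 < x -> 0 < y -> 0 < z ->
  sig1 (3, 3, 2, 3) x y z = 0 -> sig2 (3, 3, 2, 3) x y z = 0 -> cnd 0 x y z.
Proof.
move=> x0 y0 z0 h1 h2.
have {}h1 : b3 x y z + b3 x y z + b2 x y z + b3 x y z = 0 := h1.
have {}h2 : (b3 x y z) * x + (b2 x y z) * (x + y) + (b3 x y z) * (2 * x + y + z) = 0 := h2.
have f0 : - 2 * x ^+ 2 - 2 * x * y - 2 * x * z + y * z = 0.
  apply: (mulfI (x := 1 * (2 * x + y + z))); first by apply: lt0r_neq0; ps.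
  by rewrite mulr0 -[RHS]h1; bring.
have g0 : - 2 * x ^+ 3 - 2 * x ^+ 2 * y - 3 * x ^+ 2 * z - x * z ^+ 2 + y ^+ 2 * z = 0.
  apply: (mulfI (x := 1 * (2 * x + y + z))); first by apply: lt0r_neq0; ps.
  by rewrite mulr0 -[RHS]h2; bring.
have r0 : - 2 * x ^+ 4 * y - 8 * x ^+ 3 * y ^+ 2 - 4 * x ^+ 2 * y ^+ 3 + 2 * x * y ^+ 4 = 0 by apply: (comb2 f0 g0 (a := - (4 * x ^+ 3 - 5 * x ^+ 2 * y + 2 * x ^+ 2 * z - 2 * x * y ^+ 2 - x * y * z + y ^+ 3)) (b := (- 2 * x + y) ^+ 2)); ring.
by apply: (@no_root_absurd 2 [:: -1; -3; 1] x y (2 * x ^+ 1 * y ^+ 1 * (x + y))); [|vm_compute|by []|ps|apply: (comb2 r0 r0 (a := 1) (b := 0)); rewrite /bev /=; ring].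
Qed.

Lemma deg57 (x y z : int) : 0 < x -> 0 < y -> 0 < z ->
  sig1 (3, 4, -1, 3) x y z = 0 -> sig2 (3, 4, -1, 3) x y z = 0 -> cnd 0 x y z.
Proof.
move=> x0 y0 z0 h1 h2.
have {}h1 : b3 x y z + b4 x y z + (- b1 x y z) + b3 x y z = 0 := h1.
have {}h2 : (b4 x y z) * x + (- b1 x y z) * (x + y) + (b3 x y z) * (2 * x + y + z) = 0 := h2.
have f0 : - 4 * x ^+ 3 - 4 * x ^+ 2 * y - 6 * x ^+ 2 * z - 2 * x * y * z - 2 * x * z ^+ 2 + y ^+ 2 * z + y * z ^+ 2 = 0.
  apply: (mulfI (x := 1)); first by apply: lt0r_neq0; ps.
  by rewrite mulr0 -[RHS]h1; bring.
have g0 : - 4 * x ^+ 4 - 6 * x ^+ 3 * y - 8 * x ^+ 3 * z - 2 * x ^+ 2 * y ^+ 2 - 8 * x ^+ 2 * y * z - 5 * x ^+ 2 * z ^+ 2 - 2 * x * y * z ^+ 2 - x * z ^+ 3 + y ^+ 3 * z + y ^+ 2 * z ^+ 2 = 0.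
  apply: (mulfI (x := 1)); first by apply: lt0r_neq0; ps.
  by rewrite mulr0 -[RHS]h2; bring.
have r0 : 8 * x ^+ 5 * z + 8 * x ^+ 4 * y * z + 16 * x ^+ 4 * z ^+ 2 + 10 * x ^+ 3 * y * z ^+ 2 + 8 * x ^+ 3 * z ^+ 3 - x ^+ 2 * z ^+ 4 - 2 * x * y * z ^+ 4 - x * z ^+ 5 = 0 by apply: (comb2 f0 g0 (a := - (2 * x ^+ 2 * z + 2 * x * z ^+ 2 + y * z ^+ 2)) (b := (z) ^+ 2)); ring.
by apply: (@no_root_absurd 5 [:: 8; 8; 4; 0; -1] x z (1 * x ^+ 2 * z ^+ 4 * (x + z) * (x + z) * (2 * x + z))); [|vm_compute|by []|ps|apply: (comb2 f0 r0 (a := (8 * x ^+ 4 * z + 10 * x ^+ 3 * z ^+ 2 - 2 * x * z ^+ 4) ^+ 2) (b := - ((8 * x ^+ 4 * z ^+ 2 + 10 * x ^+ 3 * z ^+ 3 - 2 * x * z ^+ 5) * y + (- 32 * x ^+ 6 * z - 64 * x ^+ 5 * z ^+ 2 - 28 * x ^+ 4 * z ^+ 3 + 10 * x ^+ 3 * z ^+ 4 + 5 * x ^+ 2 * z ^+ 5 - x * z ^+ 6)))); rewrite /bev /=; ring].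
Qed.

(** The cycle is [0 -> 2 x + y + z -> x -> x + y -> 0], with opposite pairs [{0, x}] and
    [{x + y, 2 x + y + z}]; this determines the arguments of [four_cycle]. *)
Lemma deg58 (x y z : int) : 0 < x -> 0 < y -> 0 < z ->
  sig1 (3, 4, 2, 1) x y z = 0 -> sig2 (3, 4, 2, 1) x y z = 0 -> cnd 0 x y z.
Proof.
move=> x0 y0 z0 h1 h2.
have {}h1 : b3 x y z + b4 x y z + b2 x y z + b1 x y z = 0 := h1.
have {}h2 : (b4 x y z) * x + (b2 x y z) * (x + y) + (b1 x y z) * (2 * x + y + z) = 0 := h2.
have e : (x + z) ^+ 4 - (- x) ^+ 4 = (- 2 * x - 2 * y - z) ^+ 2 * ((x + z) ^+ 2 + 2 * (- x) * (x + z) - (- x) ^+ 2).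
  apply/eqP; rewrite -subr_eq0; apply/eqP.
  by transitivity (4 * (2 * x ^+ 4 + 4 * x ^+ 3 * y + 3 * x ^+ 3 * z + 2 * x ^+ 2 * y ^+ 2 + 2 * x ^+ 2 * y * z + x ^+ 2 * z ^+ 2 - 2 * x * y * z ^+ 2 - y ^+ 2 * z ^+ 2 - y * z ^+ 3)); [ring | transitivity (4 * 0 : int); [congr (_ * _); rewrite -[RHS]h2; bring | rewrite mulr0]].
have n1 : (- x) != 0 by apply/eqP; move: x0 y0 z0; clear; lia.
have n2 : (x + z) != 0 by apply/eqP; move: x0 y0 z0; clear; lia.
have d := four_cycle n1 n2 e.
(* When the squares agree, the left side of [e] is 0 and the quadratic factor on the right is
   [2 D1 D2], which is nonzero; so [E = 0], against positivity. *)
have : (- 2 * x - 2 * y - z) ^+ 2 * (2 * (- x) * (x + z)) = 0.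
  have -> : 2 * (- x) * (x + z) = (x + z) ^+ 2 + 2 * (- x) * (x + z) - (- x) ^+ 2 by rewrite d; ring.
  rewrite -e; have -> : (x + z) ^+ 4 - (- x) ^+ 4 = ((x + z) ^+ 2 - (- x) ^+ 2) * ((x + z) ^+ 2 + (- x) ^+ 2) by ring.
  by rewrite d subrr mul0r.
move/eqP; rewrite mulf_eq0 => /orP[hE2|]; last by rewrite !mulf_eq0 (negbTE n1) (negbTE n2).
have hE : (- 2 * x - 2 * y - z) = 0 by apply/eqP; move: hE2; rewrite expf_eq0.
move/eqP: d; rewrite eqf_sqr => /orP[]/eqP; move: hE x0 y0 z0; clear; lia.
Qed.

Lemma deg59 (x y z : int) : 0 < x -> 0 < y -> 0 < z ->
  sig1 (3, 4, 2, 3) x y z = 0 -> sig2 (3, 4, 2, 3) x y z = 0 -> cnd 0 x y z.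
Proof.
move=> x0 y0 z0 h1 h2.
have {}h1 : b3 x y z + b4 x y z + b2 x y z + b3 x y z = 0 := h1.
have {}h2 : (b4 x y z) * x + (b2 x y z) * (x + y) + (b3 x y z) * (2 * x + y + z) = 0 := h2.
have f0 : - 2 * x ^+ 2 - x * z + y * z = 0.
  apply: (mulfI (x := 1 * (x + y + z))); first by apply: lt0r_neq0; ps.
  by rewrite mulr0 -[RHS]h1; bring.
have g0 : - 2 * x ^+ 4 - 2 * x ^+ 3 * y - 5 * x ^+ 3 * z - 3 * x ^+ 2 * y * z - 4 * x ^+ 2 * z ^+ 2 + 2 * x * y ^+ 2 * z - x * y * z ^+ 2 - x * z ^+ 3 + y ^+ 3 * z + y ^+ 2 * z ^+ 2 = 0.
  apply: (mulfI (x := 1)); first by apply: lt0r_neq0; ps.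
  by rewrite mulr0 -[RHS]h2; bring.
have r0 : - 2 * x ^+ 6 * y - 2 * x ^+ 5 * y ^+ 2 - 4 * x ^+ 4 * y ^+ 3 - 2 * x ^+ 3 * y ^+ 4 + 2 * x ^+ 2 * y ^+ 5 = 0 by apply: (comb2 f0 g0 (a := - (- x ^+ 5 + x ^+ 4 * y - 2 * x ^+ 4 * z - x ^+ 3 * y ^+ 2 + 5 * x ^+ 3 * y * z - x ^+ 3 * z ^+ 2 - 4 * x ^+ 2 * y ^+ 3 - x ^+ 2 * y ^+ 2 * z + 2 * x ^+ 2 * y * z ^+ 2 - 3 * x * y ^+ 3 * z - x * y ^+ 2 * z ^+ 2 + y ^+ 5 + y ^+ 4 * z)) (b := (- x + y) ^+ 3)); ring.
by apply: (@no_root_absurd 3 [:: -1; 0; -2; 1] x y (2 * x ^+ 2 * y ^+ 1 * (x + y))); [|vm_compute|by []|ps|apply: (comb2 r0 r0 (a := 1) (b := 0)); rewrite /bev /=; ring].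
Qed.

Lemma deg60 (x y z : int) : 0 < x -> 0 < y -> 0 < z ->
  sig1 (4, -3, -2, -3) x y z = 0 -> sig2 (4, -3, -2, -3) x y z = 0 -> cnd 0 x y z.
Proof.
move=> x0 y0 z0 h1 h2.
have {}h1 : b4 x y z + (- b3 x y z) + (- b2 x y z) + (- b3 x y z) = 0 := h1.
have {}h2 : (- b3 x y z) * x + (- b2 x y z) * (x + y) + (- b3 x y z) * (2 * x + y + z) = 0 := h2.
have f0 : 2 * x ^+ 3 + 4 * x ^+ 2 * y + 3 * x ^+ 2 * z + 2 * x * y ^+ 2 + x * z ^+ 2 - y ^+ 2 * z - y * z ^+ 2 = 0.
  apply: (mulfI (x := 1)); first by apply: lt0r_neq0; ps.
  by rewrite mulr0 -[RHS]h1; bring.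
have g0 : 2 * x ^+ 3 + 2 * x ^+ 2 * y + 3 * x ^+ 2 * z + x * z ^+ 2 - y ^+ 2 * z = 0.
  apply: (mulfI (x := 1 * (2 * x + y + z))); first by apply: lt0r_neq0; ps.
  by rewrite mulr0 -[RHS]h2; bring.
have r0 : 4 * x ^+ 3 * y + 4 * x ^+ 2 * y ^+ 2 + 3 * x ^+ 2 * y * z - y ^+ 3 * z = 0 by apply: (comb2 g0 f0 (a := - (x - y)) (b := (x) ^+ 1)); ring.
by apply: (@no_root_absurd 5 [:: -1; 8; 6; 0; -1] x y (2 * x ^+ 2 * y ^+ 2 * (x + y))); [|vm_compute|by []|ps|apply: (comb2 g0 r0 (a := (3 * x ^+ 2 * y - y ^+ 3) ^+ 2) (b := - ((3 * x ^+ 3 * y - x * y ^+ 3) * z + (5 * x ^+ 4 * y - 4 * x ^+ 3 * y ^+ 2 - 6 * x ^+ 2 * y ^+ 3 + y ^+ 5)))); rewrite /bev /=; ring].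
Qed.

Lemma deg61 (x y z : int) : 0 < x -> 0 < y -> 0 < z ->
  sig1 (4, -3, 1, -3) x y z = 0 -> sig2 (4, -3, 1, -3) x y z = 0 -> cnd 0 x y z.
Proof.
move=> x0 y0 z0 h1 h2.
have {}h1 : b4 x y z + (- b3 x y z) + b1 x y z + (- b3 x y z) = 0 := h1.
have {}h2 : (- b3 x y z) * x + (b1 x y z) * (x + y) + (- b3 x y z) * (2 * x + y + z) = 0 := h2.
have f0 : 2 * x ^+ 2 + 2 * x * y + 2 * x * z - y * z = 0.
  apply: (mulfI (x := 1 * (2 * x + y + z))); first by apply: lt0r_neq0; ps.
  by rewrite mulr0 -[RHS]h1; bring.
have g0 : 6 * x ^+ 3 + 4 * x ^+ 2 * y + 5 * x ^+ 2 * z + x * y * z + x * z ^+ 2 - y ^+ 2 * z = 0.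
  apply: (mulfI (x := 1 * (x + y + z))); first by apply: lt0r_neq0; ps.
  by rewrite mulr0 -[RHS]h2; bring.
have r0 : 8 * x ^+ 5 - 14 * x ^+ 4 * y + 6 * x ^+ 3 * y ^+ 2 + 8 * x ^+ 2 * y ^+ 3 - 2 * x * y ^+ 4 = 0 by apply: (comb2 f0 g0 (a := - (8 * x ^+ 3 - 5 * x ^+ 2 * y + 2 * x ^+ 2 * z - 3 * x * y ^+ 2 - x * y * z + y ^+ 3)) (b := (2 * x - y) ^+ 2)); ring.
by apply: (@no_root_absurd 5 [:: 8; -14; 6; 8; -2] x y (1 * x ^+ 1)); [|vm_compute|by []|ps|apply: (comb2 r0 r0 (a := 1) (b := 0)); rewrite /bev /=; ring].
Qed.

Lemma deg62 (x y z : int) : 0 < x -> 0 < y -> 0 < z ->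
  sig1 (4, -1, -2, -1) x y z = 0 -> sig2 (4, -1, -2, -1) x y z = 0 -> cnd 0 x y z.
Proof.
move=> x0 y0 z0 h1 h2.
have {}h1 : b4 x y z + (- b1 x y z) + (- b2 x y z) + (- b1 x y z) = 0 := h1.
have {}h2 : (- b1 x y z) * x + (- b2 x y z) * (x + y) + (- b1 x y z) * (2 * x + y + z) = 0 := h2.
have f0 : - 2 * x ^+ 3 - 3 * x ^+ 2 * z + 2 * x * y ^+ 2 - x * z ^+ 2 + y ^+ 2 * z + y * z ^+ 2 = 0.
  apply: (mulfI (x := 1)); first by apply: lt0r_neq0; ps.
  by rewrite mulr0 -[RHS]h1; bring.
have g0 : - 2 * x ^+ 3 - 2 * x ^+ 2 * y - x ^+ 2 * z + 2 * x * y * z + y ^+ 2 * z + y * z ^+ 2 = 0.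
  apply: (mulfI (x := 1 * (x + z))); first by apply: lt0r_neq0; ps.
  by rewrite mulr0 -[RHS]h2; bring.
have r0 : - 2 * x ^+ 4 - 2 * x ^+ 3 * y - x ^+ 3 * z + 2 * x ^+ 2 * y ^+ 2 + 2 * x * y ^+ 3 - x * y ^+ 2 * z = 0 by apply: (comb2 g0 f0 (a := - (- x + y)) (b := (y) ^+ 1)); ring.
by apply: (@no_root_absurd 5 [:: -1; -4; -6; 4; 3] x y (2 * x ^+ 2 * y ^+ 2 * (x + y))); [|vm_compute|by []|ps|apply: (comb2 g0 r0 (a := (- x ^+ 3 - x * y ^+ 2) ^+ 2) (b := - ((- x ^+ 3 * y - x * y ^+ 3) * z + (x ^+ 5 + 2 * x ^+ 3 * y ^+ 2 - 4 * x ^+ 2 * y ^+ 3 - 3 * x * y ^+ 4)))); rewrite /bev /=; ring].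
Qed.

Lemma deg63 (x y z : int) : 0 < x -> 0 < y -> 0 < z ->
  sig1 (4, -1, 3, -1) x y z = 0 -> sig2 (4, -1, 3, -1) x y z = 0 -> cnd 0 x y z.
Proof.
move=> x0 y0 z0 h1 h2.
have {}h1 : b4 x y z + (- b1 x y z) + b3 x y z + (- b1 x y z) = 0 := h1.
have {}h2 : (- b1 x y z) * x + (b3 x y z) * (x + y) + (- b1 x y z) * (2 * x + y + z) = 0 := h2.
have f0 : - 2 * x ^+ 2 - x * z + 2 * y ^+ 2 + 2 * y * z = 0.
  apply: (mulfI (x := 1 * (x + z))); first by apply: lt0r_neq0; ps.
  by rewrite mulr0 -[RHS]h1; bring.
have g0 : - 2 * x ^+ 3 - x ^+ 2 * z + 3 * x * y * z + y ^+ 2 * z + y * z ^+ 2 = 0.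
  apply: (mulfI (x := 1 * (x + y + z))); first by apply: lt0r_neq0; ps.
  by rewrite mulr0 -[RHS]h2; bring.
have r0 : 2 * x ^+ 4 * y + 6 * x ^+ 2 * y ^+ 3 - 10 * x * y ^+ 4 = 0 by apply: (comb2 f0 g0 (a := - (x ^+ 3 - 3 * x ^+ 2 * y + 5 * x * y ^+ 2 - x * y * z + 2 * y ^+ 2 * z)) (b := (- x + 2 * y) ^+ 2)); ring.
by apply: (@no_root_absurd 7 [:: 2; 0; 6; -10] x y (1 * x ^+ 1 * y ^+ 1)); [|vm_compute|by []|ps|apply: (comb2 r0 r0 (a := 1) (b := 0)); rewrite /bev /=; ring].
Qed.

Lemma deg64 (x y z : int) : 0 < x -> 0 < y -> 0 < z ->
  sig1 (4, 0, -2, -3) x y z = 0 -> sig2 (4, 0, -2, -3) x y z = 0 -> cnd 0 x y z.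
Proof.
move=> x0 y0 z0 h1 h2.
have {}h1 : b4 x y z + 0 + (- b2 x y z) + (- b3 x y z) = 0 := h1.
have {}h2 : (0) * x + (- b2 x y z) * (x + y) + (- b3 x y z) * (2 * x + y + z) = 0 := h2.
have f0 : x ^+ 2 + x * y - 2 * x * z - y * z - z ^+ 2 = 0.
  apply: (mulfI (x := 1 * y)); first by apply: lt0r_neq0; ps.
  by rewrite mulr0 -[RHS]h1; bring.
have g0 : x ^+ 3 + x ^+ 2 * y + 2 * x ^+ 2 * z + x * z ^+ 2 - y ^+ 2 * z = 0.
  apply: (mulfI (x := 1 * (2 * x + y + z))); first by apply: lt0r_neq0; ps.
  by rewrite mulr0 -[RHS]h2; bring.
have r0 : 2 * x ^+ 4 * z + x ^+ 3 * z ^+ 2 - 3 * x ^+ 2 * z ^+ 3 - 3 * x * z ^+ 4 - z ^+ 5 = 0 by apply: (comb2 f0 g0 (a := - (x ^+ 3 - x * y * z - 2 * x * z ^+ 2 + y * z ^+ 2 - z ^+ 3)) (b := (x - z) ^+ 2)); ring.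
by apply: (@no_root_absurd 3 [:: 2; -1; -2; -1] x z (1 * z ^+ 1 * (x + z))); [|vm_compute|by []|ps|apply: (comb2 r0 r0 (a := 1) (b := 0)); rewrite /bev /=; ring].
Qed.

Lemma deg65 (x y z : int) : 0 < x -> 0 < y -> 0 < z ->
  sig1 (4, 0, -2, -1) x y z = 0 -> sig2 (4, 0, -2, -1) x y z = 0 -> cnd 0 x y z.
Proof.
move=> x0 y0 z0 h1 h2.
have {}h1 : b4 x y z + 0 + (- b2 x y z) + (- b1 x y z) = 0 := h1.
have {}h2 : (0) * x + (- b2 x y z) * (x + y) + (- b1 x y z) * (2 * x + y + z) = 0 := h2.
have f0 : - 2 * x ^+ 2 - x * y - 3 * x * z + y ^+ 2 - 2 * y * z - z ^+ 2 = 0.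
  apply: (mulfI (x := 1 * x)); first by apply: lt0r_neq0; ps.
  by rewrite mulr0 -[RHS]h1; bring.
have g0 : - x ^+ 2 - x * y + y * z = 0.
  apply: (mulfI (x := 1 * (x + z) * (2 * x + y + z))); first by apply: lt0r_neq0; ps.
  by rewrite mulr0 -[RHS]h2; bring.
have r0 : - x ^+ 2 - x * y + y * z = 0 by apply: (comb2 f0 g0 (a := - (0)) (b := (- 1) ^+ 0)); ring.
by apply: (@no_root_absurd 3 [:: -1; -4; -4; 1] x y (1 * (x + y))); [|vm_compute|by []|ps|apply: (comb2 f0 r0 (a := (y) ^+ 2) (b := - ((- y) * z + (- x ^+ 2 - 4 * x * y - 2 * y ^+ 2)))); rewrite /bev /=; ring].
Qed.

Lemma deg66 (x y z : int) : 0 < x -> 0 < y -> 0 < z ->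
  sig1 (4, 0, 1, -3) x y z = 0 -> sig2 (4, 0, 1, -3) x y z = 0 -> cnd 0 x y z.
Proof.
move=> x0 y0 z0 h1 h2.
have {}h1 : b4 x y z + 0 + b1 x y z + (- b3 x y z) = 0 := h1.
have {}h2 : (0) * x + (b1 x y z) * (x + y) + (- b3 x y z) * (2 * x + y + z) = 0 := h2.
have f0 : x ^+ 2 + x * y + x * z - y * z = 0.
  apply: (mulfI (x := 1 * (2 * x + y + z))); first by apply: lt0r_neq0; ps.
  by rewrite mulr0 -[RHS]h1; bring.
have g0 : 4 * x ^+ 3 + 3 * x ^+ 2 * y + 4 * x ^+ 2 * z + x * y * z + x * z ^+ 2 - y ^+ 2 * z = 0.
  apply: (mulfI (x := 1 * (x + y + z))); first by apply: lt0r_neq0; ps.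
  by rewrite mulr0 -[RHS]h2; bring.
have r0 : x ^+ 5 - 4 * x ^+ 4 * y + 4 * x ^+ 3 * y ^+ 2 + 4 * x ^+ 2 * y ^+ 3 - x * y ^+ 4 = 0 by apply: (comb2 f0 g0 (a := - (3 * x ^+ 3 - 4 * x ^+ 2 * y + x ^+ 2 * z - 2 * x * y ^+ 2 - x * y * z + y ^+ 3)) (b := (x - y) ^+ 2)); ring.
by apply: (@no_root_absurd 3 [:: 1; -4; 4; 4; -1] x y (1 * x ^+ 1)); [|vm_compute|by []|ps|apply: (comb2 r0 r0 (a := 1) (b := 0)); rewrite /bev /=; ring].
Qed.

Lemma deg67 (x y z : int) : 0 < x -> 0 < y -> 0 < z ->
  sig1 (4, 0, 1, 4) x y z = 0 -> sig2 (4, 0, 1, 4) x y z = 0 -> cnd 4 x y z.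
Proof.
move=> x0 y0 z0 h1 h2.
have {}h1 : b4 x y z + 0 + b1 x y z + b4 x y z = 0 := h1.
have {}h2 : (0) * x + (b1 x y z) * (x + y) + (b4 x y z) * (2 * x + y + z) = 0 := h2.
have f0 : x ^+ 2 + x * y - 2 * x * z - y * z - z ^+ 2 = 0.
  apply: (mulfI (x := 1 * y)); first by apply: lt0r_neq0; ps.
  by rewrite mulr0 -[RHS]h1; bring.
have g0 : x ^+ 2 - x * z - y * z - z ^+ 2 = 0.
  apply: (mulfI (x := 1 * y * (x + y))); first by apply: lt0r_neq0; ps.
  by rewrite mulr0 -[RHS]h2; bring.
(* The difference of the two forms is [x (y - z)]. *)
have ez : z = y.
  have : x * (y - z) = 0 by move: f0 g0; clear; lia.
  by move/eqP; rewrite mulf_eq0 (negbTE (lt0r_neq0 x0)) /= subr_eq0 => /eqP.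
have ex : x = 2 * y.
  have : (x + y) * (x - 2 * y) = 0 by move: g0; rewrite ez; clear; lia.
  have xy : x + y != 0 by apply: lt0r_neq0; ps.
  by move/eqP; rewrite mulf_eq0 (negbTE xy) /= subr_eq0 => /eqP.
exists `|y|%N; first by move: y0; clear; lia.
by rewrite gtz0_abs // ez ex; split; ring.
Qed.

Lemma deg68 (x y z : int) : 0 < x -> 0 < y -> 0 < z ->
  sig1 (4, 0, 3, -1) x y z = 0 -> sig2 (4, 0, 3, -1) x y z = 0 -> cnd 0 x y z.
Proof.
move=> x0 y0 z0 h1 h2.
have {}h1 : b4 x y z + 0 + b3 x y z + (- b1 x y z) = 0 := h1.
have {}h2 : (0) * x + (b3 x y z) * (x + y) + (- b1 x y z) * (2 * x + y + z) = 0 := h2.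
have f0 : - 2 * x ^+ 2 - x * y - x * z + y ^+ 2 + y * z = 0.
  apply: (mulfI (x := 1 * (x + z))); first by apply: lt0r_neq0; ps.
  by rewrite mulr0 -[RHS]h1; bring.
have g0 : - x ^+ 2 + y * z = 0.
  apply: (mulfI (x := 1 * (x + y + z) * (2 * x + y + z))); first by apply: lt0r_neq0; ps.
  by rewrite mulr0 -[RHS]h2; bring.
have r0 : x ^+ 3 + x ^+ 2 * y + x * y ^+ 2 - y ^+ 3 = 0 by apply: (comb2 f0 g0 (a := - (y)) (b := (- x + y) ^+ 1)); ring.
by apply: (@no_root_absurd 3 [:: 1; 1; 1; -1] x y (1)); [|vm_compute|by []|ps|apply: (comb2 r0 r0 (a := 1) (b := 0)); rewrite /bev /=; ring].
Qed.

Lemma deg69 (x y z : int) : 0 < x -> 0 < y -> 0 < z ->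
  sig1 (4, 1, -1, -4) x y z = 0 -> sig2 (4, 1, -1, -4) x y z = 0 -> cnd 0 x y z.
Proof.
move=> x0 y0 z0 h1 h2.
have {}h1 : b4 x y z + b1 x y z + (- b1 x y z) + (- b4 x y z) = 0 := h1.
have {}h2 : (b1 x y z) * x + (- b1 x y z) * (x + y) + (- b4 x y z) * (2 * x + y + z) = 0 := h2.
have g0 : - 2 * x ^+ 3 - 2 * x ^+ 2 * y - x ^+ 2 * z + x * y * z + y ^+ 2 * z + y * z ^+ 2 = 0.
  apply: (mulfI (x := 1 * y)); first by apply: lt0r_neq0; ps.
  by rewrite mulr0 -[RHS]h2; bring.
apply: (@star_triangle x (x + y) (2 * x + y + z)); try (apply/eqP; move: x0 y0 z0; clear; lia).
apply/eqP; rewrite -subr_eq0; apply/eqP.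
by transitivity ((- 2 * x ^+ 3 - 2 * x ^+ 2 * y - x ^+ 2 * z + x * y * z + y ^+ 2 * z + y * z ^+ 2)); [ring | rewrite g0 ?oppr0].
Qed.

(** The 4-cycle with opposite pairs [{0, x + y}] and [{x, 2 x + y + z}]. *)
Lemma deg70 (x y z : int) : 0 < x -> 0 < y -> 0 < z ->
  sig1 (4, 1, 2, 3) x y z = 0 -> sig2 (4, 1, 2, 3) x y z = 0 -> cnd 0 x y z.
Proof.
move=> x0 y0 z0 h1 h2.
have {}h1 : b4 x y z + b1 x y z + b2 x y z + b3 x y z = 0 := h1.
have {}h2 : (b1 x y z) * x + (b2 x y z) * (x + y) + (b3 x y z) * (2 * x + y + z) = 0 := h2.
have e : (- x - y - z) ^+ 4 - (- x - y) ^+ 4 = (- 2 * x - z) ^+ 2 * ((- x - y - z) ^+ 2 + 2 * (- x - y) * (- x - y - z) - (- x - y) ^+ 2).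
  apply/eqP; rewrite -subr_eq0; apply/eqP.
  by transitivity (4 * (- 2 * x ^+ 4 - 4 * x ^+ 3 * y - 5 * x ^+ 3 * z - 2 * x ^+ 2 * y ^+ 2 - 5 * x ^+ 2 * y * z - 4 * x ^+ 2 * z ^+ 2 + x * y ^+ 2 * z - 2 * x * y * z ^+ 2 - x * z ^+ 3 + y ^+ 3 * z + y ^+ 2 * z ^+ 2)); [ring | transitivity (4 * 0 : int); [congr (_ * _); rewrite -[RHS]h2; bring | rewrite mulr0]].
have n1 : (- x - y) != 0 by apply/eqP; move: x0 y0 z0; clear; lia.
have n2 : (- x - y - z) != 0 by apply/eqP; move: x0 y0 z0; clear; lia.
have d := four_cycle n1 n2 e.
have : (- 2 * x - z) ^+ 2 * (2 * (- x - y) * (- x - y - z)) = 0.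
  have -> : 2 * (- x - y) * (- x - y - z) = (- x - y - z) ^+ 2 + 2 * (- x - y) * (- x - y - z) - (- x - y) ^+ 2 by rewrite d; ring.
  rewrite -e; have -> : (- x - y - z) ^+ 4 - (- x - y) ^+ 4 = ((- x - y - z) ^+ 2 - (- x - y) ^+ 2) * ((- x - y - z) ^+ 2 + (- x - y) ^+ 2) by ring.
  by rewrite d subrr mul0r.
move/eqP; rewrite mulf_eq0 => /orP[hE2|]; last by rewrite !mulf_eq0 (negbTE n1) (negbTE n2).
have hE : (- 2 * x - z) = 0 by apply/eqP; move: hE2; rewrite expf_eq0.
move/eqP: d; rewrite eqf_sqr => /orP[]/eqP; move: hE x0 y0 z0; clear; lia.
Qed.

Lemma deg71 (x y z : int) : 0 < x -> 0 < y -> 0 < z ->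
  sig1 (4, 1, 4, 0) x y z = 0 -> sig2 (4, 1, 4, 0) x y z = 0 -> cnd 0 x y z.
Proof.
move=> x0 y0 z0 h1 h2.
have {}h1 : b4 x y z + b1 x y z + b4 x y z + 0 = 0 := h1.
have {}h2 : (b1 x y z) * x + (b4 x y z) * (x + y) + (0) * (2 * x + y + z) = 0 := h2.
have f0 : x ^+ 2 + x * y - 2 * x * z - y * z - z ^+ 2 = 0.
  apply: (mulfI (x := 1 * y)); first by apply: lt0r_neq0; ps.
  by rewrite mulr0 -[RHS]h1; bring.
have g0 : x * y - 2 * x * z + y ^+ 2 - y * z - z ^+ 2 = 0.
  apply: (mulfI (x := 1 * x * y)); first by apply: lt0r_neq0; ps.
  by rewrite mulr0 -[RHS]h2; bring.
have r0 : - 2 * x ^+ 3 * z + x ^+ 2 * z ^+ 2 + 4 * x * z ^+ 3 + z ^+ 4 = 0 by apply: (comb2 f0 g0 (a := - (x * y - y * z + 2 * z ^+ 2)) (b := (x - z) ^+ 2)); ring.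
by apply: (@no_root_absurd 3 [:: -2; 3; 1] x z (1 * z ^+ 1 * (x + z))); [|vm_compute|by []|ps|apply: (comb2 r0 r0 (a := 1) (b := 0)); rewrite /bev /=; ring].
Qed.

Lemma deg72 (x y z : int) : 0 < x -> 0 < y -> 0 < z ->
  sig1 (4, 3, -1, 3) x y z = 0 -> sig2 (4, 3, -1, 3) x y z = 0 -> cnd 0 x y z.
Proof.
move=> x0 y0 z0 h1 h2.
have {}h1 : b4 x y z + b3 x y z + (- b1 x y z) + b3 x y z = 0 := h1.
have {}h2 : (b3 x y z) * x + (- b1 x y z) * (x + y) + (b3 x y z) * (2 * x + y + z) = 0 := h2.
have f0 : - 4 * x ^+ 3 - 4 * x ^+ 2 * y - 6 * x ^+ 2 * z - 2 * x * y * z - 2 * x * z ^+ 2 + y ^+ 2 * z + y * z ^+ 2 = 0.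
  apply: (mulfI (x := 1)); first by apply: lt0r_neq0; ps.
  by rewrite mulr0 -[RHS]h1; bring.
have g0 : - 6 * x ^+ 3 - 4 * x ^+ 2 * y - 5 * x ^+ 2 * z - x * y * z - x * z ^+ 2 + y ^+ 2 * z = 0.
  apply: (mulfI (x := 1 * (x + y + z))); first by apply: lt0r_neq0; ps.
  by rewrite mulr0 -[RHS]h2; bring.
have r0 : - 8 * x ^+ 4 + 2 * x ^+ 3 * y - 4 * x ^+ 3 * z + 4 * x ^+ 2 * y ^+ 2 + 5 * x ^+ 2 * y * z + 2 * x * y ^+ 2 * z - y ^+ 3 * z = 0 by apply: (comb2 g0 f0 (a := - (- 2 * x + y)) (b := (- x) ^+ 1)); ring.
by apply: (@no_root_absurd 5 [:: -12; -5; 1] x y (2 * x ^+ 4 * y ^+ 2 * (x + y))); [|vm_compute|by []|ps|apply: (comb2 g0 r0 (a := (- 4 * x ^+ 3 + 5 * x ^+ 2 * y + 2 * x * y ^+ 2 - y ^+ 3) ^+ 2) (b := - ((4 * x ^+ 4 - 5 * x ^+ 3 * y - 2 * x ^+ 2 * y ^+ 2 + x * y ^+ 3) * z + (12 * x ^+ 5 - 19 * x ^+ 4 * y - 15 * x ^+ 3 * y ^+ 2 + 8 * x ^+ 2 * y ^+ 3 + 3 * x * y ^+ 4 - y ^+ 5)))); rewrite /bev /=; ring].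
Qed.

Lemma deg73 (x y z : int) : 0 < x -> 0 < y -> 0 < z ->
  sig1 (4, 4, -2, -3) x y z = 0 -> sig2 (4, 4, -2, -3) x y z = 0 -> cnd 0 x y z.
Proof.
move=> x0 y0 z0 h1 h2.
have {}h1 : b4 x y z + b4 x y z + (- b2 x y z) + (- b3 x y z) = 0 := h1.
have {}h2 : (b4 x y z) * x + (- b2 x y z) * (x + y) + (- b3 x y z) * (2 * x + y + z) = 0 := h2.
have f0 : 2 * x ^+ 2 + 2 * x * y - 2 * x * z - y * z - z ^+ 2 = 0.
  apply: (mulfI (x := 1 * y)); first by apply: lt0r_neq0; ps.
  by rewrite mulr0 -[RHS]h1; bring.
have g0 : 2 * x ^+ 4 + 4 * x ^+ 3 * y + 5 * x ^+ 3 * z + 2 * x ^+ 2 * y ^+ 2 + 3 * x ^+ 2 * y * z + 4 * x ^+ 2 * z ^+ 2 - 2 * x * y ^+ 2 * z + x * y * z ^+ 2 + x * z ^+ 3 - y ^+ 3 * z - y ^+ 2 * z ^+ 2 = 0.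
  apply: (mulfI (x := 1)); first by apply: lt0r_neq0; ps.
  by rewrite mulr0 -[RHS]h2; bring.
have r0 : 8 * x ^+ 6 * z + 24 * x ^+ 5 * z ^+ 2 + 10 * x ^+ 4 * z ^+ 3 - 13 * x ^+ 3 * z ^+ 4 - 9 * x ^+ 2 * z ^+ 5 - 2 * x * z ^+ 6 = 0 by apply: (comb2 f0 g0 (a := - (8 * x ^+ 5 + 8 * x ^+ 4 * y + 12 * x ^+ 4 * z - 12 * x ^+ 3 * y * z - 4 * x ^+ 3 * z ^+ 2 - 4 * x ^+ 2 * y ^+ 2 * z - 9 * x ^+ 2 * z ^+ 3 + 4 * x * y ^+ 2 * z ^+ 2 + 2 * x * y * z ^+ 3 - x * z ^+ 4 - y ^+ 2 * z ^+ 3)) (b := (2 * x - z) ^+ 3)); ring.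
by apply: (@no_root_absurd 5 [:: 8; 16; -6; -7; -2] x z (1 * x ^+ 1 * z ^+ 1 * (x + z))); [|vm_compute|by []|ps|apply: (comb2 r0 r0 (a := 1) (b := 0)); rewrite /bev /=; ring].
Qed.

Lemma deg74 (x y z : int) : 0 < x -> 0 < y -> 0 < z ->
  sig1 (4, 4, -2, -1) x y z = 0 -> sig2 (4, 4, -2, -1) x y z = 0 -> cnd 0 x y z.
Proof.
move=> x0 y0 z0 h1 h2.
have {}h1 : b4 x y z + b4 x y z + (- b2 x y z) + (- b1 x y z) = 0 := h1.
have {}h2 : (b4 x y z) * x + (- b2 x y z) * (x + y) + (- b1 x y z) * (2 * x + y + z) = 0 := h2.
have f0 : - 2 * x ^+ 2 - 3 * x * z + 2 * y ^+ 2 - 2 * y * z - z ^+ 2 = 0.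
  apply: (mulfI (x := 1 * x)); first by apply: lt0r_neq0; ps.
  by rewrite mulr0 -[RHS]h1; bring.
have g0 : - 2 * x ^+ 4 - 2 * x ^+ 3 * y - 3 * x ^+ 3 * z - 2 * x ^+ 2 * y * z - x ^+ 2 * z ^+ 2 + 2 * x * y * z ^+ 2 + y ^+ 2 * z ^+ 2 + y * z ^+ 3 = 0.
  apply: (mulfI (x := 1)); first by apply: lt0r_neq0; ps.
  by rewrite mulr0 -[RHS]h2; bring.
have r0 : x ^+ 2 * y * z - 2 * x * y ^+ 3 + 5 * x * y ^+ 2 * z - 2 * y ^+ 4 + 4 * y ^+ 3 * z = 0 by apply: (comb2 f0 g0 (a := - (x ^+ 2 + x * y + y ^+ 2 - y * z)) (b := (- 1) ^+ 2)); ring.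
by apply: (@no_root_absurd 5 [:: -1; -8; -18; -6; 6] x y (2 * y ^+ 2 * (x + y) * (x + y))); [|vm_compute|by []|ps|apply: (comb2 f0 r0 (a := (x ^+ 2 * y + 5 * x * y ^+ 2 + 4 * y ^+ 3) ^+ 2) (b := - ((- x ^+ 2 * y - 5 * x * y ^+ 2 - 4 * y ^+ 3) * z + (- 3 * x ^+ 3 * y - 17 * x ^+ 2 * y ^+ 2 - 24 * x * y ^+ 3 - 10 * y ^+ 4)))); rewrite /bev /=; ring].
Qed.

Lemma deg75 (x y z : int) : 0 < x -> 0 < y -> 0 < z ->
  sig1 (4, 4, 1, -3) x y z = 0 -> sig2 (4, 4, 1, -3) x y z = 0 -> cnd 0 x y z.
Proof.
move=> x0 y0 z0 h1 h2.
have {}h1 : b4 x y z + b4 x y z + b1 x y z + (- b3 x y z) = 0 := h1.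
have {}h2 : (b4 x y z) * x + (b1 x y z) * (x + y) + (- b3 x y z) * (2 * x + y + z) = 0 := h2.
have f0 : 2 * x ^+ 3 + 4 * x ^+ 2 * y + 3 * x ^+ 2 * z + 2 * x * y ^+ 2 + x * z ^+ 2 - y ^+ 2 * z - y * z ^+ 2 = 0.
  apply: (mulfI (x := 1)); first by apply: lt0r_neq0; ps.
  by rewrite mulr0 -[RHS]h1; bring.
have g0 : 4 * x ^+ 4 + 8 * x ^+ 3 * y + 8 * x ^+ 3 * z + 4 * x ^+ 2 * y ^+ 2 + 8 * x ^+ 2 * y * z + 5 * x ^+ 2 * z ^+ 2 + 2 * x * y * z ^+ 2 + x * z ^+ 3 - y ^+ 3 * z - y ^+ 2 * z ^+ 2 = 0.
  apply: (mulfI (x := 1)); first by apply: lt0r_neq0; ps.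
  by rewrite mulr0 -[RHS]h2; bring.
have r0 : - 2 * x ^+ 5 * y + 4 * x ^+ 4 * y ^+ 2 - x ^+ 4 * y * z + 12 * x ^+ 3 * y ^+ 3 + 2 * x ^+ 3 * y ^+ 2 * z + 4 * x ^+ 2 * y ^+ 4 + 3 * x ^+ 2 * y ^+ 3 * z - 2 * x * y ^+ 5 = 0 by apply: (comb2 f0 g0 (a := - (2 * x ^+ 3 - 3 * x ^+ 2 * y + x ^+ 2 * z - 2 * x * y ^+ 2 - x * y * z + y ^+ 3)) (b := (x - y) ^+ 2)); ring.
have R0 : 2 * x ^+ 2 * y ^+ 4 * (x + y) * (x + y) * (x + y) * (- x ^+ 2 + 9 * x * y - 2 * y ^+ 2) * (- x + y) * (- x + y) = 0.
  transitivity ((- x ^+ 4 * y + 2 * x ^+ 3 * y ^+ 2 + 3 * x ^+ 2 * y ^+ 3) ^+ 2 * (2 * x ^+ 3 + 4 * x ^+ 2 * y + 3 * x ^+ 2 * z + 2 * x * y ^+ 2 + x * z ^+ 2 - y ^+ 2 * z - y * z ^+ 2) - ((- x ^+ 5 * y + 3 * x ^+ 4 * y ^+ 2 + x ^+ 3 * y ^+ 3 - 3 * x ^+ 2 * y ^+ 4) * z + (- x ^+ 6 * y + 2 * x ^+ 4 * y ^+ 3 + 6 * x ^+ 3 * y ^+ 4 + 3 * x ^+ 2 * y ^+ 5 - 2 * x * y ^+ 6)) * (- 2 * x ^+ 5 * y + 4 * x ^+ 4 * y ^+ 2 - x ^+ 4 * y * z + 12 * x ^+ 3 * y ^+ 3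 + 2 * x ^+ 3 * y ^+ 2 * z + 4 * x ^+ 2 * y ^+ 4 + 3 * x ^+ 2 * y ^+ 3 * z - 2 * x * y ^+ 5)); first by ring.
  by rewrite f0 r0 !mulr0 subrr.
(* Again the factor from the leading coefficient of the pseudo-division, where the first form is
   positive. *)
have [e0|ne] := eqVneq (- x + y) 0.
  have ey : y = x by move: e0; clear; lia.
  have hp : 0 < 8 * x ^+ 3 + 2 * x ^+ 2 * z by ps.
  by move: f0 hp; rewrite ey; clear; lia.
move/eqP: R0; rewrite mulf_eq0 (negbTE ne) orbF => /eqP R0.
move/eqP: R0; rewrite mulf_eq0 (negbTE ne) orbF => /eqP R0.
have B0 : bev [:: -1; 9; -2] x y = 0.
  apply: (mulfI (x := 2 * x ^+ 2 * y ^+ 4 * (x + y) * (x + y) * (x + y))); first by apply: lt0r_neq0; ps.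
  by rewrite mulr0 -[RHS]R0 /bev /=; ring.
have chk : no_root_mod 5 [:: -1; 9; -2] by vm_compute.
by move: x0; rewrite (binary_no_root (isT : prime 5) chk B0) ltxx.
Qed.

Lemma deg76 (x y z : int) : 0 < x -> 0 < y -> 0 < z ->
  sig1 (4, 4, 1, 4) x y z = 0 -> sig2 (4, 4, 1, 4) x y z = 0 -> cnd 0 x y z.
Proof.
move=> x0 y0 z0 h1 h2.
have {}h1 : b4 x y z + b4 x y z + b1 x y z + b4 x y z = 0 := h1.
have {}h2 : (b4 x y z) * x + (b1 x y z) * (x + y) + (b4 x y z) * (2 * x + y + z) = 0 := h2.
have f0 : 2 * x ^+ 2 + 2 * x * y - 2 * x * z - y * z - z ^+ 2 = 0.
  apply: (mulfI (x := 1 * y)); first by apply: lt0r_neq0; ps.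
  by rewrite mulr0 -[RHS]h1; bring.
have g0 : 2 * x ^+ 2 - x * z - y * z - z ^+ 2 = 0.
  apply: (mulfI (x := 1 * y * (x + y))); first by apply: lt0r_neq0; ps.
  by rewrite mulr0 -[RHS]h2; bring.
have r0 : 4 * x ^+ 3 - 2 * x ^+ 2 * z - 3 * x * z ^+ 2 = 0 by apply: (comb2 f0 g0 (a := - (- z)) (b := (2 * x - z) ^+ 1)); ring.
by apply: (@no_root_absurd 5 [:: 4; -2; -3] x z (1 * x ^+ 1)); [|vm_compute|by []|ps|apply: (comb2 r0 r0 (a := 1) (b := 0)); rewrite /bev /=; ring].
Qed.

Lemma deg77 (x y z : int) : 0 < x -> 0 < y -> 0 < z ->
  sig1 (4, 4, 3, -1) x y z = 0 -> sig2 (4, 4, 3, -1) x y z = 0 -> cnd 0 x y z.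
Proof.
move=> x0 y0 z0 h1 h2.
have {}h1 : b4 x y z + b4 x y z + b3 x y z + (- b1 x y z) = 0 := h1.
have {}h2 : (b4 x y z) * x + (b3 x y z) * (x + y) + (- b1 x y z) * (2 * x + y + z) = 0 := h2.
have f0 : - 2 * x ^+ 3 - 3 * x ^+ 2 * z + 2 * x * y ^+ 2 - x * z ^+ 2 + y ^+ 2 * z + y * z ^+ 2 = 0.
  apply: (mulfI (x := 1)); first by apply: lt0r_neq0; ps.
  by rewrite mulr0 -[RHS]h1; bring.
have g0 : - 2 * x ^+ 4 - 2 * x ^+ 3 * y - 3 * x ^+ 3 * z - x ^+ 2 * z ^+ 2 + 3 * x * y ^+ 2 * z + 3 * x * y * z ^+ 2 + y ^+ 3 * z + 2 * y ^+ 2 * z ^+ 2 + y * z ^+ 3 = 0.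
  apply: (mulfI (x := 1)); first by apply: lt0r_neq0; ps.
  by rewrite mulr0 -[RHS]h2; bring.
have r0 : - 8 * x ^+ 6 - 8 * x ^+ 5 * y - 8 * x ^+ 5 * z - 4 * x ^+ 4 * y * z + 14 * x ^+ 4 * z ^+ 2 + 18 * x ^+ 3 * y * z ^+ 2 + 22 * x ^+ 3 * z ^+ 3 + 15 * x ^+ 2 * y * z ^+ 3 + 9 * x ^+ 2 * z ^+ 4 + x * y * z ^+ 4 + x * z ^+ 5 = 0 by apply: (comb2 f0 g0 (a := - (6 * x ^+ 2 * z + 2 * x * y * z + 7 * x * z ^+ 2 + y * z ^+ 2 + z ^+ 3)) (b := (2 * x + z) ^+ 2)); ring.
by apply: (@no_root_absurd 3 [:: 4; 0; -7; -5] x z (1 * x ^+ 3 * z ^+ 2 * (x + z) * (x + z) * (2 * x + z) * (2 * x + z) * (2 * x + z))); [|vm_compute|by []|ps|apply: (comb2 f0 r0 (a := (- 8 * x ^+ 5 - 4 * x ^+ 4 * z + 18 * x ^+ 3 * z ^+ 2 + 15 * x ^+ 2 * z ^+ 3 + x * z ^+ 4) ^+ 2) (b := - ((- 16 * x ^+ 6 - 16 * x ^+ 5 * z + 32 * x ^+ 4 * z ^+ 2 + 48 * x ^+ 3 * z ^+ 3 + 17 * x ^+ 2 * z ^+ 4 + x * z ^+ 5) * y + (16 * x ^+ 7 + 24 * x ^+ 6 * z - 28 * x ^+ 5 * z ^+ 2 - 62 * x ^+ 4 * z ^+ 3 - 22 * x ^+ 3 * z ^+ 4 + 4 * x ^+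 2 * z ^+ 5)))); rewrite /bev /=; ring].
Qed.

(** * Pairwise disjointness of the five curves at positive points *)

Lemma excl56 (x y z : int) : 0 < x -> 0 < y -> 0 < z -> cnd 5 x y z -> cnd 6 x y z -> False.
Proof.
move=> x0 y0 z0 f0 g0.
have {}f0 : 2 * x ^+ 2 + x * z - y * z = 0 by move: f0; rewrite /cnd => <-; ring.
have {}g0 : x ^+ 2 - y * z = 0 by move: g0; rewrite /cnd => <-; ring.
have r0 : x ^+ 3 + x ^+ 2 * y = 0 by apply: (comb2 f0 g0 (a := - (- y)) (b := (x - y) ^+ 1)); ring.
by apply: (@pos_absurd (1 * x ^+ 2 * (x + y) * (1))); [ps | apply: (comb2 r0 r0 (a := 1) (b := 0)); ring].
Qed.

Lemma excl57 (x y z : int) : 0 < x -> 0 < y -> 0 < z -> cnd 5 x y z -> cnd 7 x y z -> False.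
Proof.
move=> x0 y0 z0 f0 g0.
have {}f0 : 2 * x ^+ 2 + x * z - y * z = 0 by move: f0; rewrite /cnd => <-; ring.
have {}g0 : x ^+ 2 + x * z - y ^+ 2 = 0 by move: g0; rewrite /cnd => <-; ring.
have r0 : - x ^+ 3 - x ^+ 2 * y - x * y ^+ 2 + y ^+ 3 = 0 by apply: (comb2 f0 g0 (a := - (x)) (b := (x - y) ^+ 1)); ring.
by apply: (@no_root_absurd 3 [:: -1; -1; -1; 1] x y (1)); [|vm_compute|by []|ps|apply: (comb2 r0 r0 (a := 1) (b := 0)); rewrite /bev /=; ring].
Qed.

Lemma excl67 (x y z : int) : 0 < x -> 0 < y -> 0 < z -> cnd 6 x y z -> cnd 7 x y z -> False.
Proof.
move=> x0 y0 z0 f0 g0.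
have {}f0 : x ^+ 2 - y * z = 0 by move: f0; rewrite /cnd => <-; ring.
have {}g0 : x ^+ 2 + x * z - y ^+ 2 = 0 by move: g0; rewrite /cnd => <-; ring.
have r0 : - x ^+ 3 - x ^+ 2 * y + y ^+ 3 = 0 by apply: (comb2 f0 g0 (a := - (x)) (b := (- y) ^+ 1)); ring.
by apply: (@no_root_absurd 2 [:: -1; -1; 0; 1] x y (1)); [|vm_compute|by []|ps|apply: (comb2 r0 r0 (a := 1) (b := 0)); rewrite /bev /=; ring].
Qed.

Lemma excl58 (x y z : int) : 0 < x -> 0 < y -> 0 < z -> cnd 5 x y z -> cnd 8 x y z -> False.
Proof.
move=> x0 y0 z0 f0 g0.
have {}f0 : 2 * x ^+ 2 + x * z - y * z = 0 by move: f0; rewrite /cnd => <-; ring.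
have {}g0 : 2 * x ^+ 3 + 4 * x ^+ 2 * y + x ^+ 2 * z + 2 * x * y ^+ 2 - y ^+ 2 * z - y * z ^+ 2 = 0 by move: g0; rewrite /cnd => <-; ring.
have r0 : - 2 * x ^+ 4 * y - 2 * x ^+ 3 * y ^+ 2 - 2 * x ^+ 2 * y ^+ 3 + 2 * x * y ^+ 4 = 0 by apply: (comb2 f0 g0 (a := - (x ^+ 3 + x ^+ 2 * y - x * y ^+ 2 - x * y * z + y ^+ 3 + y ^+ 2 * z)) (b := (x - y) ^+ 2)); ring.
by apply: (@no_root_absurd 3 [:: -2; -2; -2; 2] x y (1 * x ^+ 1 * y ^+ 1)); [|vm_compute|by []|ps|apply: (comb2 r0 r0 (a := 1) (b := 0)); rewrite /bev /=; ring].
Qed.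

Lemma excl68 (x y z : int) : 0 < x -> 0 < y -> 0 < z -> cnd 6 x y z -> cnd 8 x y z -> False.
Proof.
move=> x0 y0 z0 f0 g0.
have {}f0 : x ^+ 2 - y * z = 0 by move: f0; rewrite /cnd => <-; ring.
have {}g0 : 2 * x ^+ 3 + 4 * x ^+ 2 * y + x ^+ 2 * z + 2 * x * y ^+ 2 - y ^+ 2 * z - y * z ^+ 2 = 0 by move: g0; rewrite /cnd => <-; ring.
have r0 : 2 * x ^+ 3 * y ^+ 2 + 3 * x ^+ 2 * y ^+ 3 + 2 * x * y ^+ 4 = 0 by apply: (comb2 f0 g0 (a := - (y ^+ 3 + y ^+ 2 * z)) (b := (- y) ^+ 2)); ring.
by apply: (@pos_absurd (1 * x ^+ 1 * y ^+ 2 * (2 * x ^+ 2 + 3 * x * y + 2 * y ^+ 2))); [ps | apply: (comb2 r0 r0 (a := 1) (b := 0)); ring].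
Qed.

Lemma excl78 (x y z : int) : 0 < x -> 0 < y -> 0 < z -> cnd 7 x y z -> cnd 8 x y z -> False.
Proof.
move=> x0 y0 z0 f0 g0.
have {}f0 : x ^+ 2 + x * z - y ^+ 2 = 0 by move: f0; rewrite /cnd => <-; ring.
have {}g0 : 2 * x ^+ 3 + 4 * x ^+ 2 * y + x ^+ 2 * z + 2 * x * y ^+ 2 - y ^+ 2 * z - y * z ^+ 2 = 0 by move: g0; rewrite /cnd => <-; ring.
have r0 : x ^+ 5 + 3 * x ^+ 4 * y + 4 * x ^+ 3 * y ^+ 2 + 2 * x ^+ 2 * y ^+ 3 - x * y ^+ 4 - y ^+ 5 = 0 by apply: (comb2 f0 g0 (a := - (x ^+ 3 + x ^+ 2 * y - x * y ^+ 2 - x * y * z - y ^+ 3)) (b := (x) ^+ 2)); ring.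
by apply: (@no_root_absurd 3 [:: 1; 1; 1; -1] x y (1 * (x + y) * (x + y))); [|vm_compute|by []|ps|apply: (comb2 r0 r0 (a := 1) (b := 0)); rewrite /bev /=; ring].
Qed.

Lemma excl59 (x y z : int) : 0 < x -> 0 < y -> 0 < z -> cnd 5 x y z -> cnd 9 x y z -> False.
Proof.
move=> x0 y0 z0 f0 g0.
have {}f0 : 2 * x ^+ 2 + x * z - y * z = 0 by move: f0; rewrite /cnd => <-; ring.
have {}g0 : 4 * x ^+ 3 + 4 * x ^+ 2 * y + 4 * x ^+ 2 * z + 2 * x * y * z + x * z ^+ 2 - y ^+ 2 * z = 0 by move: g0; rewrite /cnd => <-; ring.
have r0 : 2 * x ^+ 3 * y ^+ 2 + 2 * x ^+ 2 * y ^+ 3 = 0 by apply: (comb2 f0 g0 (a := - (2 * x ^+ 3 - 2 * x ^+ 2 * y + x ^+ 2 * z - 3 * x * y ^+ 2 - x * y * z + y ^+ 3)) (b := (x - y) ^+ 2)); ring.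
by apply: (@pos_absurd (2 * x ^+ 2 * y ^+ 2 * (x + y) * (1))); [ps | apply: (comb2 r0 r0 (a := 1) (b := 0)); ring].
Qed.

Lemma excl69 (x y z : int) : 0 < x -> 0 < y -> 0 < z -> cnd 6 x y z -> cnd 9 x y z -> False.
Proof.
move=> x0 y0 z0 f0 g0.
have {}f0 : x ^+ 2 - y * z = 0 by move: f0; rewrite /cnd => <-; ring.
have {}g0 : 4 * x ^+ 3 + 4 * x ^+ 2 * y + 4 * x ^+ 2 * z + 2 * x * y * z + x * z ^+ 2 - y ^+ 2 * z = 0 by move: g0; rewrite /cnd => <-; ring.
have r0 : x ^+ 5 + 4 * x ^+ 4 * y + 6 * x ^+ 3 * y ^+ 2 + 3 * x ^+ 2 * y ^+ 3 = 0 by apply: (comb2 f0 g0 (a := - (- x ^+ 3 - 4 * x ^+ 2 * y - 2 * x * y ^+ 2 - x * y * z + y ^+ 3)) (b := (- y) ^+ 2)); ring.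
by apply: (@pos_absurd (1 * x ^+ 2 * (x + y) * (x ^+ 2 + 3 * x * y + 3 * y ^+ 2))); [ps | apply: (comb2 r0 r0 (a := 1) (b := 0)); ring].
Qed.

Lemma excl79 (x y z : int) : 0 < x -> 0 < y -> 0 < z -> cnd 7 x y z -> cnd 9 x y z -> False.
Proof.
move=> x0 y0 z0 f0 g0.
have {}f0 : x ^+ 2 + x * z - y ^+ 2 = 0 by move: f0; rewrite /cnd => <-; ring.
have {}g0 : 4 * x ^+ 3 + 4 * x ^+ 2 * y + 4 * x ^+ 2 * z + 2 * x * y * z + x * z ^+ 2 - y ^+ 2 * z = 0 by move: g0; rewrite /cnd => <-; ring.
have r0 : x ^+ 5 + 2 * x ^+ 4 * y + 3 * x ^+ 3 * y ^+ 2 + 2 * x ^+ 2 * y ^+ 3 = 0 by apply: (comb2 f0 g0 (a := - (3 * x ^+ 3 + 2 * x ^+ 2 * y + x ^+ 2 * z)) (b := (x) ^+ 2)); ring.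
by apply: (@pos_absurd (1 * x ^+ 2 * (x + y) * (x ^+ 2 + x * y + 2 * y ^+ 2))); [ps | apply: (comb2 r0 r0 (a := 1) (b := 0)); ring].
Qed.

Lemma excl89 (x y z : int) : 0 < x -> 0 < y -> 0 < z -> cnd 8 x y z -> cnd 9 x y z -> False.
Proof.
move=> x0 y0 z0 f0 g0.
have {}f0 : 2 * x ^+ 3 + 4 * x ^+ 2 * y + x ^+ 2 * z + 2 * x * y ^+ 2 - y ^+ 2 * z - y * z ^+ 2 = 0 by move: f0; rewrite /cnd => <-; ring.
have {}g0 : 4 * x ^+ 3 + 4 * x ^+ 2 * y + 4 * x ^+ 2 * z + 2 * x * y * z + x * z ^+ 2 - y ^+ 2 * z = 0 by move: g0; rewrite /cnd => <-; ring.
have r0 : - 2 * x ^+ 4 - 8 * x ^+ 3 * y - x ^+ 3 * z - 6 * x ^+ 2 * y ^+ 2 - 4 * x ^+ 2 * y * z - x * y ^+ 2 * z + y ^+ 3 * z = 0 by apply: (comb2 f0 g0 (a := - (x)) (b := (- y) ^+ 1)); ring.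
by apply: (@no_root_absurd 2 [:: -1; -2; -5; 1] x y (2 * x ^+ 1 * y ^+ 3 * (x + y) * (x + y))); [|vm_compute|by []|ps|apply: (comb2 f0 r0 (a := (- x ^+ 3 - 4 * x ^+ 2 * y - x * y ^+ 2 + y ^+ 3) ^+ 2) (b := - ((x ^+ 3 * y + 4 * x ^+ 2 * y ^+ 2 + x * y ^+ 3 - y ^+ 4) * z + (- x ^+ 5 - 6 * x ^+ 4 * y - 8 * x ^+ 3 * y ^+ 2 - x ^+ 2 * y ^+ 3 + x * y ^+ 4 - y ^+ 5)))); rewrite /bev /=; ring].
Qed.

(** * Degenerate signatures *)

Definition sig3 (I : signature) (x y z : int) : int :=
  let: (i1, i2, i3, i4) := I in
  aZ i2 x y z * x ^+ 2 + aZ i3 x y z * (x + y) ^+ 2 + aZ i4 x y z * (2 * x + y + z) ^+ 2.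

(** * Degeneracy of the listed signatures on their rays and curves *)

Lemma conv1 (x y z : int) : cnd 2 x y z -> sig1 (0, 3, 2, 3) x y z = 0 /\ sig2 (0, 3, 2, 3) x y z = 0.
Proof.
have e1 : sig1 (0, 3, 2, 3) x y z = 0 + b3 x y z + b2 x y z + b3 x y z := erefl.
have e2 : sig2 (0, 3, 2, 3) x y z = (b3 x y z) * x + (b2 x y z) * (x + y) + (b3 x y z) * (2 * x + y + z) := erefl.
rewrite e1 e2.
by case=> n _ [-> -> ->]; split; bring.
Qed.

Lemma conv2 (x y z : int) : cnd 1 x y z -> sig1 (1, -3, 1, 0) x y z = 0 /\ sig2 (1, -3, 1, 0) x y z = 0.
Proof.
have e1 : sig1 (1, -3, 1, 0) x y z = b1 x y z + (- b3 x y z) + b1 x y z + 0 := erefl.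
have e2 : sig2 (1, -3, 1, 0) x y z = (- b3 x y z) * x + (b1 x y z) * (x + y) + (0) * (2 * x + y + z) := erefl.
rewrite e1 e2.
by case=> n _ [-> -> ->]; split; bring.
Qed.

Lemma conv3 (x y z : int) : cnd 1 x y z -> sig1 (1, 0, -3, 1) x y z = 0 /\ sig2 (1, 0, -3, 1) x y z = 0.
Proof.
have e1 : sig1 (1, 0, -3, 1) x y z = b1 x y z + 0 + (- b3 x y z) + b1 x y z := erefl.
have e2 : sig2 (1, 0, -3, 1) x y z = (0) * x + (- b3 x y z) * (x + y) + (b1 x y z) * (2 * x + y + z) := erefl.
rewrite e1 e2.
by case=> n _ [-> -> ->]; split; bring.
Qed.

Lemma conv4 (x y z : int) : cnd 5 x y z -> sig1 (1, 2, 1, 4) x y z = 0 /\ sig2 (1, 2, 1, 4) x y z = 0.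
Proof.
have e1 : sig1 (1, 2, 1, 4) x y z = b1 x y z + b2 x y z + b1 x y z + b4 x y z := erefl.
have e2 : sig2 (1, 2, 1, 4) x y z = (b2 x y z) * x + (b1 x y z) * (x + y) + (b4 x y z) * (2 * x + y + z) := erefl.
rewrite e1 e2.
move=> h; have {}h : 2 * x ^+ 2 + x * z - y * z = 0 by rewrite -[RHS]h; ring.
split; [transitivity ((x + y + z) * (2 * x ^+ 2 + x * z - y * z)) | transitivity ((x ^+ 2 + 2 * x * y + x * z + y ^+ 2 + y * z) * (2 * x ^+ 2 + x * z - y * z))]; try bring; by rewrite h mulr0.
Qed.

Lemma conv5 (x y z : int) : cnd 8 x y z -> sig1 (2, 1, -2, -1) x y z = 0 /\ sig2 (2, 1, -2, -1) x y z = 0.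
Proof.
have e1 : sig1 (2, 1, -2, -1) x y z = b2 x y z + b1 x y z + (- b2 x y z) + (- b1 x y z) := erefl.
have e2 : sig2 (2, 1, -2, -1) x y z = (b1 x y z) * x + (- b2 x y z) * (x + y) + (- b1 x y z) * (2 * x + y + z) := erefl.
rewrite e1 e2.
move=> h; have {}h : 2 * x ^+ 3 + 4 * x ^+ 2 * y + x ^+ 2 * z + 2 * x * y ^+ 2 - y ^+ 2 * z - y * z ^+ 2 = 0 by rewrite -[RHS]h; ring.
split; [transitivity ((0) * (2 * x ^+ 3 + 4 * x ^+ 2 * y + x ^+ 2 * z + 2 * x * y ^+ 2 - y ^+ 2 * z - y * z ^+ 2)) | transitivity ((- x - z) * (2 * x ^+ 3 + 4 * x ^+ 2 * y + x ^+ 2 * z + 2 * x * y ^+ 2 - y ^+ 2 * z - y * z ^+ 2))]; try bring; by rewrite h mulr0.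
Qed.

Lemma conv6 (x y z : int) : cnd 7 x y z -> sig1 (2, 3, -2, -3) x y z = 0 /\ sig2 (2, 3, -2, -3) x y z = 0.
Proof.
have e1 : sig1 (2, 3, -2, -3) x y z = b2 x y z + b3 x y z + (- b2 x y z) + (- b3 x y z) := erefl.
have e2 : sig2 (2, 3, -2, -3) x y z = (b3 x y z) * x + (- b2 x y z) * (x + y) + (- b3 x y z) * (2 * x + y + z) := erefl.
rewrite e1 e2.
move=> h; have {}h : x ^+ 2 + x * z - y ^+ 2 = 0 by rewrite -[RHS]h; ring.
split; [transitivity ((0) * (x ^+ 2 + x * z - y ^+ 2)) | transitivity ((2 * x * z + y * z + z ^+ 2) * (x ^+ 2 + x * z - y ^+ 2))]; try bring; by rewrite h mulr0.
Qed.

Lemma conv7 (x y z : int) : cnd 6 x y z -> sig1 (3, -3, -1, 1) x y z = 0 /\ sig2 (3, -3, -1, 1) x y z = 0.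
Proof.
have e1 : sig1 (3, -3, -1, 1) x y z = b3 x y z + (- b3 x y z) + (- b1 x y z) + b1 x y z := erefl.
have e2 : sig2 (3, -3, -1, 1) x y z = (- b3 x y z) * x + (- b1 x y z) * (x + y) + (b1 x y z) * (2 * x + y + z) := erefl.
rewrite e1 e2.
move=> h; have {}h : x ^+ 2 - y * z = 0 by rewrite -[RHS]h; ring.
split; [transitivity ((0) * (x ^+ 2 - y * z)) | transitivity ((2 * x ^+ 2 + 2 * x * y + 3 * x * z + y * z + z ^+ 2) * (x ^+ 2 - y * z))]; try bring; by rewrite h mulr0.
Qed.

Lemma conv8 (x y z : int) : cnd 9 x y z -> sig1 (3, -1, 1, -3) x y z = 0 /\ sig2 (3, -1, 1, -3) x y z = 0.
Proof.
have e1 : sig1 (3, -1, 1, -3) x y z = b3 x y z + (- b1 x y z) + b1 x y z + (- b3 x y z) := erefl.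
have e2 : sig2 (3, -1, 1, -3) x y z = (- b1 x y z) * x + (b1 x y z) * (x + y) + (- b3 x y z) * (2 * x + y + z) := erefl.
rewrite e1 e2.
move=> h; have {}h : 4 * x ^+ 3 + 4 * x ^+ 2 * y + 4 * x ^+ 2 * z + 2 * x * y * z + x * z ^+ 2 - y ^+ 2 * z = 0 by rewrite -[RHS]h; ring.
split; [transitivity ((0) * (4 * x ^+ 3 + 4 * x ^+ 2 * y + 4 * x ^+ 2 * z + 2 * x * y * z + x * z ^+ 2 - y ^+ 2 * z)) | transitivity ((x + y + z) * (4 * x ^+ 3 + 4 * x ^+ 2 * y + 4 * x ^+ 2 * z + 2 * x * y * z + x * z ^+ 2 - y ^+ 2 * z))]; try bring; by rewrite h mulr0.
Qed.

Lemma conv9 (x y z : int) : cnd 3 x y z -> sig1 (3, 0, -1, 3) x y z = 0 /\ sig2 (3, 0, -1, 3) x y z = 0.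
Proof.
have e1 : sig1 (3, 0, -1, 3) x y z = b3 x y z + 0 + (- b1 x y z) + b3 x y z := erefl.
have e2 : sig2 (3, 0, -1, 3) x y z = (0) * x + (- b1 x y z) * (x + y) + (b3 x y z) * (2 * x + y + z) := erefl.
rewrite e1 e2.
by case=> n _ [-> -> ->]; split; bring.
Qed.

Lemma conv10 (x y z : int) : cnd 5 x y z -> sig1 (3, 2, 1, 4) x y z = 0 /\ sig2 (3, 2, 1, 4) x y z = 0.
Proof.
have e1 : sig1 (3, 2, 1, 4) x y z = b3 x y z + b2 x y z + b1 x y z + b4 x y z := erefl.
have e2 : sig2 (3, 2, 1, 4) x y z = (b2 x y z) * x + (b1 x y z) * (x + y) + (b4 x y z) * (2 * x + y + z) := erefl.
rewrite e1 e2.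
move=> h; have {}h : 2 * x ^+ 2 + x * z - y * z = 0 by rewrite -[RHS]h; ring.
split; [transitivity ((0) * (2 * x ^+ 2 + x * z - y * z)) | transitivity ((x ^+ 2 + 2 * x * y + x * z + y ^+ 2 + y * z) * (2 * x ^+ 2 + x * z - y * z))]; try bring; by rewrite h mulr0.
Qed.

Lemma conv11 (x y z : int) : cnd 5 x y z -> sig1 (3, 2, 3, 4) x y z = 0 /\ sig2 (3, 2, 3, 4) x y z = 0.
Proof.
have e1 : sig1 (3, 2, 3, 4) x y z = b3 x y z + b2 x y z + b3 x y z + b4 x y z := erefl.
have e2 : sig2 (3, 2, 3, 4) x y z = (b2 x y z) * x + (b3 x y z) * (x + y) + (b4 x y z) * (2 * x + y + z) := erefl.
rewrite e1 e2.
move=> h; have {}h : 2 * x ^+ 2 + x * z - y * z = 0 by rewrite -[RHS]h; ring.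
split; [transitivity ((- x - y - z) * (2 * x ^+ 2 + x * z - y * z)) | transitivity ((0) * (2 * x ^+ 2 + x * z - y * z))]; try bring; by rewrite h mulr0.
Qed.

Lemma conv12 (x y z : int) : cnd 4 x y z -> sig1 (4, 0, 1, 4) x y z = 0 /\ sig2 (4, 0, 1, 4) x y z = 0.
Proof.
have e1 : sig1 (4, 0, 1, 4) x y z = b4 x y z + 0 + b1 x y z + b4 x y z := erefl.
have e2 : sig2 (4, 0, 1, 4) x y z = (0) * x + (b1 x y z) * (x + y) + (b4 x y z) * (2 * x + y + z) := erefl.
rewrite e1 e2.
by case=> n _ [-> -> ->]; split; bring.
Qed.

Lemma conv_third1 (x y z : int) : cnd 5 x y z -> sig3 (1, 2, 1, 4) x y z = 0.
Proof.
move=> h; have {}h : 2 * x ^+ 2 + x * z - y * z = 0 by rewrite -[RHS]h; ring.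
have -> : sig3 (1, 2, 1, 4) x y z = (b2 x y z) * x ^+ 2 + (b1 x y z) * (x + y) ^+ 2 + (b4 x y z) * (2 * x + y + z) ^+ 2 by [].
transitivity ((x ^+ 3 + 3 * x ^+ 2 * y + x ^+ 2 * z + 3 * x * y ^+ 2 + 2 * x * y * z + y ^+ 3 + y ^+ 2 * z) * (2 * x ^+ 2 + x * z - y * z)); first by bring.
by rewrite h mulr0.
Qed.

Lemma conv_third2 (x y z : int) : cnd 5 x y z -> sig3 (3, 2, 1, 4) x y z = 0.
Proof.
move=> h; have {}h : 2 * x ^+ 2 + x * z - y * z = 0 by rewrite -[RHS]h; ring.
have -> : sig3 (3, 2, 1, 4) x y z = (b2 x y z) * x ^+ 2 + (b1 x y z) * (x + y) ^+ 2 + (b4 x y z) * (2 * x + y + z) ^+ 2 by [].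
transitivity ((x ^+ 3 + 3 * x ^+ 2 * y + x ^+ 2 * z + 3 * x * y ^+ 2 + 2 * x * y * z + y ^+ 3 + y ^+ 2 * z) * (2 * x ^+ 2 + x * z - y * z)); first by bring.
by rewrite h mulr0.
Qed.

Lemma conv_third3 (x y z : int) : cnd 5 x y z -> sig3 (3, 2, 3, 4) x y z = 0.
Proof.
move=> h; have {}h : 2 * x ^+ 2 + x * z - y * z = 0 by rewrite -[RHS]h; ring.
have -> : sig3 (3, 2, 3, 4) x y z = (b2 x y z) * x ^+ 2 + (b3 x y z) * (x + y) ^+ 2 + (b4 x y z) * (2 * x + y + z) ^+ 2 by [].
transitivity ((0) * (2 * x ^+ 2 + x * z - y * z)); first by bring.
by rewrite h mulr0.
Qed.

(** * From the signature polynomials to their integer values *)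

Lemma evalZ_a i x y z : evalZ (a_ i) x y z = aZ i x y z.
Proof.
have nat_case j : evalZ (a_nat j) x y z = aN j x y z.
  by case: j => [|[|[|[|[|j]]]]]; rewrite /evalZ /a_nat /aN /b1 /b2 /b3 /b4 /pX /pY /pZ ?meval0 ?(mevalM, mevalD, mevalN, mevalXU, meval1) //=.
by case: i => j; rewrite /a_ /aZ -nat_case // /evalZ mevalN.
Qed.

(** The three coefficients are identified through [sig_form_uniq] from the expanded form, and then
    evaluated. *)
Lemma evalZ_sig J x y z : [/\ evalZ (p1 J) x y z = sig1 J x y z, evalZ (p2 J) x y z = sig2 J x y z *+ 2
  & evalZ (p3 J) x y z = sig3 J x y z].
Proof.
case: J => [[[i1 i2] i3] i4].
have [<- <- <-] : [/\ a_ i1 + a_ i2 + a_ i3 + a_ i4 = p1 (i1, i2, i3, i4),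
    (a_ i2 * k1 + a_ i3 * k2 + a_ i4 * k3) *+ 2 = p2 (i1, i2, i3, i4) &
    a_ i2 * k1 ^+ 2 + a_ i3 * k2 ^+ 2 + a_ i4 * k3 ^+ 2 = p3 (i1, i2, i3, i4)].
  apply: sig_form_uniq.
  rewrite /sig_form !(mpolyCD, mpolyCMn, mpolyCM, rmorphXn) /=; ring.
have ek1 : evalZ k1 x y z = x by rewrite /evalZ /k1 /pX mevalXU.
have ek2 : evalZ k2 x y z = x + y by rewrite /evalZ /k2 /pX /pY mevalD !mevalXU.
have ek3 : evalZ k3 x y z = 2 * x + y + z.
  by rewrite /evalZ /k3 /pX /pY /pZ !(mevalD, mevalM, mevalXU, meval1).
have := (evalZ_a i1 x y z, evalZ_a i2 x y z, evalZ_a i3 x y z, evalZ_a i4 x y z).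
rewrite /evalZ in ek1 ek2 ek3 *; move=> [[[h1 h2] h3] h4].
split; rewrite /sig1 /sig2 /sig3.
- by rewrite !mevalD h1 h2 h3 h4.
- by rewrite mevalMn mevalD mevalD !mevalM ek1 ek2 ek3 h2 h3 h4.
- by rewrite !expr2 mevalD mevalD !mevalM ek1 ek2 ek3 h2 h3 h4.
Qed.

Lemma degE x y z J : (J \in degenerate x y z) = [&& is_signature J, sig1 J x y z == 0 & sig2 J x y z == 0].
Proof. by rewrite inE /=; have [-> -> _] := evalZ_sig J x y z; rewrite mulrn_eq0. Qed.

Lemma aZN i x y z : aZ (- i) x y z = - aZ i x y z.
Proof. by case: i => [[|n]|n] //=; rewrite ?oppr0 ?opprK. Qed.

Lemma sigN J x y z : [/\ sig1 (- J) x y z = - sig1 J x y z, sig2 (- J) x y z = - sig2 J x y z &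
  sig3 (- J) x y z = - sig3 J x y z].
Proof.
case: J => [[[i1 i2] i3] i4].
have -> : - ((i1, i2, i3, i4) : signature) = (- i1, - i2, - i3, - i4) by [].
by rewrite /sig1 /sig2 /sig3 !aZN; split; ring.
Qed.

(** * Sign certificates by computation *)

Fixpoint dot (c m : seq int) : int :=
  match c, m with a :: c', b :: m' => a * b + dot c' m' | _, _ => 0 end.
Fixpoint addv (c d : seq int) : seq int :=
  match c, d with [::], _ => d | _, [::] => c | a :: c', b :: d' => (a + b) :: addv c' d' end.
Definition scv (k : int) (c : seq int) : seq int := [seq k * a | a <- c].

Lemma dot_addv c d m : dot (addv c d) m = dot c m + dot d m.
Proof.
elim: c d m => [|a c IH] [|b d] [|e m] //=; rewrite ?add0r ?addr0 //.
by rewrite IH; ring.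
Qed.

Lemma dot_scv k c m : dot (scv k c) m = k * dot c m.
Proof. by elim: c m => [|a c IH] [|e m] //=; rewrite ?mulr0 // IH; ring. Qed.

Definition mons (x y z : int) : seq int :=
  [:: x ^+ 4; x ^+ 3 * y; x ^+ 3 * z; x ^+ 2 * y ^+ 2; x ^+ 2 * y * z; x ^+ 2 * z ^+ 2; x * y ^+ 3; x * y ^+ 2 * z; x * y * z ^+ 2; x * z ^+ 3; y ^+ 4; y ^+ 3 * z; y ^+ 2 * z ^+ 2; y * z ^+ 3; z ^+ 4].

(* Coefficients of [a_n * x], [a_n * y], [a_n * z] on the quartic monomials [mons]. *)
Definition tabA (n v : nat) : seq int :=
  match n, v with
  | 1%N, 0%N => [:: 0; -1; 0; -1; -2; 0; 0; -1; -1; 0; 0; 0; 0; 0; 0]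
  | 1%N, 1%N => [:: 0; 0; 0; -1; 0; 0; -1; -2; 0; 0; 0; -1; -1; 0; 0]
  | 1%N, 2%N => [:: 0; 0; 0; 0; -1; 0; 0; -1; -2; 0; 0; 0; -1; -1; 0]
  | 2%N, 0%N => [:: 2; 3; 3; 1; 4; 1; 0; 1; 1; 0; 0; 0; 0; 0; 0]
  | 2%N, 1%N => [:: 0; 2; 0; 3; 3; 0; 1; 4; 1; 0; 0; 1; 1; 0; 0]
  | 2%N, 2%N => [:: 0; 0; 2; 0; 3; 3; 0; 1; 4; 1; 0; 0; 1; 1; 0]
  | 3%N, 0%N => [:: -2; -3; -3; -1; -2; -1; 0; 0; 0; 0; 0; 0; 0; 0; 0]
  | 3%N, 1%N => [:: 0; -2; 0; -3; -3; 0; -1; -2; -1; 0; 0; 0; 0; 0; 0]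
  | 3%N, 2%N => [:: 0; 0; -2; 0; -3; -3; 0; -1; -2; -1; 0; 0; 0; 0; 0]
  | 4%N, 0%N => [:: 0; 1; 0; 1; 0; 0; 0; 0; 0; 0; 0; 0; 0; 0; 0]
  | 4%N, 1%N => [:: 0; 0; 0; 1; 0; 0; 1; 0; 0; 0; 0; 0; 0; 0; 0]
  | 4%N, 2%N => [:: 0; 0; 0; 0; 1; 0; 0; 1; 0; 0; 0; 0; 0; 0; 0]
  | _, _ => [::]
  end.

Definition comb (n : nat) (l : int * int * int) : seq int :=
  addv (scv l.1.1 (tabA n 0)) (addv (scv l.1.2 (tabA n 1)) (scv l.2 (tabA n 2))).

Definition lval (l : int * int * int) (x y z : int) : int := l.1.1 * x + l.1.2 * y + l.2 * z.

Lemma dot_comb n l x y z : dot (comb n l) (mons x y z) = aN n x y z * lval l x y z.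
Proof.
rewrite /comb !dot_addv !dot_scv /lval; case: l => [[a b] c].
by case: n => [|[|[|[|[|n]]]]]; rewrite /tabA /mons /dot /aN /b1 /b2 /b3 /b4 ?mulr0 ?mul0r ?addr0 //; ring.
Qed.

Definition combZ (i : int) (l : int * int * int) : seq int :=
  match i with Posz n => comb n l | Negz n => scv (-1) (comb n.+1 l) end.

Lemma dot_combZ i l x y z : dot (combZ i l) (mons x y z) = aZ i x y z * lval l x y z.
Proof. by case: i => n; rewrite /combZ /aZ ?dot_scv dot_comb // mulN1r mulNr. Qed.

Definition addl (c : int) (k l : int * int * int) : int * int * int :=
  (c * k.1.1 + l.1.1, c * k.1.2 + l.1.2, c * k.2 + l.2).

(* The coefficient vector of [c * (p2 / 2) + l * p1]. *)
Definition vec (J : signature) (c : int) (l : int * int * int) : seq int :=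
  let: (i1, i2, i3, i4) := J in
  addv (combZ i1 l) (addv (combZ i2 (addl c (1, 0, 0) l))
    (addv (combZ i3 (addl c (1, 1, 0) l)) (combZ i4 (addl c (2, 1, 1) l)))).

Lemma dot_vec J c l x y z :
  dot (vec J c l) (mons x y z) = c * sig2 J x y z + lval l x y z * sig1 J x y z.
Proof.
case: J => [[[i1 i2] i3] i4]; rewrite /vec !dot_addv !dot_combZ /sig1 /sig2 /lval /addl.
by case: l => [[a b] d] /=; ring.
Qed.

(** Signs are read off the constructors of [int], so that the test runs under [vm_compute]. *)
Definition posv (c : seq int) : bool :=
  all (fun a => if a is Posz _ then true else false) c && has (fun a => if a is Posz n.+1 then true else false) c.

Lemma posv_dot c m : all (fun b => 0 < b) m -> (size c <= size m)%N -> posv c -> 0 < dot c m.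
Proof.
move=> hm hs /andP[ha hh].
have nn c' m' : all (fun b => 0 < b) m' -> all (fun a : int => if a is Posz _ then true else false) c' -> 0 <= dot c' m'.
  elim: c' m' => [|a c' IH] [|b m'] //= /andP[b0 hm'] /andP[a0 hc'].
  by rewrite addr_ge0 ?IH // mulr_ge0 ?(ltW b0) //; case: a a0.
elim: c m hm hs ha hh => [|a c IH] [|b m] //= /andP[b0 hm] hs /andP[a0 hc] /orP[a1|hh].
  by rewrite ltr_pwDl ?nn // mulr_gt0 //; case: a a1 {a0} => // -[].
by rewrite ltr_wpDl ?IH // mulr_ge0 ?(ltW b0) //; case: a a0.
Qed.

(** Multipliers [(c, l)] of [p2 / 2] and [p1]. Besides [p1] itself they give the first moment of the
    signature about each of the four pattern points, and twice that about the midpoint of [0] and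
    [x + y] and about the midpoint of [x] and [x + y]. *)
Definition certs : seq (int * (int * int * int)) :=
  [:: (0, (1, 0, 0)); (1, (0, 0, 0)); (1, (-1, 0, 0)); (1, (-1, -1, 0)); (1, (-2, -1, -1));
      (2, (-1, -1, 0)); (2, (-2, -1, 0))].

Definition one_signed (J : signature) : bool :=
  has (fun cl => let v := vec J cl.1 cl.2 in (size v <= 15)%N && (posv v || posv (scv (-1) v))) certs.

Lemma one_signed_ndeg J x y z : 0 < x -> 0 < y -> 0 < z -> one_signed J ->
  sig1 J x y z = 0 -> sig2 J x y z = 0 -> False.
Proof.
move=> x0 y0 z0 /hasP[[c l] _ /andP[sz hv]] h1 h2.
have hm : all (fun b => 0 < b) (mons x y z) by rewrite /mons /= !andbT; do !(apply/andP; split); ps.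
have d0 : dot (vec J c l) (mons x y z) = 0 by rewrite dot_vec h1 h2 !mulr0 addr0.
case/orP: hv => hv.
  by have := posv_dot hm sz hv; rewrite d0 ltxx.
have sz' : (size (scv (-1) (vec J c l)) <= size (mons x y z))%N by rewrite size_map.
by have := posv_dot hm sz' hv; rewrite dot_scv d0 mulr0 ltxx.
Qed.

(** One representative of each pair of opposite signatures treated individually, with the index of
    its condition in [cnd]. *)
Definition leftover : seq (signature * nat) :=
  [:: ((0, 1, -3, 1), 0%N); ((0, 1, 2, 1), 0%N); ((0, 3, -1, 3), 0%N); ((0, 3, 2, 3), 2%N); ((0, 4, -2, -3), 0%N); ((0, 4, -2, -1), 0%N); ((0, 4, 1, -3), 0%N); ((0, 4, 1, 4), 0%N); ((0, 4, 3, -1), 0%N); ((1, -4, -3, 1), 0%N); ((1, -4, 2, 1), 0%N); ((1, -3, -4, -4), 0%N); ((1, -3, -4, 0), 0%N); ((1, -3, -3, 1), 0%N); ((1, -3, -1, 3), 0%N); ((1, -3, 0, -4), 0%N); ((1, -3, 1, -4), 0%N); ((1, -3, 1, 0), 1%N); ((1, -3, 2, 1), 0%N); ((1, 0, -3, 1), 1%N); ((1, 0, 2, 1), 0%N); ((1, 1, -3, 1), 0%N); ((1, 1, 2, 1), 0%N); ((1, 2, 1, 4), 5%N); ((1, 4, -3, 1), 0%N); ((1, 4, 2, 1), 0%N); ((1, 4, 2, 3), 0%N); ((2, -2, 1, -1), 0%N); ((2, 1, -2, -3), 0%N); ((2, 1, -2, -1), 8%N); ((2, 1, 1, -3), 0%N);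 ((2, 3, -2, -3), 7%N); ((2, 3, -2, -1), 0%N); ((2, 3, 3, -1), 0%N); ((3, -4, -1, 3), 0%N); ((3, -4, 2, 3), 0%N); ((3, -3, -1, 1), 6%N); ((3, -3, 4, -4), 0%N); ((3, -1, -4, -4), 0%N); ((3, -1, -4, 0), 0%N); ((3, -1, -3, 1), 0%N); ((3, -1, -1, 3), 0%N); ((3, -1, 0, -4), 0%N); ((3, -1, 1, -3), 9%N); ((3, -1, 2, 3), 0%N); ((3, 0, -1, 3), 3%N); ((3, 0, 2, 3), 0%N); ((3, 2, -4, -4), 0%N); ((3, 2, -4, 0), 0%N); ((3, 2, -2, -3), 0%N); ((3, 2, 0, -4), 0%N); ((3, 2, 1, 4), 5%N); ((3, 2, 3, 4), 5%N); ((3, 2, 4, 1), 0%N); ((3, 3, -1, 3), 0%N); ((3, 3, 2, 3), 0%N); ((3, 4, -1, 3), 0%N); ((3, 4, 2, 1), 0%N); ((3, 4, 2, 3), 0%N); ((4, -3, -2, -3), 0%N); ((4, -3, 1, -3), 0%N); ((4, -1, -2, -1), 0%N); ((4, -1, 3, -1), 0%N); ((4, 0, -2, -3), 0%N); ((4, 0, -2, -1), 0%N); ((4, 0, 1, -3), 0%N); ((4, 0, 1, 4), 4%N); ((4, 0, 3, -1), 0%N); ((4, 1, -1, -4), 0%N); ((4, 1, 2, 3), 0%N); ((4, 1, 4, 0), 0%N); ((4, 3, -1, 3), 0%N); ((4, 4, -2, -3), 0%N); ((4, 4, -2, -1), 0%N); ((4, 4, 1, -3), 0%N); ((4, 4,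 1, 4), 0%N); ((4, 4, 3, -1), 0%N)].

Definition characterized (Ic : signature * nat) : Prop := forall x y z, 0 < x -> 0 < y -> 0 < z ->
  sig1 Ic.1 x y z = 0 -> sig2 Ic.1 x y z = 0 -> cnd Ic.2 x y z.

Lemma leftover_char I c : (I, c) \in leftover -> characterized (I, c).
Proof.
have mem (L : seq (signature * nat)) : foldr (fun Ic P => characterized Ic /\ P) True L ->
    forall Ic, Ic \in L -> characterized Ic.
  elim: L => //= Ic L IH [h hL] Jd; rewrite in_cons => /orP[/eqP -> //|]; exact: IH.
apply: mem.
(* One lemma for each entry of [leftover], in the same order. *)
exact (conj (@deg1) (conj (@deg2) (conj (@deg3) (conj (@deg4) (conj (@deg5) (conj (@deg6) (conj (@deg7) (conj (@deg8) (conj (@deg9) (conj (@deg10) (conj (@deg11) (conj (@deg12) (conj (@deg13) (conj (@deg14) (conj (@deg15) (conj (@deg16) (conj (@deg17) (conj (@deg18) (conj (@deg19) (conj (@deg20) (conj (@deg21) (conj (@deg22) (conj (@deg23) (conj (@deg24) (conj (@deg25) (conj (@deg26) (conj (@deg27) (conj (@deg28) (conj (@deg29) (conj (@deg30) (conj (@deg31) (conj (@deg32) (conj (@deg33) (conj (@deg34) (conj (@deg35) (conj (@deg36) (conj (@deg37) (conj (@deg38) (conj (@deg39) (conj (@deg40) (conj (@deg41) (conj (@deg42) (conj (@deg43) (conj (@deg44) (conj (@deg45) (conj (@deg46) (conj (@deg47) (conj (@deg48) (conj (@deg49) (conj (@deg50) (conj (@deg51) (conj (@deg52) (conj (@deg53)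 (conj (@deg54) (conj (@deg55) (conj (@deg56) (conj (@deg57) (conj (@deg58) (conj (@deg59) (conj (@deg60) (conj (@deg61) (conj (@deg62) (conj (@deg63) (conj (@deg64) (conj (@deg65) (conj (@deg66) (conj (@deg67) (conj (@deg68) (conj (@deg69) (conj (@deg70) (conj (@deg71) (conj (@deg72) (conj (@deg73) (conj (@deg74) (conj (@deg75) (conj (@deg76) (conj (@deg77) Logic.I))))))))))))))))))))))))))))))))))))))))))))))))))))))))))))))))))))))))))))).
Qed.

Definition rng : seq int := [:: -4; -3; -2; -1; 0; 1; 2; 3; 4].

Lemma rngP (i : int) : -4 <= i <= 4 -> i \in rng.
Proof.
move=> h; have : i = -4 \/ i = -3 \/ i = -2 \/ i = -1 \/ i = 0 \/ i = 1 \/ i = 2 \/ i = 3 \/ i = 4 by lia.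
by do 8 (case=> [-> //|]); move=> ->.
Qed.

Definition covered (J : signature) : bool :=
  [|| one_signed J, J \in [seq Ic.1 | Ic <- leftover], - J \in [seq Ic.1 | Ic <- leftover] | J \in trivial_signatures].

(** All [9^4] signatures are checked: each has a sign certificate, is listed in [leftover] up to
    sign, or is trivial. *)
Lemma all_covered : all (fun i => all (fun j => all (fun k => all (fun l => covered (i, j, k, l)) rng) rng) rng) rng.
Proof. by vm_compute. Qed.

Lemma degenerate_cases J x y z : 0 < x -> 0 < y -> 0 < z ->
  J \in degenerate x y z -> J \notin trivial_signatures ->
  exists I c, [/\ (I, c) \in leftover, cnd c x y z & J = I \/ J = - I].
Proof.
move=> x0 y0 z0; rewrite degE => /and3P[sJ /eqP h1 /eqP h2] nt.
have : covered J.
  case: J sJ {h1 h2 nt} => [[[i j] k] l] /and4P[/rngP hi /rngP hj /rngP hk /rngP hl].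
  by have /allP/(_ i hi)/allP/(_ j hj)/allP/(_ k hk)/allP/(_ l hl) := all_covered.
rewrite /covered (negbTE nt) orbF => /or3P[os|/mapP[[I c] hL /= eJ]|/mapP[[I c] hL /= eJ]].
- by case: (one_signed_ndeg x0 y0 z0 os h1 h2).
- by exists I, c; rewrite eJ in h1 h2 *; split; [|exact: (leftover_char hL)|left].
- exists I, c; have eJ' : J = - I by rewrite -eJ opprK.
  have [e1 e2 _] := sigN J x y z; rewrite eJ h1 h2 !oppr0 in e1 e2.
  by split; [|exact: (leftover_char hL)|right].
Qed.

(** * Assembly of the classification *)

Definition lst (c : nat) : seq signature :=
  match c with
  | 1%N => [:: (1, -3, 1, 0); (1, 0, -3, 1)]
  | 2%N => [:: (0, 3, 2, 3)]
  | 3%N => [:: (3, 0, -1, 3)]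
  | 4%N => [:: (4, 0, 1, 4)]
  | 5%N => [:: (1, 2, 1, 4); (3, 2, 1, 4); (3, 2, 3, 4)]
  | 6%N => [:: (3, -3, -1, 1)]
  | 7%N => [:: (2, 3, -2, -3)]
  | 8%N => [:: (2, 1, -2, -1)]
  | 9%N => [:: (3, -1, 1, -3)]
  | _ => [::]
  end.

Lemma leftover_lst I c : (I, c) \in leftover -> cnd c = cnd 0 \/ I \in lst c.
Proof.
have h : all (fun Ic : signature * nat => (Ic.2 == 0)%N || (Ic.1 \in lst Ic.2)) leftover by vm_compute.
by move/(allP h) => /= /orP[/eqP ->|]; [left | right].
Qed.

Lemma lst_degenerate c I x y z : I \in lst c -> cnd c x y z -> sig1 I x y z = 0 /\ sig2 I x y z = 0.
Proof.
move=> + h; case: c h => [|[|[|[|[|[|[|[|[|[|c]]]]]]]]]] h //=; rewrite ?inE.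
- by case/orP => /eqP ->; [exact: conv2 | exact: conv3].
- by move/eqP ->; exact: conv1.
- by move/eqP ->; exact: conv9.
- by move/eqP ->; exact: conv12.
- by case/or3P => /eqP ->; [exact: conv4 | exact: conv10 | exact: conv11].
- by move/eqP ->; exact: conv7.
- by move/eqP ->; exact: conv6.
- by move/eqP ->; exact: conv5.
- by move/eqP ->; exact: conv8.
Qed.

(** The exempted pair is the ray through [(1, 1, 1)] and the curve [x^2 = y z] that contains it, the
    one overlap among the conditions. *)
Lemma excl x y z c d : 0 < x -> 0 < y -> 0 < z -> (c < d)%N -> ~~ ((c == 1)%N && (d == 6)%N) ->
  cnd c x y z -> cnd d x y z -> False.
Proof.
move=> x0 y0 z0.
have rr (a b e a' b' e' : int) : in_ray a b e x y z -> in_ray a' b' e' x y z -> a * b' = a' * b /\ a * e' = a' * e.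
  move=> [n n0 [-> -> ->]] [m m0 [h1 h2 h3]].
  have nz : n%:Z * m%:Z != 0 by rewrite mulf_neq0 // -lt0n.
  split; apply: (mulfI nz).
    transitivity ((n%:Z * a) * (m%:Z * b')); first by ring.
    by rewrite h1 -h2; ring.
  transitivity ((n%:Z * a) * (m%:Z * e')); first by ring.
  by rewrite h1 -h3; ring.
case: c => [|[|[|[|[|[|[|[|[|[|c]]]]]]]]]]; case: d => [|[|[|[|[|[|[|[|[|[|d]]]]]]]]]];
  move=> lt ne hc hd; try (by []); try (by case: hc); try (by case: hd);
  first [ exact: (excl56 x0 y0 z0 hc hd) | exact: (excl57 x0 y0 z0 hc hd) | exact: (excl58 x0 y0 z0 hc hd)
        | exact: (excl59 x0 y0 z0 hc hd) | exact: (excl67 x0 y0 z0 hc hd) | exact: (excl68 x0 y0 z0 hc hd)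
        | exact: (excl69 x0 y0 z0 hc hd) | exact: (excl78 x0 y0 z0 hc hd) | exact: (excl79 x0 y0 z0 hc hd)
        | exact: (excl89 x0 y0 z0 hc hd)
        | (by have [] := rr _ _ _ _ _ _ hc hd)
        (* A ray against a curve: the substitution leaves a nonzero multiple of [n^2] or [n^3]. *)
        | (move: hc hd => [n n0 [-> -> ->]]; have n2 : 0 < n%:Z ^+ 2 by [rewrite exprn_gt0];
           have n3 : 0 < n%:Z ^+ 3 by [rewrite exprn_gt0];
           move: n2 n3; rewrite /cnd; move: n%:Z; clear; move=> m m2 m3 hm; lia) ].
Qed.

Definition proper_signature (I : signature) : bool :=
  [&& is_signature I, is_signature (- I), I \notin trivial_signatures & - I \notin trivial_signatures].

Lemma proper_ray1 : all proper_signature [:: (1, -3, 1, 0); (1, 0, -3, 1); (3, -3, -1, 1)].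
Proof. by vm_compute. Qed.

Lemma proper_curve6 : all proper_signature [:: (3, -3, -1, 1)].
Proof. by vm_compute. Qed.

(** The common frame of all cases: [T] must contain the signatures of every condition that holds,
    and consist of degenerate ones; [proper_signature] keeps [T] and its negatives within the bounds
    and outside the trivial signatures. *)
Lemma predD_eq x y z (T : seq signature) : 0 < x -> 0 < y -> 0 < z ->
  (forall c, cnd c x y z -> {subset lst c <= T}) ->
  (forall I, I \in T -> sig1 I x y z = 0 /\ sig2 I x y z = 0) ->
  all proper_signature T ->
  [predD degenerate x y z & trivial_signatures] =i pm T.
Proof.
move=> x0 y0 z0 fwd bwd /allP ok J.
have mE J' : (J' \in [predD degenerate x y z & trivial_signatures])
    = (J' \notin trivial_signatures) && (J' \in degenerate x y z) by rewrite inE.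
rewrite mE; apply/idP/idP.
  move=> /andP[nt dJ].
  have [I [c [hL hc eJ]]] := degenerate_cases x0 y0 z0 dJ nt.
  have hI : I \in T.
    by have [e|/(fwd c hc) //] := leftover_lst hL; move: hc; rewrite e.
  by rewrite /pm mem_cat; case: eJ => ->; [rewrite hI | rewrite (map_f _ hI) orbT].
rewrite /pm mem_cat => /orP[hJ|/mapP[I hI ->]].
  have /and4P[s1 _ t1 _] := ok _ hJ; have [e1 e2] := bwd _ hJ.
  by rewrite t1 degE s1 e1 e2 !eqxx.
have /and4P[_ s1 _ t1] := ok _ hI; have [e1 e2] := bwd _ hI; have [n1 n2 _] := sigN I x y z.
by rewrite t1 degE s1 n1 n2 e1 e2 !oppr0 !eqxx.
Qed.

Lemma cnd16 x y z : cnd 1 x y z -> cnd 6 x y z.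
Proof. by case=> n _ [-> -> ->]; rewrite /cnd; ring. Qed.

(* Under condition [c] only the signatures of [lst c] are degenerate, up to sign. *)
Lemma predD_cnd x y z c : 0 < x -> 0 < y -> 0 < z -> (c \in [:: 2; 3; 4; 5; 7; 8; 9])%N -> cnd c x y z ->
  [predD degenerate x y z & trivial_signatures] =i pm (lst c).
Proof.
move=> x0 y0 z0 hc h; apply: predD_eq => //.
- move=> d hd; have [lt|gt|<- //] := ltngtP d c.
    by case: (@excl x y z d c) => //; move: hc; rewrite !inE; case: (c =P 6%N) => [->|_]; rewrite ?andbF.
  by case: (@excl x y z c d) => //; move: hc; rewrite !inE; case: (c =P 1%N) => [->|_].
- by move=> I hI; exact: lst_degenerate hI h.
have ok : all (fun c => all proper_signature (lst c)) [:: 2; 3; 4; 5; 7; 8; 9]%N by vm_compute.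
exact: (allP ok _ hc).
Qed.

Theorem lemma6p8 (x y z : int) (hx : 0 < x) (hy : 0 < y) (hz : 0 < z) :
  let IPmS := [predD degenerate x y z & trivial_signatures] in
  let c1 := in_ray 1 1 1 x y z in
  let c2 := in_ray 1 3 2 x y z in
  let c3 := in_ray 1 4 4 x y z in
  let c4 := in_ray 2 1 1 x y z in
  let c5 := 2 * x ^+ 2 + x * z - y * z = 0 in
  let c6 := x ^+ 2 - y * z = 0 /\ ~ in_ray 1 1 1 x y z in
  let c7 := x ^+ 2 + x * z - y ^+ 2 = 0 in
  let c8 := 2 * x ^+ 3 + 4 * x ^+ 2 * y + x ^+ 2 * z + 2 * x * y ^+ 2
            - y ^+ 2 * z - y * z ^+ 2 = 0 in
  let c9 := 4 * x ^+ 3 + 4 * x ^+ 2 * y + 4 * x ^+ 2 * z + 2 * x * y * z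
            + x * z ^+ 2 - y ^+ 2 * z = 0 in
  (c1 -> IPmS =i pm [:: (1, -3, 1, 0); (1, 0, -3, 1); (3, -3, -1, 1)]) /\
  (c2 -> IPmS =i pm [:: (0, 3, 2, 3)]) /\
  (c3 -> IPmS =i pm [:: (3, 0, -1, 3)]) /\
  (c4 -> IPmS =i pm [:: (4, 0, 1, 4)]) /\
  (c5 -> IPmS =i pm [:: (1, 2, 1, 4); (3, 2, 1, 4); (3, 2, 3, 4)]) /\
  (c6 -> IPmS =i pm [:: (3, -3, -1, 1)]) /\
  (c7 -> IPmS =i pm [:: (2, 3, -2, -3)]) /\
  (c8 -> IPmS =i pm [:: (2, 1, -2, -1)]) /\
  (c9 -> IPmS =i pm [:: (3, -1, 1, -3)]) /\
  (~ c1 -> ~ c2 -> ~ c3 -> ~ c4 -> ~ c5 -> ~ c6 -> ~ c7 -> ~ c8 -> ~ c9 ->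
     IPmS =i pred0) /\
  (c5 -> forall I : signature,
     I \in pm [:: (1, 2, 1, 4); (3, 2, 1, 4); (3, 2, 3, 4)] ->
     evalZ (p3 I) x y z = 0).
Proof.
move=> IPmS c1 c2 c3 c4 c5 c6 c7 c8 c9.
(* Conditions 1 and 6 hold together on this ray, so the list is the union of [lst 1] and [lst 6]. *)
have ray1 : c1 -> IPmS =i pm [:: (1, -3, 1, 0); (1, 0, -3, 1); (3, -3, -1, 1)].
  move=> h; apply: (predD_eq hx hy hz _ _ proper_ray1).
  - move=> d hd; have [->|d1] := eqVneq d 1%N; first by move=> I; rewrite !inE; case/orP => ->; rewrite ?orbT.
    have [->|d6] := eqVneq d 6%N; first by move=> I; rewrite !inE => ->; rewrite !orbT.
    have [|lt|e] := ltngtP d 1%N; [by case: d hd {d1 d6} | | by rewrite e in d1].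
    by case: (@excl x y z 1 d) => //; rewrite (negbTE d6).
  - move=> I; rewrite !inE => /or3P[] hI.
    + by apply: (@lst_degenerate 1) => //; rewrite !inE hI.
    + by apply: (@lst_degenerate 1) => //; rewrite !inE hI orbT.
    + by apply: (@lst_degenerate 6); [rewrite !inE | exact: cnd16].
have curve6 : c6 -> IPmS =i pm [:: (3, -3, -1, 1)].
  move=> [h n1]; apply: (predD_eq hx hy hz _ _ proper_curve6).
  - move=> d hd; have [lt|gt|->] := ltngtP d 6%N; last by move=> I.
      case: (@excl x y z d 6) => //; case: (d =P 1%N) => // e.
      by case: n1; rewrite e in hd.
    by case: (@excl x y z 6 d).
  - by move=> I hI; exact: (@lst_degenerate 6).
have third I : c5 -> I \in pm [:: (1, 2, 1, 4); (3, 2, 1, 4); (3, 2, 3, 4)] -> evalZ (p3 I) x y z = 0.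
  move=> h hI; have [_ _ ->] := evalZ_sig I x y z.
  have base J : J \in [:: (1, 2, 1, 4); (3, 2, 1, 4); (3, 2, 3, 4)] -> sig3 J x y z = 0.
    by rewrite !inE => /or3P[] /eqP ->; [exact: conv_third1 | exact: conv_third2 | exact: conv_third3].
  move: hI; rewrite /pm mem_cat => /orP[|/mapP[J hJ ->]]; first exact: base.
  by have [_ _ ->] := sigN J x y z; rewrite base // oppr0.
split=> //; split; first exact: (@predD_cnd x y z 2).
split; first exact: (@predD_cnd x y z 3).
split; first exact: (@predD_cnd x y z 4).
split; first exact: (@predD_cnd x y z 5).
split=> //; split; first exact: (@predD_cnd x y z 7).
split; first exact: (@predD_cnd x y z 8).
split; first exact: (@predD_cnd x y z 9).
split; last by move=> h I; exact: third.
move=> n1 n2 n3 n4 n5 n6 n7 n8 n9.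
have n66 : ~ cnd 6 x y z by move=> h; apply: n6.
have h0 : IPmS =i pm [::].
  apply: predD_eq => //.
  by move=> d hd; exfalso; case: d hd => [|[|[|[|[|[|[|[|[|[|d]]]]]]]]]].
by move=> J; rewrite h0.
Qed.
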